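(* Let $M$ be a closed $C^\infty$ manifold, let $\mathcal{U}\subset\mathcal{A}^\infty(M)$ be the open and dense set of flows described in the context (each attractor and repeller contains a nonresonant fixed or periodic point whose derivative is not conjugate to that at any other such point), and let $\mathcal{V}\subset\mathcal{U}$ be the open and dense set of flows described in the context, whose members have the basin-linking property. If $\Phi=(\varphi^t)_{t\in\mathbb{R}}\in\mathcal{V}$, if $f_1,f_2\colon M\to M$ are $C^\infty$ diffeomorphisms each commuting with $\varphi^t$ for all $t\in\mathbb{R}$, and if $f_1=f_2$ on a nonempty open set, then $f_1=f_2$ on $M$.
   Context: $\mathcal{A}^\infty(M)$ is the set of $C^\infty$ flows on $M$ that satisfy Axiom A, have the no cycles property, and are not transitive Anosov flows. **Basic definitions.** A point $x$ is nonwandering for $\Phi$ if for every open $U\ni x$ and $T>0$ there is $t>T$ with $\varphi^t(U)\cap U\neq\varnothing$; $NW(\Phi)$ is the set of nonwandering points. A flow on an invariant set is transitive if some forward semiorbit $\varphi^{[0,\infty)}(x)$ is dense in it. A compact $\Phi$-invariant set $\Lambda$ is hyperbolic if there are finitely many hyperbolic fixed points $p_1,\dots,p_k$ and a closed set $\Lambda'$ with $\Lambda=\Lambda'\cup\{p_1,\dots,p_k\}$, a $\Phi$-invariant splitting $T_{\Lambda'}M=E^s\oplus E^c\oplus E^u$, and constants $C\ge1$, $\lambda\in(0,1)$ such that for all $x\in\Lambda'$: $E^c(x)=\mathbb{R}X(x)\neq\{0\}$, where $X$ is the vector field generating $\Phi$, and $\|D\varphi^t|_{E^s_x}\|\le C\lambda^t$,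 $\|D\varphi^{-t}|_{E^u_x}\|\le C\lambda^t$ for all $t>0$. A flow on a connected manifold $M$ is Anosov if $M$ is a hyperbolic set for it. $\Phi$ satisfies Axiom A if $NW(\Phi)$ is hyperbolic and is the closure of the periodic orbits (hyperbolic fixed points are allowed). For an Axiom A flow, $NW(\Phi)$ is a finite disjoint union of basic sets $\Lambda_1,\dots,\Lambda_m$ (locally maximal transitive hyperbolic sets). Let $W^s(\Lambda_i)=\{x:\varnothing\neq\omega(x)\subset\Lambda_i\}$ and $W^u(\Lambda_i)=\{x:\varnothing\neq\alpha(x)\subset\Lambda_i\}$, with $\omega(x),\alpha(x)$ the $\omega$- and $\alpha$-limit sets. Attractors (repellers) are the basic sets for which $W^s(\Lambda_i)$ (respectively $W^u(\Lambda_i)$) is a neighborhood of $\Lambda_i$. Write $\Lambda_i\gg\Lambda_j$ if $(W^u(\Lambda_i)\smallsetminus\Lambda_i)\cap(W^s(\Lambda_j)\smallsetminus\Lambda_j)\neq\varnothing$; the no cycles property means that there is no sequence $\Lambda_{i_1}\gg\Lambda_{i_2}\gg\cdots\gg\Lambda_{i_k}\gg\Lambda_{i_1}$. **The set $\mathcal{U}$.** $\mathcal{U}$ is an open and dense set of flows in $\mathcal{A}^\infty(M)$ such that each attractor or repeller contains a fixed or periodic point $p$ with two properties: (a) $p$ is nonresonant (for repellers: with respect to the time-reversed flow); (b) the derivative at $p$ of the period map (if $p$ is periodic) or of the time-1 map (if $p$ is fixed) is not linearly conjugate to the corresponding derivative at any other periodic orbit with the same period, respectively at any other fixed point. Nonresonance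 of a periodic point $p$ of period $T$ in an attractor means that, for the eigenvalues $\lambda_1,\dots,\lambda_n$ (with multiplicity) of $D\varphi^T(p)$ on the tangent space of the strong stable manifold of $p$, $\operatorname{Re}\lambda_i\neq \operatorname{Re}\lambda_1^{m_1}\cdots\operatorname{Re}\lambda_n^{m_n}$ for all $i$ and all integers $m_j\ge0$ with $\sum m_j\ge2$. Nonresonance of a fixed attracting point means that the linearization $A$ of the generating vector field there, with eigenvalues $\lambda_1,\dots,\lambda_n$ (all with negative real part), satisfies $\operatorname{Re}\big(\lambda_i-(m_1\lambda_1+\cdots+m_n\lambda_n)\big)\neq0$ for all $i$ and all integers $m_j\ge0$ with $\sum m_j\ge2$. **The set $\mathcal{V}$.** $\mathcal{V}\subset\mathcal{U}$ is an open and dense set (whose existence is established separately) such that every $\Phi\in\mathcal{V}$ has the basin-linking property: if $\Lambda$ and $\Lambda'$ are attractors for $\Phi$ with $\overline{W^s(\Lambda)}\cap\overline{W^s(\Lambda')}\neq\varnothing$, then there exists a hyperbolic repeller $\Lambda_r$ with $W^s(\Lambda)\cap W^u(\Lambda_r)\neq\varnothing$ and $W^s(\Lambda')\cap W^u(\Lambda_r)\neq\varnothing$.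
   Formalization: The closed manifold M is additionally assumed connected; on a disconnected M the claim fails (take f_1 the identity and f_2 equal to φ^1 on one component and the identity elsewhere). *)

(* Defs.v *)
From mathcomp Require Export all_boot all_order all_algebra.
From mathcomp Require Export all_classical all_reals all_analysis.
From mathcomp Require Export complex.

Set Implicit Arguments.
Unset Strict Implicit.
Unset Printing Implicit Defensive.

Export Order.TTheory GRing.Theory Num.Theory.
Export numFieldNormedType.Exports.

Local Open Scope ring_scope.
Local Open Scope classical_set_scope.

Definition iderive (R : realType) (V W : normedModType R)
    (vs : seq V) (f : V -> W) : V -> W :=
  foldr (fun v g => 'D_v g) f vs.

(* Meant for open [A] and finite-dimensional [V]: all iterated directional
   derivatives exist and are continuous on [A]. The values of [f] outside [A]
   do not matter. *)
Definition smooth_on (R : realType) (V W : normedModType R)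
    (A : set V) (f : V -> W) : Prop :=
  forall (vs : seq V) (x : V), A x ->
    {for x, continuous (iderive vs f)} /\
    (forall v : V, derivable (iderive vs f) x v).

(* [cmap] is a homeomorphism of the open set [cdom] onto the open set
   [cmap @` cdom]; both [cmap] and its inverse [cinv] are totalized with
   arbitrary values. *)
Record chart (R : realType) (n : nat) (M : topologicalType) := Chart {
  cdom : set M;
  cmap :> M -> 'rV[R]_n;
  cinv : 'rV[R]_n -> M;
  cdom_open : open cdom;
  cimg_open : open (cmap @` cdom);
  cmapK : forall x, cdom x -> cinv (cmap x) = x;
  cmap_continuous : forall x, cdom x -> {for x, continuous cmap};
  cinv_continuous : forall y, (cmap @` cdom) y -> {for y, continuous cinv} }.

Definition cimg (R : realType) (n : nat) (M : topologicalType)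
  (c : chart R n M) : set 'rV[R]_n := c @` cdom c.

(* [chart_at x] is an arbitrary choice of a chart around [x]. It is used to
   identify T_x M with 'rV[R]_n: a tangent vector at [x] is represented by its
   coordinates in [chart_at x]. Linear maps act on row vectors on the right. *)
Record closed_manifold (R : realType) (n : nat) := ClosedManifold {
  mcarrier :> topologicalType;
  atlas : set (chart R n mcarrier);
  chart_at : mcarrier -> chart R n mcarrier;
  chart_at_atlas : forall x, atlas (chart_at x);
  chart_at_dom : forall x, cdom (chart_at x) x;
  atlas_compat : forall c d, atlas c -> atlas d ->
    smooth_on (c @` (cdom c `&` cdom d)) (d \o cinv c);
  mhausdorff : hausdorff_space mcarrier;
  mcompact : compact [set: mcarrier];
  mconnected : connected [set: mcarrier] }.

Definition smooth_map (R : realType) (n : nat) (M : closed_manifold R n)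
    (f : M -> M) : Prop :=
  continuous f /\
  forall c d : chart R n M, atlas c -> atlas d ->
    smooth_on (c @` (cdom c `&` f @^-1` cdom d)) (d \o f \o cinv c).

Definition smooth_diffeo (R : realType) (n : nat) (M : closed_manifold R n)
    (f : M -> M) : Prop :=
  smooth_map f /\
  exists g : M -> M, [/\ smooth_map g, cancel f g & cancel g f].

(* D_x f : T_x M -> T_(f x) M *)
Definition tangent_map (R : realType) (n : nat) (M : closed_manifold R n)
    (f : M -> M) (x : M) : 'M[R]_n :=
  'J (chart_at (f x) \o f \o cinv (chart_at x)) (chart_at x x).

(* [g x] is the Gram matrix of the metric on T_x M in the coordinates of
   [chart_at x]; the last clause is its smoothness in every chart. *)
Definition riemannian_metric (R : realType) (n : nat) (M : closed_manifold R n)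
    (g : M -> 'M[R]_n) : Prop :=
  [/\ forall x, (g x)^T = g x,
      forall (x : M) (v : 'rV[R]_n), v != 0 -> 0 < (v *m g x *m v^T) 0 0
    & forall c : chart R n M, atlas c ->
        smooth_on (cimg c)
          (fun y : 'rV[R]_n =>
             let J := 'J (chart_at (cinv c y) \o cinv c) y in
             J *m g (cinv c y) *m J^T)].

Definition tnorm (R : realType) (n : nat) (M : closed_manifold R n)
    (g : M -> 'M[R]_n) (x : M) (v : 'rV[R]_n) : R :=
  Num.sqrt ((v *m g x *m v^T) 0 0).

(* T_p S as the set of velocities at p of smooth curves in S through p. *)
Definition tangent_space (R : realType) (n : nat) (M : closed_manifold R n)
    (S : set M) (p : M) : set 'rV[R]_n :=
  [set v | exists (gam : R^o -> M) (e : R),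
    [/\ 0 < e, gam 0 = p,
        (forall s : R, `|s| < e -> S (gam s) /\ cdom (chart_at p) (gam s)),
        smooth_on (fun s : R^o => `|s| < e) (chart_at p \o gam)
      & 'D_1 (chart_at p \o gam) 0 = v]].

Section Flows.
Variables (R : realType) (n : nat) (M : closed_manifold R n).
Implicit Types (phi : R -> M -> M) (L : set M) (p x : M) (t T : R).

Definition smooth_flow phi : Prop :=
  [/\ forall x, phi 0 x = x,
      forall s t x, phi (s + t) x = phi s (phi t x),
      continuous (fun z : R * M => phi z.1 z.2)
    & forall c d : chart R n M, atlas c -> atlas d ->
        smooth_on
          [set z : R^o * 'rV[R]_n |
             cimg c z.2 /\ cdom d (phi z.1 (cinv c z.2))]
          (fun z : R^o * 'rV[R]_n => d (phi z.1 (cinv c z.2)))].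

Definition reverse phi : R -> M -> M := fun t => phi (- t).

(* The generating vector field X in the chart c, and X(x) in T_x M. *)
Definition vfield_in (c : chart R n M) phi (y : 'rV[R]_n) : 'rV[R]_n :=
  'D_1 (fun t : R^o => c (phi t (cinv c y))) 0.

Definition vfield phi x : 'rV[R]_n :=
  vfield_in (chart_at x) phi (chart_at x x).

Definition fixed_point phi p : Prop := forall t, phi t p = p.

Definition has_period phi p T : Prop :=
  [/\ 0 < T, phi T p = p & forall s, 0 < s < T -> phi s p <> p].

Definition complexify (m : nat) (A : 'M[R]_m) : 'M[R[i]]_m :=
  map_mx (real_complex R) A.

Definition linearization phi p : 'M[R]_n :=
  'J (vfield_in (chart_at p) phi) (chart_at p p).

Definition hyperbolic_fixed_point phi p : Prop :=
  fixed_point phi p /\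
  forall z : R[i], eigenvalue (complexify (linearization phi p)) z ->
    complex.Re z != 0.

Definition invariant phi L : Prop :=
  forall t x, L x -> L (phi t x).

(* Subspaces of T_x M are row spaces of square matrices. By compactness, the
   choice of the Riemannian metric g does not matter. *)
Definition hyperbolic_set phi L : Prop :=
  [/\ compact L, invariant phi L &
    exists P L' : set M,
    [/\ finite_set P, forall p, P p -> hyperbolic_fixed_point phi p,
        closed L', L = L' `|` P &
      exists (g Es Ec Eu : M -> 'M[R]_n) (C lam : R),
      [/\ riemannian_metric g, 1 <= C, 0 < lam < 1 &
        forall x, L' x ->
        [/\ mxdirect (Es x + Ec x + Eu x) /\ (Es x + Ec x + Eu x :=: 1%:M)%MS,
            forall t,
              [/\ (Es x *m tangent_map (phi t) x :=: Es (phi t x))%MS,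
                  (Ec x *m tangent_map (phi t) x :=: Ec (phi t x))%MS
                & (Eu x *m tangent_map (phi t) x :=: Eu (phi t x))%MS],
            (Ec x :=: vfield phi x)%MS /\ vfield phi x != 0,
            forall t (v : 'rV[R]_n), 0 < t -> (v <= Es x)%MS ->
              tnorm g (phi t x) (v *m tangent_map (phi t) x)
                <= C * (lam `^ t) * tnorm g x v
          & forall t (v : 'rV[R]_n), 0 < t -> (v <= Eu x)%MS ->
              tnorm g (phi (- t) x) (v *m tangent_map (phi (- t)) x)
                <= C * (lam `^ t) * tnorm g x v]]]].

Definition nonwandering phi : set M :=
  [set x | forall (U : set M) T, open U -> U x -> 0 < T ->
     exists2 t, T < t & (phi t @` U) `&` U !=set0].

Definition transitive_on phi L : Prop :=
  exists2 x, L x & L `<=` closure [set phi t x | t in [set t : R | 0 <= t]].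

(* Fixed points count as (degenerate) periodic orbits. *)
Definition axiom_A phi : Prop :=
  hyperbolic_set phi (nonwandering phi) /\
  nonwandering phi = closure [set x | exists2 T, 0 < T & phi T x = x].

Definition anosov phi : Prop := hyperbolic_set phi [set: M].

Definition locally_maximal phi L : Prop :=
  exists U : set M,
    [/\ open U, L `<=` U & L = [set x | forall t, U (phi t x)]].

Definition spectral_decomposition phi (m : nat) (Ls : 'I_m -> set M) : Prop :=
  [/\ nonwandering phi = \bigcup_i Ls i, trivIset setT Ls
    & forall i, [/\ locally_maximal phi (Ls i), transitive_on phi (Ls i)
                  & hyperbolic_set phi (Ls i)]].

Definition basic_set phi L : Prop :=
  exists (m : nat) (Ls : 'I_m -> set M),
    spectral_decomposition phi Ls /\ exists i, Ls i = L.

Definition omega_limit phi x : set M := cluster ((fun t => phi t x) @ +oo%R).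
Definition alpha_limit phi x : set M := cluster ((fun t => phi t x) @ -oo%R).

Definition Ws phi L : set M :=
  [set x | omega_limit phi x !=set0 /\ omega_limit phi x `<=` L].
Definition Wu phi L : set M :=
  [set x | alpha_limit phi x !=set0 /\ alpha_limit phi x `<=` L].

Definition attractor phi L : Prop := basic_set phi L /\ L `<=` interior (Ws phi L).
Definition repeller phi L : Prop := basic_set phi L /\ L `<=` interior (Wu phi L).

Definition connects phi L1 L2 : Prop :=
  (Wu phi L1 `\` L1) `&` (Ws phi L2 `\` L2) !=set0.

Definition no_cycles phi : Prop :=
  ~ exists (k : nat) (c : 'I_k.+1 -> set M),
      forall i, basic_set phi (c i) /\ connects phi (c i) (c (ordS i)).

Definition A_infty : set (R -> M -> M) :=
  [set phi | [/\ smooth_flow phi, axiom_A phi, no_cycles phi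
               & ~ (anosov phi /\ transitive_on phi [set: M])]].

(* Uniform closeness, on the compact set K in the chart c, of all partial
   derivatives of order at most k of the generating vector fields. *)
Definition Ck_close (c : chart R n M) (K : set 'rV[R]_n) (k : nat) (e : R)
    (phi psi : R -> M -> M) : Prop :=
  forall (s : seq 'I_n) (y : 'rV[R]_n), (size s <= k)%N -> K y ->
    `| iderive [seq delta_mx 0 i | i <- s] (vfield_in c phi) y
       - iderive [seq delta_mx 0 i | i <- s] (vfield_in c psi) y | < e.

Definition Cinfty_nbhs phi : set (set (R -> M -> M)) :=
  [set N | exists (r k : nat) (c : 'I_r -> chart R n M)
                  (K : 'I_r -> set 'rV[R]_n) (e : R),
     [/\ 0 < e,
         forall j, [/\ atlas (c j), compact (K j) & K j `<=` cimg (c j)]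
       & [set psi | forall j, Ck_close (c j) (K j) k e phi psi] `<=` N]].

Definition open_in (A U : set (R -> M -> M)) : Prop :=
  U `<=` A /\
  forall phi, U phi -> exists2 N, Cinfty_nbhs phi N & N `&` A `<=` U.

Definition dense_in (A U : set (R -> M -> M)) : Prop :=
  U `<=` A /\
  forall phi, A phi -> forall N, Cinfty_nbhs phi N -> N `&` U !=set0.

(* d(phi_t y, phi_t p) -> 0, written with the unique uniformity of the compact
   Hausdorff space M, whose entourages are the neighborhoods of the diagonal. *)
Definition strong_stable phi p : set M :=
  [set y | forall W : set (M * M), open W -> (forall x, W (x, x)) ->
     \forall t \near +oo%R, W (phi t y, phi t p)].

Definition eigenvalues (m : nat) (A : 'M[R]_m) (lam : 'I_m -> R[i]) : Prop :=
  char_poly (complexify A) = \prod_(i < m) ('X - (lam i)%:P).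

(* The rows of B are a basis of the tangent space of the strong stable manifold
   of p, and [conjmx B _] is the matrix in this basis of the restriction. *)
Definition nonresonant_periodic phi p T : Prop :=
  exists (d : nat) (B : 'M[R]_(d, n)) (lam : 'I_d -> R[i]),
  [/\ row_free B,
      forall v, tangent_space (strong_stable phi p) p v <-> (v <= B)%MS,
      eigenvalues (conjmx B (tangent_map (phi T) p)) lam
    & forall (i : 'I_d) (m : 'I_d -> nat), (2 <= \sum_j m j)%N ->
        complex.Re (lam i) <> \prod_j (complex.Re (lam j)) ^+ m j].

Definition nonresonant_fixed phi p : Prop :=
  exists lam : 'I_n -> R[i],
  [/\ eigenvalues (linearization phi p) lam,
      forall i, complex.Re (lam i) < 0
    & forall (i : 'I_n) (m : 'I_n -> nat), (2 <= \sum_j m j)%N ->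
        complex.Re (lam i - \sum_j lam j *+ m j) <> 0].

Definition nonresonant phi p : Prop :=
  (fixed_point phi p /\ nonresonant_fixed phi p) \/
  (exists2 T, has_period phi p T & nonresonant_periodic phi p T).

Definition unique_derivative phi p : Prop :=
  (fixed_point phi p /\
   forall q, fixed_point phi q -> q <> p ->
     ~ (tangent_map (phi 1) p ~_{in unitmx} tangent_map (phi 1) q)) \/
  (exists2 T, has_period phi p T &
   forall q, has_period phi q T -> (forall t, q <> phi t p) ->
     ~ (tangent_map (phi T) p ~_{in unitmx} tangent_map (phi T) q)).

Definition nonresonant_unique phi : Prop :=
  (forall L, attractor phi L ->
     exists p, [/\ L p, nonresonant phi p & unique_derivative phi p]) /\
  (forall L, repeller phi L ->
     exists p, [/\ L p, nonresonant (reverse phi) p & unique_derivative phi p]).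

Definition basin_linking phi : Prop :=
  forall L L', attractor phi L -> attractor phi L' ->
    closure (Ws phi L) `&` closure (Ws phi L') !=set0 ->
    exists Lr, [/\ repeller phi Lr,
                   Ws phi L `&` Wu phi Lr !=set0
                 & Ws phi L' `&` Wu phi Lr !=set0].

End Flows.
Arguments A_infty {R n} M.

(* Main.v *)
(** Let Z be the interior of {f1 = f2}; it is open and invariant under the flow.
    At a point of the closure of Z, the maps f1 and f2 have the same Taylor
    expansion in charts, so d(f1 y, f2 y) = O(d(y, closure Z)^k) for all k.
    If y converges exponentially to a compact set contained in closure Z, then
    f1 and f2 are therefore super-exponentially close along its orbit; pulling
    back by the flow, which commutes with both maps and distorts distances at
    most exponentially, gives f1 y = f2 y.

    It remains to move Z around. A weighted shadowing lemma, obtained as a fixed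
    point of a contraction on finite pseudo-orbits, shows that an orbit which
    stays near a basic set approaches it exponentially, and that a basic set
    whose basin meets Z lies in closure Z; for a hyperbolic fixed point, a
    quadratic Lyapunov form replaces shadowing. Hence Z contains the basin of
    every attractor (or, reversing time, of every repeller) that it meets. The
    basins of attractors have dense union by Baire's theorem. If the closures of
    two basins meet, basin linking carries Z from the first into the basin of a
    repeller, and from there into the second; so by connectedness Z contains
    the basins of all attractors, and Z is dense. *)

From HB Require Import structures.
From mathcomp Require Import ring lra zify finmap spectral.
Require Import Defs.
Set Implicit Arguments.
Unset Strict Implicit.
Unset Printing Implicit Defensive.
Local Open Scope ring_scope.
Local Open Scope classical_set_scope.

(** The manifold comes without a metric and [chart_at x] varies discontinuously with [x], so
    estimates are made in a finite cover by charts with nested balls, where the distance [mdist] is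
    equivalent to the coordinate norm. No stable manifolds are constructed. By Axiom A, a periodic
    point near the regular part [H] of the nonwandering set lies in [H]; hence closing an orbit
    segment near a basic set to a periodic pseudo-orbit and shadowing it yields a point of [H].
    Weights [2^-1 ^+ minn k (A - k)] make the shadowing error decay away from the ends of the
    segment, and this is where exponential approach comes from. Fixed points must be treated apart,
    because there an error along the flow cannot be absorbed by a change of time. Since a basic set
    is by definition a member of some spectral decomposition, one has to be built, from classes of
    chain equivalent points of [H]; every basic set is then shown to be either a fixed point or
    isolated and chain transitive in [H]. *)

Section Norms.
Variable R : realType.

Lemma mx_entry_le m n (A : 'M[R]_(m, n)) i j : `|A i j| <= `|A|.
Proof.
by rewrite [leRHS]/Num.Def.normr /= mx_normrE; exact: (le_bigmax _ _ (i, j)).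
Qed.

Lemma mx_norm_le m n (A : 'M[R]_(m, n)) (K : R) :
  0 <= K -> (forall i j, `|A i j| <= K) -> `|A| <= K.
Proof.
by move=> K0 AK; rewrite [leLHS]/Num.Def.normr /= mx_normrE bigmax_le.
Qed.

Lemma rv_norm_le n (v : 'rV[R]_n) (K : R) :
  0 <= K -> (forall j, `|v 0 j| <= K) -> `|v| <= K.
Proof. by move=> K0 vK; apply: mx_norm_le => // i j; rewrite ord1. Qed.

Lemma mulmx_norm_le m n p (A : 'M[R]_(m, n)) (B : 'M[R]_(n, p)) :
  `|A *m B| <= n%:R * `|A| * `|B|.
Proof.
apply: mx_norm_le => [|i j]; first by rewrite !mulr_ge0.
rewrite mxE; apply: (le_trans (ler_norm_sum _ _ _)).
have -> : n%:R * `|A| * `|B| = \sum_(k < n) `|A| * `|B|.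
  by rewrite sumr_const card_ord -mulrA mulr_natl.
by apply: ler_sum => k _; rewrite normrM ler_pM ?mx_entry_le.
Qed.

Lemma rv_row_le m n (A : 'M[R]_(m, n)) i : `|row i A| <= `|A|.
Proof. by apply: rv_norm_le => // j; rewrite mxE mx_entry_le. Qed.

Lemma mx_norm_rows m n (A : 'M[R]_(m, n)) K :
  0 <= K -> (forall i, `|row i A| <= K) -> `|A| <= K.
Proof.
move=> K0 AK; apply: mx_norm_le => // i j; apply: le_trans (AK i).
by apply: le_trans (mx_entry_le _ 0 j); rewrite mxE.
Qed.

End Norms.

(** Near-covering compactness with the filter of right neighborhoods of 0; monotonicity in [r] turns
    local radii into one radius for all of [K]. *)
Lemma compact_uniform (R : realType) (T : topologicalType) (K : set T)
    (P : R -> T -> Prop) :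
  compact K ->
  (forall r r' y, 0 < r' -> r' <= r -> P r y -> P r' y) ->
  (forall x, K x -> exists2 r, 0 < r & nbhs x (P r)) ->
  exists2 r, 0 < r & forall y, K y -> P r y.
Proof.
move=> /compact_near_coveringP cK Pmon loc.
have := cK R (0 : R)^'+ (fun r y => P r y) _.
case=> [x Kx|r0 /= r00 H].
  have [r r0 nx] := loc _ Kx.
  exists (P r, [set r' | r' <= r /\ 0 < r']).
    split=> //=; near=> r'; split=> //.
    by near: r'; exact: nbhs_right_le.
  by case=> y r' /= [Py [le_r pos]]; exact: Pmon Py.
exists (r0 / 2); first by rewrite divr_gt0.
apply: H; last by rewrite divr_gt0.
rewrite /ball /= sub0r normrN gtr0_norm ?divr_gt0 // ltr_pdivrMr //.
by rewrite ltr_pMr // ltr1n.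
Unshelve. all: by end_near. Qed.

(** The sets [f i] need not be open. Near-covering compactness is applied to the filter on finite
    sequences whose sets contain all extensions of some sequence. *)
Lemma compact_finite_cover (T : topologicalType) (I : eqType) (K : set T)
    (f : I -> set T) :
  compact K -> (forall x, K x -> exists i, nbhs x (f i)) ->
  exists s : seq I, forall x, K x -> exists2 i, i \in s & f i x.
Proof.
move=> /compact_near_coveringP cK Kf.
pose F : set_system (seq I) :=
  [set P | exists s0 : seq I, forall s : seq I, {subset s0 <= s} -> P s].
have FF : Filter F.
  split; first by exists [::].
    move=> P Q [s0 Ps] [s1 Qs]; exists (s0 ++ s1) => s s01.
    by split; [apply: Ps|apply: Qs] => i Hi; apply: s01; rewrite mem_cat Hi ?orbT.
  by move=> P Q PQ [s0 Ps]; exists s0 => s /Ps/PQ.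
have [x Kx|s Hs] := cK _ F (fun s x => exists2 i, i \in s & f i x) FF.
  have [i fi] := Kf x Kx; exists (f i, [set s : seq I | i \in s]) => /=.
    by split=> //; exists [:: i] => s; apply; rewrite inE.
  by move=> [y s] /= [fy si]; exists i.
by exists s => x /Hs; apply.
Qed.

(** * Smooth functions and flatness *)

Section MeanValue.
Variable R : realType.

Lemma norm_between (t t' u q r : R) :
  (0 <= u <= t - t') || (t - t' <= u <= 0) ->
  `|t - q| < r -> `|t' - q| < r -> `|t' + u - q| < r.
Proof.
by rewrite !ltr_norml => /orP[] /andP[? ?] /andP[? ?] /andP[? ?];
  apply/andP; split; lra.
Qed.

Lemma scaler_regular1 (a : R) : a *: (1 : R^o) = a.
Proof. exact: mulr1. Qed.

(** Balls of the maximum norm are boxes, so coordinates can be changed one at a time without leaving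
    a ball. *)
Lemma box_norm_lt n (y z w q : 'rV[R]_n) r : 0 < r ->
  (forall i, (y 0 i <= w 0 i <= z 0 i) || (z 0 i <= w 0 i <= y 0 i)) ->
  `|z - q| < r -> `|y - q| < r -> `|w - q| < r.
Proof.
move=> r0 Hw za ya; rewrite /Num.Def.normr /= mx_normrE bigmax_lt //= => -[k j] _.
have := le_lt_trans (mx_entry_le _ 0 j) za.
have := le_lt_trans (mx_entry_le _ 0 j) ya.
move: (Hw j); rewrite (ord1 k) !mxE !ltr_norml /= {Hw za ya}.
by case/orP=> /andP[? ?] /andP[? ?] /andP[? ?]; apply/andP; split; lra.
Qed.

Lemma mvt_line (V : normedModType R) m (f : V -> 'rV[R]_m) x e (a K : R) :
  0 <= K ->
  (forall u : R, (0 <= u <= a) || (a <= u <= 0) ->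
     derivable f (x + u *: e) e /\ `|'D_e f (x + u *: e)| <= K) ->
  `|f (x + a *: e) - f x| <= K * `|a|.
Proof.
move=> K0 H; apply: rv_norm_le => [|j]; first by rewrite mulr_ge0.
pose k := fun u : R => f (x + u *: e) 0 j.
have dk u : (0 <= u <= a) || (a <= u <= 0) ->
    is_derive u (1 : R) k ('D_e f (x + u *: e) 0 j).
  move=> /H[df _].
  have dfj : derivable (fun y => f y 0 j) (x + u *: e) e.
    by move/derivable_mxP : df => /(_ 0 j).
  have -> : 'D_e f (x + u *: e) 0 j = 'D_e (fun y => f y 0 j) (x + u *: e).
    by rewrite derive_mx // mxE.
  have E : (fun h : R => h^-1 *: ((k \o shift u) (h *: 1) - k u)) =
    (fun h : R => h^-1 *: (((fun y => f y 0 j) \o shift (x + u *: e)) (h *: e)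
        - f (x + u *: e) 0 j)).
    apply/funext => h; rewrite /k /=; congr (_ *: (f _ 0 j - _)).
    by rewrite scaler_regular1 scalerDl addrCA.
  split; first by rewrite /derivable E.
  by rewrite /derive E.
have -> : (f (x + a *: e) - f x) 0 j = k a - k 0.
  by rewrite !mxE /k scale0r addr0.
have bd u : (0 <= u <= a) || (a <= u <= 0) -> `|'D_e f (x + u *: e) 0 j| <= K.
  by move=> /H[_]; apply: le_trans; exact: mx_entry_le.
have [a0|a0] := leP 0 a.
  have [|  |c + ->] := @MVT_segment R k (fun u => 'D_e f (x + u *: e) 0 j) 0 a a0.
  - by move=> c; rewrite in_itv /= => /andP[c0 ca]; apply: dk; rewrite (ltW c0) (ltW ca).
  - apply: derivable_within_continuous => u; rewrite in_itv /= => ua.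
    by have [] := dk u; rewrite ?ua.
  - rewrite in_itv /= => ca; rewrite subr0 normrM ler_wpM2r //.
    by apply: bd; rewrite ca.
have [|  |c + ] := @MVT_segment R k (fun u => 'D_e f (x + u *: e) 0 j) a 0 (ltW a0).
- by move=> c; rewrite in_itv /= => /andP[c0 ca]; apply: dk; rewrite (ltW c0) (ltW ca) orbT.
- apply: derivable_within_continuous => u; rewrite in_itv /= => ua.
  by have [] := dk u; rewrite ?ua ?orbT.
- rewrite in_itv /= => ca E; rewrite distrC E sub0r normrM normrN ler_wpM2r //.
  by apply: bd; rewrite ca orbT.
Qed.

(** The path from [y] to [z] changes one coordinate at a time, so partial derivatives on the box
    spanned by the two points suffice; the factor [n] counts the moves. *)
Lemma box_lip n m (f : 'rV[R]_n -> 'rV[R]_m) (y z : 'rV[R]_n) (K : R) :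
  0 <= K ->
  (forall p : 'rV[R]_n, (forall i, (y 0 i <= p 0 i <= z 0 i) || (z 0 i <= p 0 i <= y 0 i)) ->
    forall i, derivable f p (delta_mx 0 i) /\ `|'D_(delta_mx 0 i) f p| <= K) ->
  `|f z - f y| <= n%:R * K * `|z - y|.
Proof.
move=> K0 H.
pose h (k : nat) : 'rV[R]_n := \row_i (if (i < k)%N then z 0 i else y 0 i).
have -> : z = h n by apply/rowP => i; rewrite mxE ltn_ord.
have -> : y = h 0%N by apply/rowP => i; rewrite mxE ltn0.
rewrite -(telescope_sumr (fun k => f (h k)) (leq0n n)).
apply: (le_trans (ler_norm_sum _ _ _)); rewrite big_mkord.
have -> : n%:R * K * `|h n - h 0%N| = \sum_(k < n) K * `|h n - h 0%N|.
  by rewrite sumr_const card_ord -mulrA mulr_natl.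
apply: ler_sum => k _.
have -> : h k.+1 = h k + (z 0 k - y 0 k) *: delta_mx 0 k.
  apply/rowP => i; rewrite !mxE /= ltnS leq_eqVlt.
  have [->|ik] := eqVneq i k; first by rewrite eqxx ltnn /= mulr1 addrC subrK.
  by rewrite (negPf (ik : i != k :> nat)) /= mulr0 addr0.
apply: (@le_trans _ _ (K * `|z 0 k - y 0 k|)); last first.
  rewrite ler_wpM2l //; apply: le_trans (mx_entry_le _ 0 k).
  by rewrite !mxE ltn_ord ltn0.
apply: mvt_line => // u Hu; apply: H => i; rewrite !mxE /=.
have [->|ik] := eqVneq i k.
  rewrite ltnn mulr1; case/orP: Hu => /andP[? ?]; apply/orP; [left|right];
  by apply/andP; split; lra.
by rewrite mulr0 addr0; case: ifP => _; rewrite !lexx ?andbT; exact: le_total.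
Qed.

End MeanValue.

Section Smooth.
Variable R : realType.

Lemma continuous_bounded (T : topologicalType) (V : normedModType R) (K : set T)
    (f : T -> V) : compact K -> (forall x, K x -> {for x, continuous f}) ->
  exists2 C, 0 < C & forall x, K x -> `|f x| <= C.
Proof.
move=> cK cf.
have [r r0 H] : exists2 r, 0 < r & forall y, K y -> `|f y| <= r^-1.
  apply: compact_uniform cK _ _ => [r r' y r'0 r'r|x Kx].
    by move/le_trans; apply; rewrite lef_pV2 ?posrE // (lt_le_trans r'0).
  exists (`|f x| + 1)^-1; first by rewrite invr_gt0 ltr_wpDl.
  rewrite invrK; have /cvgrPdist_lt/(_ _ ltr01) := cf x Kx.
  apply: filterS => y yx; rewrite -lerBlDl; apply: le_trans (ltW yx).
  by rewrite distrC lerB_dist.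
by exists r^-1; rewrite ?invr_gt0.
Qed.

Lemma smooth_on_derive (V W : normedModType R) (A : set V) (f : V -> W) v :
  smooth_on A f -> smooth_on A ('D_v f).
Proof.
by move=> sf vs x Ax; have := sf (rcons vs v) x Ax; rewrite /iderive foldr_rcons.
Qed.

Lemma smooth_on_derivable (V W : normedModType R) (A : set V) (f : V -> W) x v :
  smooth_on A f -> A x -> derivable f x v.
Proof. by move=> sf Ax; have [_] := sf [::] x Ax; exact. Qed.

Lemma smooth_on_continuous (V W : normedModType R) (A : set V) (f : V -> W) x :
  smooth_on A f -> A x -> {for x, continuous f}.
Proof. by move=> sf Ax; have [] := sf [::] x Ax. Qed.

(** Induction on [k]: the partial derivatives of [f] are again flat on [S], and the mean value
    estimate on the box between [x] and [y] gains one order. The start is the boundedness of [f] on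
    the compact set [B]. *)
Lemma flat_bound n m (A B S : set 'rV[R]_n) (f : 'rV[R]_n -> 'rV[R]_m) r0 k :
  smooth_on A f -> compact B -> B `<=` A ->
  (forall x y, S x -> `|y - x| <= r0 -> B y) ->
  (forall vs x, S x -> iderive vs f x = 0) ->
  exists2 C, 0 <= C & forall x y, S x -> `|y - x| <= r0 ->
    `|f y| <= C * `|y - x| ^+ k.
Proof.
move=> sf cB BA SB; elim: k f sf => [|k IH] f sf f0.
  have [C C0 HC] : exists2 C, 0 < C & forall x, B x -> `|f x| <= C.
    by apply: continuous_bounded => // x /BA; exact: smooth_on_continuous.
  by exists C => [|x y Sx xy]; [exact: ltW|rewrite expr0 mulr1 HC //; exact: SB xy].
have /choice[C HC] : forall i : 'I_n, exists C, 0 <= C /\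
    forall x y, S x -> `|y - x| <= r0 ->
    `|'D_(delta_mx 0 i) f y| <= C * `|y - x| ^+ k.
  move=> i; have [||C C0 HC] := IH ('D_(delta_mx 0 i) f).
  - exact: smooth_on_derive.
  - by move=> vs x Sx; have := f0 (rcons vs (delta_mx 0 i)) x Sx;
      rewrite /iderive foldr_rcons.
  - by exists C.
have C0 : 0 <= \sum_i C i by apply: sumr_ge0 => i _; case: (HC i).
exists (n%:R * \sum_i C i) => [|x y Sx xy]; first by rewrite mulr_ge0.
have fx : f x = 0 by exact: (f0 [::]).
rewrite -[f y]subr0 -fx exprSr mulrA -mulrA mulrA -(mulrA n%:R).
apply: box_lip => [|p bp i]; first by rewrite mulr_ge0 ?exprn_ge0.
have px : `|p - x| <= `|y - x|.
  apply: rv_norm_le => // j; apply: le_trans (mx_entry_le _ 0 j); rewrite !mxE.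
  case/orP: (bp j) => /andP[? ?]; first by rewrite !ger0_norm ?subr_ge0; lra.
  by rewrite !ler0_norm ?subr_le0; lra.
have pr : `|p - x| <= r0 := le_trans px xy.
split; first by apply: smooth_on_derivable sf _; exact/BA/(SB x).
have [Ci0 /(_ x p Sx pr)/le_trans->//] := HC i.
apply: ler_pM => //.
  by rewrite (bigD1 i) //= lerDl sumr_ge0 // => j _; case: (HC j).
by rewrite lerXn2r ?nnegrE.
Qed.

Lemma fin_lower_pos (I : finType) (r : I -> R) :
  (forall i, 0 < r i) -> exists2 r0, 0 < r0 & forall i, r0 <= r i.
Proof.
move=> r0; exists (\big[Num.min/1]_i r i).
  by apply: (big_ind (fun x => 0 < x)) => // x y; rewrite lt_min => -> ->.
by move=> i; rewrite (bigD1 i) //= ge_min lexx.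
Qed.

Lemma fin_upper (I : finType) (r : I -> R) :
  exists2 C, 1 <= C & forall i, r i <= C.
Proof.
exists (1 + \sum_i `|r i|); first by rewrite lerDl sumr_ge0.
move=> i; rewrite (bigD1 i) //=; apply: le_trans (ler_norm _) _.
by rewrite addrCA lerDl addr_ge0 // sumr_ge0.
Qed.

Lemma compact_unif_cont (V W : normedModType R) (K : set V) (g : V -> W) eta :
  compact K -> (forall q, K q -> {for q, continuous g}) -> 0 < eta ->
  exists2 r, 0 < r & forall q p, K q -> `|p - q| < r -> `|g p - g q| < eta.
Proof.
move=> cK cg eta0.
pose P r q := forall p, `|p - q| < r -> `|g p - g q| < eta.
have [r r0 H] : exists2 r, 0 < r & forall q, K q -> P r q.
  apply: compact_uniform cK _ _ => [r r' y r'0 r'r Pry p pr'|x Kx].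
    exact/Pry/(lt_le_trans pr').
  have /cvgrPdist_lt/(_ (eta / 2)) := cg x Kx; rewrite divr_gt0 // => /(_ isT).
  move=> /nbhs_ballP[r /= r0 Hr]; exists (r / 2); first by rewrite divr_gt0.
  apply/nbhs_ballP; exists (r / 2) => /=; first by rewrite divr_gt0.
  move=> q; rewrite -ball_normE /ball_ /= => xq p pq.
  have h1 : `|g x - g q| < eta / 2.
    apply: (Hr q); rewrite -ball_normE /ball_ /=; apply: lt_trans xq _.
    by rewrite ltr_pdivrMr // ltr_pMr // ltr1n.
  have h2 : `|g x - g p| < eta / 2.
    apply: (Hr p); rewrite -ball_normE /ball_ /=.
    rewrite -(subrKA q) (le_lt_trans (ler_normD _ _)) // (splitr r) ltrD //.
    by rewrite distrC.
  rewrite -(subrKA (g x)) (le_lt_trans (ler_normD _ _)) // (splitr eta) ltrD //.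
  by rewrite distrC.
by exists r => // q p /H; exact.
Qed.

Lemma compact_open_near (V : normedModType R) (K A : set V) :
  compact K -> open A -> K `<=` A ->
  exists2 r, 0 < r & forall q p, K q -> `|p - q| < r -> A p.
Proof.
move=> cK oA KA.
pose P r q := forall p, `|p - q| < r -> A p.
have [r r0 H] : exists2 r, 0 < r & forall q, K q -> P r q.
  apply: compact_uniform cK _ _ => [r r' y r'0 r'r Pry p pr'|x Kx].
    exact/Pry/(lt_le_trans pr').
  have /nbhs_ballP[r /= r0 Hr] : nbhs x A by exact/open_nbhs_nbhs/(conj oA)/KA.
  exists (r / 2); first by rewrite divr_gt0.
  apply/nbhs_ballP; exists (r / 2) => /=; first by rewrite divr_gt0.
  move=> q; rewrite -ball_normE /ball_ /= => xq p pq.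
  apply: (Hr p); rewrite -ball_normE /ball_ /=.
  rewrite -(subrKA q) (le_lt_trans (ler_normD _ _)) // (splitr r) ltrD //.
  by rewrite distrC.
by exists r => // q p /H; exact.
Qed.

Lemma derive_affine (V W : normedModType R) (L : V -> W) a v w :
  (forall h : R, L (h *: v + a) = L a + h *: w) -> is_derive a v L w.
Proof.
move=> H.
have E : \forall h \near 0^', h^-1 *: ((L \o shift a) (h *: v) - L a) = w.
  near=> h; rewrite /= H addrAC subrr add0r scalerA mulVf ?scale1r //.
  by near: h; exact: nbhs_dnbhs_neq.
split; last by exact: lim_near_cst.
by apply: is_cvg_near_cst; apply: filterS E => h ->.
Unshelve. all: by end_near. Qed.

Lemma derive_subr (V W : normedModType R) (F L : V -> W) p v w :
  derivable F p v -> is_derive p v L w ->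
  derivable (fun x => F x - L x) p v /\
  'D_v (fun x => F x - L x) p = 'D_v F p - w.
Proof.
move=> dF dL; have dL' : derivable L p v by exact: ex_derive.
have := derivableB dF dL'; have := deriveB dF dL'.
by rewrite (@derive_val _ _ _ _ _ _ _ dL).
Qed.

Definition jac_rows n m (V : normedModType R) (e : 'I_n -> V) (F : V -> 'rV[R]_m) q
  : 'M[R]_(n, m) := \matrix_(i, j) 'D_(e i) F q 0 j.

Lemma row_jac_rows n m (V : normedModType R) (e : 'I_n -> V) (F : V -> 'rV[R]_m) q i :
  row i (jac_rows e F q) = 'D_(e i) F q.
Proof. by apply/rowP => j; rewrite !mxE. Qed.

Definition space_dir n (i : 'I_n) : R^o * 'rV[R]_n := (0, delta_mx 0 i).
Definition time_dir n : R^o * 'rV[R]_n := (1, 0).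

Lemma derive_slice n m (F : R^o * 'rV[R]_n -> 'rV[R]_m) t w e :
  derivable F (t, w) (0, e) ->
  derivable (fun w => F (t, w)) w e /\
  'D_e (fun w => F (t, w)) w = 'D_((0, e) : R^o * 'rV[R]_n) F (t, w).
Proof.
move=> dF.
have E : (fun h : R => h^-1 *: (((fun w => F (t, w)) \o shift w) (h *: e) - F (t, w))) =
    (fun h : R => h^-1 *: ((F \o shift ((t, w) : R^o * 'rV_n)) (h *: (0, e))
      - F (t, w))).
  apply/funext => h /=; congr (_ *: (F _ - _)).
  by apply: injective_projections; rewrite /= ?scaler0 ?add0r.
by split; rewrite ?/derivable ?/derive E.
Qed.

(** Strict differentiability, uniform over [K]: both points vary near [q], as contraction estimates
    require. Subtracting the linear part at [q] leaves a function [G] with small partial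
    derivatives, whose increment is split into a time increment and a space increment. *)
Lemma c1_uniform n m (Om K : set (R^o * 'rV[R]_n))
    (F : R^o * 'rV[R]_n -> 'rV[R]_m) (eta : R) :
  smooth_on Om F -> open Om -> compact K -> K `<=` Om -> 0 < eta ->
  exists2 r, 0 < r & forall q, K q -> forall (t t' : R^o) (z z' : 'rV[R]_n),
    `|(t, z) - q| < r -> `|(t', z') - q| < r ->
    Om (t, z) /\
    `|F (t, z) - F (t', z') - ((t - t') *: 'D_(time_dir n) F q +
        (z - z') *m jac_rows (@space_dir n) F q)| <=
      eta * (`|t - t'| + `|z - z'|).
Proof.
move=> sF oOm cK KOm eta0.
(* The space increment uses [n] partial derivatives, each costing [e1]; the successor keeps the
   division safe for [n = 0]. *)
pose e1 := eta / n.+1%:R.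
have e10 : 0 < e1 by rewrite divr_gt0.
have contD v : exists2 r, 0 < r & forall q p, K q -> `|p - q| < r ->
    `|'D_v F p - 'D_v F q| < e1.
  apply: compact_unif_cont => // q Kq.
  by apply: smooth_on_continuous (smooth_on_derive v sF) (KOm _ Kq).
have [r1 r10 H1] := contD (time_dir n).
have /choice[r2 H2] : forall i : 'I_n, exists r, 0 < r /\
    forall q p, K q -> `|p - q| < r ->
    `|'D_(space_dir i) F p - 'D_(space_dir i) F q| < e1.
  by move=> i; have [r] := contD (space_dir i); exists r.
have [r3 r30 H3] := compact_open_near cK oOm KOm.
have [|r4 r40 H4] := @fin_lower_pos 'I_n r2; first by move=> i; case: (H2 i).
exists (Num.min r1 (Num.min r3 r4)); first by rewrite !lt_min r10 r30.
move=> q Kq t t' z z'; rewrite !lt_min => /and3P[a1 a3 a4] /and3P[b1 b3 b4].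
split; first exact: H3 a3.
set X := 'D_(time_dir n) F q; set J := jac_rows _ F q.
pose G (p : R^o * 'rV[R]_n) := F p - (p.1 *: X + p.2 *m J).
have -> : F (t, z) - F (t', z') - ((t - t') *: X + (z - z') *m J) =
    (G (t, z) - G (t', z)) + (G (t', z) - G (t', z')).
  rewrite /G /= mulmxBl scalerBl; set a := z *m J; set b := z' *m J.
  by clearbody a b; apply/rowP => j; rewrite !mxE; ring.
have norm_pair (a : R^o) (b : 'rV[R]_n) : `|(a, b)| = Num.max `|a| `|b| by [].
apply: le_trans (ler_normD _ _) _; rewrite mulrDr; apply: lerD.
- have -> : (t, z) = (t', z) + (t - t') *: time_dir n.
    apply: injective_projections; rewrite /= ?scaler0 ?addr0 //.
    by rewrite scaler_regular1 addrC subrK.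
  apply: (@mvt_line _ _ _ G); first exact: ltW.
  move=> u Hu; set p := (_ + _).
  have p3 : `|p - q| < Num.min r1 r3.
    have : p - q = (t' + u - q.1, z - q.2).
      apply: injective_projections; rewrite /= ?scaler0 ?addr0 //.
      by rewrite scaler_regular1.
    move=> ->; move: a1 a3 b1 b3; rewrite lt_min !norm_pair !gt_max /=.
    move=> /andP[a11 ->] /andP[a31 ->] /andP[b11 _] /andP[b31 _]; rewrite !andbT.
    by rewrite !(norm_between Hu).
  move: p3; rewrite lt_min => /andP[p1 p3].
  have dF : derivable F p (time_dir n).
    by apply: smooth_on_derivable sF _; exact: H3 p3.
  have dL : is_derive p (time_dir n) (fun p => p.1 *: X + p.2 *m J) X.
    apply: derive_affine => h; rewrite /= scaler0 add0r scalerDl scaler_regular1.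
    by rewrite -addrA addrC.
  have [dG ->] := derive_subr dF dL.
  split; first exact: dG.
  apply/ltW/(lt_le_trans (H1 _ _ Kq p1)).
  by rewrite ler_pdivrMr // ler_pMr // ler1n.
- pose g (w : 'rV[R]_n) := G (t', w).
  have etaE : eta = n%:R * e1 + e1.
    by rewrite -[X in _ + X]mul1r -mulrDl natr1 mulrC divfK.
  rewrite etaE mulrDl; apply: ler_wpDr; first by rewrite mulr_ge0 // ltW.
  apply: (@box_lip _ _ _ g) => [|w Hw i]; first exact: ltW.
  have w4 : `|(t', w) - q| < Num.min r3 r4.
    move: a3 a4 b3 b4; rewrite lt_min !norm_pair !gt_max /=.
    move=> /andP[_ a3] /andP[_ a4] /andP[-> b3] /andP[-> b4] /=.
    by rewrite !(box_norm_lt _ Hw).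
  move: w4; rewrite lt_min => /andP[w3 w4].
  have dF : derivable F (t', w) (space_dir i).
    by apply: smooth_on_derivable sF _; exact: H3 w3.
  have dL : is_derive (t', w) (space_dir i) (fun p => p.1 *: X + p.2 *m J)
      ('D_(space_dir i) F q).
    apply: derive_affine => h; rewrite /= scaler0 add0r mulmxDl addrCA addrC.
    by rewrite -scalemxAl -rowE row_jac_rows.
  have [dG EG] : derivable G (t', w) (space_dir i) /\ 'D_(space_dir i) G (t', w)
      = 'D_(space_dir i) F (t', w) - 'D_(space_dir i) F q.
    by have [dG EG] := derive_subr dF dL; split; [exact: dG|exact: EG].
  have [dg ->] := derive_slice dG; split; first exact: dg.
  rewrite EG; apply/ltW.
  have [_] := H2 i; apply=> //; exact: lt_le_trans (H4 i).
Qed.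

End Smooth.

Lemma smooth_loc_lip (R : realType) n m (A : set 'rV[R]_n)
    (f : 'rV[R]_n -> 'rV[R]_m) y :
  smooth_on A f -> open A -> A y ->
  exists r C : R, [/\ 0 < r, 0 <= C & forall p q, `|p - y| < r -> `|q - y| < r ->
    A p /\ `|f p - f q| <= C * `|p - q|].
Proof.
move=> sf oA Ay.
have /nbhs_ballP[r0 /= r00 Hr0] : nbhs y A by exact: open_nbhs_nbhs.
have /choice[r2 H2] : forall i : 'I_n, exists r, 0 < r /\
    forall p, `|p - y| < r ->
    `|'D_(delta_mx 0 i) f p| <= `|'D_(delta_mx 0 i) f y| + 1.
  move=> i.
  have /cvgrPdist_lt/(_ _ ltr01)/nbhs_ballP[r /= rp Hr] :=
    smooth_on_continuous (smooth_on_derive (delta_mx 0 i) sf) Ay.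
  exists r; split=> // p py; rewrite -lerBlDl; apply: le_trans (lerB_dist _ _) _.
  rewrite distrC; apply/ltW/Hr; by rewrite -ball_normE /ball_ /= distrC.
have [|r4 r40 H4] := @fin_lower_pos _ 'I_n r2; first by move=> i; case: (H2 i).
have [C C1 HC] := @fin_upper _ 'I_n (fun i => `|'D_(delta_mx 0 i) f y| + 1).
have C0 : 0 <= C := le_trans ler01 C1.
have rpos : 0 < Num.min r0 r4 by rewrite lt_min r00.
exists (Num.min r0 r4), (n%:R * C); split=> [||p q py qy] //.
  by rewrite mulr_ge0.
have inA w : `|w - y| < Num.min r0 r4 -> A w.
  rewrite lt_min => /andP[wy _]; apply: Hr0.
  by rewrite -ball_normE /ball_ /= distrC.
split; first exact: inA.
apply: box_lip => // w bw i.
have wy : `|w - y| < Num.min r0 r4 by exact: box_norm_lt bw _ _.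
split; first by apply: smooth_on_derivable sf _; exact: inA.
apply: le_trans (HC i); have [_] := H2 i; apply.
by move: wy; rewrite lt_min => /andP[_ /lt_le_trans->].
Qed.

Lemma nbhs_normP (R : realType) (V : normedModType R) (x : V) (A : set V) :
  nbhs x A <-> exists2 r : R, 0 < r & forall y, `|y - x| < r -> A y.
Proof.
split=> [/nbhs_ballP[r /= r0 H]|[r r0 H]].
  by exists r => // y yx; apply: H; rewrite -ball_normE /ball_ /= distrC.
apply/nbhs_ballP; exists r => // y; rewrite -ball_normE /ball_ /= distrC.
exact: H.
Qed.

Lemma continuous_normP (R : realType) (V W : normedModType R) (f : V -> W) x :
  {for x, continuous f} <-> forall e, 0 < e ->
    exists2 d : R, 0 < d & forall y, `|y - x| < d -> `|f y - f x| < e.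
Proof.
split=> [cf e e0|H].
  have /cvgrPdist_lt/(_ _ e0)/nbhs_normP[d d0 Hd] := cf.
  by exists d => // y /Hd; rewrite distrC.
apply/cvgrPdist_lt => e /H[d d0 Hd]; apply/nbhs_normP; exists d => // y /Hd.
by rewrite distrC.
Qed.

Lemma clamp_lip (R : realType) (x y : R) :
  `|Num.max 0 (Num.min 1 x) - Num.max 0 (Num.min 1 y)| <= `|x - y|.
Proof.
have key a b : a <= b :> R -> `|Num.max 0 (Num.min 1 a) - Num.max 0 (Num.min 1 b)|
    <= b - a.
  move=> ab; rewrite ler_norml; case: (leP 1 a) => h1; case: (leP 1 b) => h2;
  rewrite ?(max_r ler01); try (case: (leP 0 a) => h3); try (case: (leP 0 b) => h4);
  by apply/andP; split; lra.
have [/[dup] xy /key|/ltW/[dup] yx /key] := leP x y.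
  by rewrite (distrC x) (ger0_norm (_ : 0 <= y - x)) ?subr_ge0.
by rewrite distrC (ger0_norm (_ : 0 <= x - y)) ?subr_ge0.
Qed.

(** * Charts and a distance on the manifold *)

Section Charts.
Variables (R : realType) (n : nat) (M : topologicalType).
Implicit Type c : chart R n M.

Lemma cinv_dom c y : cimg c y -> cdom c (cinv c y).
Proof. by case=> x dx <-; rewrite cmapK. Qed.

Lemma cinvK c y : cimg c y -> c (cinv c y) = y.
Proof. by case=> x dx <-; rewrite cmapK. Qed.

Lemma cimg_dom c x : cdom c x -> cimg c (c x).
Proof. by exists x. Qed.

Lemma chart_sub_open c (A : set M) : open A -> open (c @` (cdom c `&` A)).
Proof.
move=> oA; rewrite openE => y [x [dx Ax] <-].
have cx : cimg c (c x) by exact: cimg_dom.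
have nA : nbhs (cinv c (c x)) A by rewrite cmapK //; exact: open_nbhs_nbhs.
have h1 := @cinv_continuous _ _ _ c _ cx _ nA.
have h2 : nbhs (c x) (cimg c) by apply: open_nbhs_nbhs; split=> //; exact: cimg_open.
have h3 : nbhs (c x) ([set z | A (cinv c z)] `&` cimg c) by apply: filterI; [exact: h1|exact: h2].
rewrite /interior /=; apply: filterS h3 => z [Az cz].
by exists (cinv c z); [split=> //; exact: cinv_dom|exact: cinvK].
Qed.

Lemma chart_preim_nbhs c x (B : set 'rV[R]_n) :
  cdom c x -> nbhs (c x) B -> nbhs x [set y | cdom c y /\ B (c y)].
Proof.
move=> dx nB; have := @cmap_continuous _ _ _ c x dx _ nB => h.
have h2 : nbhs x (cdom c) by apply: open_nbhs_nbhs; split=> //; exact: cdom_open.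
by apply: filterS (filterI h2 h) => y [].
Qed.

Lemma chart_img_nbhs c x (U : set M) :
  cdom c x -> nbhs x U -> nbhs (c x) [set y | cimg c y /\ U (cinv c y)].
Proof.
move=> dx nU; have cx := cimg_dom dx.
have h : nbhs (c x) (cinv c @^-1` U).
  by apply: (@cinv_continuous _ _ _ c _ cx); rewrite cmapK.
have h2 : nbhs (c x) (cimg c) by apply: open_nbhs_nbhs; split=> //; exact: cimg_open.
by apply: filterS (filterI h2 h) => y [].
Qed.

Definition cball (z : 'rV[R]_n) (r : R) : set 'rV[R]_n := [set y : 'rV[R]_n | `|y - z| <= r].

Lemma cball_compact z r : compact (cball z r).
Proof.
apply: bounded_closed_compact.
  exists (`|z| + r); split; first exact: num_real.
  move=> s rs y /= yz; apply/ltW/(le_lt_trans _ rs).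
  by rewrite -[y](subrK z) (le_trans (ler_normD _ _)) // addrC lerD2l.
have -> : cball z r = (fun y : 'rV[R]_n => `|y - z|) @^-1` [set s | s <= r] by [].
apply: closed_comp; last exact: closed_le.
move=> y _; apply/continuous_normP => e e0; exists e => // w wy.
apply: le_lt_trans wy; apply: le_trans (ler_dist_dist _ _) _.
by rewrite opprB addrA subrK.
Qed.

(** Piecewise linear in the distance to [z]: 1 up to [2 * r], 0 beyond [3 * r]. *)
Definition cutoff (z : 'rV[R]_n) (r : R) (w : 'rV[R]_n) : R :=
  Num.max 0 (Num.min 1 (3 - `|w - z| / r)).

Lemma cutoff_ge0 z r w : 0 <= cutoff z r w.
Proof. by rewrite /cutoff le_max lexx. Qed.

Lemma cutoff_le1 z r w : cutoff z r w <= 1.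
Proof. by rewrite /cutoff ge_max ler01 /= ge_min lexx. Qed.

Lemma cutoff_lip z r w w' : 0 < r ->
  `|cutoff z r w - cutoff z r w'| <= r^-1 * `|w - w'|.
Proof.
move=> r0; have ri : 0 < r^-1 by rewrite invr_gt0.
have h : `| `|w - z| / r - `|w' - z| / r| <= r^-1 * `|w - w'|.
  rewrite -mulrBl normrM (gtr0_norm ri) mulrC ler_pM2l //.
  by apply: le_trans (ler_dist_dist _ _) _; rewrite opprB addrA subrK.
apply: le_trans h; apply: le_trans (clamp_lip _ _) _.
by rewrite [X in `|X| <= _](_ : _ = - (`|w - z| / r - `|w' - z| / r)) ?normrN //; ring.
Qed.

End Charts.

(** Three radii are used: balls of radius [gcr] cover, estimates are made in those of radius
    [2 * gcr], and the cutoff functions vanish outside those of radius [3 * gcr], which still lie in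
    the chart images. *)
Record good_cover (R : realType) (n : nat) (M : closed_manifold R n) := GoodCover {
  gcN : nat;
  gch : 'I_gcN -> chart R n M;
  gcz : 'I_gcN -> 'rV[R]_n;
  gcr : 'I_gcN -> R;
  gch_atlas : forall i, atlas (gch i);
  gcr_gt0 : forall i, 0 < gcr i;
  gc_ball : forall i, cball (gcz i) (3 * gcr i) `<=` cimg (gch i);
  gc_cover : forall x, exists i, cdom (gch i) x /\ `|gch i x - gcz i| < gcr i }.

Lemma good_cover_exists (R : realType) (n : nat) (M : closed_manifold R n) :
  inhabited (good_cover M).
Proof.
have H (x : M) : exists r : R, 0 < r /\ cball (chart_at x x) (3 * r) `<=` cimg (chart_at x).
  have : nbhs (chart_at x x) (cimg (chart_at x)).
    apply: open_nbhs_nbhs; split; first exact: cimg_open.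
    exact/cimg_dom/chart_at_dom.
  move=> /nbhs_normP[r r0 Hr]; exists (r / 4); split; first by rewrite divr_gt0.
  by move=> y /= yx; apply: Hr; apply: le_lt_trans yx _; lra.
have /choice[r {}H] := H.
pose f (x : M) := [set y | cdom (chart_at x) y /\ `|chart_at x y - chart_at x x| < r x].
have [x _|s cD] := compact_finite_cover (f := f) (@mcompact _ _ M).
  exists x; apply: (@chart_preim_nbhs _ _ _ (chart_at x) x
    [set w : 'rV[R]_n | `|w - chart_at x x| < r x]); first exact: chart_at_dom.
  by apply/nbhs_normP; exists (r x); [case: (H x)|].
constructor; apply: (@GoodCover _ _ _ (size s) (fun i => chart_at (tnth (in_tuple s) i))
  (fun i => chart_at (tnth (in_tuple s) i) (tnth (in_tuple s) i))
  (fun i => r (tnth (in_tuple s) i))) => [i|i|i|x].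
- exact: chart_at_atlas.
- by case: (H (tnth (in_tuple s) i)).
- by case: (H (tnth (in_tuple s) i)).
- have [y yD fx] := cD x I.
  have /tnthP[i yi] : y \in in_tuple s by [].
  by exists i; rewrite -yi.
Qed.

Section Distance.
Variables (R : realType) (n : nat) (M : closed_manifold R n) (G : good_cover M).
Local Notation c := (@gch R n M G).
Local Notation z := (@gcz R n M G).
Local Notation rho := (@gcr R n M G).

(** Base points are chosen in a [core]; perturbations of a uniform size then remain in the [wide]
    domain of the same chart. *)
Definition core i : set M := [set x | cdom (c i) x /\ `|c i x - z i| < rho i].
Definition wide i : set M := [set x | cdom (c i) x /\ `|c i x - z i| <= 2 * rho i].

Lemma core_wide i x : core i x -> wide i x.
Proof.
move=> [dx h]; split=> //; apply/ltW/(lt_trans h).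
by rewrite ltr_pMl ?gcr_gt0 // ltr1n.
Qed.

Lemma wide_dom i x : wide i x -> cdom (c i) x. Proof. by case. Qed.

Definition bump i (x : M) : R :=
  if pselect (cdom (c i) x) then cutoff (z i) (rho i) (c i x) else 0.

(** The factor [bump i x] removes the arbitrary value that the total function [c i] takes outside
    its chart domain. *)
Definition bumped i (x : M) : 'rV[R]_n := bump i x *: (c i x - z i).

(* The distance induced by the embedding of M given by cutoff functions and
   cut-off charts of a finite atlas; M is only assumed to be a compact
   Hausdorff space, so no metric comes with it. *)
Definition mdist (x y : M) : R :=
  \sum_i (`|bump i x - bump i y| + `|bumped i x - bumped i y|).

Lemma mdist_ge0 x y : 0 <= mdist x y.
Proof. by apply: sumr_ge0 => i _; rewrite addr_ge0. Qed.

Lemma mdistxx x : mdist x x = 0.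
Proof. by rewrite /mdist big1 // => i _; rewrite !subrr !normr0 addr0. Qed.

Lemma mdistC x y : mdist x y = mdist y x.
Proof.
by apply: eq_bigr => i _; rewrite (distrC (bump i x)) (distrC (bumped i x)).
Qed.

Lemma mdist_triangle y x w : mdist x w <= mdist x y + mdist y w.
Proof.
rewrite /mdist -big_split /=; apply: ler_sum => i _.
rewrite addrACA; apply: lerD; first by rewrite -(subrKA (bump i y)) ler_normD.
by rewrite -(subrKA (bumped i y)) ler_normD.
Qed.

Lemma bump_le i x y : `|bump i x - bump i y| <= mdist x y.
Proof.
by rewrite /mdist (bigD1 i) //= -addrA lerDl addr_ge0 // sumr_ge0.
Qed.

Lemma bumped_le i x y : `|bumped i x - bumped i y| <= mdist x y.
Proof.
by rewrite /mdist (bigD1 i) //= addrAC lerDr addr_ge0 // sumr_ge0.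
Qed.

Lemma bump_wide i x : wide i x -> bump i x = 1.
Proof.
move=> [dx h]; rewrite /bump; case: pselect => //= _; rewrite /cutoff.
have : `|c i x - z i| / rho i <= 2 by rewrite ler_pdivrMr ?gcr_gt0.
by move=> h2; rewrite min_l ?max_r //; lra.
Qed.

Lemma wide_chart_dist i x y : wide i x -> wide i y -> `|c i x - c i y| <= mdist x y.
Proof.
move=> wx wy; apply: le_trans (bumped_le i x y).
by rewrite /bumped !bump_wide // !scale1r opprB addrA subrK.
Qed.

(** A distance below 1/4 keeps [bump i y] above 3/4. So [y] is in the chart domain, outside which
    [bump] is 0, and [bumped] bounds its distance to the center by 5/4 divided by 3/4, that is 5/3
    radii. *)
Lemma core_near_wide : exists2 d, 0 < d & forall i x y, core i x -> mdist x y < d ->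
  wide i y.
Proof.
have [|d0 d00 H] := @fin_lower_pos R _ rho; first exact: gcr_gt0.
exists (Num.min (1 / 4) (d0 / 4)); first by rewrite lt_min !divr_gt0.
move=> i x y cx; rewrite lt_min => /andP[h1 h2].
have b1 := bump_wide (core_wide cx).
have h3 := le_lt_trans (bump_le i x y) h1.
have h4 := le_lt_trans (bumped_le i x y) h2.
have dy : cdom (c i) y.
  move: h3; rewrite b1 /bump; case: pselect => //= _.
  by rewrite subr0 normr1; lra.
split=> //; have b34 : 3 / 4 < bump i y.
  by move: h3; rewrite b1 ltr_norml => /andP[_]; lra.
have hy : `|bumped i y| < rho i + rho i / 4.
  have hr := H i; rewrite -[bumped i y](subrK (bumped i x)).
  apply: le_lt_trans (ler_normD _ _) _; rewrite addrC; apply: ltrD.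
    by rewrite /bumped b1 scale1r; case: cx.
  by rewrite distrC; apply: lt_le_trans h4 _; lra.
move: hy; rewrite /bumped normrZ ger0_norm; last by lra.
have := gcr_gt0 i; have := normr_ge0 (c i y - z i); nra.
Qed.

Lemma mdist_eq0 x y : mdist x y = 0 -> x = y.
Proof.
move=> d0; have [d dpos H] := core_near_wide.
have [i cx] := gc_cover G x.
have wy : wide i y by apply: H cx _; rewrite d0.
have := wide_chart_dist (core_wide cx) wy; rewrite d0 normr_le0 subr_eq0 => /eqP e.
by rewrite -(cmapK (wide_dom (core_wide cx))) e cmapK //; exact: wide_dom wy.
Qed.

Definition cinv_ball i := cinv (c i) @` cball (z i) (3 * rho i).

Lemma cinv_ball_closed i : closed (cinv_ball i).
Proof.
apply: compact_closed; first exact: mhausdorff.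
apply: continuous_compact; last exact: cball_compact.
apply: continuous_in_subspaceT => y /set_mem By.
by apply: cinv_continuous; exact: gc_ball By.
Qed.

Lemma bump_out i x : ~ cinv_ball i x -> bump i x = 0.
Proof.
move=> nx; rewrite /bump; case: pselect => // dx.
rewrite /cutoff max_l //; rewrite ge_min; apply/orP; right.
rewrite subr_le0 ler_pdivlMr ?gcr_gt0 //; apply/ltW; rewrite ltNge; apply/negP => h.
by apply: nx; exists (c i x) => //; rewrite cmapK.
Qed.

Lemma trans_smooth i k : smooth_on (c i @` (cdom (c i) `&` cdom (c k)))
   (c k \o cinv (c i)).
Proof. by apply: atlas_compat; exact: gch_atlas. Qed.

(** Outside chart [k], [bump k] vanishes in a neighborhood, because it lives on the closed set
    [cinv_ball k] inside the chart domain. Inside chart [k], the transition map is locally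
    Lipschitz, and so are its products with the cutoff. *)
Lemma bumps_loc_lip i k (y : 'rV[R]_n) : cball (z i) (2 * rho i) y ->
  exists r C : R, [/\ 0 < r, 0 <= C & forall p, `|p - y| < r ->
   forall q, `|q - y| < r ->
   `|bump k (cinv (c i) p) - bump k (cinv (c i) q)| +
   `|bumped k (cinv (c i) p) - bumped k (cinv (c i) q)| <= C * `|p - q|].
Proof.
move=> By.
have iy : cimg (c i) y.
  apply: gc_ball; apply: le_trans By _.
  by rewrite ler_pM2r ?gcr_gt0 // ler_nat.
set x := cinv (c i) y.
have xy : c i x = y by exact: cinvK.
have dx : cdom (c i) x by exact: cinv_dom.
case: (pselect (cdom (c k) x)) => [dk|ndk]; last first.
  have : nbhs x (~` cinv_ball k).
    apply: open_nbhs_nbhs; split; first exact/closed_openC/cinv_ball_closed.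
    case=> w /gc_ball cw wx; apply: ndk; rewrite -wx; exact: cinv_dom.
  move=> /(chart_img_nbhs dx); rewrite xy => /nbhs_normP[r r0 Hr].
  exists r, 0; split=> // p py q qy; have [_ /bump_out p0] := Hr _ py.
  have [_ /bump_out q0] := Hr _ qy.
  by rewrite /bumped p0 q0 !scale0r !subrr !normr0 addr0 mul0r.
have oA := @chart_sub_open R n M (c i) (cdom (c k)) (@cdom_open _ _ _ _).
have Ay : (c i @` (cdom (c i) `&` cdom (c k))) y by exists x.
have [r [C [r0 C0 H]]] := smooth_loc_lip (@trans_smooth i k) oA Ay.
pose g := c k \o cinv (c i); rewrite -/g in H.
pose B := `|g y - z k| + C * r.
have B0 : 0 <= B by rewrite addr_ge0 // mulr_ge0 // ltW.
have rk := gcr_gt0 k.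
exists r, (((rho k)^-1 + 1 + (rho k)^-1 * B) * C); split=> //.
  by rewrite !(mulr_ge0,addr_ge0) // ?invr_ge0 ltW.
move=> p py q qy; have [Ap pq] := H p q py qy; have [Aq _] := H q p qy py.
have E w : (c i @` (cdom (c i) `&` cdom (c k))) w ->
    bump k (cinv (c i) w) = cutoff (z k) (rho k) (g w).
  by case=> u [du dku] <-; rewrite /g /= cmapK // /bump; case: pselect.
rewrite /bumped !E // -[c k (cinv (c i) p)]/(g p) -[c k (cinv (c i) q)]/(g q).
have h1 := cutoff_lip (z k) (g p) (g q) rk.
set bp := cutoff _ _ (g p) in h1 *; set bq := cutoff _ _ (g q) in h1 *.
have gq : `|g q - z k| <= B.
  rewrite -(subrKA (g y)) addrC; apply: le_trans (ler_normD _ _) _.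
  rewrite lerD2l; have yy : `|y - y| < r by rewrite subrr normr0.
  have [_ /le_trans->//] := H q y qy yy.
  by rewrite ler_wpM2l // ltW.
have -> : bp *: (g p - z k) - bq *: (g q - z k) =
    bp *: (g p - g q) + (bp - bq) *: (g q - z k).
  by apply/rowP => j; rewrite !mxE; ring.
have h2 : `|bp *: (g p - g q)| <= `|g p - g q|.
  by rewrite normrZ ger0_norm ?cutoff_ge0 // ler_piMl // cutoff_le1.
have h3 : `|(bp - bq) *: (g q - z k)| <= (rho k)^-1 * `|g p - g q| * B.
  by rewrite normrZ ler_pM.
have h4 := ler_normD (bp *: (g p - g q)) ((bp - bq) *: (g q - z k)).
apply: (@le_trans _ _ (((rho k)^-1 + 1 + (rho k)^-1 * B) * `|g p - g q|)); first by lra.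
rewrite -mulrA ler_wpM2l // !addr_ge0 // ?mulr_ge0 // ?invr_ge0; exact: ltW.
Qed.

(** With [wide_chart_dist], this makes [mdist] and the coordinate norm equivalent on wide domains.
    Local Lipschitz constants settle pairs closer than some [r]; for the other pairs the bound [b]
    on the cut-off functions is enough. *)
Lemma mdist_chart_upper : exists2 K, 0 < K & forall i x y, wide i x -> wide i y ->
  mdist x y <= K * `|c i x - c i y|.
Proof.
have /choice[K HK] : forall ik : 'I_(gcN G) * 'I_(gcN G), exists K, 0 < K /\ forall p q,
   cball (z ik.1) (2 * rho ik.1) p -> cball (z ik.1) (2 * rho ik.1) q ->
   `|bump ik.2 (cinv (c ik.1) p) - bump ik.2 (cinv (c ik.1) q)| +
   `|bumped ik.2 (cinv (c ik.1) p) - bumped ik.2 (cinv (c ik.1) q)| <= K * `|p - q|.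
  move=> [i k] /=.
  pose h p q := `|bump k (cinv (c i) p) - bump k (cinv (c i) q)| +
     `|bumped k (cinv (c i) p) - bumped k (cinv (c i) q)|.
  have [r r0 H] : exists2 r, 0 < r & forall p, cball (z i) (2 * rho i) p ->
      forall q, `|q - p| < r -> h p q <= r^-1 * `|p - q|.
    apply: compact_uniform; first exact: cball_compact.
      move=> r r' p r'0 rr' H q qp; apply: le_trans (H _ (lt_le_trans qp rr')) _.
      by rewrite ler_wpM2r // lef_pV2 // posrE // (lt_le_trans r'0).
    move=> y /bumps_loc_lip -/(_ k)[r [C [r0 C0 H]]].
    exists (Num.min (r / 2) (C + 1)^-1).
      by rewrite lt_min divr_gt0 //= invr_gt0 ltr_wpDl.
    apply/nbhs_normP; exists (r / 2); first by rewrite divr_gt0.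
    move=> p py q; rewrite lt_min => /andP[qp _].
    apply: le_trans (H p _ q _) _.
    - by apply: lt_trans py _; lra.
    - rewrite -(subrKA p); apply: le_lt_trans (ler_normD _ _) _; lra.
    - rewrite ler_wpM2r //; apply: (@le_trans _ _ (C + 1)); first by lra.
      rewrite -[leLHS]invrK lef_pV2 ?posrE ?invr_gt0 ?ltr_wpDl ?lt_min ?divr_gt0 //=.
        by rewrite ge_min lexx orbT.
      by rewrite invr_gt0 ltr_wpDl.
  pose b := 2 + 2 * (3 * rho k).
  have rk := gcr_gt0 k.
  have hb p q : h p q <= b.
    have b1 x : `|bump k x| <= 1.
      rewrite /bump; case: pselect => /= _; last by rewrite normr0.
      by rewrite ger0_norm ?cutoff_ge0 // cutoff_le1.
    have b2 x : `|bumped k x| <= 3 * rho k.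
      case: (pselect (cinv_ball k x)) => [[w Bw wx]|/bump_out].
        rewrite /bumped normrZ -wx cinvK; last exact: gc_ball.
        apply: le_trans _ (Bw : `|w - z k| <= _).
        by rewrite ler_piMl.
      by rewrite /bumped => ->; rewrite scale0r normr0 mulr_ge0 // ltW.
    rewrite /b mulr2n [2 * _]mulrDl mul1r; apply: lerD; apply: le_trans (ler_normB _ _) _.
      exact: lerD.
    exact: lerD.
  exists (r^-1 * (1 + b)); split.
    by rewrite mulr_gt0 ?invr_gt0 // /b; lra.
  move=> p q Bp Bq; have [pq|pq] := ltP `|q - p| r.
    apply: le_trans (H _ Bp _ pq) _; rewrite -mulrA ler_wpM2l ?invr_ge0 ?(ltW r0) //.
    by rewrite ler_peMl // /b; lra.
  apply: le_trans (hb p q) _.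
  have h1 : 1 <= r^-1 * `|p - q| by rewrite mulrC ler_pdivlMr // mul1r distrC.
  have b0 : 0 <= b by rewrite /b; lra.
  rewrite mulrAC; apply: (@le_trans _ _ (1 * (1 + b))); first by rewrite mul1r lerDr.
  by rewrite ler_wpM2r // addr_ge0.
have [K' K1 HK'] := @fin_upper R _ K.
exists (\sum_(k < gcN G) K' + 1).
  by rewrite ltr_wpDl // sumr_ge0 // => j _; exact: le_trans ler01 K1.
move=> i x y [dx wx] [dy wy]; rewrite mulrDl mulr_suml.
apply: ler_wpDr; first by rewrite mul1r.
apply: ler_sum => k _.
have [K0 /(_ (c i x) (c i y) wx wy)] := HK (i, k); rewrite /= !cmapK //.
by move/le_trans; apply; rewrite ler_wpM2r.
Qed.

Lemma mdist_nbhsP x (U : set M) :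
  nbhs x U <-> exists2 e, 0 < e & forall y, mdist x y < e -> U y.
Proof.
have [d d0 Hd] := core_near_wide; have [K K0 HK] := mdist_chart_upper.
have [i cx] := gc_cover G x; have wx := core_wide cx; have dx := wide_dom wx.
split=> [nU|[e e0 He]].
  have /nbhs_normP[r r0 Hr] := chart_img_nbhs dx nU.
  exists (Num.min d r); first by rewrite lt_min d0.
  move=> y; rewrite lt_min => /andP[yd yr]; have wy := Hd _ _ _ cx yd.
  have [_] : cimg (c i) (c i y) /\ U (cinv (c i) (c i y)).
    by apply: Hr; rewrite distrC; apply: le_lt_trans yr; exact: wide_chart_dist.
  by rewrite cmapK //; exact: wide_dom wy.
apply: filterS (chart_preim_nbhs (B := [set w : 'rV[R]_n | `|w - c i x| <
  Num.min (rho i - `|c i x - z i|) (e / K)]) dx _); last first.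
  apply/nbhs_normP; exists (Num.min (rho i - `|c i x - z i|) (e / K)) => //.
  by rewrite lt_min subr_gt0 divr_gt0 // andbT; case: cx.
move=> y [dy]; rewrite /= lt_min => /andP[h1 h2]; apply: He.
have wy : wide i y.
  apply: core_wide; split=> //; rewrite -(subrKA (c i x)).
  by apply: le_lt_trans (ler_normD _ _) _; rewrite -ltrBrDr.
apply: le_lt_trans (HK _ _ _ wx wy) _.
by rewrite mulrC -ltr_pdivlMr // distrC.
Qed.

End Distance.

(** * Weighted shadowing for sequences of nearly linear maps *)

(* Needed for the completeNormedModType structure on matrices. *)
HB.instance Definition _ (R : realType) m n := Complete.on 'M[R]_(m, n).

Lemma banach_ball (R : realType) (V : completeNormedModType R) (T : V -> V) (r : R) :
  0 <= r -> `|T 0| <= r / 2 ->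
  (forall x y, `|x| <= r -> `|y| <= r -> `|T x - T y| <= `|x - y| / 2) ->
  exists2 x, `|x| <= r & T x = x.
Proof.
move=> r0 T0 HT.
pose U : set V := [set x | `|x| <= r].
have TU : {homo T : x / U x >-> U x}.
  move=> x Ux; rewrite /U /= -[T x](subrK (T 0)) (le_trans (ler_normD _ _)) //.
  rewrite [leRHS]splitr lerD //; apply: le_trans (HT _ _ Ux _) _.
    by rewrite normr0.
  by rewrite subr0 ler_pM2r.
have [|||x Ux Tx] := @banach_fixed_point _ _ U (mkfun TU).
- exists (2^-1)%:nng; split; first by rewrite /= invf_lt1 // ltr1n.
  move=> [x y] /= [Ux Uy]; rewrite mulrC; exact: HT.
- have -> : U = closed_ball_ Num.norm (0 : V) r.
    by apply/funext => x; rewrite /closed_ball_ /U /= sub0r normrN.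
  exact: closed_closed_ball_.
- by exists 0; rewrite /U /= normr0.
- by exists x.
Qed.

Section Shadowing.
Variables (R : realType) (n N : nat).
Local Notation I := 'I_N.+1.
Local Notation nx := (@ordS N.+1).
Local Notation pv := (@ord_pred N.+1).
Local Notation V := 'rV[R]_n.

Definition rdot (v : V) (l : 'cV[R]_n) : R := (v *m l) 0 0.

Lemma rdotD v w l : rdot (v + w) l = rdot v l + rdot w l.
Proof. by rewrite /rdot mulmxDl mxE. Qed.
Lemma rdotB v w l : rdot (v - w) l = rdot v l - rdot w l.
Proof. by rewrite /rdot mulmxBl !mxE. Qed.
Lemma rdotZ a v l : rdot (a *: v) l = a * rdot v l.
Proof. by rewrite /rdot -scalemxAl mxE. Qed.
Lemma rdot_mul v l (X : V) : v *m (l *m X) = rdot v l *: X.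
Proof. by rewrite mulmxA [v *m l]mx11_scalar mul_scalar_mx. Qed.

Lemma newton_diff (p p' q q' f f' : V) (A : 'M[R]_n) :
  p + (q - f) *m A - (p' + (q' - f') *m A) = p - p' + (q - q' - (f - f')) *m A.
Proof.
rewrite !mulmxBl; move: (q *m A) (q' *m A) (f *m A) (f' *m A) => a b c d.
by apply/rowP => j; rewrite !mxE; ring.
Qed.

Lemma newton_cancel (p q e x : V) (A A' : 'M[R]_n) : A *m A' = 1%:M ->
  p + (q - (e + p *m A + x)) *m A' = (q - e - x) *m A'.
Proof.
move=> AA'; rewrite !(mulmxBl, mulmxDl) -(mulmxA p) AA' mulmx1.
move: (q *m A') (e *m A') (x *m A') => a b c.
by apply/rowP => j; rewrite !mxE; ring.
Qed.

(* Indices are cyclic, so that [brk] empty gives periodic pseudo-orbits; a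
   finite segment is encoded by one index [k] with [brk k], where no condition
   links [k] to its successor. [Ps], [Pu] and [l *m X] are the projections onto
   the stable, unstable and flow directions. Along the flow direction the
   error is absorbed by the time [t]. *)
Variables (brk : pred I) (w : I -> R) (F : I -> V -> R -> V)
  (D E Ps Pu Qs Qu : I -> 'M[R]_n) (l : I -> 'cV[R]_n) (X : I -> V)
  (a eta b0 B r : R).
Hypotheses (b01 : 1 <= b0) (b0B : b0 <= B) (a0 : 0 <= a) (aB : 24 * b0 * a <= 1)
  (eta0 : 0 <= eta) (etaB : 84 * B ^+ 4 * eta <= 1).
Hypotheses (w0 : forall k, 0 < w k) (w1 : forall k, w k <= 1)
  (wnx : forall k, w (nx k) <= 2 * w k) (wpv : forall k, w k <= 2 * w (nx k)).
Hypotheses (DE : forall k, ~~ brk k -> D k *m E k = 1%:M) (ED : forall k, ~~ brk k -> E k *m D k = 1%:M).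
Hypotheses (P1 : forall k, Ps k + Pu k + l k *m X k = 1%:M)
  (Pss : forall k, Ps k *m Ps k = Ps k) (Puu : forall k, Pu k *m Pu k = Pu k)
  (Psu : forall k, Ps k *m Pu k = 0) (Pus : forall k, Pu k *m Ps k = 0)
  (XPs : forall k, X k *m Ps k = 0) (XPu : forall k, X k *m Pu k = 0)
  (Psl : forall k, Ps k *m l k = 0) (Pul : forall k, Pu k *m l k = 0)
  (Xl : forall k, rdot (X k) (l k) = 1).
(** [Qs k] and [Qu k] stand for the projections at the image point. They are only close to the
    projections at the next index, since a pseudo-orbit jumps in between. *)
Hypotheses (PsD : forall k, ~~ brk k -> Ps k *m D k = D k *m Qs k)
  (PuD : forall k, ~~ brk k -> Pu k *m D k = D k *m Qu k)
  (Qs_near : forall k (v : V), ~~ brk k -> `|v *m Qs k - v *m Ps (nx k)| <= eta * `|v|)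
  (Qu_near : forall k (v : V), ~~ brk k -> `|v *m Qu k - v *m Pu (nx k)| <= eta * `|v|)
  (contr_s : forall k (v : V), ~~ brk k -> `|v *m Ps k *m D k| <= a * `|v|)
  (contr_u : forall k (v : V), ~~ brk k -> `|v *m Qu k *m E k| <= a * `|v|).
Hypotheses (PsB0 : forall k (v : V), `|v *m Ps k| <= b0 * `|v|)
  (PuB0 : forall k (v : V), `|v *m Pu k| <= b0 * `|v|)
  (lB : forall k (v : V), `|rdot v (l k)| <= B * `|v|)
  (XB : forall k, `|X k| <= B)
  (DB : forall k (v : V), ~~ brk k -> `|v *m D k| <= B * `|v|)
  (EB : forall k (v : V), ~~ brk k -> `|v *m E k| <= B * `|v|).
Hypothesis FE : forall k (z z' : V) (t t' : R), ~~ brk k ->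
  `|z| <= r -> `|z'| <= r -> `|t| <= r -> `|t'| <= r ->
  `|F k z t - F k z' t' - ((z - z') *m D k + (t - t') *: X (nx k))|
    <= eta * (`|z - z'| + `|t - t'|).

(** One unknown vector per index encodes two things: its stable and unstable parts are the
    displacement, its coefficient along the flow is the correction of time. *)
Let zs k (v : V) := v *m (Ps k + Pu k).
Let ts k (v : V) := rdot v (l k).

Let B1 : 1 <= B. Proof. exact: le_trans b01 b0B. Qed.

Let PsB k (v : V) : `|v *m Ps k| <= B * `|v|.
Proof. by apply: le_trans (PsB0 k v) _; rewrite ler_wpM2r. Qed.

Let PuB k (v : V) : `|v *m Pu k| <= B * `|v|.
Proof. by apply: le_trans (PuB0 k v) _; rewrite ler_wpM2r. Qed.

Let zsB0 k v : `|zs k v| <= 2 * b0 * `|v|.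
Proof.
rewrite /zs mulmxDr (le_trans (ler_normD _ _)) //.
by have := PsB0 k v; have := PuB0 k v; lra.
Qed.

Let zsB k v : `|zs k v| <= 2 * B * `|v|.
Proof. by apply: le_trans (zsB0 k v) _; rewrite ler_wpM2r // ler_wpM2l. Qed.

Let zsS k v : zs k v *m Ps k = v *m Ps k.
Proof. by rewrite /zs -mulmxA mulmxDl Pss Pus addr0. Qed.

Let zsU k v : zs k v *m Pu k = v *m Pu k.
Proof. by rewrite /zs -mulmxA mulmxDl Psu Puu add0r. Qed.

Let zsK k v : zs k (zs k v) = zs k v.
Proof. by rewrite {1}/zs mulmxDr zsS zsU -mulmxDr. Qed.

Let zsl k v : rdot (zs k v) (l k) = 0.
Proof. by rewrite /rdot /zs -mulmxA mulmxDl Psl Pul addr0 mulmx0 mxE. Qed.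

Let zsD k v : ~~ brk k -> zs k v *m D k = v *m D k *m (Qs k + Qu k).
Proof. by move=> nb; rewrite /zs -!mulmxA mulmxDl PsD // PuD // -mulmxDr. Qed.

Let EPu k : ~~ brk k -> E k *m Pu k = Qu k *m E k.
Proof.
move=> nb; rewrite -[E k *m Pu k]mulmx1 -(DE nb) -mulmxA (mulmxA (Pu k)) PuD //.
by rewrite !mulmxA ED // mul1mx.
Qed.

Let Fk k v := F k (zs k v) (ts k v).

(* The three components of the fixed point equation: the stable one is solved
   forwards, the unstable one backwards through [E], and the central one, which
   neither contracts nor expands, by adjusting the time. *)
Let stepS k v : V := if brk k then 0 else Fk k v *m Ps (nx k).
Let stepU k v v' : V :=
  if brk k then 0 else (zs k v + (zs (nx k) v' - Fk k v) *m E k) *m Pu k.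
Let stepC k v : V :=
  if brk k then 0 else (ts k v - rdot (Fk k v) (l (nx k))) *: X k.

Let dF k v v' := Fk k v - Fk k v' - (zs k (v - v') *m D k + ts k (v - v') *: X (nx k)).

Let dF_le k v v' b : ~~ brk k -> 2 * B * `|v| <= r -> 2 * B * `|v'| <= r ->
  `|v - v'| <= b -> `|dF k v v'| <= 3 * B * eta * b.
Proof.
move=> nb vr v'r vv'; have hB := B1.
have tr u : 2 * B * `|u| <= r -> `|ts k u| <= r.
  move=> h; apply: le_trans h; apply: le_trans (lB _ _) _.
  rewrite ler_wpM2r //.
  lra.
have zr u : 2 * B * `|u| <= r -> `|zs k u| <= r by apply: le_trans.
have zB : zs k (v - v') = zs k v - zs k v' by rewrite /zs mulmxBl.
have tB : ts k (v - v') = ts k v - ts k v' by rewrite /ts rdotB.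
rewrite /dF zB tB; apply: le_trans (FE nb (zr _ vr) (zr _ v'r) (tr _ vr) (tr _ v'r)) _.
rewrite -zB -tB; apply: (@le_trans _ _ (eta * (3 * B * b))); last by rewrite mulrCA !mulrA.
rewrite ler_wpM2l //; have := zsB k (v - v'); have := lB k (v - v').
rewrite -/(ts k _); have := ler_pM (le_trans ler01 B1) (normr_ge0 _) (lexx B) vv'; lra.
Qed.

Let dF_eq k v v' e : dF k v v' = e ->
  Fk k v - Fk k v' = e + zs k (v - v') *m D k + ts k (v - v') *: X (nx k).
Proof. by move=> <-; rewrite /dF -addrA subrK. Qed.

Let stepS_lip k v v' b : 2 * B * `|v| <= r -> 2 * B * `|v'| <= r ->
  `|v - v'| <= b -> `|stepS k v - stepS k v'| <= (a + 5 * B ^+ 2 * eta) * b.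
Proof.
move=> vr v'r vv'; have bb : 0 <= b := le_trans (normr_ge0 _) vv'.
have hB := B1; have B0 : 0 <= B := le_trans ler01 B1.
rewrite /stepS; case: ifPn => nb.
  by rewrite subrr normr0 mulr_ge0 // addr_ge0 // !mulr_ge0 // exprn_ge0.
move: (dF_le nb vr v'r vv'); move dE : (dF k v v') => e h.
rewrite -mulmxBl (dF_eq dE).
rewrite !mulmxDl -scalemxAl XPs scaler0 addr0.
have -> : zs k (v - v') *m D k *m Ps (nx k) =
  (v - v') *m Ps k *m D k - (zs k (v - v') *m D k *m Qs k -
    zs k (v - v') *m D k *m Ps (nx k)).
  by rewrite -(mulmxA (zs _ _) _ (Qs k)) -PsD // mulmxA zsS opprB addrCA subrr addr0.
have h1 := contr_s (v - v') nb.
have h2 := Qs_near (zs k (v - v') *m D k) nb.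
have h3 := DB (zs k (v - v')) nb.
have h4 := zsB k (v - v').
have h5 := PsB (nx k) e.
set x1 := _ *m Ps k *m D k in h1 *; set x2 := _ - _ *m Ps (nx k) in h2 *.
set x3 := e *m _ in h5 *.
apply: (@le_trans _ _ (`|x3| + (`|x1| + `|x2|))).
  by apply: le_trans (ler_normD _ _) _; rewrite lerD2l ler_normB.
have g1 : `|x1| <= a * b by apply: le_trans h1 _; rewrite ler_wpM2l.
have g3 : `|x3| <= 3 * B ^+ 2 * eta * b.
  apply: le_trans h5 _; apply: (@le_trans _ _ (B * (3 * B * eta * b))).
    by rewrite ler_wpM2l.
  by rewrite le_eqVlt; apply/orP; left; apply/eqP; ring.
have g2 : `|x2| <= 2 * B ^+ 2 * eta * b.
  apply: le_trans h2 _; apply: (@le_trans _ _ (eta * (B * (2 * B * b)))).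
    rewrite ler_wpM2l // (le_trans h3) // ler_wpM2l // (le_trans h4) //.
    by rewrite ler_wpM2l // mulr_ge0.
  by rewrite le_eqVlt; apply/orP; left; apply/eqP; ring.
lra.
Qed.

(** The linear part of [Fk] cancels against [zs k v]. What remains is the next unknown, contracted
    by [Qu k] and [E k], the nonlinear remainder, and a flow term that is small because [Qu k] is
    near [Pu (nx k)], which kills [X (nx k)]. The bound [2 * b] on [u - u'] anticipates that
    neighboring weights differ by a factor of at most 2. *)
Let stepU_lip k v v' u u' b : 2 * B * `|v| <= r -> 2 * B * `|v'| <= r ->
  `|v - v'| <= b -> `|u - u'| <= 2 * b ->
  `|stepU k v u - stepU k v' u'| <= (4 * b0 * a + 4 * B ^+ 3 * eta) * b.
Proof.
move=> vr v'r vv' uu'; have bb : 0 <= b := le_trans (normr_ge0 _) vv'.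
have hB := B1; have B0 : 0 <= B := le_trans ler01 B1; have he := eta0; have ha := a0.
rewrite /stepU; case: ifPn => nb.
  by rewrite subrr normr0 mulr_ge0 // addr_ge0 // !mulr_ge0 ?exprn_ge0 //; exact: le_trans ler01 b01.
move: (dF_le nb vr v'r vv'); move dE : (dF k v v') => e h.
rewrite -mulmxBl.
have -> : zs k v + (zs (nx k) u - Fk k v) *m E k - (zs k v' + (zs (nx k) u' - Fk k v') *m E k)
   = (zs (nx k) (u - u') - e - ts k (v - v') *: X (nx k)) *m E k.
  have -> : zs k v + (zs (nx k) u - Fk k v) *m E k - (zs k v' + (zs (nx k) u' - Fk k v') *m E k)
   = (zs k v - zs k v') + (zs (nx k) u - zs (nx k) u' - (Fk k v - Fk k v')) *m E k.
    exact: newton_diff.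
  have zB j (p q : V) : zs j p - zs j q = zs j (p - q) by rewrite /zs mulmxBl.
  by rewrite (dF_eq dE) !zB; exact/newton_cancel/DE.
rewrite -mulmxA EPu // mulmxA !mulmxBl -scalemxAl.
have g1 : `|zs (nx k) (u - u') *m Qu k *m E k| <= 4 * b0 * a * b.
  apply: le_trans (contr_u _ nb) _; apply: (@le_trans _ _ (a * (2 * b0 * (2 * b)))).
    rewrite ler_wpM2l // (le_trans (zsB0 _ _)) // ler_wpM2l // mulr_ge0 //.
    exact: le_trans ler01 b01.
  by rewrite le_eqVlt; apply/orP; left; apply/eqP; ring.
have g2 : `|e *m Qu k *m E k| <= 3 * B ^+ 3 * eta * b.
  rewrite -mulmxA -EPu // mulmxA; apply: le_trans (PuB _ _) _.
  apply: (@le_trans _ _ (B * (B * (3 * B * eta * b)))).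
    by rewrite ler_wpM2l // (le_trans (EB _ nb)) // ler_wpM2l.
  by rewrite le_eqVlt; apply/orP; left; apply/eqP; ring.
have g3 : `|ts k (v - v') *: X (nx k) *m Qu k *m E k| <= B ^+ 3 * eta * b.
  rewrite -!scalemxAl normrZ; apply: (@le_trans _ _ ((B * b) * (B * (eta * B)))).
    apply: ler_pM => //; first by apply: le_trans (lB _ _) _; rewrite ler_wpM2l.
    apply: le_trans (EB _ nb) _; rewrite ler_wpM2l //.
    have := Qu_near (X (nx k)) nb; rewrite XPu subr0 => /le_trans; apply.
    by rewrite ler_wpM2l.
  by rewrite le_eqVlt; apply/orP; left; apply/eqP; ring.
apply: le_trans (ler_normB _ _) _; apply: le_trans (lerD (ler_normB _ _) (lexx _)) _.
move: g1 g2 g3; rewrite -!scalemxAl; lra.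
Qed.

(** The time terms cancel exactly, since [l (nx k)] takes the value 1 on [X (nx k)]. The image of
    the stable and unstable part is almost killed by [l (nx k)], because [Qs k] and [Qu k] are near
    projections that [l (nx k)] annihilates. *)
Let stepC_lip k v v' b : 2 * B * `|v| <= r -> 2 * B * `|v'| <= r ->
  `|v - v'| <= b -> `|stepC k v - stepC k v'| <= 7 * B ^+ 4 * eta * b.
Proof.
move=> vr v'r vv'; have bb : 0 <= b := le_trans (normr_ge0 _) vv'.
have hB := B1; have B0 : 0 <= B := le_trans ler01 B1; have he := eta0.
rewrite /stepC; case: ifPn => nb.
  by rewrite subrr normr0 mulr_ge0 // !mulr_ge0 // exprn_ge0.
move: (dF_le nb vr v'r vv'); move dE : (dF k v v') => e h.
rewrite -scalerBl normrZ.
have -> : ts k v - rdot (Fk k v) (l (nx k)) - (ts k v' - rdot (Fk k v') (l (nx k))) =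
   - (rdot e (l (nx k)) + rdot (zs k (v - v') *m D k) (l (nx k))).
  have tB : ts k (v - v') = ts k v - ts k v' by rewrite /ts rdotB.
  have -> : forall x y p q : R, x - p - (y - q) = (x - y) - (p - q) by move=> *; ring.
  rewrite -rdotB (dF_eq dE) -tB !rdotD rdotZ Xl mulr1; ring.
rewrite normrN.
set x := zs k (v - v') *m D k.
have hx : `|x| <= 2 * B ^+ 2 * b.
  apply: le_trans (DB _ nb) _; apply: (@le_trans _ _ (B * (2 * B * b))).
    by rewrite ler_wpM2l // (le_trans (zsB _ _)) // ler_wpM2l // mulr_ge0.
  by rewrite le_eqVlt; apply/orP; left; apply/eqP; ring.
have xE : x = x *m Qs k + x *m Qu k by rewrite -mulmxDr /x -zsD // zsK.
have P'l (v1 : V) : rdot (v1 *m Ps (nx k)) (l (nx k)) = 0.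
  by rewrite /rdot -mulmxA Psl mulmx0 mxE.
have P'u (v1 : V) : rdot (v1 *m Pu (nx k)) (l (nx k)) = 0.
  by rewrite /rdot -mulmxA Pul mulmx0 mxE.
have dx : `|rdot x (l (nx k))| <= 4 * B ^+ 3 * eta * b.
  have -> : rdot x (l (nx k)) = rdot (x *m Qs k - x *m Ps (nx k)) (l (nx k)) +
      rdot (x *m Qu k - x *m Pu (nx k)) (l (nx k)).
    by rewrite !rdotB P'l P'u !subr0 -rdotD -xE.
  apply: (@le_trans _ _ (B * (eta * (2 * B ^+ 2 * b)) + B * (eta * (2 * B ^+ 2 * b)))).
    apply: le_trans (ler_normD _ _) _.
    apply: lerD; apply: le_trans (lB _ _) _; rewrite ler_wpM2l //.
      by apply: le_trans (Qs_near _ nb) _; rewrite ler_wpM2l.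
    by apply: le_trans (Qu_near _ nb) _; rewrite ler_wpM2l.
  by rewrite le_eqVlt; apply/orP; left; apply/eqP; ring.
have de : `|rdot e (l (nx k))| <= 3 * B ^+ 2 * eta * b.
  apply: le_trans (lB _ _) _; apply: (@le_trans _ _ (B * (3 * B * eta * b))).
    by rewrite ler_wpM2l.
  by rewrite le_eqVlt; apply/orP; left; apply/eqP; ring.
apply: (@le_trans _ _ ((7 * B ^+ 3 * eta * b) * B)); last first.
  by rewrite le_eqVlt; apply/orP; left; apply/eqP; ring.
apply: ler_pM => //; apply: le_trans (ler_normD _ _) _.
have : B ^+ 2 * (eta * b) <= B ^+ 3 * (eta * b).
  by rewrite ler_wpM2r ?mulr_ge0 // ler_weXn2l.
by move: dx de; rewrite -!mulrA; lra.
Qed.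

Let Fk0 k : Fk k 0 = F k 0 0.
Proof. by rewrite /Fk /zs /ts /rdot !mul0mx mxE. Qed.

(** Row [k] of [xi] is the unknown divided by its weight, so that the maximum norm of matrices
    becomes the weighted norm. *)
Let step k (xi : 'M[R]_(N.+1, n)) : V :=
  stepS (pv k) (w (pv k) *: row (pv k) xi) +
  stepU k (w k *: row k xi) (w (nx k) *: row (nx k) xi) +
  stepC k (w k *: row k xi).

Let wpv' k : w (pv k) <= 2 * w k.
Proof. by have := wpv (pv k); rewrite ord_predK. Qed.

Let step_lip k xi xi' : 2 * B * `|xi| <= r -> 2 * B * `|xi'| <= r ->
  `|step k xi - step k xi'| <= w k * (`|xi - xi'| / 2).
Proof.
move=> xr x'r; have hB := B1; have B0 : 0 <= B := le_trans ler01 B1.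
have he := eta0; have ha := a0; have haB := aB; have heB := etaB.
have dom j (y : 'M[R]_(N.+1, n)) : 2 * B * `|y| <= r -> 2 * B * `|w j *: row j y| <= r.
  move=> h; apply: le_trans h; rewrite ler_wpM2l ?mulr_ge0 // normrZ.
  rewrite gtr0_norm ?w0 // -[leRHS]mul1r.
  by apply: ler_pM => //; [exact: ltW|exact: rv_row_le].
have diff j : `|w j *: row j xi - w j *: row j xi'| <= w j * `|xi - xi'|.
  rewrite -scalerBr -linearB normrZ gtr0_norm ?w0 // ler_wpM2l ?(ltW (w0 _)) //.
  exact: rv_row_le.
set d := `|xi - xi'| in diff *; have d0 : 0 <= d by exact: normr_ge0.
have wd0 : 0 <= w k * d by rewrite mulr_ge0 // ltW.
have h1 := stepS_lip (pv k) (dom (pv k) _ xr) (dom _ _ x'r) (diff (pv k)).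
have h2 : `|stepU k (w k *: row k xi) (w (nx k) *: row (nx k) xi) -
    stepU k (w k *: row k xi') (w (nx k) *: row (nx k) xi')| <=
    (4 * b0 * a + 4 * B ^+ 3 * eta) * (w k * d).
  apply: stepU_lip => //; try exact: dom.
  by apply: le_trans (diff _) _; rewrite mulrA ler_wpM2r.
have h3 := stepC_lip k (dom k _ xr) (dom _ _ x'r) (diff k).
have h1' : (a + 5 * B ^+ 2 * eta) * (w (pv k) * d) <=
   (2 * a + 10 * B ^+ 2 * eta) * (w k * d).
  have -> : (2 * a + 10 * B ^+ 2 * eta) * (w k * d) =
    (a + 5 * B ^+ 2 * eta) * (2 * w k * d) by ring.
  by rewrite ler_wpM2l ?addr_ge0 ?mulr_ge0 ?exprn_ge0 // ler_wpM2r.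
rewrite /step opprD addrACA; apply: le_trans (ler_normD _ _) _.
rewrite opprD addrACA; apply: le_trans (lerD (ler_normD _ _) (lexx _)) _.
(* This sum is where 24 and 84 come from: as [a <= b0 * a] and [1 <= B], it is at most
   [6 * b0 * a + 21 * B ^+ 4 * eta], and each summand is at most 1/4. *)
apply: (@le_trans _ _ ((2 * a + 10 * B ^+ 2 * eta + (4 * b0 * a + 4 * B ^+ 3 * eta)
   + 7 * B ^+ 4 * eta) * (w k * d))); first by rewrite !mulrDl; lra.
have b1 : B ^+ 2 * eta <= B ^+ 4 * eta by rewrite ler_wpM2r // ler_weXn2l.
have b2 : B ^+ 3 * eta <= B ^+ 4 * eta by rewrite ler_wpM2r // ler_weXn2l.
have b3 : a <= b0 * a by rewrite ler_peMl.
have -> : w k * (d / 2) = (1 / 2) * (w k * d) by ring.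
rewrite ler_wpM2r //; move: haB heB b1 b2; rewrite -!mulrA; lra.
Qed.

Lemma weighted_shadowing eps : 0 <= eps -> 16 * B ^+ 3 * eps <= r ->
  (forall k, ~~ brk k -> `|F k 0 0| <= eps * w k) ->
  exists (z : I -> V) (t : I -> R), forall k,
    [/\ `|z k| <= 16 * B ^+ 3 * eps * w k, `|t k| <= 16 * B ^+ 3 * eps * w k &
        ~~ brk k -> F k (z k) (t k) = z (nx k)].
Proof.
move=> eps0 epsr F0; have hB := B1; have B0 : 0 <= B := le_trans ler01 B1.
(* The three components of [T 0] contribute [2 * B * eps], [B ^+ 2 * eps] and [B ^+ 2 * eps],
   together at most half of this radius. *)
pose rho := 8 * B ^+ 2 * eps.
have rho0 : 0 <= rho by rewrite !mulr_ge0 ?exprn_ge0.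
have rhoE : 2 * B * rho = 16 * B ^+ 3 * eps by rewrite /rho; ring.
pose T (xi : 'M[R]_(N.+1, n)) : 'M[R]_(N.+1, n) :=
  \matrix_(k, j) ((w k)^-1 *: step k xi) 0 j.
have rT k xi : row k (T xi) = (w k)^-1 *: step k xi.
  by apply/rowP => j; rewrite !mxE.
have dom (xi : 'M[R]_(N.+1, n)) : `|xi| <= rho -> 2 * B * `|xi| <= r.
  by move=> h; apply: le_trans epsr; rewrite -rhoE ler_wpM2l // mulr_ge0.
have [|xi yi hx hy|xi xi_le Txi] := @banach_ball R _ T rho rho0.
- apply: mx_norm_rows => [|k]; first by rewrite divr_ge0.
  rewrite rT normrZ gtr0_norm ?invr_gt0 ?w0 // mulrC ler_pdivrMr ?w0 //.
  rewrite /step !linear0 ?scaler0.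
  have hS : `|stepS (pv k) 0| <= 2 * B * eps * w k.
    rewrite /stepS; case: ifPn => [_|nb].
      by rewrite normr0 !mulr_ge0 // ltW.
    rewrite ord_predK Fk0; apply: le_trans (PsB _ _) _.
    rewrite (mulrC 2) -!mulrA ler_wpM2l // mulrCA (le_trans (F0 _ nb)) //.
    by rewrite ler_wpM2l.
  have hU : `|stepU k 0 0| <= B ^+ 2 * eps * w k.
    rewrite /stepU; case: ifPn => [_|nb].
      by rewrite normr0 !mulr_ge0 ?exprn_ge0 // ltW.
    rewrite Fk0 /zs !mul0mx add0r sub0r mulNmx mulNmx normrN.
    apply: le_trans (PuB _ _) _; rewrite expr2 -!mulrA ler_wpM2l //.
    by apply: le_trans (EB _ nb) _; rewrite ler_wpM2l // F0.
  have hC : `|stepC k 0| <= B ^+ 2 * eps * w k.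
    rewrite /stepC; case: ifPn => [_|nb].
      by rewrite normr0 !mulr_ge0 ?exprn_ge0 // ltW.
    rewrite Fk0 /ts {1}/rdot mul0mx mxE sub0r scaleNr normrN normrZ expr2.
    rewrite mulrC -!mulrA; apply: ler_pM => //.
    by apply: le_trans (lB _ _) _; rewrite ler_wpM2l // F0.
  apply: le_trans (ler_normD _ _) _; apply: le_trans (lerD (ler_normD _ _) (lexx _)) _.
  have : B * (eps * w k) <= B ^+ 2 * (eps * w k).
    by rewrite ler_wpM2r ?mulr_ge0 ?(ltW (w0 _)) // -{1}[B]expr1 ler_weXn2l.
  by rewrite /rho; move: hS hU hC; rewrite -!mulrA; lra.
- apply: mx_norm_rows => [|k]; first by rewrite divr_ge0.
  have -> : row k (T xi - T yi) = row k (T xi) - row k (T yi).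
    by apply/rowP => j; rewrite !mxE.
  rewrite !rT -scalerBr normrZ gtr0_norm ?invr_gt0 ?w0 //.
  by rewrite ler_pdivrMl ?w0 // step_lip ?dom.
pose ze k := w k *: row k xi.
have zeE k : ze k = step k xi.
  by rewrite /ze -[in LHS]Txi rT scalerA divff ?scale1r // gt_eqF.
have ze_le k : `|ze k| <= rho * w k.
  rewrite /ze normrZ gtr0_norm ?w0 // mulrC ler_wpM2r ?(ltW (w0 _)) //.
  exact: le_trans (rv_row_le _ _) xi_le.
have stS k : ze (nx k) *m Ps (nx k) = stepS k (ze k).
  rewrite {1}zeE /step ordSK -/(ze k) !mulmxDl.
  have -> : stepS k (ze k) *m Ps (nx k) = stepS k (ze k).
    by rewrite /stepS; case: ifP; rewrite ?mul0mx // -mulmxA Pss.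
  rewrite [X in _ + X + _](_ : _ = 0) ?[X in _ + X](_ : _ = 0) ?addr0 //.
    by rewrite /stepC; case: ifP; rewrite ?mul0mx // -scalemxAl XPs scaler0.
  by rewrite /stepU; case: ifP; rewrite ?mul0mx // -mulmxA Pus mulmx0.
have stU k : ze k *m Pu k = stepU k (ze k) (ze (nx k)).
  rewrite {1}zeE /step -/(ze k) -/(ze (nx k)) !mulmxDl.
  have -> : stepU k (ze k) (ze (nx k)) *m Pu k = stepU k (ze k) (ze (nx k)).
    by rewrite /stepU; case: ifP; rewrite ?mul0mx // -mulmxA Puu.
  rewrite [X in X + _ + _](_ : _ = 0) ?[X in _ + X](_ : _ = 0) ?addr0 ?add0r //.
    by rewrite /stepC; case: ifP; rewrite ?mul0mx // -scalemxAl XPu scaler0.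
  by rewrite /stepS ord_predK; case: ifP; rewrite ?mul0mx // -mulmxA Psu mulmx0.
have stC k : ~~ brk k -> rdot (Fk k (ze k)) (l (nx k)) = 0.
  move=> nb; have : ts k (ze k) = rdot (stepC k (ze k)) (l k).
    rewrite /ts {1}zeE /step -/(ze k) -/(ze (nx k)) !rdotD.
    rewrite [X in X + _ + _](_ : _ = 0) ?[X in _ + X + _](_ : _ = 0) ?add0r //.
      rewrite /stepU; case: ifP => _; first by rewrite /rdot mul0mx mxE.
      by rewrite /rdot -mulmxA Pul mulmx0 mxE.
    rewrite /stepS ord_predK; case: ifP => _; first by rewrite /rdot mul0mx mxE.
    by rewrite /rdot -mulmxA Psl mulmx0 mxE.
  rewrite /stepC (negPf nb) rdotZ Xl mulr1 => /eqP.
  by rewrite eq_sym subr_eq addrC -subr_eq subrr => /eqP.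
exists (fun k => zs k (ze k)), (fun k => ts k (ze k)) => k; split.
- apply: le_trans (zsB _ _) _; rewrite -rhoE -[leRHS]mulrA ler_wpM2l ?mulr_ge0 //.
- apply: le_trans (lB _ _) _; rewrite -rhoE -[leRHS]mulrA.
  apply: (@le_trans _ _ (2 * B * `|ze k|)); last by rewrite ler_wpM2l ?mulr_ge0.
  by rewrite ler_wpM2r //; lra.
move=> nb; rewrite -/(Fk k (ze k)); apply/esym/eqP; rewrite -subr_eq0.
set x := zs (nx k) (ze (nx k)) - Fk k (ze k).
have xs : x *m Ps (nx k) = 0.
  by rewrite /x mulmxBl zsS stS /stepS (negPf nb) subrr.
have xl : rdot x (l (nx k)) = 0 by rewrite /x rdotB zsl stC // subrr.
have xE : x = x *m Pu (nx k).
  rewrite -{1}[x]mulmx1 -(P1 (nx k)) !mulmxDr xs add0r rdot_mul xl scale0r addr0 //.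
(* The defect [x] is fixed by [Pu (nx k)], whereas the backward equation only says that [Qu k] kills
   it. These maps are [eta]-close, so the norm of [x] is at most [eta] times itself, and [x]
   vanishes. *)
have xQ : x *m Qu k = 0.
  have : x *m E k *m Pu k = 0.
    have := stU k; rewrite /stepU (negPf nb) -/x mulmxDl zsU => /eqP.
    by rewrite -[X in X == _]addr0 => /eqP/addrI/esym.
  rewrite -mulmxA EPu // => h.
  by rewrite -[x *m Qu k]mulmx1 -(ED nb) mulmxA -(mulmxA x) h mul0mx.
have : `|x| <= eta * `|x|.
  by have := Qu_near x nb; rewrite xQ sub0r normrN -xE.
have etal : eta < 1.
  have he := eta0; have heB := etaB.
  have : 1 * eta <= B ^+ 4 * eta by rewrite ler_wpM2r // exprn_ege1.
  by move: heB; rewrite -mulrA; lra.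
have := normr_ge0 x; rewrite -normr_le0 => x0 xx.
have : (1 - eta) * `|x| <= 0 by rewrite mulrBl mul1r subr_le0.
by rewrite pmulr_rle0 // subr_gt0.
Qed.

End Shadowing.

(** * The flow in charts *)

Section Jacobians.
Variable R : realType.

(** Derivatives as explicit estimates: these compose and localize easily, while ['J] and ['D] are
    total functions that carry no proof of differentiability. [has_jac_J] and [has_velP] translate
    back. *)
Definition has_jac n m (f : 'rV[R]_n -> 'rV[R]_m) (x : 'rV[R]_n) (A : 'M[R]_(n, m)) :=
  forall eta, 0 < eta -> exists2 r : R, 0 < r & forall z : 'rV[R]_n, `|z - x| < r ->
    `|f z - f x - (z - x) *m A| <= eta * `|z - x|.

Definition has_vel m (g : R -> 'rV[R]_m) (t : R) (v : 'rV[R]_m) :=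
  forall eta, 0 < eta -> exists2 r : R, 0 < r & forall h : R, `|h| < r ->
    `|g (t + h) - g t - h *: v| <= eta * `|h|.

Lemma mulmx_right_norm n m (v : 'rV[R]_n) (A : 'M[R]_(n, m)) :
  `|v *m A| <= n%:R * `|A| * `|v|.
Proof. by rewrite mulrAC; exact: mulmx_norm_le. Qed.

Lemma mulmxr_continuous n m (A : 'M[R]_(n, m)) :
  continuous (mulmxr A : 'rV[R]_n -> 'rV[R]_m).
Proof.
move=> x; apply/continuous_normP => e e0.
pose K := n%:R * `|A| + 1; have K0 : 0 < K by rewrite ltr_wpDl // mulr_ge0.
exists (e / K); first by rewrite divr_gt0.
move=> y; rewrite ltr_pdivlMr // => yx; apply: le_lt_trans yx.
rewrite /= -mulmxBl (le_trans (mulmx_right_norm _ _)) // mulrC ler_wpM2l //.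
by rewrite /K lerDl.
Qed.

Lemma has_jac_J n m (f : 'rV[R]_n -> 'rV[R]_m) x A : has_jac f x A -> 'J f x = A.
Proof.
move=> fA; rewrite /jacobian.
have -> : 'd f x = mulmxr A :> ('rV[R]_n -> 'rV[R]_m).
  apply: diff_unique; first exact: mulmxr_continuous.
  apply/eqaddoP => eta eta0; have [r r0 H] := fA _ eta0.
  apply/nbhs_normP; exists r => // z; rewrite subr0 => zr.
  have := H (z + x); rewrite addrK => /(_ zr).
  by rewrite /= opprD addrA.
by apply/row_matrixP => i; rewrite !rowE mul_rV_lin1.
Qed.

Lemma has_jac_near n m (f g : 'rV[R]_n -> 'rV[R]_m) (x : 'rV[R]_n) A (r : R) : 0 < r ->
  (forall y, `|y - x| < r -> f y = g y) -> has_jac f x A -> has_jac g x A.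
Proof.
move=> r0 fg fA eta /fA[r' r'0 H]; exists (Num.min r r'); first by rewrite lt_min r0.
move=> z; rewrite lt_min => /andP[zr zr']; rewrite -fg // -fg; first exact: H.
by rewrite subrr normr0.
Qed.

Lemma has_jac_id n (x : 'rV[R]_n) : has_jac id x 1%:M.
Proof. by move=> e e0; exists 1 => // z _; rewrite mulmx1 subrr normr0 mulr_ge0 // ltW. Qed.

Lemma has_jac_lip n m (f : 'rV[R]_n -> 'rV[R]_m) x A : has_jac f x A ->
  exists2 r : R, 0 < r & forall z, `|z - x| < r ->
    `|f z - f x| <= (n%:R * `|A| + 1) * `|z - x|.
Proof.
move=> /(_ _ ltr01)[r r0 H]; exists r => // z /H h.
rewrite -[f z - f x](subrK ((z - x) *m A)) mulrDl addrC.
by apply: le_trans (ler_normD _ _) _; apply: lerD => //; exact: mulmx_right_norm.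
Qed.

Lemma has_jac_comp n m p (f : 'rV[R]_n -> 'rV[R]_m) (g : 'rV[R]_m -> 'rV[R]_p)
    (x : 'rV[R]_n) A C :
  has_jac f x A -> has_jac g (f x) C -> has_jac (g \o f) x (A *m C).
Proof.
move=> fA gC eta eta0; have [r1 r10 H1] := has_jac_lip fA.
pose K := n%:R * `|A| + 1; have K0 : 0 < K by rewrite ltr_wpDl // mulr_ge0.
pose K' := m%:R * `|C| + 1; have K'0 : 0 < K' by rewrite ltr_wpDl // mulr_ge0.
have [|r2 r20 H2] := fA (eta / 2 / K'); first by rewrite !divr_gt0.
have [|r3 r30 H3] := gC (eta / 2 / K); first by rewrite !divr_gt0.
exists (Num.min (Num.min r1 r2) (r3 / K)); first by rewrite !lt_min r10 r20 divr_gt0.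
move=> z; rewrite !lt_min => /andP[/andP[z1 z2] z3].
have fz : `|f z - f x| <= K * `|z - x| by exact: H1.
have h3 : `|f z - f x| < r3.
  by apply: le_lt_trans fz _; rewrite mulrC -ltr_pdivlMr.
have -> : (g \o f) z - (g \o f) x - (z - x) *m (A *m C) =
   (g (f z) - g (f x) - (f z - f x) *m C) + (f z - f x - (z - x) *m A) *m C.
  have -> : (f z - f x - (z - x) *m A) *m C =
     (f z - f x) *m C - (z - x) *m (A *m C) by rewrite mulmxBl mulmxA.
  by rewrite addrA subrK.
apply: le_trans (ler_normD _ _) _; rewrite [eta]splitr mulrDl; apply: lerD.
  apply: le_trans (H3 _ h3) _.
  rewrite [leRHS](_ : _ = eta / 2 / K * (K * `|z - x|)) ?ler_wpM2l //.
    by rewrite !divr_ge0 // ltW.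
  by rewrite mulrA divfK // gt_eqF.
apply: le_trans (mulmx_right_norm _ _) _.
have := H2 _ z2 => h2.
apply: (@le_trans _ _ (K' * (eta / 2 / K' * `|z - x|))).
  by apply: ler_pM => //; rewrite ?mulr_ge0 // /K' lerDl.
by rewrite mulrA (mulrC K') divfK // gt_eqF.
Qed.

Lemma has_vel_comp m p (g : R -> 'rV[R]_m) (f : 'rV[R]_m -> 'rV[R]_p) t v C :
  has_vel g t v -> has_jac f (g t) C -> has_vel (f \o g) t (v *m C).
Proof.
move=> gv fC eta eta0.
pose K := `|v| + 1; have K0 : 0 < K by rewrite ltr_wpDl.
pose K' := m%:R * `|C| + 1; have K'0 : 0 < K' by rewrite ltr_wpDl // mulr_ge0.
have [|r1 r10 H1] := gv 1; first by [].
have [|r2 r20 H2] := gv (eta / 2 / K'); first by rewrite !divr_gt0.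
have [|r3 r30 H3] := fC (eta / 2 / K); first by rewrite !divr_gt0.
exists (Num.min (Num.min r1 r2) (r3 / K)); first by rewrite !lt_min r10 r20 divr_gt0.
move=> h; rewrite !lt_min => /andP[/andP[h1 h2] h3].
have gh : `|g (t + h) - g t| <= K * `|h|.
  rewrite -[g (t + h) - g t](subrK (h *: v)) /K mulrDl addrC.
  apply: le_trans (ler_normD _ _) _; apply: lerD; last exact: H1.
  by rewrite normrZ mulrC.
have k3 : `|g (t + h) - g t| < r3.
  by apply: le_lt_trans gh _; rewrite mulrC -ltr_pdivlMr.
have -> : (f \o g) (t + h) - (f \o g) t - h *: (v *m C) =
   (f (g (t + h)) - f (g t) - (g (t + h) - g t) *m C) +
   (g (t + h) - g t - h *: v) *m C.
  have -> : (g (t + h) - g t - h *: v) *m C =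
     (g (t + h) - g t) *m C - h *: (v *m C) by rewrite mulmxBl scalemxAl.
  by rewrite addrA subrK.
apply: le_trans (ler_normD _ _) _; rewrite [eta]splitr mulrDl; apply: lerD.
  apply: le_trans (H3 _ k3) _.
  rewrite [leRHS](_ : _ = eta / 2 / K * (K * `|h|)) ?ler_wpM2l //.
    by rewrite !divr_ge0 // ltW.
  by rewrite mulrA divfK // gt_eqF.
apply: le_trans (mulmx_right_norm _ _) _.
have := H2 _ h2 => h2'.
apply: (@le_trans _ _ (K' * (eta / 2 / K' * `|h|))).
  by apply: ler_pM => //; rewrite ?mulr_ge0 // /K' lerDl.
by rewrite mulrA (mulrC K') divfK // gt_eqF.
Qed.

Lemma has_vel_near m (f g : R -> 'rV[R]_m) t v (r : R) : 0 < r ->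
  (forall h, `|h| < r -> f (t + h) = g (t + h)) -> has_vel f t v -> has_vel g t v.
Proof.
move=> r0 fg fv eta /fv[r' r'0 H]; exists (Num.min r r'); first by rewrite lt_min r0.
move=> h; rewrite lt_min => /andP[hr hr']; rewrite -fg //.
by have := fg 0; rewrite normr0 addr0 => /(_ r0) <-; exact: H.
Qed.

Lemma has_velP m (g : R^o -> 'rV[R]_m) t v : has_vel g t v <-> is_derive t 1 g v.
Proof.
split=> [gv|dg].
  have lim_v : (fun h : R => h^-1 *: ((g \o shift t) (h *: (1 : R^o)) - g t)) @ 0^' --> v.
    apply/cvgrPdist_le => e e0; have [r r0 H] := gv _ e0.
    near=> h; rewrite /= scaler_regular1.
    have h0 : h != 0 by near: h; exact: nbhs_dnbhs_neq.
    have hr : `|h| < r by near: h; exact: dnbhs0_lt.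
    have := H _ hr; rewrite (addrC t) => H'.
    rewrite distrC -[v](scalerK h0) -scalerBr normrZ normfV mulrC.
    by rewrite ler_pdivrMr ?normr_gt0.
  split; first by apply/cvg_ex; exists v.
  exact: cvg_lim.
move=> eta eta0; have dv : derivable g t 1 by exact: ex_derive.
have Dv : 'D_1 g t = v by exact: derive_val.
have /derivable_nbhs := dv; rewrite Dv => /eqaddoP/(_ _ eta0)/nbhs_normP[r r0 H].
exists r => // h hr; have := H h; rewrite subr0 => /(_ hr).
have E : g (h *: (1 : R^o) + t) - (g t + h *: v) = g (t + h) - g t - h *: v.
  by rewrite scaler_regular1 opprD addrA (addrC h).
by rewrite -E.
Unshelve. all: by end_near. Qed.

Lemma has_vel_uniq m (g : R -> 'rV[R]_m) t v v' : has_vel g t v -> has_vel g t v' -> v = v'.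
Proof.
move=> /(@has_velP m g t v) h1 /(@has_velP m g t v') h2.
by rewrite -(@derive_val _ _ _ _ _ _ _ h1) (@derive_val _ _ _ _ _ _ _ h2).
Qed.

End Jacobians.

Lemma pair_norm_lt (R : realType) n (a a' : R^o) (b b' : 'rV[R]_n) r :
  (`|((a, b) : R^o * 'rV[R]_n) - (a', b')| < r) = (`|a - a'| < r) && (`|b - b'| < r).
Proof. by rewrite [ `|_ - _ : R^o * _|]/Num.Def.normr /= /Num.Def.normr /= gt_max. Qed.

Section FlowInCharts.
Variables (R : realType) (n : nat) (M : closed_manifold R n) (phi : R -> M -> M).
Hypothesis sphi : smooth_flow phi.
Implicit Types (c d e : chart R n M) (x : M) (s t : R).

Lemma flow0 x : phi 0 x = x. Proof. by case: sphi. Qed.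
Lemma flowD s t x : phi (s + t) x = phi s (phi t x). Proof. by case: sphi. Qed.
Lemma flowC s t x : phi s (phi t x) = phi t (phi s x).
Proof. by rewrite -!flowD addrC. Qed.
Lemma flowK s x : phi (- s) (phi s x) = x.
Proof. by rewrite -flowD addNr flow0. Qed.
Lemma flowNK s x : phi s (phi (- s) x) = x.
Proof. by rewrite -flowD addrN flow0. Qed.

Lemma flow_cont s x (U : set M) : nbhs (phi s x) U ->
  exists2 r : R, 0 < r & nbhs x [set y | forall t, `|t - s| < r -> U (phi t y)].
Proof.
move=> nU; have [_ _ cphi _] := sphi.
have := cphi (s, x) U nU; case=> -[A B] /= [/nbhs_normP[r r0 Hr] nB] AB.
exists r => //; apply: filterS nB => y By t ts.
by apply: (AB (t, y)); split=> //=; exact: Hr.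
Qed.

Definition flowc c d (p : R^o * 'rV[R]_n) : 'rV[R]_n := d (phi p.1 (cinv c p.2)).
Definition flow_dom c d : set (R^o * 'rV[R]_n) :=
  [set z | cimg c z.2 /\ cdom d (phi z.1 (cinv c z.2))].

Lemma flow_dom_open c d : open (flow_dom c d).
Proof.
rewrite openE => -[s y] [/= cy dy].
have [r r0 H] := flow_cont (open_nbhs_nbhs (conj (@cdom_open _ _ _ d) dy)).
have := chart_img_nbhs (cinv_dom cy) H; rewrite cinvK //.
move=> /nbhs_normP[r' r'0 H']; apply/nbhs_normP; exists (Num.min r r').
  by rewrite lt_min r0.
move=> [t z]; rewrite pair_norm_lt !lt_min.
move=> /andP[/andP[ts _] /andP[_ zy]].
by have [cz Hz] := H' _ zy; split; [exact: cz|exact: Hz].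
Qed.

Lemma flowc_smooth c d : atlas c -> atlas d -> smooth_on (flow_dom c d) (flowc c d).
Proof. by case: sphi => _ _ _; apply. Qed.

Definition DM c d s x : 'M[R]_n := 'J (fun y => d (phi s (cinv c y))) (c x).

Definition XM c x : 'rV[R]_n := vfield_in c phi (c x).

Lemma flowc_derive c d s x : atlas c -> atlas d -> cdom c x -> cdom d (phi s x) ->
  has_jac (fun y => d (phi s (cinv c y))) (c x)
     (jac_rows (@space_dir R n) (flowc c d) (s, c x)) /\
  has_vel (fun t => d (phi t x)) s ('D_(time_dir R n) (flowc c d) (s, c x)).
Proof.
move=> ac ad cx dx.
pose q : R^o * 'rV[R]_n := (s, c x).
have Oq : flow_dom c d q by split; [exact: cimg_dom|rewrite /= cmapK].
have H eta : 0 < eta -> exists2 r, 0 < r & forall (t t' : R^o) (z z' : 'rV[R]_n),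
    `|(t, z) - q| < r -> `|(t', z') - q| < r -> flow_dom c d (t, z) /\
    `|flowc c d (t, z) - flowc c d (t', z') - ((t - t') *: 'D_(time_dir R n) (flowc c d) q +
        (z - z') *m jac_rows (@space_dir R n) (flowc c d) q)| <=
      eta * (`|t - t'| + `|z - z'|).
  move=> eta0; have cq : compact [set q] by exact: compact_set1.
  have qO : [set q] `<=` flow_dom c d by move=> _ ->.
  have [r r0 Hr] := c1_uniform (flowc_smooth ac ad)
    (@flow_dom_open c d) cq qO eta0.
  by exists r => // t t' z z'; exact: Hr.
split=> eta /H[r r0 Hr]; exists r => //.
  move=> z zx; have [||_] := Hr s s z (c x).
  - by rewrite pair_norm_lt subrr normr0 r0.
  - by rewrite subrr normr0.
  by rewrite subrr normr0 scale0r !add0r.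
move=> h hr; have [||_] := Hr (s + h) s (c x) (c x).
- by rewrite pair_norm_lt subrr normr0 r0 andbT addrAC subrr add0r.
- by rewrite subrr normr0.
have -> : s + h - s = h by rewrite addrAC subrr add0r.
by rewrite subrr normr0 mul0mx !addr0 /flowc /= !cmapK.
Qed.

Lemma DM_jac c d s x : atlas c -> atlas d -> cdom c x -> cdom d (phi s x) ->
  has_jac (fun y => d (phi s (cinv c y))) (c x) (DM c d s x).
Proof.
move=> ac ad cx dx; have [h _] := flowc_derive ac ad cx dx.
by rewrite /DM (has_jac_J h).
Qed.

Lemma DM_jac_rows c d s x : atlas c -> atlas d -> cdom c x -> cdom d (phi s x) ->
  DM c d s x = jac_rows (@space_dir R n) (flowc c d) (s, c x).
Proof.
by move=> ac ad cx dx; have [h _] := flowc_derive ac ad cx dx; exact: has_jac_J.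
Qed.

Lemma DM_comp c d e s t x : atlas c -> atlas d -> atlas e ->
  cdom c x -> cdom d (phi s x) -> cdom e (phi (t + s) x) ->
  DM c e (t + s) x = DM c d s x *m DM d e t (phi s x).
Proof.
move=> ac ad ae cx dx ex; have h1 := DM_jac ac ad cx dx.
have ex' : cdom e (phi t (phi s x)) by rewrite -flowD.
have h2 := DM_jac ad ae dx ex'.
have := has_jac_comp h1 (g := fun y => e (phi t (cinv d y))) (C := DM d e t (phi s x)).
rewrite /= cmapK // => /(_ h2) h3.
have [r r0 Hr] : exists2 r : R, 0 < r & forall y : 'rV[R]_n, `|y - c x| < r ->
    cimg c y /\ cdom d (phi s (cinv c y)).
  have [r r0 H] := flow_cont (open_nbhs_nbhs (conj (@cdom_open _ _ _ d) dx)).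
  have /nbhs_normP[r' r'0 H'] := chart_img_nbhs cx H.
  exists r' => // y /H'[cy Hy]; split=> //.
  by apply: Hy; rewrite subrr normr0.
have h4 : has_jac (fun y => e (phi (t + s) (cinv c y))) (c x)
    (DM c d s x *m DM d e t (phi s x)).
  apply: has_jac_near r0 _ h3 => y /Hr[cy dy].
  by rewrite /= cmapK // flowD.
by rewrite /DM (has_jac_J h4).
Qed.

Lemma DM0 c x : cdom c x -> DM c c 0 x = 1%:M.
Proof.
move=> cx; apply: has_jac_J.
have /nbhs_normP[r r0 Hr] : nbhs (c x) (cimg c).
  by apply: open_nbhs_nbhs; split; [exact: cimg_open|exact: cimg_dom].
apply: has_jac_near r0 _ (has_jac_id _) => y /Hr cy.
by rewrite flow0 cinvK.
Qed.

Lemma DM_inv c d s x : atlas c -> atlas d -> cdom c x -> cdom d (phi s x) ->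
  DM c d s x *m DM d c (- s) (phi s x) = 1%:M.
Proof.
move=> ac ad cx dx; rewrite -DM_comp // ?addNr ?flow0 // DM0 //.
Qed.

Lemma XM_vel c x : atlas c -> cdom c x -> has_vel (fun t => c (phi t x)) 0 (XM c x).
Proof.
move=> ac cx; have cx' : cdom c (phi 0 x) by rewrite flow0.
have [_ h] := flowc_derive ac ac cx cx'.
suff -> : XM c x = 'D_(time_dir R n) (flowc c c) (0, c x) by [].
have := proj1 (@has_velP R n (fun t => c (phi t x)) 0 _) h.
rewrite /XM /vfield_in (cmapK cx) => h'; exact: (@derive_val _ _ _ _ _ _ _ h').
Qed.

Lemma XM_vel_at c s x : atlas c -> cdom c (phi s x) ->
  has_vel (fun t => c (phi t x)) s (XM c (phi s x)).
Proof.
move=> ac cx; have := XM_vel ac cx => h eta /h[r r0 H]; exists r => // u /H.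
by rewrite add0r flow0 (addrC s) flowD.
Qed.

(** Both sides are the velocity at [t = 0] of the same curve [phi s (phi t x) = phi t (phi s x)]. *)
Lemma XM_push c d s x : atlas c -> atlas d -> cdom c x -> cdom d (phi s x) ->
  XM c x *m DM c d s x = XM d (phi s x).
Proof.
move=> ac ad cx dx; have h1 := XM_vel ac cx; have h2 := DM_jac ac ad cx dx.
have h3 : has_vel ((fun y => d (phi s (cinv c y))) \o (fun t => c (phi t x))) 0
    (XM c x *m DM c d s x).
  by apply: has_vel_comp h1 _; rewrite flow0.
have h4 := XM_vel ad dx.
have nx : nbhs (phi 0 x) (cdom c).
  by apply: open_nbhs_nbhs; split; [exact: cdom_open|rewrite flow0].
have [r r0 /nbhs_singleton Hr] := flow_cont nx.
suff h5 : has_vel (fun t => d (phi t (phi s x))) 0 (XM c x *m DM c d s x).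
  exact: has_vel_uniq h5 h4.
apply: has_vel_near r0 _ h3 => u ur.
have cu : cdom c (phi (0 + u) x) by apply: Hr; rewrite add0r subr0.
by rewrite /= cmapK // (flowC s).
Qed.

Lemma flowc_time_derive c d s x : atlas c -> atlas d -> cdom c x -> cdom d (phi s x) ->
  'D_(time_dir R n) (flowc c d) (s, c x) = XM d (phi s x).
Proof.
move=> ac ad cx dx; have [_ h] := flowc_derive ac ad cx dx.
exact: has_vel_uniq h (XM_vel_at ad dx).
Qed.

Lemma tangent_map_DM s x :
  tangent_map (phi s) x = DM (chart_at x) (chart_at (phi s x)) s x.
Proof. by []. Qed.

Lemma vfield_XM x : vfield phi x = XM (chart_at x) x.
Proof. by []. Qed.

End FlowInCharts.

Lemma compact_preim_closed (T S : topologicalType) (A : set T) (C : set S) (g : T -> S) :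
  compact A -> (forall x, A x -> {for x, continuous g}) -> closed C ->
  compact (A `&` g @^-1` C).
Proof.
move=> cA cg clC F FF FAC.
have FA : F A by apply: filterS FAC => x [].
have [p [Ap clp]] := cA F FF FA; exists p; split=> //; split=> //.
apply: clC => U nU.
have [q [[_ Cq] Uq]] := clp _ _ FAC (cg p Ap _ nU).
by exists (g q); split.
Qed.

Lemma half_norm_lower (R : realType) (V : normedModType R) (a b : V) :
  `|b - a| <= `|a| / 2 -> `|a| / 2 <= `|b|.
Proof. by move=> h; have := lerB_dist a b; rewrite (distrC a); lra. Qed.

Section QuadraticForms.
Variables (R : realType) (n : nat).
Implicit Types (S T : 'M[R]_n) (v w : 'rV[R]_n).

Definition qf S v : R := (v *m S *m v^T) 0 0.

Lemma trmx_norm v : `|v^T| <= `|v|.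
Proof. by apply: mx_norm_le => // i j; rewrite mxE mx_entry_le. Qed.

Lemma bilin_le S v w : `|(v *m S *m w^T) 0 0| <= n%:R ^+ 2 * `|S| * (`|v| * `|w|).
Proof.
apply: le_trans (mx_entry_le _ _ _) _; apply: le_trans (mulmx_norm_le _ _) _.
have -> : n%:R ^+ 2 * `|S| * (`|v| * `|w|) = n%:R * (n%:R * `|v| * `|S|) * `|w| by ring.
by apply: ler_pM; rewrite ?mulr_ge0 ?ler_wpM2l ?mulmx_norm_le ?trmx_norm.
Qed.

Lemma qf_le S v : `|qf S v| <= n%:R ^+ 2 * `|S| * `|v| ^+ 2.
Proof. by rewrite expr2; exact: bilin_le. Qed.

Lemma qfB S T v : qf (S - T) v = qf S v - qf T v.
Proof. by rewrite /qf mulmxBr mulmxBl !mxE. Qed.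

Lemma qf_diff S v w : qf S v - qf S w =
  ((v - w) *m S *m v^T) 0 0 + (w *m S *m (v - w)^T) 0 0.
Proof.
have E (A B : 'M[R]_1) : (A - B) 0 0 = A 0 0 - B 0 0 by rewrite !mxE.
have tB : (v - w)^T = v^T - w^T by apply/matrixP => i j; rewrite !mxE.
by rewrite /qf tB mulmxBr !mulmxBl !E addrA subrK.
Qed.

Lemma qf_continuous S v : {for v, continuous (qf S : 'rV[R]_n -> R^o)}.
Proof.
apply/continuous_normP => e e0; pose K := n%:R ^+ 2 * `|S| * (2 * `|v| + 1) + 1.
have K0 : 0 < K by rewrite ltr_wpDl // !mulr_ge0 ?addr_ge0 ?mulr_ge0 ?exprn_ge0.
exists (Num.min 1 (e / K)); first by rewrite lt_min ltr01 divr_gt0.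
move=> w; rewrite lt_min => /andP[w1]; rewrite ltr_pdivlMr // => we.
apply: le_lt_trans we; rewrite qf_diff; apply: le_trans (ler_normD _ _) _.
apply: le_trans (lerD (bilin_le _ _ _) (bilin_le _ _ _)) _.
have wv : `|w| <= `|v| + 1.
  rewrite -[w](subrK v) addrC; apply: le_trans (ler_normD _ _) _.
  by rewrite lerD2l ltW.
have -> : n%:R ^+ 2 * `|S| * (`|w - v| * `|w|) + n%:R ^+ 2 * `|S| * (`|v| * `|w - v|) =
   `|w - v| * (n%:R ^+ 2 * `|S| * (`|w| + `|v|)) by ring.
rewrite ler_wpM2l // /K ler_wpDr // ler_wpM2l ?mulr_ge0 ?exprn_ge0 //; lra.
Qed.

Lemma qfZ S a v : qf S (a *: v) = a ^+ 2 * qf S v.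
Proof. by rewrite /qf linearZ /= -!scalemxAl -scalemxAr scalerA mxE. Qed.

Lemma qf_lower S : (forall v, v != 0 -> 0 < qf S v) ->
  exists2 m : R, 0 < m & forall v, m * `|v| ^+ 2 <= qf S v.
Proof.
move=> Spos; pose sph : set 'rV[R]_n := [set v | `|v| = 1].
have csph : compact sph.
  apply: (@subclosed_compact _ _ (cball 0 1)); last 2 first.
  - exact: cball_compact.
  - by move=> v /= v1; rewrite /cball /= subr0 v1.
  have -> : sph = (fun v : 'rV[R]_n => `|v|) @^-1` [set 1] by [].
  apply: closed_comp; last exact: closed_eq.
  by move=> v _; exact: norm_continuous.
have [m m0 H] : exists2 m : R, 0 < m & forall v, sph v -> m <= qf S v.
  apply: compact_uniform csph _ _ => [r r' v r'0 rr'|v v1]; first exact: le_trans.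
  have v0 : v != 0 by rewrite -normr_gt0 (v1 : `|v| = 1).
  have q0 := Spos _ v0; exists (qf S v / 2); first by rewrite divr_gt0.
  have /continuous_normP/(_ (qf S v / 2)) := @qf_continuous S v.
  rewrite divr_gt0 // => /(_ isT)[d d0 Hd]; apply/nbhs_normP; exists d => // w /Hd.
  by rewrite /= ltr_norml => /andP[h _]; lra.
exists m => // v; have [->|v0] := eqVneq v 0.
  by rewrite normr0 expr0n mulr0 /qf !mul0mx mxE.
have nv : 0 < `|v| by rewrite normr_gt0.
have := H (`|v|^-1 *: v); rewrite qfZ /sph /= normrZ normfV normr_id mulVf ?gt_eqF //.
move=> /(_ erefl); rewrite exprVn mulrC ler_pdivlMr ?exprn_gt0 //.
Qed.

End QuadraticForms.

(** * Estimates for the flow that are uniform over the manifold *)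

Section UniformFlow.
Variables (R : realType) (n : nat) (M : closed_manifold R n) (G : good_cover M)
  (phi : R -> M -> M).
Hypothesis sphi : smooth_flow phi.
Local Notation c := (@gch R n M G).
Local Notation z := (@gcz R n M G).
Local Notation rho := (@gcr R n M G).
Local Notation wide := (@wide R n M G).
Local Notation I := 'I_(gcN G).
Implicit Types (i j : I) (x y : M) (s t : R).

Definition D i j s x := DM phi (c i) (c j) s x.
Definition X i x := XM phi (c i) x.

Lemma wideE i : wide i = cinv (c i) @` cball (z i) (2 * rho i).
Proof.
have sub : cball (z i) (2 * rho i) `<=` cimg (c i).
  move=> y By; apply: gc_ball; apply: le_trans By _.
  by rewrite ler_pM2r ?gcr_gt0 // ler_nat.
apply/seteqP; split=> [x [dx wx]|_ [y By <-]].
  by exists (c i x) => //; rewrite cmapK.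
split; first exact/cinv_dom/sub.
by rewrite cinvK //; exact: sub.
Qed.

Lemma wide_closed i : closed (wide i).
Proof.
rewrite wideE; apply: compact_closed; first exact: mhausdorff.
apply: continuous_compact; last exact: cball_compact.
apply: continuous_in_subspaceT => y /set_mem By.
apply: cinv_continuous; apply: gc_ball; apply: le_trans By _.
by rewrite ler_pM2r ?gcr_gt0 // ler_nat.
Qed.

(** Bounded times and starting points in [wide i] whose endpoints lie in [wide j]. Compactness of
    this set, for each of the finitely many pairs of charts, is the source of all uniform
    constants. *)
Definition flow_compact (T0 : R) i j : set (R^o * 'rV[R]_n) :=
  ([set s : R^o | `|s| <= T0] `*` cball (z i) (2 * rho i)) `&`
  (fun p => phi p.1 (cinv (c i) p.2)) @^-1` wide j.

Lemma flow_compact_compact T0 i j : compact (flow_compact T0 i j).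
Proof.
apply: compact_preim_closed; last exact: wide_closed.
  apply: compact_setX; last exact: cball_compact.
  have -> : [set s : R^o | `|s| <= T0] = `[- T0, T0]%classic.
    by apply/seteqP; split=> s; rewrite /= in_itv /= ler_norml.
  exact: (@segment_compact R).
move=> [s y] [_ /= By].
have iy : cimg (c i) y.
  apply: gc_ball; apply: le_trans By _.
  by rewrite ler_pM2r ?gcr_gt0 // ler_nat.
move=> U nU; have [r r0 Hr] := flow_cont sphi nU.
have := chart_img_nbhs (cinv_dom iy) Hr; rewrite cinvK //.
move=> /nbhs_normP[r' r'0 H']; apply/nbhs_normP; exists (Num.min r r').
  by rewrite lt_min r0.
move=> [t w]; rewrite pair_norm_lt !lt_min => /andP[/andP[ts _] /andP[_ zy]].
by have [_] := H' _ zy; apply.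
Qed.

Lemma flow_compact_sub T0 i j : flow_compact T0 i j `<=` flow_dom phi (c i) (c j).
Proof.
move=> [s y] [[_ /= By] /= wy]; split; last exact: wide_dom wy.
apply: gc_ball; apply: le_trans By _.
by rewrite ler_pM2r ?gcr_gt0 // ler_nat.
Qed.

Lemma flow_compactE T0 i j s x : `|s| <= T0 -> wide i x -> wide j (phi s x) ->
  flow_compact T0 i j (s, c i x).
Proof.
move=> sT [dx wx] wy; split; last by rewrite /= cmapK.
by [].
Qed.

Lemma DE i j s x : cdom (c i) x -> cdom (c j) (phi s x) ->
  D i j s x = jac_rows (@space_dir R n) (flowc phi (c i) (c j)) (s, c i x).
Proof. by move=> *; apply: DM_jac_rows => //; exact: gch_atlas. Qed.

Lemma XE i j s x : cdom (c i) x -> cdom (c j) (phi s x) ->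
  'D_(time_dir R n) (flowc phi (c i) (c j)) (s, c i x) = X j (phi s x).
Proof. by move=> *; apply: flowc_time_derive => //; exact: gch_atlas. Qed.

Lemma jac_rows_le m p (V : normedModType R) (e : 'I_m -> V) (F F' : V -> 'rV[R]_p)
    q q' (K : R) :
  0 <= K -> (forall k, `|'D_(e k) F q - 'D_(e k) F' q'| <= K) ->
  `|jac_rows e F q - jac_rows e F' q'| <= K.
Proof.
move=> K0 H; apply: mx_norm_rows => // k.
by rewrite linearB /= !row_jac_rows.
Qed.

(** The first part compares two perturbed orbits with two perturbed times, as shadowing needs; the
    second is the uniform continuity of the derivative and of the vector field in the base point. *)
Lemma flow_uniform T0 eta : 0 < eta -> exists2 r : R, 0 < r & forall i j s x,
  `|s| <= T0 -> wide i x -> wide j (phi s x) ->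
  (forall (w w' : 'rV[R]_n) (t t' : R), `|w| < r -> `|w'| < r -> `|t| < r -> `|t'| < r ->
    [/\ cimg (c i) (c i x + w),
        cdom (c j) (phi (s + t) (cinv (c i) (c i x + w))) &
     `|c j (phi (s + t) (cinv (c i) (c i x + w))) -
       c j (phi (s + t') (cinv (c i) (c i x + w'))) -
       ((w - w') *m D i j s x + (t - t') *: X j (phi s x))| <=
       eta * (`|w - w'| + `|t - t'|)]) /\
  (forall x', cdom (c i) x' -> `|c i x' - c i x| < r ->
    [/\ cdom (c j) (phi s x'), `|D i j s x' - D i j s x| <= eta &
        `|X j (phi s x') - X j (phi s x)| <= eta]).
Proof.
move=> eta0.
have sm i j := flowc_smooth sphi (gch_atlas i) (gch_atlas j).
have /choice[r1 H1] : forall ij : I * I, exists r : R, 0 < r /\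
    forall q, flow_compact T0 ij.1 ij.2 q -> forall (t t' : R^o) (w w' : 'rV[R]_n),
    `|(t, w) - q| < r -> `|(t', w') - q| < r ->
    flow_dom phi (c ij.1) (c ij.2) (t, w) /\
    `|flowc phi (c ij.1) (c ij.2) (t, w) - flowc phi (c ij.1) (c ij.2) (t', w') -
      ((t - t') *: 'D_(time_dir R n) (flowc phi (c ij.1) (c ij.2)) q +
        (w - w') *m jac_rows (@space_dir R n) (flowc phi (c ij.1) (c ij.2)) q)| <=
      eta * (`|t - t'| + `|w - w'|).
  move=> [i j] /=.
  have [r r0 Hr] := c1_uniform (sm i j) (@flow_dom_open _ _ _ _ sphi (c i) (c j))
    (@flow_compact_compact T0 i j) (@flow_compact_sub T0 i j) eta0.
  by exists r.
have contD i j v : exists2 r : R, 0 < r & forall q p, flow_compact T0 i j q ->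
    `|p - q| < r -> `|'D_v (flowc phi (c i) (c j)) p - 'D_v (flowc phi (c i) (c j)) q| < eta.
  apply: compact_unif_cont => //; first exact: flow_compact_compact.
  move=> q /flow_compact_sub; exact: smooth_on_continuous (smooth_on_derive v (sm i j)).
have /choice[r2 H2] : forall ij : I * I, exists r : R, 0 < r /\
    forall q p, flow_compact T0 ij.1 ij.2 q -> `|p - q| < r ->
    `|'D_(time_dir R n) (flowc phi (c ij.1) (c ij.2)) p -
      'D_(time_dir R n) (flowc phi (c ij.1) (c ij.2)) q| < eta.
  by move=> [i j]; have [r] := contD i j (time_dir R n); exists r.
have /choice[r3 H3] : forall ijk : I * I * 'I_n, exists r : R, 0 < r /\
    forall q p, flow_compact T0 ijk.1.1 ijk.1.2 q -> `|p - q| < r ->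
    `|'D_(space_dir R ijk.2) (flowc phi (c ijk.1.1) (c ijk.1.2)) p -
      'D_(space_dir R ijk.2) (flowc phi (c ijk.1.1) (c ijk.1.2)) q| < eta.
  by move=> [[i j] k]; have [r] := contD i j (space_dir R k); exists r.
have [|q1 q10 Q1] := @fin_lower_pos R _ r1; first by move=> ij; case: (H1 ij).
have [|q2 q20 Q2] := @fin_lower_pos R _ r2; first by move=> ij; case: (H2 ij).
have [|q3 q30 Q3] := @fin_lower_pos R _ r3; first by move=> ij; case: (H3 ij).
exists (Num.min q1 (Num.min q2 q3)); first by rewrite !lt_min q10 q20.
move=> i j s x sT wx wy; have Kq := flow_compactE sT wx wy.
have dx := wide_dom wx; have dy := wide_dom wy.
split=> [w w' t t'|x' dx'].
  rewrite !lt_min => /and3P[w1 _ _] /and3P[w'1 _ _] /and3P[t1 _ _] /and3P[t'1 _ _].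
  have [_ /(_ _ Kq (s + t) (s + t') (c i x + w) (c i x + w'))] := H1 (i, j).
  have cancel_add (V : zmodType) (a b : V) : a + b - a = b by rewrite addrAC subrr add0r.
  rewrite !pair_norm_lt !cancel_add.
  rewrite !(lt_le_trans _ (Q1 (i, j))) //= => /(_ isT isT)[[im dm]].
  have E (V : zmodType) (a b b' : V) : a + b - (a + b') = b - b' by rewrite opprD addrACA subrr add0r.
  rewrite !E -DE // XE // => h; split=> //.
  by rewrite (addrC ((w - w') *m _)) (addrC `|w - w'|).
rewrite !lt_min => /and3P[h1 h2 h3].
have near r : `|c i x' - c i x| < r -> `|((s, c i x') : R^o * 'rV_n) - (s, c i x)| < r.
  move=> h; rewrite pair_norm_lt h subrr normr0 andbT; apply: le_lt_trans h.
  exact: normr_ge0.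
have [_ /(_ _ Kq s s (c i x') (c i x'))] := H1 (i, j).
case=> [||[_ /=]].
- exact/near/(lt_le_trans h1).
- exact/near/(lt_le_trans h1).
rewrite cmapK // => dy' _; split=> //.
- rewrite !DE //; apply: jac_rows_le => [|k]; first exact: ltW.
  apply/ltW; have [_ H] := H3 (i, j, k); apply: H => //.
  exact/near/(lt_le_trans h3).
- rewrite -(XE dx dy) -(XE dx' dy'); apply/ltW; have [_ H] := H2 (i, j); apply: H => //.
  exact/near/(lt_le_trans h2).
Qed.

Lemma flow_bounded T0 : exists2 B : R, 1 <= B & forall i j s x,
  `|s| <= T0 -> wide i x -> wide j (phi s x) ->
  `|D i j s x| <= B /\ `|X j (phi s x)| <= B.
Proof.
have sm i j := flowc_smooth sphi (gch_atlas i) (gch_atlas j).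
have contD i j v : exists B : R, forall q, flow_compact T0 i j q ->
    `|'D_v (flowc phi (c i) (c j)) q| <= B.
  have [|B _ HB] := continuous_bounded (f := 'D_v (flowc phi (c i) (c j)))
      (@flow_compact_compact T0 i j).
    move=> q /flow_compact_sub; exact: smooth_on_continuous (smooth_on_derive v (sm i j)).
  by exists B.
have /choice[b1 H1] : forall ij : I * I, exists B : R, forall q, flow_compact T0 ij.1 ij.2 q ->
    `|'D_(time_dir R n) (flowc phi (c ij.1) (c ij.2)) q| <= B.
  by move=> [i j]; exact: contD.
have /choice[b2 H2] : forall ijk : I * I * 'I_n, exists B : R,
    forall q, flow_compact T0 ijk.1.1 ijk.1.2 q ->
    `|'D_(space_dir R ijk.2) (flowc phi (c ijk.1.1) (c ijk.1.2)) q| <= B.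
  by move=> [[i j] k]; exact: contD.
have [B1 B11 HB1] := @fin_upper R _ b1; have [B2 B21 HB2] := @fin_upper R _ b2.
exists (B1 + B2); first by lra.
move=> i j s x sT wx wy; have Kq := flow_compactE sT wx wy.
have dx := wide_dom wx; have dy := wide_dom wy.
split; last first.
  rewrite -(XE dx dy); apply: le_trans (H1 (i, j) _ Kq) _.
  by apply: le_trans (HB1 _) _; lra.
rewrite DE // -[jac_rows _ _ _]subr0.
have -> : (0 : 'M[R]_n) = jac_rows (@space_dir R n) (cst 0) (s, c i x).
  by apply/matrixP => k l; rewrite !mxE derive_cst mxE.
apply: jac_rows_le => [|k]; first by lra.
rewrite derive_cst subr0; apply: le_trans (H2 (i, j, k) _ Kq) _.
by apply: le_trans (HB2 _) _; lra.
Qed.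

Lemma X_lower_bound (L : set M) : closed L ->
  (forall x, L x -> vfield phi x != 0) ->
  exists2 m : R, 0 < m & forall i x, wide i x -> L x -> m <= `|X i x|.
Proof.
move=> cL X0.
have Xnz i x : cdom (c i) x -> L x -> X i x != 0.
  move=> dx Lx; apply/eqP => X0'; have := X0 x Lx.
  have := @XM_push R n M phi sphi (c i) (chart_at x) 0 x (gch_atlas i) (chart_at_atlas x) dx.
  rewrite (flow0 sphi) // => /(_ (chart_at_dom x)).
  by rewrite -/(X i x) X0' mul0mx vfield_XM => <-; rewrite eqxx.
have /choice[m Hm] : forall i, exists m : R, 0 < m /\
    forall x, wide i x -> L x -> m <= `|X i x|.
  move=> i; pose P (m : R) x := cdom (c i) x -> m <= `|X i x|.
  have cK : compact (wide i `&` L).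
    apply: (@subclosed_compact _ _ [set: M]) => //; last exact: mcompact.
    by apply: closedI => //; exact: wide_closed.
  have [m m0 H] : exists2 m, 0 < m & forall x, (wide i `&` L) x -> P m x.
    apply: compact_uniform cK _ _ => [r r' x r'0 rr' Px dx|x [wx Lx]].
      exact: le_trans rr' (Px dx).
    have Xp : 0 < `|X i x| by rewrite normr_gt0; exact: Xnz (wide_dom wx) Lx.
    exists (`|X i x| / 2); first by rewrite divr_gt0.
    have [|r r0 Hr] := @flow_uniform 0 (`|X i x| / 2); first by rewrite divr_gt0.
    have [||_ HX] := Hr i i 0 x _ wx; rewrite ?normr0 ?(flow0 sphi) //.
    apply: filterS (chart_preim_nbhs (B := [set w : 'rV[R]_n | `|w - c i x| < r])
      (wide_dom wx) _); last by apply/nbhs_normP; exists r.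
    move=> x' [dx' /= xr] _; have [_ _ h] := HX x' dx' xr.
    move: h; rewrite !(flow0 sphi) => h.
    exact: half_norm_lower h.
  by exists m; split=> // x wx Lx; apply: H => //; exact: wide_dom wx.
have [|m0 m00 H] := @fin_lower_pos R _ m; first by move=> i; case: (Hm i).
exists m0 => // i x wx Lx; apply: le_trans (H i) _.
by have [_] := Hm i; apply.
Qed.

(** Derivative of a change of charts, written as the flow at time 0 so that the chain rule [DM_comp]
    applies to it as well. *)
Definition to_center i x : 'M[R]_n := DM phi (c i) (chart_at x) 0 x.
Definition of_center i x : 'M[R]_n := DM phi (chart_at x) (c i) 0 x.

Lemma to_of_center i x : cdom (c i) x -> to_center i x *m of_center i x = 1%:M.
Proof.
move=> dx; have := @DM_inv R n M phi sphi (c i) (chart_at x) 0 x (gch_atlas i)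
  (chart_at_atlas x) dx.
by rewrite oppr0 (flow0 sphi) // => -> //; exact: chart_at_dom.
Qed.

Lemma of_to_center i x : cdom (c i) x -> of_center i x *m to_center i x = 1%:M.
Proof. by move=> /to_of_center; exact: mulmx1C. Qed.

Lemma D_tangent i j s x : cdom (c i) x -> cdom (c j) (phi s x) ->
  D i j s x = to_center i x *m tangent_map (phi s) x *m of_center j (phi s x).
Proof.
move=> dx dy; have ax := chart_at_atlas x; have ay := chart_at_atlas (phi s x).
have ai := gch_atlas i; have aj := gch_atlas j.
have h := @DM_comp R n M phi sphi (c i) (chart_at x) (chart_at (phi s x)) 0 s x ai ax ay dx.
rewrite !(flow0 sphi) // addr0 in h.
rewrite tangent_map_DM /to_center -(h (chart_at_dom x) (chart_at_dom _)).
have := @DM_comp R n M phi sphi (c i) (chart_at (phi s x)) (c j) s 0 x ai ay aj dx.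
by rewrite add0r => /(_ (chart_at_dom _) dy).
Qed.

Lemma D_inv i j s x : cdom (c i) x -> cdom (c j) (phi s x) ->
  D i j s x *m D j i (- s) (phi s x) = 1%:M.
Proof. by move=> *; apply: DM_inv => //; exact: gch_atlas. Qed.

Lemma D_push_X i j s x : cdom (c i) x -> cdom (c j) (phi s x) ->
  X i x *m D i j s x = X j (phi s x).
Proof. by move=> *; apply: XM_push => //; exact: gch_atlas. Qed.

(** In the coordinates of the fixed chart [i] the Gram matrix [N i] is continuous, in contrast to
    [g], which refers to [chart_at x]. It is therefore bounded, and bounded below as a quadratic
    form, on a compact ball. *)
Lemma tnorm_compare (g : M -> 'M[R]_n) : riemannian_metric g ->
  exists2 kap : R, 1 <= kap & forall i x (v : 'rV[R]_n), wide i x ->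
    tnorm g x (v *m to_center i x) <= kap * `|v| /\
    `|v| <= kap * tnorm g x (v *m to_center i x).
Proof.
move=> [gsym gpos gsm].
pose N i (y : 'rV[R]_n) : 'M[R]_n :=
  let J := 'J (chart_at (cinv (c i) y) \o cinv (c i)) y in
  J *m g (cinv (c i) y) *m J^T.
have tN i x (v : 'rV[R]_n) : cdom (c i) x ->
    tnorm g x (v *m to_center i x) = Num.sqrt ((v *m N i (c i x) *m v^T) 0 0).
  move=> dx; rewrite /tnorm /N /=.
  have E : cmap (chart_at x) \o cinv (c i) = (fun u => chart_at x (phi 0 (cinv (c i) u))).
    by apply/funext => u; rewrite (flow0 sphi).
  by rewrite (cmapK dx) E trmx_mul !mulmxA.
have Nc i (y : 'rV[R]_n) : cball (z i) (2 * rho i) y -> {for y, continuous (N i)}.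
  move=> By; apply: smooth_on_continuous (gsm _ (gch_atlas i)) _.
  by apply: gc_ball; apply: le_trans By _; rewrite ler_pM2r ?gcr_gt0 // ler_nat.
have Npos i x v : cdom (c i) x -> v != 0 -> 0 < qf (N i (c i x)) v.
  move=> dx v0; have := gpos x (v *m to_center i x).
  have tE := tN i x v dx; rewrite /tnorm in tE.
  have -> : v *m to_center i x != 0.
    apply: contra_neq v0 => v0; rewrite -[v]mulmx1 -(to_of_center dx).
    by rewrite mulmxA v0 mul0mx.
  move=> /(_ isT) pos; rewrite -sqrtr_gt0 -tE sqrtr_gt0; exact: pos.
clearbody N.
have /choice[b Hb] : forall i, exists b : R, forall y : 'rV[R]_n, cball (z i) (2 * rho i) y ->
    `|N i y| <= b.
  move=> i; have [|b _ H] := continuous_bounded (f := N i) (@cball_compact _ _ (z i) (2 * rho i)).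
    exact: Nc.
  by exists b.
have /choice[m Hm] : forall i, exists m : R, 0 < m /\ forall y : 'rV[R]_n, cball (z i) (2 * rho i) y ->
    forall v, m * `|v| ^+ 2 <= qf (N i y) v.
  move=> i; have [m m0 H] : exists2 m : R, 0 < m & forall y : 'rV[R]_n, cball (z i) (2 * rho i) y ->
      forall v, m * `|v| ^+ 2 <= qf (N i y) v.
    apply: compact_uniform; first exact: cball_compact.
      by move=> r r' y r'0 rr' H v; apply: le_trans (H v); rewrite ler_wpM2r ?exprn_ge0.
    move=> y By; have iy : cimg (c i) y.
      by apply: gc_ball; apply: le_trans By _; rewrite ler_pM2r ?gcr_gt0 // ler_nat.
    have [|m m0 Hm] := @qf_lower R n (N i y).
      by move=> v v0; rewrite -(cinvK iy); apply: Npos => //; exact: cinv_dom.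
    exists (m / 2); first by rewrite divr_gt0.
    pose K : R := n%:R ^+ 2 + 1; have K0 : 0 < K by rewrite ltr_wpDl // exprn_ge0.
    have /continuous_normP/(_ (m / 2 / K)) := Nc i y By; rewrite !divr_gt0 //.
    move=> /(_ isT)[d d0 Hd]; apply/nbhs_normP.
    exists d; first exact: d0.
    move=> y' /Hd h v.
    have := qf_le (N i y' - N i y) v; rewrite qfB ler_norml => /andP[h1 _].
    have := Hm v; have v2 : 0 <= `|v| ^+ 2 by rewrite exprn_ge0.
    have : n%:R ^+ 2 * `|N i y' - N i y| * `|v| ^+ 2 <= m / 2 * `|v| ^+ 2.
      rewrite ler_wpM2r //; apply: (@le_trans _ _ (K * (m / 2 / K))).
        by apply: ler_pM; [exact: exprn_ge0|exact: normr_ge0|rewrite /K lerDl|exact: ltW].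
      by rewrite mulrC divfK // gt_eqF.
    by lra.
  by exists m.
have [B B1 HB] := @fin_upper R _ b.
have [|m0 m00 Hm0] := @fin_lower_pos R _ m; first by move=> i; case: (Hm i).
pose s := Num.sqrt m0; have s0 : 0 < s by rewrite sqrtr_gt0.
exists (n%:R * B + 1 + s^-1).
  have B0 : 0 <= B by lra.
  have h1 : 0 <= n%:R * B by rewrite mulr_ge0.
  have h2 : 0 < s^-1 by rewrite invr_gt0.
  by lra.
move=> i x v [dx wx]; rewrite tN //; have B0 : 0 <= B by lra.
have ub : Num.sqrt (qf (N i (c i x)) v) <= n%:R * B * `|v|.
  have -> : n%:R * B * `|v| = Num.sqrt ((n%:R * B * `|v|) ^+ 2).
    by rewrite sqrtr_sqr ger0_norm // !mulr_ge0.
  rewrite ler_sqrt ?exprn_ge0 ?mulr_ge0 //; apply: le_trans (ler_norm _) _.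
  apply: le_trans (qf_le _ _) _; rewrite !exprMn ler_wpM2r ?exprn_ge0 //.
  rewrite ler_wpM2l ?exprn_ge0 //; apply: le_trans (Hb i _ wx) _.
  by apply: le_trans (HB i) _; rewrite ler_eXnr.
have lb : s * `|v| <= Num.sqrt (qf (N i (c i x)) v).
  have -> : s * `|v| = Num.sqrt (m0 * `|v| ^+ 2).
    by rewrite sqrtrM ?ltW // sqrtr_sqr normr_id.
  have [_ /(_ _ wx v) h] := Hm i.
  by apply: ler_wsqrtr; apply: le_trans h; rewrite ler_wpM2r ?exprn_ge0.
have v0 := normr_ge0 v; have si : 0 < s^-1 by rewrite invr_gt0.
split; first by apply: le_trans ub _; rewrite ler_wpM2r //; lra.
apply: (@le_trans _ _ (s^-1 * Num.sqrt (qf (N i (c i x)) v))).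
  by rewrite -ler_pdivrMl // ?invrK // mulrC.
by rewrite ler_wpM2r ?sqrtr_ge0 // lerDr addr_ge0 // mulr_ge0.
Qed.

End UniformFlow.

(** * The hyperbolic splitting in charts *)

Section Projections.
Variables (F : fieldType) (n : nat).

Lemma direct3_proj (E1 E2 E3 : 'M[F]_n) :
  mxdirect (E1 + E2 + E3) -> (E1 + E2 + E3 :=: 1%:M)%MS ->
  exists P1 P2 P3 : 'M[F]_n,
  [/\ P1 + P2 + P3 = 1%:M,
      [/\ (P1 <= E1)%MS, (P2 <= E2)%MS & (P3 <= E3)%MS],
      forall p (W : 'M[F]_(p, n)), (W <= E1)%MS -> [/\ W *m P1 = W, W *m P2 = 0 & W *m P3 = 0],
      forall p (W : 'M[F]_(p, n)), (W <= E2)%MS -> [/\ W *m P1 = 0, W *m P2 = W & W *m P3 = 0]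
    & forall p (W : 'M[F]_(p, n)), (W <= E3)%MS -> [/\ W *m P1 = 0, W *m P2 = 0 & W *m P3 = W]].
Proof.
rewrite mxdirectE /= => /eqP rk full.
have d12 : mxdirect (E1 + E2).
  rewrite mxdirectE /= eqn_leq mxrank_adds_leqif /=.
  have := mxrank_adds_leqif (E1 + E2)%MS E3; rewrite rk => -[h _].
  by rewrite -(leq_add2r (\rank E3)).
have i12 : (E1 :&: E2 = 0)%MS by apply/mxdirect_addsP.
have i123 : ((E1 + E2) :&: E3 = 0)%MS.
  apply/mxdirect_addsP; rewrite mxdirectE /= rk; move: d12; rewrite mxdirectE /=.
  by move/eqP ->.
pose A := proj_mx (E1 + E2)%MS E3; pose P3 := proj_mx E3 (E1 + E2)%MS.
pose B1 := proj_mx E1 E2; pose B2 := proj_mx E2 E1.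
have i21 : (E2 :&: E1 = 0)%MS by rewrite capmxC.
have i312 : (E3 :&: (E1 + E2) = 0)%MS by rewrite capmxC.
have A3 : A + P3 = 1%:M.
  have s1 : (1%:M <= E1 + E2 + E3)%MS by rewrite full.
  by have := add_proj_mx i123 s1; rewrite !mul1mx.
have AE : (A <= E1 + E2)%MS by rewrite -[A]mul1mx proj_mx_sub.
have AB : A *m B1 + A *m B2 = A by apply: add_proj_mx.
exists (A *m B1), (A *m B2), P3; split.
- by rewrite AB.
- by rewrite -[P3]mul1mx !proj_mx_sub.
- move=> p W WE; have WE' : (W <= E1 + E2)%MS := submx_trans WE (addsmxSl _ _).
  have WA : W *m A = W := proj_mx_id i123 WE'.
  have W1 : W *m B1 = W := proj_mx_id i12 WE.
  have W2 : W *m B2 = 0 := proj_mx_0 i21 WE.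
  have W3 : W *m P3 = 0 := proj_mx_0 i312 WE'.
  by rewrite (mulmxA W A B1) (mulmxA W A B2) WA W1 W2 W3.
- move=> p W WE; have WE' : (W <= E1 + E2)%MS := submx_trans WE (addsmxSr _ _).
  have WA : W *m A = W := proj_mx_id i123 WE'.
  have W1 : W *m B1 = 0 := proj_mx_0 i12 WE.
  have W2 : W *m B2 = W := proj_mx_id i21 WE.
  have W3 : W *m P3 = 0 := proj_mx_0 i312 WE'.
  by rewrite (mulmxA W A B1) (mulmxA W A B2) WA W1 W2 W3.
- move=> p W WE; have WA : W *m A = 0 := proj_mx_0 i123 WE.
  have W3 : W *m P3 = W := proj_mx_id i312 WE.
  by rewrite (mulmxA W A B1) (mulmxA W A B2) WA W3 !mul0mx.
Qed.

End Projections.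

(* The hyperbolic splitting as projections [spS], [spC], [spU], written in every
   chart whose wide domain contains the point, instead of in [chart_at x], which
   is not continuous in [x]. *)
Record splitting (R : realType) (n : nat) (M : closed_manifold R n) (G : good_cover M)
    (phi : R -> M -> M) (L : set M) := Splitting {
  spS : 'I_(gcN G) -> M -> 'M[R]_n;
  spC : 'I_(gcN G) -> M -> 'M[R]_n;
  spU : 'I_(gcN G) -> M -> 'M[R]_n;
  spK : R;
  splam : R;
  spK1 : 1 <= spK;
  splam01 : 0 < splam < 1;
  sp_sum : forall i x, L x -> wide i x -> spS i x + spC i x + spU i x = 1%:M;
  spSS : forall i x, L x -> wide i x ->
    [/\ spS i x *m spS i x = spS i x, spS i x *m spC i x = 0 & spS i x *m spU i x = 0];
  spCC : forall i x, L x -> wide i x ->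
    [/\ spC i x *m spS i x = 0, spC i x *m spC i x = spC i x & spC i x *m spU i x = 0];
  spUU : forall i x, L x -> wide i x ->
    [/\ spU i x *m spS i x = 0, spU i x *m spC i x = 0 & spU i x *m spU i x = spU i x];
  sp_inv : forall i j s x, L x -> wide i x -> wide j (phi s x) ->
    [/\ spS i x *m D phi i j s x = D phi i j s x *m spS j (phi s x),
        spC i x *m D phi i j s x = D phi i j s x *m spC j (phi s x) &
        spU i x *m D phi i j s x = D phi i j s x *m spU j (phi s x)];
  spS_contr : forall i j s x (v : 'rV[R]_n), L x -> wide i x -> wide j (phi s x) -> 0 < s ->
    `|v *m spS i x *m D phi i j s x| <= spK * splam `^ s * `|v *m spS i x|;
  spU_contr : forall i j s x (v : 'rV[R]_n), L x -> wide i x -> wide j (phi (- s) x) -> 0 < s ->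
    `|v *m spU i x *m D phi i j (- s) x| <= spK * splam `^ s * `|v *m spU i x|;
  spC_bound : forall i j s x (v : 'rV[R]_n), L x -> wide i x -> wide j (phi s x) ->
    `|v *m spC i x *m D phi i j s x| <= spK * `|v *m spC i x|;
  spX : forall i x, L x -> wide i x -> X phi i x *m spC i x = X phi i x;
  spCX : forall i x, L x -> wide i x -> (spC i x <= X phi i x)%MS }.

Lemma splitting_exists (R : realType) (n : nat) (M : closed_manifold R n)
    (G : good_cover M) (phi : R -> M -> M) (L : set M) (g Es Ec Eu : M -> 'M[R]_n) (C lam : R) :
  smooth_flow phi -> closed L -> invariant phi L ->
  riemannian_metric g -> 1 <= C -> 0 < lam < 1 ->
  (forall x, L x ->
        [/\ mxdirect (Es x + Ec x + Eu x) /\ (Es x + Ec x + Eu x :=: 1%:M)%MS,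
            forall t,
              [/\ (Es x *m tangent_map (phi t) x :=: Es (phi t x))%MS,
                  (Ec x *m tangent_map (phi t) x :=: Ec (phi t x))%MS
                & (Eu x *m tangent_map (phi t) x :=: Eu (phi t x))%MS],
            (Ec x :=: vfield phi x)%MS /\ vfield phi x != 0,
            forall t (v : 'rV[R]_n), 0 < t -> (v <= Es x)%MS ->
              tnorm g (phi t x) (v *m tangent_map (phi t) x)
                <= C * (lam `^ t) * tnorm g x v
          & forall t (v : 'rV[R]_n), 0 < t -> (v <= Eu x)%MS ->
              tnorm g (phi (- t) x) (v *m tangent_map (phi (- t)) x)
                <= C * (lam `^ t) * tnorm g x v]) ->
  inhabited (splitting G phi L).
Proof.
move=> sphi clL invL gR C1 lam01 H.
have /choice[P HP] : forall x, exists P : 'M[R]_n * 'M[R]_n * 'M[R]_n, L x ->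
  [/\ P.1.1 + P.1.2 + P.2 = 1%:M,
      [/\ (P.1.1 <= Es x)%MS, (P.1.2 <= Ec x)%MS & (P.2 <= Eu x)%MS],
      forall p (W : 'M[R]_(p, n)), (W <= Es x)%MS -> [/\ W *m P.1.1 = W, W *m P.1.2 = 0 & W *m P.2 = 0],
      forall p (W : 'M[R]_(p, n)), (W <= Ec x)%MS -> [/\ W *m P.1.1 = 0, W *m P.1.2 = W & W *m P.2 = 0]
    & forall p (W : 'M[R]_(p, n)), (W <= Eu x)%MS -> [/\ W *m P.1.1 = 0, W *m P.1.2 = 0 & W *m P.2 = W]].
  move=> x; case: (pselect (L x)) => [Lx|]; last by exists (0, 0, 0).
  have [[d1 d2] _ _ _ _] := H x Lx; have [P1 [P2 [P3 h]]] := direct3_proj d1 d2.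
  by exists (P1, P2, P3).
pose A i x := @to_center R n M G phi i x; pose A' i x := @of_center R n M G phi i x.
have AA' i x : wide i x -> A i x *m A' i x = 1%:M.
  by move=> wx; apply: to_of_center => //; exact: wide_dom wx.
have A'A i x : wide i x -> A' i x *m A i x = 1%:M.
  by move=> wx; apply: of_to_center => //; exact: wide_dom wx.
have DT i j s x : wide i x -> wide j (phi s x) ->
    D phi i j s x = A i x *m tangent_map (phi s) x *m A' j (phi s x).
  by move=> wx wy; apply: D_tangent => //; [exact: wide_dom wx|exact: wide_dom wy].
have [kap kap1 Hk] := (tnorm_compare G sphi gR :
  exists2 kap : R, 1 <= kap & forall i x (v : 'rV[R]_n), wide i x ->
    tnorm g x (v *m A i x) <= kap * `|v| /\ `|v| <= kap * tnorm g x (v *m A i x)).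
have Xc i x : L x -> wide i x -> X phi i x *m A i x = vfield phi x.
  move=> Lx wx; have := @XM_push R n M phi sphi (gch i) (chart_at x) 0 x (gch_atlas i)
    (chart_at_atlas x) (wide_dom wx).
  by rewrite (flow0 sphi); apply; exact: chart_at_dom.
clearbody A A'.
have AK p (W : 'M[R]_(p, n)) i x : wide i x -> W *m A i x *m A' i x = W.
  by move=> wx; rewrite -mulmxA AA' // mulmx1.
have A'K p (W : 'M[R]_(p, n)) i x : wide i x -> W *m A' i x *m A i x = W.
  by move=> wx; rewrite -mulmxA A'A // mulmx1.
pose cj i x (Q : 'M[R]_n) := A i x *m Q *m A' i x.
have cjM i x Q Q' : wide i x -> cj i x Q *m cj i x Q' = cj i x (Q *m Q').
  move=> wx; by rewrite /cj !mulmxA A'K.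
have cj0 i x : cj i x 0 = 0 by rewrite /cj mulmx0 mul0mx.
have cjD i x Q Q' : cj i x (Q + Q') = cj i x Q + cj i x Q'.
  by rewrite /cj mulmxDr mulmxDl.
have cj1 i x : wide i x -> cj i x 1%:M = 1%:M by move=> wx; rewrite /cj mulmx1 AA'.
have cjDm i j s x Q Q' : wide i x -> wide j (phi s x) ->
    Q *m tangent_map (phi s) x = tangent_map (phi s) x *m Q' ->
    cj i x Q *m D phi i j s x = D phi i j s x *m cj j (phi s x) Q'.
  move=> wx wy QQ'; rewrite DT // /cj !mulmxA.
  by rewrite A'K // -(mulmxA (A i x) Q) QQ' !mulmxA A'K.
have Pinv s x : L x ->
  [/\ (P x).1.1 *m tangent_map (phi s) x = tangent_map (phi s) x *m (P (phi s x)).1.1,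
      (P x).1.2 *m tangent_map (phi s) x = tangent_map (phi s) x *m (P (phi s x)).1.2 &
      (P x).2 *m tangent_map (phi s) x = tangent_map (phi s) x *m (P (phi s x)).2].
  move=> Lx; have Ly := invL s x Lx.
  have [s1 [e1 e2 e3] _ _ _] := HP x Lx; have [_ inv _ _ _] := H x Lx.
  have [i1 i2 i3] := inv s; have [_ _ f1 f2 f3] := HP _ Ly.
  set T := tangent_map _ _ in i1 i2 i3 *.
  have TE : T = (P x).1.1 *m T + (P x).1.2 *m T + (P x).2 *m T.
    by rewrite -!mulmxDl s1 mul1mx.
  have [] := f1 _ ((P x).1.1 *m T); first by rewrite -i1 submxMr.
  move=> a1 a2 a3.
  have [] := f2 _ ((P x).1.2 *m T); first by rewrite -i2 submxMr.
  move=> b1 b2 b3.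
  have [] := f3 _ ((P x).2 *m T); first by rewrite -i3 submxMr.
  move=> c1 c2 c3.
  by rewrite {2 4 6}TE !mulmxDl a1 a2 a3 b1 b2 b3 c1 c2 c3 !addr0 !add0r.
have X0 x : L x -> vfield phi x != 0 by move=> Lx; have [_ _ [_ ?] _ _] := H x Lx.
have [m m0 Hm] := X_lower_bound G sphi clL X0.
have [BX BX1 HBX] := @flow_bounded R n M G phi sphi 0.
have XB (i : 'I_(gcN G)) x : wide i x -> `|X phi i x| <= BX.
  by move=> wx; have [||_] := HBX i i 0 x _ wx; rewrite ?normr0 ?(flow0 sphi).
have lamge0 s : 0 <= lam `^ s by exact: powR_ge0.
(* The time [s] may have either sign, so that this serves the stable direction forwards and the
   unstable one backwards. *)
have contr (E : M -> 'M[R]_n) s x (i j : 'I_(gcN G)) (v : 'rV[R]_n) : L x -> wide i x -> wide j (phi s x) ->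
  (v *m A i x <= E x)%MS ->
  (forall w : 'rV[R]_n, (w <= E x)%MS -> tnorm g (phi s x) (w *m tangent_map (phi s) x)
      <= C * (lam `^ `|s|) * tnorm g x w) ->
  `|v *m D phi i j s x| <= (kap * C * kap + BX / m) * lam `^ `|s| * `|v|.
  move=> Lx wx wy vE /(_ _ vE) h.
  have [_ h2] := Hk j (phi s x) (v *m D phi i j s x) wy.
  apply: le_trans h2 _.
  have -> : v *m D phi i j s x *m A j (phi s x) = v *m A i x *m tangent_map (phi s) x.
    by rewrite DT // !mulmxA A'K.
  have [h3 _] := Hk i x v wx.
  apply: (@le_trans _ _ (kap * (C * lam `^ `|s| * (kap * `|v|)))).
    rewrite ler_wpM2l; [|lra|] => //; apply: le_trans h _.
    by rewrite ler_wpM2l // mulr_ge0 //; lra.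
  have -> : kap * (C * lam `^ `|s| * (kap * `|v|)) = kap * C * kap * (lam `^ `|s| * `|v|) by ring.
  rewrite -[leRHS]mulrA ler_wpM2r ?mulr_ge0 // lerDl divr_ge0 //; lra.
constructor.
(* In the constant, [kap] appears twice, for the comparison of norms at the two ends of the orbit
   segment, and [BX / m] bounds the ratio of the lengths of the vector field at two points, hence
   the growth in the flow direction. *)
apply: (@Splitting R n M G phi L (fun i x => cj i x (P x).1.1) (fun i x => cj i x (P x).1.2)
  (fun i x => cj i x (P x).2) (kap * C * kap + BX / m) lam) => //.
- have h1 : 1 <= kap * C by rewrite -[1]mulr1 ler_pM.
  have h2 : 1 <= kap * C * kap by rewrite -[1]mulr1 ler_pM.
  have h3 : 0 <= BX / m by rewrite divr_ge0 //; lra.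
  by lra.
- by move=> i x Lx wx; have [s1 _ _ _ _] := HP x Lx; rewrite -!cjD s1 cj1.
- move=> i x Lx wx; have [_ [e1 e2 e3] f1 f2 f3] := HP x Lx.
  by have [a1 a2 a3] := f1 _ _ e1; rewrite !cjM // a1 a2 a3 cj0.
- move=> i x Lx wx; have [_ [e1 e2 e3] f1 f2 f3] := HP x Lx.
  by have [a1 a2 a3] := f2 _ _ e2; rewrite !cjM // a1 a2 a3 cj0.
- move=> i x Lx wx; have [_ [e1 e2 e3] f1 f2 f3] := HP x Lx.
  by have [a1 a2 a3] := f3 _ _ e3; rewrite !cjM // a1 a2 a3 cj0.
- move=> i j s x Lx wx wy; have [p1 p2 p3] := Pinv s x Lx.
  by split; apply: cjDm.
- move=> i j s x v Lx wx wy s0; rewrite -[in leRHS](ger0_norm (ltW s0)).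
  have [_ [e1 e2 e3] _ _ _] := HP x Lx; have [_ _ _ hs _] := H x Lx.
  apply: (@contr Es) => //; last by move=> w wE; have := hs s w s0 wE; rewrite (ger0_norm (ltW s0)).
  rewrite /cj !mulmxA A'K //.
  exact: submx_trans (submxMl _ _) e1.
- move=> i j s x v Lx wx wy s0; rewrite -[in leRHS](ger0_norm (ltW s0)) -(normrN s).
  have [_ [e1 e2 e3] _ _ _] := HP x Lx; have [_ _ _ _ hu] := H x Lx.
  apply: (@contr Eu) => //; last by move=> w wE; have := hu s w s0 wE; rewrite normrN (ger0_norm (ltW s0)).
  rewrite /cj !mulmxA A'K //.
  exact: submx_trans (submxMl _ _) e3.
- move=> i j s x v Lx wx wy.
  have : (v *m cj i x (P x).1.2 <= X phi i x)%MS.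
    have [_ [e1 e2 e3] _ _ _] := HP x Lx; have [_ _ [ec _] _ _] := H x Lx.
    have : (v *m cj i x (P x).1.2 *m A i x <= X phi i x *m A i x)%MS.
      rewrite Xc // /cj !mulmxA A'K // -ec.
      exact: submx_trans (submxMl _ _) e2.
    by move=> /(submxMr (A' i x)); rewrite !AK.
  move=> /sub_rVP[a ->]; rewrite -scalemxAl D_push_X //; [|exact: wide_dom wx|exact: wide_dom wy].
  rewrite 2!normrZ mulrCA; apply: (ler_wpM2l (normr_ge0 a)).
  apply: (@le_trans _ _ (BX / m * `|X phi i x|)); last first.
    by rewrite ler_wpM2r // lerDr !mulr_ge0 //; lra.
  apply: le_trans (XB _ _ wy) _; rewrite -mulrA ler_peMr //; first by lra.
  by rewrite mulrC ler_pdivlMr // mul1r Hm.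
- move=> i x Lx wx; have [_ _ _ f2 _] := HP x Lx; have [_ _ [ec _] _ _] := H x Lx.
  have vE : (vfield phi x <= Ec x)%MS by rewrite ec.
  have [_ h _] := f2 _ (vfield phi x) vE.
  by rewrite /cj !mulmxA Xc // h -(Xc i x Lx wx) AK.
- move=> i x Lx wx.
  have [_ [e1 e2 e3] _ _ _] := HP x Lx; have [_ _ [ec _] _ _] := H x Lx.
  have : (cj i x (P x).1.2 *m A i x <= X phi i x *m A i x)%MS.
    rewrite Xc // /cj A'K // -ec.
    exact: submx_trans (submxMl _ _) e2.
  by move=> /(submxMr (A' i x)); rewrite !AK.
Qed.

(** * Time reversal *)

Section Reverse.
Variables (R : realType) (n : nat) (M : closed_manifold R n).

Definition flip (p : R^o * 'rV[R]_n) : R^o * 'rV[R]_n := (- p.1, p.2).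

Lemma iderive_flip (F : R^o * 'rV[R]_n -> 'rV[R]_n) vs :
  iderive vs (F \o flip) = iderive (map flip vs) F \o flip.
Proof.
elim: vs => [//|v vs IH] /=; rewrite {}IH; set f := iderive _ F.
apply/funext => x; rewrite /derive /=; congr (lim (_ @ 0^')).
apply/funext => h; congr (_ *: (f _ - _)).
by apply: injective_projections => //=; rewrite opprD scalerN.
Qed.

Lemma derivable_flip (F : R^o * 'rV[R]_n -> 'rV[R]_n) x v :
  derivable F (flip x) (flip v) -> derivable (F \o flip) x v.
Proof.
rewrite /derivable => H; move: H; set f := (fun _ => _); set f' := (fun _ => _).
suff -> : f' = f by [].
apply/funext => h; rewrite /f /f' /=; congr (_ *: (F _ - _)).
by apply: injective_projections => //=; rewrite opprD scalerN.
Qed.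

Lemma flip_continuous : continuous flip.
Proof.
move=> x; apply/continuous_normP => e e0; exists e => // y.
case: x y => x1 x2 [y1 y2]; rewrite !pair_norm_lt /=.
by rewrite -opprD normrN.
Qed.

Lemma smooth_flow_reverse (phi : R -> M -> M) : smooth_flow phi -> smooth_flow (reverse phi).
Proof.
move=> [f0 fD fc fs]; split.
- by move=> x; rewrite /reverse oppr0.
- by move=> s t x; rewrite /reverse opprD.
- move=> [t x] U nU; have := fc (- t, x) U nU => -[[A B] /= [/nbhs_normP[r r0 Hr] nB] AB].
  exists ([set s | `|s - t| < r], B).
    by split => //=; apply/nbhs_normP; exists r.
  move=> [s y] /= [st By]; apply: (AB (- s, y)); split=> //=.
  by apply: Hr; rewrite -opprD normrN.
move=> c d ac ad vs x [cx dx].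
have fx := fs c d ac ad (map flip vs) (flip x).
have [] := fx; first by [].
move=> h1 h2.
have E : (fun z : R^o * 'rV[R]_n => d (reverse phi z.1 (cinv c z.2))) =
   (fun z : R^o * 'rV[R]_n => d (phi z.1 (cinv c z.2))) \o flip by [].
split; rewrite E iderive_flip.
  by apply: continuous_comp; [exact: flip_continuous|exact: h1].
by move=> v; apply: derivable_flip; exact: h2.
Qed.

Lemma XM_reverse (phi : R -> M -> M) (c : chart R n M) x :
  smooth_flow phi -> atlas c -> cdom c x -> XM (reverse phi) c x = - XM phi c x.
Proof.
move=> sphi ac cx; have h := XM_vel (smooth_flow_reverse sphi) ac cx.
apply: has_vel_uniq h _ => eta /(XM_vel sphi ac cx)[r r0 H]; exists r => // h hr.
have := H (- h); rewrite normrN => /(_ hr).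
by rewrite /reverse add0r scalerN opprK scaleNr opprK !add0r !oppr0.
Qed.

Lemma X_reverse (G : good_cover M) (phi : R -> M -> M) i x : smooth_flow phi ->
  wide (G := G) i x -> X (G := G) (reverse phi) i x = - X phi i x.
Proof. by move=> sphi wx; apply: XM_reverse => //; [exact: gch_atlas|exact: wide_dom wx]. Qed.

(** Stable and unstable parts change places, so that results on the stable projection transfer to
    the unstable one. The definition is transparent because that transfer computes the projections
    of the reversed splitting. *)
Definition splitting_reverse (G : good_cover M) (phi : R -> M -> M) (L : set M) :
  smooth_flow phi -> splitting G phi L -> splitting G (reverse phi) L.
Proof.
move=> sphi sp; apply: (@Splitting R n M G (reverse phi) L (spU sp) (spC sp) (spS sp) (spK sp) (splam sp)).
- exact: spK1.
- exact: splam01.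
- by move=> i x Lx wx; rewrite -(sp_sum sp Lx wx) addrC (addrC (spU _ _ _)) addrA.
- by move=> i x Lx wx; have [? ? ?] := spUU sp Lx wx.
- by move=> i x Lx wx; have [? ? ?] := spCC sp Lx wx.
- by move=> i x Lx wx; have [? ? ?] := spSS sp Lx wx.
- by move=> i j s x Lx wx wy; have [? ? ?] := sp_inv sp Lx wx wy.
- by move=> i j s x v Lx wx wy s0; exact: (spU_contr sp v Lx wx wy s0).
- move=> i j s x v Lx wx; rewrite /D /DM /reverse opprK => wy s0.
  exact: (spS_contr sp v Lx wx wy s0).
- by move=> i j s x v Lx wx wy; exact: (spC_bound sp v Lx wx wy).
- by move=> i x Lx wx; rewrite X_reverse // mulNmx spX.
- by move=> i x Lx wx; rewrite X_reverse // eqmx_opp; exact: spCX.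
Defined.

End Reverse.

Lemma powR_small (R : realType) (K lam eps : R) : 0 < lam < 1 -> 0 <= K -> 0 < eps ->
  exists2 T : R, 1 <= T & forall t, T <= t -> K * lam `^ t <= eps.
Proof.
move=> /andP[l0 l1] K0 e0.
have H : (K * lam ^+ m) @[m --> \oo] --> (0 : R).
  rewrite -(mulr0 K); apply: cvgMr; apply: cvg_expr.
  by rewrite ger0_norm // ltW.
have /cvgrPdist_lt/(_ _ e0)[m _ Hm] := H.
exists (m.+1%:R); first by rewrite ler1n.
move=> t mt; have := Hm m.+1 (leqnSn m); rewrite sub0r normrN ger0_norm; last first.
  by rewrite mulr_ge0 // exprn_ge0 // ltW.
move=> h; apply: le_trans (ltW h); rewrite ler_wpM2l // -powR_mulrn; last exact: ltW.
have l01 : 0 < lam <= 1 by rewrite l0 ltW.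
exact: (ger_powR l01).
Qed.

(** * Boundedness and continuity of the hyperbolic projections *)

Section ProjectionBounds.
Variables (R : realType) (n : nat) (M : closed_manifold R n) (G : good_cover M)
  (phi : R -> M -> M) (L : set M).
Hypotheses (sphi : smooth_flow phi) (invL : invariant phi L).
Variable sp : splitting G phi L.
Local Notation I := 'I_(gcN G).
Local Notation V := 'rV[R]_n.
Local Notation S := (spS sp).
Local Notation C := (spC sp).
Local Notation U := (spU sp).
Local Notation K := (spK sp).
Local Notation lam := (splam sp).
Implicit Types (i j : I) (x : M) (v : V).

Lemma wide_exists x : exists i, wide i x.
Proof. by have [i /core_wide wx] := gc_cover G x; exists i. Qed.

Lemma lam_le1 (s : R) : 0 < s -> lam `^ s <= 1.
Proof.
move=> s0; have /andP[l0 l1] := splam01 sp.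
have l01 : 0 < lam <= 1 by rewrite l0 ltW.
by rewrite -[leRHS](powRr0 lam); apply: (ger_powR l01); exact: ltW.
Qed.

Lemma spK_ge0 : 0 <= K. Proof. exact: le_trans ler01 (spK1 sp). Qed.

Lemma D_mul_le (T : R) : exists2 B : R, 1 <= B & forall i j s x v, `|s| <= T -> wide i x ->
  wide j (phi s x) -> `|v *m D phi i j s x| <= B * `|v|.
Proof.
have [B B1 HB] := @flow_bounded R n M G phi sphi T.
exists (n%:R * B + 1); first by rewrite lerDr mulr_ge0 //; lra.
move=> i j s x v sT wx wy; apply: le_trans (mulmx_right_norm _ _) _.
rewrite ler_wpM2r //; have [h _] := HB i j s x sT wx wy.
by apply: ler_wpDr => //; rewrite ler_wpM2l.
Qed.

Lemma DK i j s x v : wide i x -> wide j (phi s x) ->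
  v *m D phi i j s x *m D phi j i (- s) (phi s x) = v.
Proof.
move=> wx wy; rewrite -mulmxA D_inv ?mulmx1 //; [exact: wide_dom wx|exact: wide_dom wy].
Qed.

Lemma center_push_back i j s x v : L x -> wide i x -> wide j (phi s x) ->
  `|v *m C i x| <= K * `|v *m C i x *m D phi i j s x|.
Proof.
move=> Lx wx wy; have [_ cD _] := sp_inv sp Lx wx wy.
have Ly := invL s Lx.
have := spC_bound sp (v *m D phi i j s x) (i := j) (j := i) (s := - s) Ly wy.
rewrite flowK // => /(_ wx).
have -> : v *m D phi i j s x *m C j (phi s x) = v *m C i x *m D phi i j s x.
  by rewrite -!mulmxA cD.
by rewrite DK.
Qed.

(** Flow backwards for a time [T]: the unstable part shrinks to at most the fraction [(2 * K)^-1],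
    while the center part loses at most the factor [K]. So the two cannot nearly cancel unless both
    are small. *)
Lemma center_unstable_angle : exists2 B : R, 1 <= B & forall i x v, L x -> wide i x ->
  `|v *m C i x| <= B * `|v *m (C i x + U i x)|.
Proof.
have K1 := spK1 sp; have K0 := spK_ge0.
have [|T T1 HT] := powR_small (splam01 sp) K0 (eps := (2 * K)^-1).
  by rewrite invr_gt0; lra.
have T0 : 0 < T by lra.
have [B B1 HB] := D_mul_le T.
exists (2 * K * B + 1); first by rewrite lerDr !mulr_ge0 //; lra.
move=> i x v Lx wx; have [j wy] := wide_exists (phi (- T) x).
set D1 := D phi i j (- T) x.
have h1 := center_push_back v Lx wx wy.
have h2 := spU_contr sp v Lx wx wy T0.
have h3 := HT T (lexx T).
have TT : `|- T| <= T by rewrite normrN gtr0_norm.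
have h4 := HB i j (- T) x (v *m (C i x + U i x)) TT wx wy.
rewrite -/D1 in h1 h2 h4; rewrite mulmxDr mulmxDl in h4.
rewrite mulmxDr; set a := v *m C i x in h1 h4 *; set b := v *m U i x in h2 h4 *.
have h5 : `|a *m D1| <= B * `|a + b| + K * lam `^ T * `|b|.
  have := ler_normB (a *m D1 + b *m D1) (b *m D1); rewrite addrK => h.
  by apply: le_trans h _; exact: lerD.
have h6 : `|b| <= `|a + b| + `|a|.
  by have := ler_normB (a + b) a; rewrite addrAC subrr add0r.
have h7 : K * lam `^ T * `|b| <= (2 * K)^-1 * (`|a + b| + `|a|).
  by apply: ler_pM => //; rewrite ?mulr_ge0 ?powR_ge0.
have h8 : K * `|a *m D1| <= K * (B * `|a + b| + (2 * K)^-1 * (`|a + b| + `|a|)).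
  by rewrite ler_wpM2l //; lra.
have h9 : K * ((2 * K)^-1 * (`|a + b| + `|a|)) = (`|a + b| + `|a|) / 2.
  by rewrite mulrA invfM mulrCA divff ?mulr1 1?mulrC //; apply: lt0r_neq0; lra.
rewrite mulrDr h9 in h8; rewrite mulrDl mul1r; move: h1 h8; rewrite -!mulrA; lra.
Qed.

(** Each summand is controlled in backward time; the angle bound allows their sum to control them
    both. *)
Lemma cu_backward : exists2 B : R, 1 <= B & forall i j s x v, L x -> wide i x ->
  wide j (phi (- s) x) -> 0 < s ->
  `|v *m (C i x + U i x) *m D phi i j (- s) x| <= B * `|v *m (C i x + U i x)|.
Proof.
have K1 := spK1 sp; have K0 := spK_ge0.
have [B B1 HB] := center_unstable_angle.
exists (K * (2 * B + 1)).
  by rewrite -[leLHS]mulr1; apply: ler_pM => //; lra.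
move=> i j s x v Lx wx wy s0; have h1 := HB i x v Lx wx.
have h2 := spC_bound sp v Lx wx wy; have h3 := spU_contr sp v Lx wx wy s0.
have h4 := lam_le1 s0.
rewrite mulmxDr mulmxDl; rewrite mulmxDr in h1.
set a := v *m C i x in h1 h2 *; set b := v *m U i x in h1 h3 *.
have h6 : `|b| <= `|a + b| + `|a|.
  by have := ler_normB (a + b) a; rewrite addrAC subrr add0r.
have h7 : K * lam `^ s * `|b| <= K * `|b|.
  by rewrite ler_wpM2r // ler_piMr.
apply: le_trans (ler_normD _ _) _.
apply: (@le_trans _ _ (K * (`|a| + `|b|))); first by rewrite mulrDr; apply: lerD => //; apply: le_trans h3 _.
by rewrite -mulrA ler_wpM2l // mulrDl mul1r; lra.
Qed.

Lemma cu_forward : exists2 B : R, 1 <= B & forall i j s x v, L x -> wide i x ->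
  wide j (phi s x) -> 0 < s ->
  `|v *m (C i x + U i x)| <= B * `|v *m (C i x + U i x) *m D phi i j s x|.
Proof.
have [B B1 HB] := cu_backward; exists B => // i j s x v Lx wx wy s0.
have [_ cD uD] := sp_inv sp Lx wx wy; have Ly := invL s Lx.
have := HB j i s (phi s x) (v *m D phi i j s x) Ly wy; rewrite flowK // => /(_ wx s0).
have -> : v *m D phi i j s x *m (C j (phi s x) + U j (phi s x)) =
   v *m (C i x + U i x) *m D phi i j s x.
  by rewrite -!mulmxA mulmxDr mulmxDl cD uD.
by rewrite DK.
Qed.

(** Flow forwards for a time [T]: a large stable part in a short vector would be balanced by an
    equally large center-unstable part. The latter shrinks at most by the factor [B3], the former at
    least to the fraction [(2 * B3)^-1]. *)
Lemma stable_projection_bounded : exists2 B : R, 1 <= B & forall i x v, L x -> wide i x ->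
  `|v *m S i x| <= B * `|v|.
Proof.
have K1 := spK1 sp; have K0 := spK_ge0.
have [B3 B31 H3] := cu_forward.
have B30 : 0 < B3 by lra.
have [|T T1 HT] := powR_small (splam01 sp) K0 (eps := (2 * B3)^-1).
  by rewrite invr_gt0; lra.
have T0 : 0 < T by lra.
have [B B1 HB] := D_mul_le T.
exists (2 * (B3 * B + 1)).
  have : 0 <= B3 * B by rewrite mulr_ge0; lra.
  by move=> ?; lra.
move=> i x v Lx wx; have [j wy] := wide_exists (phi T x).
have TT : `|T| <= T by rewrite gtr0_norm.
have h1 := HB i j T x v TT wx wy.
have h2 := spS_contr sp v Lx wx wy T0.
have h3 := HT T (lexx T).
have h4 := H3 i j T x v Lx wx wy T0.
set D1 := D phi i j T x in h1 h2 h4.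
have vE : v = v *m S i x + v *m (C i x + U i x).
  by rewrite -mulmxDr addrA sp_sum // mulmx1.
have vDE : v *m (C i x + U i x) *m D1 = v *m D1 - v *m S i x *m D1.
  by rewrite -mulmxBl {2}vE addrAC subrr add0r.
set a := v *m S i x in h2 vE vDE *; set w := v *m _ in h4 vE vDE.
have h5 : `|a| <= `|v| + `|w|.
  by have := ler_normB v w; rewrite {1}vE addrK.
have h6 : K * lam `^ T * `|a| <= (2 * B3)^-1 * `|a| by rewrite ler_wpM2r.
have h7 : `|w *m D1| <= B * `|v| + (2 * B3)^-1 * `|a|.
  by rewrite vDE; apply: le_trans (ler_normB _ _) _; apply: lerD => //; exact: le_trans h6.
have h8 : B3 * `|w *m D1| <= B3 * (B * `|v|) + `|a| / 2.
  apply: (@le_trans _ _ (B3 * (B * `|v| + (2 * B3)^-1 * `|a|))); first by rewrite ler_wpM2l // ltW.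
  rewrite mulrDr lerD2l mulrA invfM mulrCA divff ?mulr1 1?mulrC //; exact: lt0r_neq0.
move: h8; rewrite mulrDr mulrDl mulr1 -!mulrA; lra.
Qed.

Lemma flow_near (T0 eta : R) : 0 < eta -> exists2 r : R, 0 < r & forall i j s x x',
  `|s| <= T0 -> wide i x -> core j (phi s x) -> cdom (gch i) x' ->
  `|gch i x' - gch i x| < r ->
  [/\ wide j (phi s x'), `|D phi i j s x' - D phi i j s x| <= eta,
      `|X phi j (phi s x') - X phi j (phi s x)| <= eta &
      `|gch j (phi s x') - gch j (phi s x)| <= eta].
Proof.
move=> eta0; have [B B1 HB] := D_mul_le T0.
pose e := Num.min eta 1; have e0 : 0 < e by rewrite lt_min eta0 ltr01.
have [r0 r00 H] := @flow_uniform R n M G phi sphi T0 e e0.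
have [|p p0 Hp] := @fin_lower_pos R _ (@gcr R n M G); first exact: gcr_gt0.
pose q := Num.min eta p; have q0 : 0 < q by rewrite lt_min eta0.
exists (Num.min r0 (q / (B + 1))); first by rewrite lt_min r00 divr_gt0 //; lra.
move=> i j s x x' sT wx cy dx'; rewrite lt_min => /andP[xr xq].
have wy := core_wide cy.
have [H1 H2] := H i j s x sT wx wy.
have [dy' hD hX] := H2 x' dx' xr.
have [||||_ _] := H1 (gch i x' - gch i x) 0 0 0; rewrite ?normr0 //.
rewrite addrCA subrr !addr0 !(cmapK dx') (cmapK (wide_dom wx)) !subr0 scale0r addr0 normr0 addr0 => h.
have he : e <= 1 by rewrite /e ge_min lexx orbT.
have hn : `|gch j (phi s x') - gch j (phi s x)| < q.
  have h2 := HB i j s x (gch i x' - gch i x) sT wx wy.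
  have := ler_normD (gch j (phi s x') - gch j (phi s x) - (gch i x' - gch i x) *m D phi i j s x)
    ((gch i x' - gch i x) *m D phi i j s x); rewrite subrK.
  have : e * `|gch i x' - gch i x| <= 1 * `|gch i x' - gch i x| by rewrite ler_wpM2r.
  move: xq; rewrite ltr_pdivlMr; last by lra.
  lra.
have qe : q <= eta by rewrite /q ge_min lexx.
have qp : q <= p by rewrite /q ge_min lexx orbT.
have ee : e <= eta by rewrite /e ge_min lexx.
split; [|exact: le_trans hD ee|exact: le_trans hX ee|exact: le_trans (ltW hn) qe].
split=> //; have [_ cz] := cy; rewrite -(subrKA (gch j (phi s x))).
apply: le_trans (ler_normD _ _) _; have := Hp j; lra.
Qed.

Lemma cu_projection_bounded : exists2 B : R, 1 <= B & forall i x v, L x -> wide i x ->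
  `|v *m (C i x + U i x)| <= B * `|v|.
Proof.
have [B B1 HB] := stable_projection_bounded; exists (1 + B); first by lra.
move=> i x v Lx wx; have h := HB i x v Lx wx.
have -> : v *m (C i x + U i x) = v - v *m S i x.
  have h1 := congr1 (mulmx v) (sp_sum sp Lx wx).
  by rewrite mulmx1 -addrA mulmxDr in h1; rewrite -{2}h1 addrAC subrr add0r.
by apply: le_trans (ler_normB _ _) _; rewrite mulrDl mul1r lerD2l.
Qed.

Lemma mulmx_near (A A' : 'M[R]_n) v (e b : R) : `|A' - A| <= e -> `|v *m A| <= b ->
  `|v *m A'| <= b + n%:R * e * `|v|.
Proof.
move=> h1 h2; have -> : v *m A' = v *m A + v *m (A' - A) by rewrite -mulmxDr addrC subrK.
apply: le_trans (ler_normD _ _) _; apply: lerD => //.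
by apply: le_trans (mulmx_right_norm _ _) _; rewrite ler_wpM2r // ler_wpM2l.
Qed.

Lemma core_exists x : exists j, core j x.
Proof. by have [j] := gc_cover G x; exists j. Qed.

(* A vector is nearly stable at a nearby point [x'] if and only if it stays small
   under the flow for a long time, and this is a continuous condition. *)
Lemma stable_projection_continuous (eta : R) : 0 < eta ->
  exists2 r : R, 0 < r & forall i x x' v, L x -> L x' -> wide i x -> wide i x' ->
    `|gch i x' - gch i x| < r -> `|v *m S i x' - v *m S i x| <= eta * `|v|.
Proof.
move=> eta0; have K1 := spK1 sp; have K0 := spK_ge0.
have [Bs Bs1 HBs] := stable_projection_bounded.
have [Bc Bc1 HBc] := cu_projection_bounded.
have [B3 B31 H3] := cu_forward; have [B4 B41 H4] := cu_backward.
pose Q := B3 * Bc * Bs + Bs * (B4 + 1) * Bc.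
have Q1 : 1 <= Q.
  rewrite /Q; have h1 : 1 * 1 <= B3 * Bc by apply: ler_pM => //; lra.
  have h2 : 1 * 1 <= B3 * Bc * Bs by apply: ler_pM => //; lra.
  have h3 : 0 <= Bs * (B4 + 1) * Bc by rewrite !mulr_ge0 //; lra.
  lra.
pose e := eta / (4 * Q); have e0 : 0 < e by rewrite divr_gt0 //; lra.
have [T T1 HT] := powR_small (splam01 sp) K0 e0.
have T0 : 0 < T by lra.
pose e1 := Num.min e 1 / n.+1%:R.
have e10 : 0 < e1 by rewrite divr_gt0 // lt_min e0 ltr01.
have ne1 : n%:R * e1 <= Num.min e 1.
  rewrite /e1 mulrCA ler_piMr //; first by rewrite le_min ler01 andbT ltW.
  by rewrite ler_pdivrMr ?mul1r ?ler_nat ?ltr0n.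
have ne1e : n%:R * e1 <= e by apply: le_trans ne1 _; rewrite ge_min lexx.
have ne11 : n%:R * e1 <= 1 by apply: le_trans ne1 _; rewrite ge_min lexx orbT.
have [r r0 Hr] := flow_near T e10.
exists r => // i x x' v Lx Lx' wx wx' xr.
have dx' := wide_dom wx'.
have Bs0 : 0 <= Bs by lra.
have Bc0 : 0 <= Bc by lra.
have B30 : 0 <= B3 by lra.
have B40 : 0 <= B4 + 1 by lra.
have hA : forall u : V, `|u *m S i x *m (C i x' + U i x')| <= 2 * e * (B3 * Bc) * `|u *m S i x|.
  move=> u; have [j cy] := core_exists (phi T x); have wy := core_wide cy.
  have TT : `|T| <= T by rewrite gtr0_norm.
  have [wy' hD _ _] := Hr i j T x x' TT wx cy dx' xr.
  set a := u *m S i x.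
  have h1 : `|a *m D phi i j T x| <= e * `|a|.
    by apply: le_trans (spS_contr sp u Lx wx wy T0) _; rewrite ler_wpM2r // HT.
  have h2 := mulmx_near hD h1.
  have h3 : `|a *m D phi i j T x'| <= 2 * e * `|a|.
    apply: le_trans h2 _; rewrite -mulrDl; apply: ler_wpM2r; first exact: normr_ge0.
    by clear -ne1e ne11; lra.
  have [_ cD uD] := sp_inv sp Lx' wx' wy'.
  have h4 : `|a *m (C i x' + U i x') *m D phi i j T x'| <= Bc * (2 * e * `|a|).
    have -> : a *m (C i x' + U i x') *m D phi i j T x' =
       a *m D phi i j T x' *m (C j (phi T x') + U j (phi T x')).
      by rewrite -(mulmxA a) mulmxDl cD uD -mulmxDr (mulmxA a).
    apply: le_trans (HBc _ _ _ (invL T Lx') wy') _.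
    exact: (ler_wpM2l Bc0 h3).
  apply: le_trans (H3 i j T x' a Lx' wx' wy' T0) _.
  apply: (@le_trans _ _ (B3 * (Bc * (2 * e * `|a|)))); first exact: (ler_wpM2l B30 h4).
  by rewrite le_eqVlt; apply/orP; left; apply/eqP; ring.
have hB : forall u : V, `|u *m (C i x + U i x) *m S i x'| <=
    e * (Bs * (B4 + 1)) * `|u *m (C i x + U i x)|.
  move=> u; have [j cy] := core_exists (phi (- T) x); have wy := core_wide cy.
  have TT : `|- T| <= T by rewrite normrN gtr0_norm.
  have [wy' hD _ _] := Hr i j (- T) x x' TT wx cy dx' xr.
  set a := u *m (C i x + U i x).
  have h1 := H4 i j T x u Lx wx wy T0; rewrite -/a in h1.
  have h2 := mulmx_near hD h1.
  have h3 : `|a *m D phi i j (- T) x'| <= (B4 + 1) * `|a|.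
    apply: le_trans h2 _; rewrite -mulrDl; apply: ler_wpM2r; first exact: normr_ge0.
    by clear -ne1e ne11; lra.
  have [sD _ _] := sp_inv sp Lx' wx' wy'.
  set y' := phi (- T) x' in wy' sD; have Ly' : L y' := invL (- T) Lx'.
  have y'T : phi T y' = x' by rewrite /y' (flowNK sphi).
  have wyx : wide i (phi T y') by rewrite y'T.
  have h5 := spS_contr sp (a *m D phi i j (- T) x') Ly' wy' wyx T0.
  have E : a *m D phi i j (- T) x' *m S j y' *m D phi j i T y' = a *m S i x'.
    rewrite -(mulmxA a) -sD -!mulmxA -{2}[T]opprK.
    by rewrite (D_inv sphi dx' (wide_dom wy')) mulmx1.
  rewrite E in h5; apply: le_trans h5 _.
  apply: (@le_trans _ _ (e * (Bs * ((B4 + 1) * `|a|)))).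
    apply: ler_pM.
    - exact: mulr_ge0 K0 (powR_ge0 _ _).
    - exact: normr_ge0.
    - exact: HT.
    - exact: le_trans (HBs _ _ _ Ly' wy') (ler_wpM2l Bs0 h3).
  by rewrite le_eqVlt; apply/orP; left; apply/eqP; ring.
(* Only cross terms survive: vectors stable at [x] seen in the center-unstable space at [x'], small
   by flowing forwards as in [hA], and the converse, small by flowing backwards as in [hB]. *)
have -> : v *m S i x' - v *m S i x =
    v *m (C i x + U i x) *m S i x' - v *m S i x *m (C i x' + U i x').
  have E1 : v *m S i x' = v *m S i x *m S i x' + v *m (C i x + U i x) *m S i x'.
    by rewrite -mulmxDl -mulmxDr addrA sp_sum // mulmx1.
  have E2 : v *m S i x = v *m S i x *m S i x' + v *m S i x *m (C i x' + U i x').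
    by rewrite -mulmxDr addrA sp_sum // mulmx1.
  by rewrite E1 {2}E2 opprD addrACA subrr add0r.
apply: le_trans (ler_normB _ _) _.
apply: (@le_trans _ _ (e * (Bs * (B4 + 1)) * (Bc * `|v|) + 2 * e * (B3 * Bc) * (Bs * `|v|))).
  apply: lerD.
    apply: le_trans (hB v) (ler_wpM2l _ (HBc _ _ _ Lx wx)).
    exact: mulr_ge0 (ltW e0) (mulr_ge0 Bs0 B40).
  apply: le_trans (hA v) (ler_wpM2l _ (HBs _ _ _ Lx wx)).
  exact: mulr_ge0 (mulr_ge0 (ler0n _ 2) (ltW e0)) (mulr_ge0 B30 Bc0).
have -> : e * (Bs * (B4 + 1)) * (Bc * `|v|) + 2 * e * (B3 * Bc) * (Bs * `|v|) =
   e * (Bs * (B4 + 1) * Bc + 2 * (B3 * Bc * Bs)) * `|v| by ring.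
rewrite ler_wpM2r //; apply: (@le_trans _ _ (e * (4 * Q))); last first.
  by rewrite /e divfK // mulf_neq0 ?gt_eqF //; exact: lt_le_trans ltr01 Q1.
apply: ler_wpM2l; first exact: ltW.
have h1 := mulr_ge0 (mulr_ge0 B30 Bc0) Bs0.
have h2 := mulr_ge0 (mulr_ge0 Bs0 B40) Bc0.
by rewrite /Q; lra.
Qed.

End ProjectionBounds.

(** * Shadowing for the flow *)

Section FlowMetric.
Variables (R : realType) (n : nat) (M : closed_manifold R n) (G : good_cover M).
Local Notation I := 'I_(gcN G).
Local Notation V := 'rV[R]_n.
Local Notation mdist := (@mdist R n M G).

Lemma mdist_bounded : exists2 B : R, 1 <= B & forall x y : M, mdist x y <= B.
Proof.
have [[x0 _]|nM] := pselect (exists x0 : M, True); last first.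
  by exists 1 => // x; exfalso; apply: nM; exists x.
have [|x _|r r0 H] := @compact_uniform R M [set: M] (fun r x => mdist x0 x <= 1 / r) (@mcompact R n M).
- move=> r r' x r'0 rr' h; apply: le_trans h _.
  by rewrite !div1r lef_pV2 // posrE //; exact: lt_le_trans rr'.
- have h := mdist_ge0 G x0 x; exists (1 / (mdist x0 x + 1)); first by rewrite divr_gt0 //; lra.
  apply/(@mdist_nbhsP R n M G); exists 1 => // y xy; rewrite div1r invf_div divr1.
  by have := mdist_triangle G x x0 y; lra.
exists (2 / r + 1); first by rewrite lerDr divr_ge0 // ltW.
move=> x y; have := mdist_triangle G x0 x y; rewrite (mdistC G x x0).
by have := H x Logic.I; have := H y Logic.I; lra.
Qed.

Variable phi : R -> M -> M.
Hypothesis sphi : smooth_flow phi.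

Lemma wide_small : exists2 p : R, 0 < p & forall (i : I) (x y : M), core i x -> cdom (gch i) y ->
  `|gch i y - gch i x| <= p -> wide i y.
Proof.
have [|p p0 Hp] := @fin_lower_pos R _ (@gcr R n M G); first exact: gcr_gt0.
exists p => // i x y [_ cx] dy h; split=> //.
have := ler_normD (gch i y - gch i x) (gch i x - gcz i); rewrite subrKA.
have := Hp i; lra.
Qed.

(** Points closer than [e] are compared through the derivative in charts; for the others, the bound
    [A] on all distances, divided by [e], is a Lipschitz constant. *)
Lemma flow_lip (T0 : R) : exists2 K : R, 1 <= K & forall (s : R) x y,
  `|s| <= T0 -> mdist (phi s x) (phi s y) <= K * mdist x y.
Proof.
have [d d0 Hd] := core_near_wide G; have [K K0 HK] := mdist_chart_upper G.
have [r r0 Hr] := @flow_uniform R n M G phi sphi T0 1 ltr01.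
have [r' r'0 Hr'] := @flow_near R n M G phi sphi T0 1 ltr01.
have [B B1 HB] := @D_mul_le R n M G phi sphi T0.
have [A A1 HA] := mdist_bounded.
pose e := Num.min d (Num.min r r'); have e0 : 0 < e by rewrite !lt_min d0 r0 r'0.
have g1 : 0 <= K * (B + 1) by rewrite mulr_ge0 ?ltW //; lra.
have g2 : 0 <= A / e by rewrite divr_ge0 ?ltW //; lra.
exists (K * (B + 1) + A / e + 1); first by lra.
move=> s x y sT; have h0 := mdist_ge0 G x y.
have [far|] := leP e (mdist x y).
  apply: le_trans (HA _ _) _; apply: (@le_trans _ _ (A / e * mdist x y)).
    by rewrite -mulrA ler_peMr //; [lra|rewrite ler_pdivlMl // mulr1].
  by rewrite ler_wpM2r //; lra.
rewrite !lt_min => /and3P[xd xr xr'].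
have [i cx] := core_exists G x; have wx := core_wide cx; have wy := Hd _ _ _ cx xd.
have [j cx'] := core_exists G (phi s x); have wx' := core_wide cx'.
have h := wide_chart_dist wy wx; rewrite (mdistC G y x) in h.
have [wy' _ _ _] := Hr' i j s x y sT wx cx' (wide_dom wy) (le_lt_trans h xr').
have [H1 _] := Hr i j s x sT wx wx'.
have [||||_ _] := H1 (gch i y - gch i x) 0 0 0; rewrite ?normr0 //.
  exact: le_lt_trans h xr.
rewrite addrCA subrr !addr0 !(cmapK (wide_dom wy)) (cmapK (wide_dom wx)) !subr0 scale0r addr0 normr0 addr0 => h1.
have h2 := HB i j s x (gch i y - gch i x) sT wx wx'.
have h3 := ler_normD (gch j (phi s y) - gch j (phi s x) - (gch i y - gch i x) *m D phi i j s x)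
    ((gch i y - gch i x) *m D phi i j s x); rewrite subrK in h3.
have h4 := HK _ _ _ wx' wy'; rewrite distrC in h4.
apply: le_trans h4 _; apply: (@le_trans _ _ (K * ((B + 1) * mdist x y))).
  rewrite ler_pM2l //; apply: le_trans h3 _.
  apply: le_trans (lerD h1 h2) _; rewrite -mulrDl [1 + B]addrC.
  by rewrite ler_wpM2l //; lra.
by rewrite mulrA ler_wpM2r //; lra.
Qed.

Lemma flow_time_lip : exists2 K : R, 1 <= K & forall (t : R) x,
  mdist (phi t x) x <= K * `|t|.
Proof.
have [p p0 Hp] := wide_small; have [K K0 HK] := mdist_chart_upper G.
have [r r0 Hr] := @flow_uniform R n M G phi sphi 0 1 ltr01.
have [B B1 HB] := @flow_bounded R n M G phi sphi 0.
have [A A1 HA] := mdist_bounded.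
pose e := Num.min r (p / (B + 1)).
have e0 : 0 < e by rewrite lt_min r0 divr_gt0 //; lra.
have g1 : 0 <= K * (B + 1) by rewrite mulr_ge0 ?ltW //; lra.
have g2 : 0 <= A / e by rewrite divr_ge0 ?ltW //; lra.
exists (K * (B + 1) + A / e + 1); first by lra.
move=> t x; have h0 := normr_ge0 t.
have [far|] := leP e `|t|.
  apply: le_trans (HA _ _) _; apply: (@le_trans _ _ (A / e * `|t|)).
    by rewrite -mulrA ler_peMr //; [lra|rewrite ler_pdivlMl // mulr1].
  by rewrite ler_wpM2r //; lra.
rewrite lt_min ltr_pdivlMr; last by lra.
move=> /andP[tr tp].
have [i cx] := core_exists G x; have wx := core_wide cx.
have wx0 : wide i (phi 0 x) by rewrite (flow0 sphi).
have z0 : `|0 : R| <= 0 by rewrite normr0.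
have [H1 _] := Hr i i 0 x z0 wx wx0.
have [||||_] := H1 0 0 t 0; rewrite ?normr0 //.
rewrite !addr0 add0r (cmapK (wide_dom wx)) (flow0 sphi) !subr0 mul0mx normr0 !add0r mul1r => dt h1.
have [_ h2] := HB i i 0 x z0 wx wx0; rewrite (flow0 sphi) in h2.
have h3 := ler_normD (gch i (phi t x) - gch i x - t *: X phi i x) (t *: X phi i x).
rewrite subrK normrZ in h3.
have h4 : `|gch i (phi t x) - gch i x| <= (B + 1) * `|t|.
  apply: le_trans h3 _; apply: le_trans (lerD h1 (ler_wpM2l h0 h2)) _.
  by rewrite le_eqVlt; apply/orP; left; apply/eqP; ring.
have wt : wide i (phi t x) by apply: Hp cx dt _; apply: le_trans h4 _; rewrite mulrC ltW.
apply: le_trans (HK _ _ _ wt wx) _; apply: (@le_trans _ _ (K * ((B + 1) * `|t|))).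
  by rewrite ler_wpM2l // ltW.
by rewrite mulrA ler_wpM2r //; lra.
Qed.

End FlowMetric.

(** Separate statement so that the arithmetic is decided in a small context. It bounds the distance
    from the image of a center to the next center. *)
Lemma chain_bound4 (R : realType) (D a b e f e' g Lm del : R) :
  0 < del -> D <= a + b -> b <= e + f -> a <= Lm * g -> Lm * g <= Lm * del ->
  e <= e' -> e' <= del -> f < del -> D < del * (Lm + 3).
Proof. lra. Qed.

Lemma chain_bound2 (R : realType) (D e f e' del d : R) :
  0 < del -> D <= e + f -> e <= e' -> e' <= del -> f < del -> 3 * del < d -> D < d.
Proof. lra. Qed.

(** Replaces the velocity [x] at the image point by the velocity [x'] at the next center, and
    displacements from the center by displacements from the pseudo-orbit. Half of [e] pays for
    it. *)
Lemma recenter_bound (R : realType) (n : nat) (o z z' f f' p x x' : 'rV[R]_n) (A : 'M[R]_n)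
    (t t' e : R) : 0 <= e ->
  `|f - f' - ((o + z - (o + z')) *m A + (t - t') *: x)| <=
    e / 2 * (`|o + z - (o + z')| + `|t - t'|) -> `|x - x'| <= e / 2 ->
  `|f - p - (f' - p) - ((z - z') *m A + (t - t') *: x')| <= e * (`|z - z'| + `|t - t'|).
Proof.
move=> e0; have -> : o + z - (o + z') = z - z' by rewrite opprD addrACA subrr add0r.
move: (z - z') => v; move: (t - t') => s h1 h2.
have -> : f - p - (f' - p) - (v *m A + s *: x') =
   f - f' - (v *m A + s *: x) + s *: (x - x').
  move: (v *m A) => u; apply/rowP => j; rewrite !mxE; ring.
apply: le_trans (ler_normD _ _) _; rewrite normrZ.
have h3 : `|s| * `|x - x'| <= `|s| * (e / 2) by rewrite ler_wpM2l.
have h4 : 0 <= e * `|v| by rewrite mulr_ge0.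
lra.
Qed.

(* The weights [w] make shadowing points close to pseudo-orbits where the jumps
   are small, which yields the exponential estimates. *)
Definition shadowing (R : realType) (n : nat) (M : closed_manifold R n) (G : good_cover M)
    (phi : R -> M -> M) (L : set M) (tau delta Cs : R) : Prop :=
  forall (N : nat) (brk : pred 'I_N.+1) (w : 'I_N.+1 -> R) (x : 'I_N.+1 -> M)
    (s : 'I_N.+1 -> R) (eps : R),
  0 <= eps -> eps <= delta ->
  (forall k, exists2 c, L c & mdist G (x k) c < delta) ->
  (forall k, tau <= s k <= 2 * tau) ->
  (forall k, 0 < w k) -> (forall k, w k <= 1) ->
  (forall k, w (ordS k) <= 2 * w k) -> (forall k, w k <= 2 * w (ordS k)) ->
  (forall k, ~~ brk k -> mdist G (phi (s k) (x k)) (x (ordS k)) <= eps * w k) ->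
  exists (y : 'I_N.+1 -> M) (t : 'I_N.+1 -> R), forall k,
    [/\ mdist G (y k) (x k) <= Cs * eps * w k, `|t k| <= Cs * eps * w k &
        ~~ brk k -> phi (s k + t k) (y k) = y (ordS k)].

Section FlowShadowing.
Variables (R : realType) (n : nat) (M : closed_manifold R n) (G : good_cover M)
  (phi : R -> M -> M) (L : set M).
Hypotheses (sphi : smooth_flow phi) (closedL : closed L) (invL : invariant phi L)
  (regL : forall x, L x -> vfield phi x != 0).
Variable sp : splitting G phi L.
Local Notation I := 'I_(gcN G).
Local Notation V := 'rV[R]_n.
Local Notation mdist := (@mdist R n M G).
Local Notation S := (spS sp).
Local Notation C := (spC sp).
Local Notation U := (spU sp).
Local Notation K := (spK sp).
Local Notation lam := (splam sp).

Lemma unstable_projection_bounded : exists2 B : R, 1 <= B & forall i x (v : V), L x -> wide i x ->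
  `|v *m U i x| <= B * `|v|.
Proof.
have invL' : invariant (reverse phi) L by move=> t x; exact: invL.
exact: (@stable_projection_bounded R n M G _ L (smooth_flow_reverse sphi) invL' (splitting_reverse sphi sp)).
Qed.

Lemma unstable_projection_continuous (eta : R) : 0 < eta ->
  exists2 r : R, 0 < r & forall i x x' (v : V), L x -> L x' -> wide i x -> wide i x' ->
    `|gch i x' - gch i x| < r -> `|v *m U i x' - v *m U i x| <= eta * `|v|.
Proof.
have invL' : invariant (reverse phi) L by move=> t x; exact: invL.
exact: (@stable_projection_continuous R n M G _ L (smooth_flow_reverse sphi) invL' (splitting_reverse sphi sp)).
Qed.

(** The linear form giving the coefficient along [X] of the center part: the rows of [C i x] are
    multiples of [X phi i x], which the pseudo-inverse divides out. *)
Definition center_form i x : 'cV[R]_n := C i x *m pinvmx (X phi i x).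

Lemma center_formE i x : L x -> wide i x -> center_form i x *m X phi i x = C i x.
Proof. by move=> Lx wx; exact: mulmxKpV (spCX sp Lx wx). Qed.

Lemma col_row_eq0 (u : 'cV[R]_n) (v : V) : v != 0 -> u *m v = 0 -> u = 0.
Proof.
move=> v0 uv; have [j vj] : exists j, v 0 j != 0.
  apply: contrapT => h; move/negP: v0; apply; apply/eqP/rowP => j; rewrite mxE.
  by apply: contrapT => /eqP vj; apply: h; exists j.
apply/colP => i; rewrite mxE; have /matrixP/(_ i j) := uv.
by rewrite !mxE big_ord1 => /eqP; rewrite mulf_eq0 (negPf vj) orbF => /eqP.
Qed.

Lemma center_form_props i x : L x -> wide i x -> X phi i x != 0 ->
  [/\ S i x *m center_form i x = 0, U i x *m center_form i x = 0 &
      rdot (X phi i x) (center_form i x) = 1].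
Proof.
move=> Lx wx X0; have lX := center_formE Lx wx.
have [_ sc _] := spSS sp Lx wx; have [_ uc _] := spUU sp Lx wx.
split.
- by apply: (col_row_eq0 X0); rewrite -mulmxA lX sc.
- by apply: (col_row_eq0 X0); rewrite -mulmxA lX uc.
have h := spX sp Lx wx; rewrite -lX rdot_mul in h.
apply/eqP; rewrite -subr_eq0.
have : (rdot (X phi i x) (center_form i x) - 1) *: X phi i x == 0.
  by rewrite scalerBl scale1r h subrr.
by rewrite scaler_eq0 (negPf X0) orbF.
Qed.

Lemma X_stable0 i x : L x -> wide i x ->
  X phi i x *m S i x = 0 /\ X phi i x *m U i x = 0.
Proof.
move=> Lx wx; have [cs _ cu] := spCC sp Lx wx.
by rewrite -(spX sp Lx wx) -!mulmxA cs cu !mulmx0.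
Qed.

(** The splitting exists only over [L], so the linear data are taken at points [c k] of [L] near the
    pseudo-orbit, while displacements are measured from the points [x k] themselves. *)
Lemma flow_shadowing : exists tau delta Cs : R,
  [/\ 1 <= tau, 0 < delta, 1 <= Cs & shadowing G phi L tau delta Cs].
Proof.
have [Bs Bs1 HBs] := stable_projection_bounded sphi invL sp.
have [Bu Bu1 HBu] := unstable_projection_bounded.
have [m m0 Hm] := @X_lower_bound R n M G phi sphi L closedL regL.
have [BX BX1 HBX] := @flow_bounded R n M G phi sphi 0.
pose b := Bs + Bu; have b1 : 1 <= b by rewrite /b; lra.
have b0 : 0 < b by apply: lt_le_trans ltr01 b1.
(* [tau] will be so large that one step contracts by [a], the norm bound [b] of the projections
   included. *)
pose a := (24 * b)^-1; have a0 : 0 < a by rewrite invr_gt0 mulr_gt0.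
have Kb : 0 <= K * b by rewrite mulr_ge0 ?(ltW b0) // (spK_ge0 sp).
have [tau tau1 Htau] := powR_small (splam01 sp) Kb a0.
have [BD BD1 HBD] := @D_mul_le R n M G phi sphi (2 * tau).
pose B := b + BX + BD + (1 + b) / m.
have q0 : 0 <= (1 + b) / m by rewrite divr_ge0 // ?ltW //; lra.
have bB : b <= B by rewrite /B; lra.
have BXB : BX <= B by rewrite /B; lra.
have BDB : BD <= B by rewrite /B; lra.
have qB : (1 + b) / m <= B by rewrite /B; lra.
have B1 : 1 <= B by exact: le_trans b1 bB.
clearbody B.
have B0 : 0 < B by exact: lt_le_trans ltr01 B1.
pose eta := (84 * B ^+ 4)^-1.
have eta0 : 0 < eta by rewrite invr_gt0 mulr_gt0 // exprn_gt0.
have eta20 : 0 < eta / 2 by rewrite divr_gt0.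
have [r0 r00 Hr0] := @flow_uniform R n M G phi sphi (2 * tau) _ eta20.
have [rS rS0 HrS] := stable_projection_continuous sphi invL sp eta0.
have [rU rU0 HrU] := unstable_projection_continuous eta0.
have [rX rX0 HrX] := @flow_near R n M G phi sphi 0 _ eta20.
have [p p0 Hp] := wide_small G.
have [d d0 Hd] := core_near_wide G; have [KM KM0 HKM] := mdist_chart_upper G.
have [Lm Lm1 HLm] := @flow_lip R n M G phi sphi (2 * tau).
pose r1 := Num.min r0 p; have r10 : 0 < r1 by rewrite lt_min r00 p0.
pose r := r1 / 2; have rpos : 0 < r by rewrite divr_gt0.
pose c0 := Num.min (Num.min d rS) (Num.min rU rX).
have c00 : 0 < c0 by rewrite !lt_min d0 rS0 rU0 rX0.
(* The three terms keep [x k] within [r] of its center, the image of [c k] within [c0] of the next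
   center, and the solution of size [16 * B ^+ 3 * eps] within the radius [r] of validity. *)
pose delta := Num.min (Num.min r (c0 / (Lm + 3))) (r / (16 * B ^+ 3)).
have Lm3 : 0 < Lm + 3 := ltr_wpDl (le_trans ler01 Lm1) (ltr0Sn R 2).
have B3 : 0 < 16 * B ^+ 3 by rewrite mulr_gt0 // exprn_gt0.
have de0 : 0 < delta by rewrite !lt_min rpos !divr_gt0.
pose Cs := (KM + 1) * (16 * B ^+ 3).
have B31 : 1 <= 16 * B ^+ 3.
  have h16 : 1 <= 16 :> R by rewrite ler1n.
  by have := ler_pM ler01 ler01 h16 (exprn_ege1 3 B1); rewrite mulr1.
exists tau, delta, Cs; split=> //.
  rewrite /Cs; have : 1 * 1 <= (KM + 1) * (16 * B ^+ 3).
    by apply: ler_pM => //; rewrite lerDr ltW.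
  by rewrite mulr1.
move=> N brk w x s eps eps0 epsd Hx Hs w0 w1 wn wp Hlink.
have dr : delta <= r by rewrite /delta !ge_min lexx.
have dc : delta * (Lm + 3) <= c0.
  by rewrite -ler_pdivlMr // /delta !ge_min lexx orbT.
have dB : 16 * B ^+ 3 * delta <= r.
  by rewrite mulrC -ler_pdivlMr // /delta !ge_min lexx orbT.
have cd : c0 <= d by rewrite /c0 !ge_min lexx.
have cS : c0 <= rS by rewrite /c0 !ge_min lexx orbT.
have cU : c0 <= rU by rewrite /c0 !ge_min lexx orbT.
have cX : c0 <= rX by rewrite /c0 !ge_min lexx !orbT.
clearbody delta c0.
have dd : 3 * delta < d.
  have : delta * 3 < delta * (Lm + 3) by rewrite ltr_pM2l // ltrDr (lt_le_trans ltr01 Lm1).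
  by rewrite mulrC => h; exact: lt_le_trans h (le_trans dc cd).
have dltd : delta < d by apply: lt_trans dd; rewrite ltr_pMl // ltr1n.
have Lm0 : 0 <= Lm by exact: le_trans ler01 Lm1.
have /choice[c Hc] : forall k, exists c, L c /\ mdist (x k) c < delta.
  by move=> k; have [c ? ?] := Hx k; exists c.
have Lc k : L (c k) by have [] := Hc k.
have xc k : mdist (x k) (c k) < delta by have [] := Hc k.
have /choice[i ci] : forall k, exists i : I, core i (c k).
  by move=> k; exact: core_exists.
have wc k : wide (i k) (c k) by apply: core_wide.
have wx k : wide (i k) (x k).
  by apply: Hd (ci k) _; rewrite mdistC; exact: lt_trans (xc k) dltd.
have sabs k : `|s k| <= 2 * tau.
  have /andP[h1 h2] := Hs k; rewrite ger0_norm //; exact: le_trans (le_trans ler01 tau1) h1.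
have ew k : eps * w k <= delta.
  apply: le_trans epsd; rewrite ler_piMr //.
have Hclose k : ~~ brk k -> mdist (phi (s k) (c k)) (c (ordS k)) < c0.
  move=> nb; apply: lt_le_trans dc.
  have h1 := mdist_triangle G (phi (s k) (x k)) (phi (s k) (c k)) (c (ordS k)).
  have h2 := mdist_triangle G (x (ordS k)) (phi (s k) (x k)) (c (ordS k)).
  have h3 := HLm (s k) (c k) (x k) (sabs k).
  have h4 := Hlink k nb; have h5 := ew k; have h6 := xc (ordS k).
  have h7 : Lm * mdist (c k) (x k) <= Lm * delta.
    by apply: ler_wpM2l => //; rewrite mdistC; exact: ltW.
  exact: chain_bound4 de0 h1 h2 h3 h7 h4 h5 h6.
have wpc k : ~~ brk k -> wide (i (ordS k)) (phi (s k) (c k)).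
  move=> nb; apply: Hd (ci (ordS k)) _; rewrite mdistC.
  exact: lt_le_trans (Hclose k nb) cd.
have wpx k : ~~ brk k -> wide (i (ordS k)) (phi (s k) (x k)).
  move=> nb; apply: Hd (ci (ordS k)) _; rewrite mdistC.
  have h2 := mdist_triangle G (x (ordS k)) (phi (s k) (x k)) (c (ordS k)).
  have h4 := Hlink k nb; have h5 := ew k; have h6 := xc (ordS k).
  exact: chain_bound2 de0 h2 h4 h5 h6 dd.
have chc k : ~~ brk k -> `|gch (i (ordS k)) (phi (s k) (c k)) - gch (i (ordS k)) (c (ordS k))| < c0.
  by move=> nb; apply: le_lt_trans (wide_chart_dist _ _) (Hclose k nb); [exact: wpc|exact: wc].
have Xn0 k : X phi (i k) (c k) != 0.
  by rewrite -normr_gt0; exact: lt_le_trans m0 (Hm _ _ (wc k) (Lc k)).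
have norm0 : `|0 : R| <= 0 by rewrite normr0.
have xcr k : `|gch (i k) (x k) - gch (i k) (c k)| < r.
  apply: le_lt_trans (wide_chart_dist (wx k) (wc k)) _.
  exact: lt_le_trans (xc k) dr.
pose F k (v : V) (t : R) : V :=
  gch (i (ordS k)) (phi (s k + t) (cinv (gch (i k)) (gch (i k) (x k) + v))) -
  gch (i (ordS k)) (x (ordS k)).
have rr : r + r = r1 by rewrite /r -splitr.
have r1r0 : r1 <= r0 by rewrite /r1 ge_min lexx.
have r1p : r1 <= p by rewrite /r1 ge_min lexx orbT.
have rr0 : r < r0 by apply: lt_le_trans r1r0; rewrite -rr ltrDl.
have shift k (v : V) : gch (i k) (x k) + v = gch (i k) (c k) + (gch (i k) (x k) - gch (i k) (c k) + v).
  by rewrite addrA addrCA subrr addr0.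
have small k (v : V) : `|v| <= r -> `|gch (i k) (x k) - gch (i k) (c k) + v| < r1.
  move=> vr; apply: le_lt_trans (ler_normD _ _) _; rewrite -rr.
  exact: ltr_leD (xcr k) vr.
pose Dk k := D phi (i k) (i (ordS k)) (s k) (c k).
pose Ek k := D phi (i (ordS k)) (i k) (- s k) (phi (s k) (c k)).
pose Qs k := S (i (ordS k)) (phi (s k) (c k)).
pose Qu k := U (i (ordS k)) (phi (s k) (c k)).
pose l k := center_form (i k) (c k).
pose Xk k := X phi (i k) (c k).
have Lpc k : L (phi (s k) (c k)) := invL (s k) (Lc k).
have s0 k : 0 < s k by have /andP[h1 _] := Hs k; exact: lt_le_trans (lt_le_trans ltr01 tau1) h1.
have backE k : phi (- s k) (phi (s k) (c k)) = c k by exact: flowK.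
have wback k : wide (i k) (phi (- s k) (phi (s k) (c k))) by rewrite backE.
have aB : 24 * b * a <= 1 by rewrite divff // gt_eqF // mulr_gt0.
have etaB : 84 * B ^+ 4 * eta <= 1 by rewrite divff // gt_eqF // mulr_gt0 // exprn_gt0.
have DE k : ~~ brk k -> Dk k *m Ek k = 1%:M.
  by move=> nb; apply: (D_inv sphi); [exact: wide_dom (wc k)|exact: wide_dom (wpc k nb)].
have ED k : ~~ brk k -> Ek k *m Dk k = 1%:M.
  move=> nb; have := D_inv sphi (wide_dom (wpc k nb)) (wide_dom (wback k)).
  by rewrite opprK backE.
have P1 k : S (i k) (c k) + U (i k) (c k) + l k *m Xk k = 1%:M.
  by rewrite (center_formE (Lc k) (wc k)) addrAC (sp_sum sp (Lc k) (wc k)).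
have Pss k : S (i k) (c k) *m S (i k) (c k) = S (i k) (c k) by have [] := spSS sp (Lc k) (wc k).
have Puu k : U (i k) (c k) *m U (i k) (c k) = U (i k) (c k) by have [] := spUU sp (Lc k) (wc k).
have Psu k : S (i k) (c k) *m U (i k) (c k) = 0 by have [] := spSS sp (Lc k) (wc k).
have Pus k : U (i k) (c k) *m S (i k) (c k) = 0 by have [] := spUU sp (Lc k) (wc k).
have XPs k : Xk k *m S (i k) (c k) = 0 by have [] := X_stable0 (Lc k) (wc k).
have XPu k : Xk k *m U (i k) (c k) = 0 by have [] := X_stable0 (Lc k) (wc k).
have Psl k : S (i k) (c k) *m l k = 0 by have [] := center_form_props (Lc k) (wc k) (Xn0 k).
have Pul k : U (i k) (c k) *m l k = 0 by have [] := center_form_props (Lc k) (wc k) (Xn0 k).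
have Xl k : rdot (Xk k) (l k) = 1 by have [] := center_form_props (Lc k) (wc k) (Xn0 k).
have PsD k : ~~ brk k -> S (i k) (c k) *m Dk k = Dk k *m Qs k.
  by move=> nb; have [] := sp_inv sp (Lc k) (wc k) (wpc k nb).
have PuD k : ~~ brk k -> U (i k) (c k) *m Dk k = Dk k *m Qu k.
  by move=> nb; have [] := sp_inv sp (Lc k) (wc k) (wpc k nb).
have Qs_near k (v : V) : ~~ brk k -> `|v *m Qs k - v *m S (i (ordS k)) (c (ordS k))| <= eta * `|v|.
  move=> nb; apply: HrS (Lc _) (Lpc _) (wc _) (wpc k nb) _.
  exact: lt_le_trans (chc k nb) cS.
have Qu_near k (v : V) : ~~ brk k -> `|v *m Qu k - v *m U (i (ordS k)) (c (ordS k))| <= eta * `|v|.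
  move=> nb; apply: HrU (Lc _) (Lpc _) (wc _) (wpc k nb) _.
  exact: lt_le_trans (chc k nb) cU.
have Bsb : Bs <= b by rewrite lerDl (le_trans ler01 Bu1).
have Bub : Bu <= b by rewrite lerDr (le_trans ler01 Bs1).
have PsB k (v : V) : `|v *m S (i k) (c k)| <= b * `|v|.
  exact: le_trans (HBs _ _ v (Lc k) (wc k)) (ler_wpM2r (normr_ge0 _) Bsb).
have PuB k (v : V) : `|v *m U (i k) (c k)| <= b * `|v|.
  exact: le_trans (HBu _ _ v (Lc k) (wc k)) (ler_wpM2r (normr_ge0 _) Bub).
have Klam k (v : R) : 0 <= v -> K * lam `^ (s k) * (b * v) <= a * v.
  move=> v0; have /andP[h1 _] := Hs k; rewrite mulrA ler_wpM2r //.
  by rewrite mulrAC; exact: Htau.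
have Klam0 k : 0 <= K * lam `^ (s k) by rewrite mulr_ge0 ?(spK_ge0 sp) ?powR_ge0.
have contr_s k (v : V) : ~~ brk k -> `|v *m S (i k) (c k) *m Dk k| <= a * `|v|.
  move=> nb; apply: le_trans (spS_contr sp v (Lc k) (wc k) (wpc k nb) (s0 k)) _.
  apply: le_trans (Klam k _ (normr_ge0 v)); apply: ler_wpM2l => //; exact: PsB.
have contr_u k (v : V) : ~~ brk k -> `|v *m Qu k *m Ek k| <= a * `|v|.
  move=> nb; apply: le_trans (spU_contr sp v (Lpc k) (wpc k nb) (wback k) (s0 k)) _.
  apply: le_trans (Klam k _ (normr_ge0 v)); apply: ler_wpM2l => //.
  exact: le_trans (HBu _ _ v (Lpc k) (wpc k nb)) (ler_wpM2r (normr_ge0 _) Bub).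
have XB k : `|Xk k| <= B.
  have wc0 : wide (i k) (phi 0 (c k)) by rewrite (flow0 sphi).
  have [_ h] := HBX (i k) (i k) 0 (c k) norm0 (wc k) wc0.
  by rewrite (flow0 sphi) in h; exact: le_trans h BXB.
have lB k (v : V) : `|rdot v (l k)| <= B * `|v|.
  have h1 : `|v *m C (i k) (c k)| <= (1 + b) * `|v|.
    have -> : v *m C (i k) (c k) = v - (v *m S (i k) (c k) + v *m U (i k) (c k)).
      have h := congr1 (mulmx v) (sp_sum sp (Lc k) (wc k)).
      rewrite mulmx1 addrAC mulmxDr mulmxDr in h.
      by rewrite -{2}h addrAC subrr add0r.
    rewrite mulrDl mul1r; apply: le_trans (ler_normB _ _) _; rewrite lerD2l.
    apply: le_trans (ler_normD _ _) _; rewrite mulrDl.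
    exact: lerD (HBs _ _ v (Lc k) (wc k)) (HBu _ _ v (Lc k) (wc k)).
  rewrite -(center_formE (Lc k) (wc k)) rdot_mul normrZ in h1.
  have h2 : `|rdot v (l k)| * m <= (1 + b) * `|v|.
    apply: le_trans h1; apply: ler_wpM2l => //; exact: Hm (wc k) (Lc k).
  have h3 : `|rdot v (l k)| <= (1 + b) / m * `|v| by rewrite mulrAC ler_pdivlMr.
  exact: le_trans h3 (ler_wpM2r (normr_ge0 _) qB).
have DB k (v : V) : ~~ brk k -> `|v *m Dk k| <= B * `|v|.
  move=> nb; apply: le_trans (HBD _ _ _ _ v (sabs k) (wc k) (wpc k nb)) _.
  by rewrite ler_wpM2r // normr_ge0.
have EB k (v : V) : ~~ brk k -> `|v *m Ek k| <= B * `|v|.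
  move=> nb; have sabs' : `|- s k| <= 2 * tau by rewrite normrN.
  apply: le_trans (HBD _ _ _ _ v sabs' (wpc k nb) (wback k)) _.
  by rewrite ler_wpM2r // normr_ge0.
have Xnear k : ~~ brk k -> `|X phi (i (ordS k)) (phi (s k) (c k)) - Xk (ordS k)| <= eta / 2.
  move=> nb; have ci0 : core (i (ordS k)) (phi 0 (c (ordS k))) by rewrite (flow0 sphi).
  have [|_ _ h _] := HrX _ _ _ _ _ norm0 (wc (ordS k)) ci0 (wide_dom (wpc k nb)).
    exact: lt_le_trans (chc k nb) cX.
  by rewrite !(flow0 sphi) in h.
have FE k (z z' : V) (t t' : R) : ~~ brk k ->
   `|z| <= r -> `|z'| <= r -> `|t| <= r -> `|t'| <= r ->
   `|F k z t - F k z' t' - ((z - z') *m Dk k + (t - t') *: Xk (ordS k))|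
    <= eta * (`|z - z'| + `|t - t'|).
  move=> nb hz hz' ht ht'.
  have [H1 _] := Hr0 _ _ _ _ (sabs k) (wc k) (wpc k nb).
  have [||_ _] := H1 _ _ t t' (lt_le_trans (small k z hz) r1r0) (lt_le_trans (small k z' hz') r1r0).
  - exact: le_lt_trans ht rr0.
  - exact: le_lt_trans ht' rr0.
  rewrite -!shift => h; exact: recenter_bound (ltW eta0) h (Xnear k nb).
have F0 k : ~~ brk k -> `|F k 0 0| <= eps * w k.
  move=> nb; rewrite /F !addr0 (cmapK (wide_dom (wx k))).
  exact: le_trans (wide_chart_dist (wpx k nb) (wx (ordS k))) (Hlink k nb).
have epsr : 16 * B ^+ 3 * eps <= r by apply: le_trans dB; rewrite ler_pM2l.
have [z [t Hzt]] := @weighted_shadowing R n N brk w F Dk Ek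
  (fun k => S (i k) (c k)) (fun k => U (i k) (c k)) Qs Qu l Xk a eta b B r
  b1 bB (ltW a0) aB (ltW eta0) etaB w0 w1 wn wp DE ED P1 Pss Puu Psu Pus XPs XPu Psl Pul
  Xl PsD PuD Qs_near Qu_near contr_s contr_u PsB PuB lB XB DB EB FE eps eps0 epsr F0.
have zr k : `|z k| <= r.
  have [h _ _] := Hzt k; apply: le_trans h (le_trans _ epsr).
  by rewrite ler_piMr // mulr_ge0 // ltW.
have tr k : `|t k| <= r.
  have [_ h _] := Hzt k; apply: le_trans h (le_trans _ epsr).
  by rewrite ler_piMr // mulr_ge0 // ltW.
pose y k := cinv (gch (i k)) (gch (i k) (x k) + z k).
have yimg k : cimg (gch (i k)) (gch (i k) (x k) + z k).
  have wc0 : wide (i k) (phi 0 (c k)) by rewrite (flow0 sphi).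
  have z2 : `|0 : R| <= 2 * tau by rewrite normr0 mulr_ge0 // (le_trans ler01).
  have [H1 _] := Hr0 _ _ _ _ z2 (wc k) wc0.
  have sm := lt_le_trans (small k _ (zr k)) r1r0.
  have [||h _ _] := H1 _ _ 0 0 sm sm; rewrite ?normr0 //.
  by rewrite shift.
have ydom k : cdom (gch (i k)) (y k) by exact: cinv_dom.
have ych k : gch (i k) (y k) = gch (i k) (x k) + z k by exact: cinvK.
have wy k : wide (i k) (y k).
  apply: Hp (ci k) (ydom k) _; rewrite ych shift addrAC subrr add0r.
  exact: le_trans (ltW (small k _ (zr k))) r1p.
have CsE : Cs = KM * (16 * B ^+ 3) + 16 * B ^+ 3 by rewrite /Cs mulrDl mul1r.
have ew0 k : 0 <= eps * w k by rewrite mulr_ge0 // ltW.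
exists y, t => k; have [hz ht hF] := Hzt k; split.
- apply: le_trans (HKM _ _ _ (wy k) (wx k)) _; rewrite ych addrAC subrr add0r.
  apply: (@le_trans _ _ (KM * (16 * B ^+ 3) * (eps * w k))).
    by rewrite -mulrA ler_pM2l // mulrA.
  by rewrite -(mulrA Cs) ler_wpM2r // CsE lerDl ltW.
- apply: le_trans ht _; rewrite -!(mulrA _ eps) ler_wpM2r // CsE lerDr.
  by rewrite mulr_ge0 // ltW.
move=> nb; have := hF nb; rewrite /F => h.
have [H1 _] := Hr0 _ _ _ _ (sabs k) (wc k) (wpc k nb).
have sm := lt_le_trans (small k _ (zr k)) r1r0.
have tm := le_lt_trans (tr k) rr0.
have [_ hd _] := H1 _ _ _ _ sm sm tm tm; rewrite -shift -/(y k) in hd.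
rewrite -/(y k) in h; rewrite -(cmapK hd) -(cmapK (ydom (ordS k))) ych -h.
by rewrite addrCA subrr addr0.
Qed.

End FlowShadowing.

Lemma succ_time (R : realType) k (s : R) : k.+1%:R * s = s + k%:R * s.
Proof. by rewrite -natr1 mulrDl mul1r addrC. Qed.

Lemma half_leq m A : (2 * m <= A)%N -> (m <= A)%N. Proof. lia. Qed.

Lemma half_minn m A : (2 * m <= A)%N -> minn m (A - m) = m. Proof. lia. Qed.

Lemma exp_small (R : realType) (C e : R) : 0 <= C -> 0 < e -> exists m : nat, forall k, (m <= k)%N ->
  C * 2^-1 ^+ k < e.
Proof.
move=> C0 e0; have l01 : 0 < (2^-1 : R) < 1 by rewrite invr_gt0 invf_lt1 ?ltr0n ?ltr1n.
have e20 : 0 < e / 2 by rewrite divr_gt0.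
have [T T1 HT] := powR_small l01 C0 e20.
exists (Num.trunc T).+1 => k mk.
have T0 : 0 <= T by apply: le_trans ler01 T1.
have /andP[_ h2] := trunc_itv T0.
have Tk : T <= k%:R by apply: le_trans (ltW h2) _; rewrite ler_nat.
have := HT _ Tk; rewrite powR_mulrn ?invr_ge0 //; lra.
Qed.

(** * Pseudo-orbits and chain classes *)

Section PseudoOrbits.
Variables (R : realType) (n : nat) (M : closed_manifold R n) (G : good_cover M)
  (phi : R -> M -> M) (H : set M) (tau delta Cs : R).
Hypotheses (sphi : smooth_flow phi) (tau1 : 1 <= tau) (delta0 : 0 < delta) (Cs1 : 1 <= Cs).
Hypothesis Hsh : shadowing G phi H tau delta Cs.
Local Notation d := (@mdist R n M G).

Definition near (r : R) (A : set M) (x : M) := exists2 c, A c & d x c < r.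

(** The second term keeps the corrections of time below 1/2, while steps last at least [tau >= 1];
    corrected times therefore remain positive. *)
Definition del : R := Num.min delta (1 / (2 * Cs)).

Lemma del_gt0 : 0 < del.
Proof. by rewrite lt_min delta0 divr_gt0 // mulr_gt0 // (lt_le_trans ltr01). Qed.

(** The weight is 1 at both ends, so that pseudo-orbits can be concatenated without violating the
    conditions on neighboring weights. *)
Definition pseudo (N : nat) (w : nat -> R) (x : nat -> M) (s : nat -> R) (eps : R) : Prop :=
  [/\ forall k, (k <= N)%N ->
        [/\ near del H (x k), tau <= s k <= 2 * tau, 0 < w k & w k <= 1],
      forall k, (k < N)%N ->
        [/\ w k.+1 <= 2 * w k, w k <= 2 * w k.+1 & d (phi (s k) (x k)) (x k.+1) <= eps * w k],
      w 0%N = 1 & w N = 1].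

(** Passes from cyclic families to sequences, with [T k] the sum of the corrected times of the first
    [k] steps. Without a break the last point jumps back to the first one, and the shadowing orbit
    is periodic. *)
Lemma pseudo_shadow (brk : bool) N w x s eps : 0 <= eps -> eps <= del -> pseudo N w x s eps ->
  (~~ brk -> d (phi (s N) (x N)) (x 0%N) <= eps) ->
  exists (y : M) (T : nat -> R), [/\ T 0%N = 0,
    forall k, (k <= N)%N -> 0 <= T k /\ d (phi (T k) y) (x k) <= Cs * eps * w k &
    ~~ brk -> exists2 T' : R, 0 < T' & phi T' y = y].
Proof.
move=> eps0 epsd [h1 h2 w0 wN] hN.
have Cs0 : 0 < Cs := lt_le_trans ltr01 Cs1.
have epsd' : eps <= delta by apply: le_trans epsd _; rewrite /del ge_min lexx.
have Ceps : Cs * eps <= 1 / 2.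
  have : eps <= 1 / (2 * Cs) by apply: le_trans epsd _; rewrite /del ge_min lexx orbT.
  by rewrite ler_pdivlMr ?mulr_gt0 // ler_pdivlMr //; lra.
have le (k : 'I_N.+1) : (k <= N)%N by rewrite -ltnS.
have oS (k : 'I_N.+1) : (ordS k = k.+1 :> nat /\ (k < N)%N) \/ (ordS k = 0 :> nat /\ k = N :> nat).
  have [kN|kN] := ltnP k N; first by left; rewrite /= modn_small.
  have e : k = N :> nat by apply/eqP; rewrite eqn_leq kN le.
  by right; rewrite /= e modnn.
have [k|k|k|k|k|k|k|y [t Hyt]] := @Hsh N (fun k : 'I_N.+1 => brk && (k == N :> nat))
   (fun k : 'I_N.+1 => w k) (fun k : 'I_N.+1 => x k) (fun k : 'I_N.+1 => s k) eps eps0 epsd'.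
- have [[c Hc hc] _ _ _] := h1 k (le k); exists c => //; apply: lt_le_trans hc _.
  by rewrite /del ge_min lexx.
- by have [] := h1 k (le k).
- by have [] := h1 k (le k).
- by have [] := h1 k (le k).
- by case: (oS k) => -[-> kN]; [have [] := h2 k kN|rewrite w0 kN wN; lra].
- by case: (oS k) => -[-> kN]; [have [] := h2 k kN|rewrite w0 kN wN; lra].
- case: (oS k) => -[-> kN]; first by have [] := h2 k kN.
  by rewrite kN eqxx andbT => /hN; rewrite wN mulr1.
pose o k : 'I_N.+1 := inord k.
have oE k : (k <= N)%N -> o k = k :> nat by move=> kN; rewrite /o inordK.
have st k : (k <= N)%N -> 0 < s k + t (o k).
  move=> kN; have [_ ht _] := Hyt (o k); have [_ /andP[hs _] wk0 wk] := h1 k kN.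
  rewrite oE // in ht.
  have : Cs * eps * w k <= 1 / 2 * 1 by apply: ler_pM => //; [exact: mulr_ge0 (ltW Cs0) eps0|exact: ltW].
  by move: ht; rewrite ler_norml => /andP[ht _]; have h := tau1; lra.
pose T k := \sum_(0 <= j < k) (s j + t (o j)).
have T0 k : (k <= N.+1)%N -> 0 <= T k.
  move=> kN; rewrite /T big_nat_cond; apply: sumr_ge0 => j.
  by rewrite andbT => /andP[_ jk]; apply/ltW/st; exact: leq_trans jk kN.
have orb k : (k <= N)%N -> phi (T k) (y (o 0%N)) = y (o k).
  elim: k => [_|k IH kN]; first by rewrite /T big_nil (flow0 sphi).
  rewrite /T big_nat_recr //= addrC (flowD sphi) IH; last exact: ltnW.
  have [_ _ h] := Hyt (o k); rewrite oE in h; last exact: ltnW.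
  rewrite h; last by rewrite (ltn_eqF kN) andbF.
  congr y; apply: val_inj; rewrite /= oE; last exact: ltnW.
  by rewrite oE // modn_small.
exists (y (o 0%N)), T; split; first by rewrite /T big_nil.
  move=> k kN; split; first by apply: T0; exact: leqW.
  by rewrite orb //; have [h _ _] := Hyt (o k); rewrite oE in h.
move=> nb; exists (T N.+1).
  rewrite /T big_nat_recr //=; apply: ltr_wpDl; [exact: T0|exact: st].
rewrite /T big_nat_recr //= addrC (flowD sphi) -/(T N) orb //.
have [_ _ h] := Hyt (o N); rewrite oE // in h; rewrite h; last by rewrite (negbTE nb).
by congr y; apply: val_inj; rewrite /= !oE // modnn.
Qed.

Definition glue (T : Type) A (f g : nat -> T) k := if (k <= A)%N then f k else g (k - A.+1)%N.

Lemma glue1 T A (f g : nat -> T) k : (k <= A)%N -> glue A f g k = f k.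
Proof. by rewrite /glue => ->. Qed.

Lemma glue2 T A (f g : nat -> T) k : glue A f g (k + A.+1) = g k.
Proof. by rewrite /glue addnK; case: ifP => //; lia. Qed.

Lemma glueP A k : (k <= A)%N \/ exists j, k = (j + A.+1)%N.
Proof. by have [h|h] := leqP k A; [left|right; exists (k - A.+1)%N; lia]. Qed.

Lemma pseudo_cat A B w1 w2 x1 x2 s1 s2 eps :
  pseudo A w1 x1 s1 eps -> pseudo B w2 x2 s2 eps ->
  d (phi (s1 A) (x1 A)) (x2 0%N) <= eps ->
  pseudo (B + A.+1) (glue A w1 w2) (glue A x1 x2) (glue A s1 s2) eps.
Proof.
move=> [a1 a2 a3 a4] [b1 b2 b3 b4] hj; split.
- move=> k kN; case: (glueP A k) => [kA|[j kj]]; first by rewrite !glue1 //; exact: a1.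
  by rewrite kj !glue2; apply: b1; lia.
- move=> k kN; case: (glueP A k) => [kA|[j kj]].
    have [kA'|kA'] := ltnP k A; first by rewrite !glue1 //; exact: a2.
    have -> : k = A by lia.
    have E T (f g : nat -> T) : glue A f g A.+1 = g 0%N by rewrite -[A.+1]add0n glue2.
    by rewrite !E !glue1 // a4 b3 mulr1; split=> //; lra.
  by rewrite kj -addSn !glue2; apply: b2; lia.
- by rewrite glue1.
- by rewrite glue2.
Qed.

(** The last jump leads to [b], which is not itself an entry of the sequence; a chain starting at
    [b] can thus be appended directly. *)
Definition chain eps a b := exists (N : nat) (x : nat -> M) (s : nat -> R),
  [/\ x 0%N = a, forall k, (k <= N)%N -> H (x k), pseudo N (fun=> 1) x s eps &
      d (phi (s N) (x N)) b <= eps].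

Lemma near_in A r x : 0 < r -> A x -> near r A x.
Proof. by move=> r0 Ax; exists x => //; rewrite mdistxx. Qed.

Lemma pseudo1 N x s eps : (forall k, (k <= N)%N -> near del H (x k) /\ tau <= s k <= 2 * tau) ->
  (forall k, (k < N)%N -> d (phi (s k) (x k)) (x k.+1) <= eps) -> pseudo N (fun=> 1) x s eps.
Proof.
move=> h1 h2; split=> // k kN; first by have [] := h1 k kN.
by rewrite !mulr1; split; [lra|lra|exact: h2].
Qed.

Lemma glue_const T A (c : T) : glue A (fun=> c) (fun=> c) = fun=> c.
Proof. by apply/funext => k; rewrite /glue if_same. Qed.

Lemma chain_trans eps a b c : chain eps a b -> chain eps b c -> chain eps a c.
Proof.
move=> [A [x1 [s1 [e1 H1 p1 l1]]]] [B [x2 [s2 [e2 H2 p2 l2]]]].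
exists (B + A.+1)%N, (glue A x1 x2), (glue A s1 s2); split.
- by rewrite glue1.
- move=> k kN; case: (glueP A k) => [kA|[j kj]]; first by rewrite !glue1 //; exact: H1.
  by rewrite kj !glue2; apply: H2; lia.
- by rewrite -(@glue_const R A 1); apply: pseudo_cat => //; rewrite e2.
- by rewrite !glue2.
Qed.

(** The number of steps is the integer part [m] of [T / tau]; it is positive, and
    [T < (m + 1) * tau <= 2 * m * tau]. *)
Lemma split_time T : tau <= T -> exists (N : nat) (s : R),
  tau <= s <= 2 * tau /\ N.+1%:R * s = T.
Proof.
have t0 : 0 < tau := lt_le_trans ltr01 tau1.
move=> tT; pose m := Num.trunc (T / tau).
have q0 : 0 <= T / tau by rewrite divr_ge0 // ltW //; exact: lt_le_trans t0 tT.
have /andP[m1 m2] := trunc_itv q0; rewrite -/m in m1 m2.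
have m0 : (0 < m)%N.
  rewrite lt0n; apply/eqP => m0; move: m2; rewrite m0 ltr_pdivrMr // mul1r.
  by rewrite ltNge tT.
exists m.-1, (T / m%:R); rewrite prednK //.
have mr : 0 < m%:R :> R by rewrite ltr0n.
split; last by rewrite mulrC divfK // gt_eqF.
rewrite ler_pdivlMr // ler_pdivrMr //; move: m1; rewrite ler_pdivlMr // mulrC => -> /=.
move: m2; rewrite ltr_pdivrMr // => m2; apply: le_trans (ltW m2) _.
rewrite -mulrA [tau * _]mulrC mulrA ler_pM2r // -natrM ler_nat; lia.
Qed.

Lemma orbit_pseudo x s N eps : 0 <= eps -> tau <= s <= 2 * tau ->
  (forall k, (k <= N)%N -> near del H (phi (k%:R * s) x)) ->
  pseudo N (fun=> 1) (fun k => phi (k%:R * s) x) (fun=> s) eps.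
Proof.
move=> e0 hs hn; apply: pseudo1 => [k kN|k kN]; first by split=> //; exact: hn.
by rewrite -(flowD sphi) (succ_time k) mdistxx.
Qed.

(* The error made by closing up an orbit segment of length [A] at its two ends
   decays away from these ends. *)
Definition hat (A k : nat) : R := 2^-1 ^+ minn k (A - k).

Lemma hat_gt0 A k : 0 < hat A k. Proof. by rewrite exprn_gt0 // invr_gt0. Qed.

Lemma hat_le1 A k : hat A k <= 1.
Proof. by rewrite exprn_ile1 ?invr_ge0 // invf_le1 // ler1n. Qed.

Lemma half_exp_le m k : (m <= k.+1)%N -> 2^-1 ^+ k <= 2 * 2^-1 ^+ m :> R.
Proof.
move=> mk; apply: (@le_trans _ _ (2 * 2^-1 ^+ k.+1)); first by rewrite exprS; lra.
by rewrite ler_pM2l // ler_wiXn2l // ?invr_ge0 // invf_le1 // ler1n.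
Qed.

Lemma hat_pseudo x s A eps : 0 <= eps -> tau <= s <= 2 * tau ->
  (forall k, (k <= A)%N -> near del H (phi (k%:R * s) x)) ->
  pseudo A (hat A) (fun k => phi (k%:R * s) x) (fun=> s) eps.
Proof.
move=> e0 hs hn; split.
- by move=> k kA; rewrite hat_gt0 hat_le1; split=> //; exact: hn.
- move=> k kA; rewrite -(flowD sphi) (succ_time k) mdistxx.
  split; last by rewrite mulr_ge0 // ltW // hat_gt0.
    by apply: half_exp_le; lia.
  by apply: half_exp_le; lia.
- by rewrite /hat min0n expr0.
- by rewrite /hat subnn minn0 expr0.
Qed.

Lemma pseudo_le N w x s eps eps' : eps <= eps' -> pseudo N w x s eps -> pseudo N w x s eps'.
Proof.
move=> ee [h1 h2 h3 h4]; split=> // k kN; have [? ? h] := h2 k kN; split=> //.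
apply: le_trans h _; rewrite ler_wpM2r //; apply: ltW.
by have [_ _ h _] := h1 k (ltnW kN).
Qed.

Lemma chain_le eps eps' a b : eps <= eps' -> chain eps a b -> chain eps' a b.
Proof.
move=> ee [N [x [s [h1 h2 h3 h4]]]]; exists N, x, s; split=> //.
  exact: pseudo_le h3.
exact: le_trans h4 ee.
Qed.

Lemma chain_end eps e a b b' : d b b' <= e -> chain eps a b -> chain (eps + e) a b'.
Proof.
move=> bb [N [x [s [h1 h2 h3 h4]]]]; exists N, x, s; split=> //.
  by apply: pseudo_le h3; have := mdist_ge0 G b b'; lra.
by have := mdist_triangle G b (phi (s N) (x N)) b'; lra.
Qed.

Lemma chain_start : exists2 K : R, 1 <= K & forall eps a a' b, H a' ->
  chain eps a b -> chain (eps + K * d a' a) a' b.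
Proof.
have [K K1 HK] := @flow_lip R n M G phi sphi (2 * tau); exists K => //.
move=> eps a a' b Ha' [N [x [s [h1 h2 h3 h4]]]].
have K0 : 0 <= K * d a' a by rewrite mulr_ge0 ?mdist_ge0 // (le_trans ler01).
have ss k : (k <= N)%N -> `|s k| <= 2 * tau.
  move=> kN; have [/(_ k kN)[_ /andP[h5 h6] _ _] _ _ _] := h3; rewrite ger0_norm //.
  by apply: le_trans h5; exact: le_trans ler01 tau1.
exists N, (fun k => if k is 0%N then a' else x k), s; split=> //.
- by case=> // k kN; exact: h2.
- apply: pseudo1 => k kN.
    have [/(_ k kN)[h5 h6 _ _] _ _ _] := h3; split=> //.
    by case: k kN h5 {h6} => // _ _; apply: near_in => //; exact: del_gt0.
  have [_ /(_ k kN)[_ _ h] _ _] := h3; rewrite mulr1 in h.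
  case: k kN h => [|k] kN h /=; last by lra.
  have := mdist_triangle G (phi (s 0%N) (x 0%N)) (phi (s 0%N) a') (x 1%N).
  by have := HK (s 0%N) a' (x 0%N) (ss 0%N (ltnW kN)); rewrite h1 in h *; lra.
case: N h2 h3 h4 ss => [|N] h2 h3 h4 ss /=; last by lra.
have := mdist_triangle G (phi (s 0%N) (x 0%N)) (phi (s 0%N) a') b.
by have := HK (s 0%N) a' (x 0%N) (ss 0%N (leqnn _)); rewrite h1 in h4 *; lra.
Qed.

(** For an Axiom A flow both properties of periodic points follow from the density of periodic
    points in the nonwandering set and the positive distance of [H] from the fixed points. They are
    the only means by which shadowing orbits are recognized as points of [H]. *)
Hypotheses (invH : invariant phi H)
  (per_dense : forall x (r : R), H x -> 0 < r ->
     exists p (T : R), [/\ H p, 0 < T, phi T p = p & d x p < r])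
  (per_isol : exists2 r : R, 0 < r & forall z (T : R) c, 0 < T -> phi T z = z ->
     H c -> d z c < r -> H z).

Lemma flow_per p (T : R) k : phi T p = p -> phi (k%:R * T) p = p.
Proof.
move=> h; elim: k => [|k IH]; first by rewrite mul0r (flow0 sphi).
by rewrite succ_time (flowD sphi) IH h.
Qed.

Lemma per_time p (T S : R) : 0 < T -> phi T p = p -> exists2 T' : R, S <= T' & phi T' p = p.
Proof.
move=> T0 h; exists ((Num.trunc (`|S| / T)).+1%:R * T); last exact: flow_per.
have q0 : 0 <= `|S| / T by rewrite divr_ge0 // ltW.
have /andP[_ h2] := trunc_itv q0; rewrite ltr_pdivrMr // in h2.
by apply: le_trans (ler_norm S) _; exact: ltW.
Qed.

Lemma chain_orbit eps a b T : 0 <= eps -> H a -> tau <= T -> d (phi T a) b <= eps -> chain eps a b.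
Proof.
move=> e0 Ha tT h; have [N [s [hs hN]]] := split_time tT.
have Hk k : H (phi (k%:R * s) a) by exact: invH.
exists N, (fun k => phi (k%:R * s) a), (fun=> s); split=> //.
- by rewrite mul0r (flow0 sphi).
- apply: orbit_pseudo => // k _; apply: near_in => //; exact: del_gt0.
- by rewrite -(flowD sphi) -succ_time hN.
Qed.

(** A periodic orbit can be followed from any of its points to any other one, whatever the order of
    [u] and [v], by adding periods. *)
Lemma chain_hop eps : 0 < eps -> exists2 r : R, 0 < r & forall p T u v a b,
  H p -> 0 < T -> phi T p = p -> H a -> d a (phi u p) < r -> d (phi v p) b < r -> chain eps a b.
Proof.
move=> e0; have [K K1 HK] := chain_start.
have K0 : 0 < K by apply: lt_le_trans ltr01 K1.
exists (Num.min (eps / 2) (eps / (2 * K))); first by rewrite lt_min !divr_gt0 // mulr_gt0.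
move=> p T u v a b Hp T0 hp Ha; rewrite !lt_min => /andP[_ h1] /andP[h2 _].
have [T' hT' pT'] := per_time (tau - v + u) T0 hp.
have c1 : chain 0 (phi u p) (phi v p).
  apply: (@chain_orbit 0 _ _ (v - u + T')) => //; [exact: invH|by have h := tau1; lra|].
  by rewrite -(flowD sphi) addrAC subrK (flowD sphi) pT' mdistxx.
have c2 := HK 0 _ a _ Ha c1; have c3 := chain_end (ltW h2) c2.
apply: chain_le c3; rewrite ltr_pdivlMr ?mulr_gt0 // in h1.
by rewrite add0r; lra.
Qed.

(** Also for positive [u], where the chain goes against the flow: a periodic orbit passing close to
    [a] leads back to [a]. *)
Lemma chain_along eps a u : 0 < eps -> H a -> chain eps (phi u a) a.
Proof.
move=> e0 Ha; have [r r0 Hr] := chain_hop e0.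
have [K K1 HK] := @flow_lip R n M G phi sphi `|u|.
have K0 : 0 < K by apply: lt_le_trans ltr01 K1.
have [|p [T [Hp T0 hp ap]]] := per_dense (r := r / K) Ha; first by rewrite divr_gt0.
rewrite ltr_pdivlMr // in ap.
apply: (Hr p T u 0) => //; first exact: invH.
  by apply: le_lt_trans (HK u a p (lexx _)) _; rewrite mulrC.
rewrite (flow0 sphi) mdistC; apply: le_lt_trans ap.
by rewrite ler_peMr ?mdist_ge0.
Qed.

(** The distance [e0] does not depend on [eps]. Take periodic points [p] and [q] very near [a] and
    [b], and shadow the closed pseudo-orbit that runs along the orbit of [p] for a long time, then
    along that of [q]. Its jumps are only bounded by [E], but the weights bring the shadowing orbit
    arbitrarily close to both orbits in the middle of the two blocks; being periodic it lies in [H],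
    and chains can hop from orbit to orbit. *)
Lemma chain_local : exists2 e0 : R, 0 < e0 & forall a b, H a -> H b -> d a b < e0 ->
  forall eps, 0 < eps -> chain eps a b.
Proof.
have [r0 r00 Hr0] := per_isol.
have Cs0 : 0 < Cs by apply: lt_le_trans ltr01 Cs1.
pose E := Num.min del (r0 / (2 * Cs)).
have E0 : 0 < E by rewrite lt_min del_gt0 divr_gt0 // mulr_gt0.
have Ed : E <= del by rewrite /E ge_min lexx.
have Er : Cs * E < r0.
  have : E <= r0 / (2 * Cs) by rewrite /E ge_min lexx orbT.
  by rewrite ler_pdivlMr ?mulr_gt0 //; lra.
exists (E / 3); first by rewrite divr_gt0.
move=> a b Ha Hb ab eps eps0; have [r rr Hr] := chain_hop eps0.
pose r1 := Num.min r (E / 3); have r10 : 0 < r1 by rewrite lt_min rr divr_gt0.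
have [p [T [Hp T0 hp]]] := per_dense Ha r10; rewrite lt_min => /andP[apr apE].
have [q [S [Hq S0 hq]]] := per_dense Hb r10; rewrite lt_min => /andP[bqr bqE].
have pq : d p q <= E.
  have := mdist_triangle G a p q; have := mdist_triangle G b a q; rewrite (mdistC G p a).
  by move: apE bqE ab; lra.
have CE0 : 0 <= Cs * E by rewrite mulr_ge0 // ltW.
have [m Hm] := exp_small CE0 rr.
have block z U : H z -> 0 < U -> phi U z = z -> exists A s,
    [/\ (2 * m <= A)%N, pseudo A (hat A) (fun k => phi (k%:R * s) z) (fun=> s) E &
     phi s (phi (A%:R * s) z) = z].
  move=> Hz U0 hz; have [U' hU' zU'] := per_time ((2 * m).+1%:R * (2 * tau)) U0 hz.
  have t0 : 0 < 2 * tau by rewrite mulr_gt0 // (lt_le_trans ltr01).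
  have tU : tau <= U'.
    apply: le_trans hU'; rewrite mulrA ler_peMl ?(le_trans ler01) //.
    by rewrite -natrM ler1n.
  have [A [s [hs hA]]] := split_time tU; exists A, s; split.
  - have /andP[_ s2] := hs.
    have : (2 * m).+1%:R * (2 * tau) <= A.+1%:R * (2 * tau).
      by apply: le_trans hU' _; rewrite -hA ler_wpM2l.
    by rewrite ler_pM2r // ler_nat ltnS.
  - apply: hat_pseudo => //; first exact: ltW.
    by move=> k _; apply: near_in; [exact: del_gt0|exact: invH].
  - by rewrite -(flowD sphi) -succ_time hA.
have [A [s [Am pA zA]]] := block p T Hp T0 hp.
have [B [s' [Bm pB zB]]] := block q S Hq S0 hq.
have pc := pseudo_cat pA pB; rewrite mul0r (flow0 sphi) zA in pc.
have [|y [Ty [Ty0 Hy Hper]]] := pseudo_shadow (brk := false) (ltW E0) Ed (pc pq).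
  by move=> _; rewrite !glue2 glue1 // mul0r (flow0 sphi) zB mdistC.
have [|T' T'0 yT'] := Hper; first by [].
have Hyy : H y.
  have [_ h] := Hy 0%N (leq0n _); rewrite Ty0 !glue1 // (flow0 sphi) mul0r (flow0 sphi) in h.
  apply: (Hr0 y T' p) => //; apply: le_lt_trans h _.
  by apply: le_lt_trans Er; rewrite ler_piMr // hat_le1.
have [_ h1] : 0 <= Ty m /\ d (phi (Ty m) y) (phi (m%:R * s) p) <= Cs * E * hat A m.
  have h := Hy m (leq_trans (half_leq Am) (leq_trans (leqnSn A) (leq_addl _ _))).
  by rewrite (glue1 _ _ (half_leq Am)) (glue1 _ _ (half_leq Am)) in h.
have [_ h2] : 0 <= Ty (m + A.+1)%N /\ d (phi (Ty (m + A.+1)%N) y) (phi (m%:R * s') q) <= Cs * E * hat B m.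
  have h : (m + A.+1 <= B + A.+1)%N by rewrite leq_add2r half_leq.
  by have := Hy _ h; rewrite !glue2.
have hm D : (2 * m <= D)%N -> Cs * E * hat D m < r.
  by move=> mD; rewrite /hat half_minn //; exact: Hm.
have c1 : chain eps a (phi (Ty m) y).
  apply: (Hr p T 0 (m%:R * s)) => //; first by rewrite (flow0 sphi).
  by rewrite mdistC; apply: le_lt_trans h1 (hm _ Am).
have c2 : chain eps (phi (Ty m) y) (phi (Ty (m + A.+1)%N) y).
  by apply: (Hr y T' (Ty m) (Ty (m + A.+1)%N)) => //; rewrite ?mdistxx //; exact: invH.
have c3 : chain eps (phi (Ty (m + A.+1)%N) y) b.
  apply: (Hr q S (m%:R * s') 0) => //; [exact: invH|exact: le_lt_trans h2 (hm _ Bm)|].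
  by rewrite (flow0 sphi) mdistC.
exact: chain_trans (chain_trans c1 c2) c3.
Qed.

(* [L] is isolated in [H] and chain transitive; this is how basic sets enter. *)
Definition chain_class (L : set M) : Prop :=
  [/\ L `<=` H, closed L, invariant phi L,
      exists2 e : R, 0 < e & forall a b, L a -> H b -> d a b < e -> L b &
      forall a b (eps : R), L a -> L b -> 0 < eps -> chain eps a b].

(** Density of a whole orbit is enough, since chains can also go against the flow. This makes the
    criterion invariant under time reversal, unlike density of a forward semiorbit. *)
Lemma connected_chain_class L x0 : L `<=` H -> closed L -> invariant phi L ->
  (exists2 e : R, 0 < e & forall a b, L a -> H b -> d a b < e -> L b) ->
  L x0 -> (forall a (r : R), L a -> 0 < r -> exists t, d (phi t x0) a < r) -> chain_class L.
Proof.
move=> LH cL iL sL Lx0 dn; split=> // a b eps La Lb eps0.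
have [e0 e00 Hloc] := chain_local.
have [t1 h1] := dn a e0 La e00; have [t2 h2] := dn b e0 Lb e00.
have Hx0 t : H (phi t x0) by apply: invH; exact: LH.
have c1 : chain eps a (phi t1 x0) by apply: Hloc => //; [exact: LH|rewrite mdistC].
have c2 : chain eps (phi t1 x0) x0 by apply: chain_along => //; exact: LH.
have c3 : chain eps x0 (phi t2 x0).
  by have := chain_along (- t2) eps0 (Hx0 t2); rewrite (flowK sphi).
have c4 : chain eps (phi t2 x0) b by apply: Hloc => //; exact: LH.
exact: chain_trans (chain_trans c1 c2) (chain_trans c3 c4).
Qed.

Lemma chain_class_per L : chain_class L -> exists2 r : R, 0 < r & forall z (T : R) c, 0 < T -> phi T z = z ->
  L c -> d z c < r -> L z.
Proof.
move=> [LH _ _ [e e0 He] _]; have [r r0 Hr] := per_isol.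
exists (Num.min e r); first by rewrite lt_min e0 r0.
move=> z T c T0 hz Lc; rewrite lt_min => /andP[h1 h2].
by apply: (He c) => //; [apply: (Hr z T c) => //; exact: LH|rewrite mdistC].
Qed.

Lemma small_eps (r : R) : 0 < r -> exists2 E : R, 0 < E & E <= del /\ Cs * E < r.
Proof.
move=> r0; have Cs0 : 0 < Cs by apply: lt_le_trans ltr01 Cs1.
exists (Num.min del (r / (2 * Cs))); first by rewrite lt_min del_gt0 divr_gt0 // mulr_gt0.
split; first by rewrite ge_min lexx.
have : Num.min del (r / (2 * Cs)) <= r / (2 * Cs) by rewrite ge_min lexx orbT.
by rewrite ler_pdivlMr ?mulr_gt0 //; lra.
Qed.

(** Shadow a closed chain from [a] to [c] and back to [a]: the orbit obtained is periodic and starts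
    near [a], hence lies in [L]. *)
Lemma chain_class_mixing L a c (r : R) : chain_class L -> L a -> L c -> 0 < r ->
  exists z t, [/\ L z, 0 <= t, d z a < r & d (phi t z) c < r].
Proof.
move=> gL La Lc r0; have [LH _ _ _ chL] := gL; have [r1 r10 Hr1] := chain_class_per gL.
have rr0 : 0 < Num.min r r1 by rewrite lt_min r0 r10.
have [E E0 [Ed]] := small_eps rr0; rewrite lt_min => /andP[Er Er1].
have [A [x1 [s1 [e1 H1 p1 l1]]]] := chL a c E La Lc E0.
have [B [x2 [s2 [e2 H2 p2 l2]]]] := chL c a E Lc La E0.
have l1' : d (phi (s1 A) (x1 A)) (x2 0%N) <= E by rewrite e2.
have pc := pseudo_cat p1 p2 l1'; rewrite glue_const in pc.
have [|y [T [T0 Hy Hp]]] := pseudo_shadow (brk := false) (ltW E0) Ed pc.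
  by move=> _; rewrite !glue2 glue1 // e1.
have [|T' T'0 hT'] := Hp; first by [].
have [_ h0] := Hy 0%N (leq0n _).
rewrite T0 (flow0 sphi) glue1 // e1 mulr1 in h0.
have [h1 h2] := Hy (0 + A.+1)%N (leq_addl _ _); rewrite glue2 e2 mulr1 in h2.
exists y, (T (0 + A.+1)%N); split=> //; last 2 first.
- exact: le_lt_trans h0 Er.
- exact: le_lt_trans h2 Er.
by apply: (Hr1 y T' a) => //; exact: le_lt_trans h0 Er1.
Qed.

Lemma tau_range : tau <= tau <= 2 * tau.
Proof. by rewrite lexx /=; have := tau1; lra. Qed.

(* Close the segment to a periodic pseudo-orbit that only jumps near its ends;
   the shadowing orbit is periodic, hence in [H], and close to [L]. *)
Lemma chain_class_closing L : chain_class L -> exists rho C : R, [/\ 0 < rho, 0 <= C &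
  forall x A, (forall k, (k <= A)%N -> near rho L (phi (k%:R * tau) x)) ->
  forall k, (k <= A)%N -> exists2 c, L c & d (phi (k%:R * tau) x) c <= C * hat A k].
Proof.
move=> gL; have [LH _ iL _ chL] := gL; have [r1 r10 Hr1] := chain_class_per gL.
have r20 : 0 < r1 / 2 by rewrite divr_gt0.
have [E E0 [Ed Er]] := small_eps r20.
have [K K1 HK] := @flow_lip R n M G phi sphi tau.
have Cs0 : 0 < Cs by apply: lt_le_trans ltr01 Cs1.
have tt : `|tau| <= tau by rewrite ger0_norm // (le_trans ler01 tau1).
pose rho := Num.min (E / (K + 2)) (r1 / 2).
have K2 : 0 < K + 2 by have := K1; lra.
have rho0 : 0 < rho by rewrite lt_min r20 divr_gt0.
have rK : rho * (K + 2) <= E by rewrite -ler_pdivlMr // /rho ge_min lexx.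
have rr : rho <= r1 / 2 by rewrite /rho ge_min lexx orbT.
have CE0 : 0 <= Cs * E by rewrite mulr_ge0 // ltW.
clearbody rho; exists rho, (Cs * E); split=> // x A hx.
have KE : K * rho <= E by move: rK; rewrite mulrDr mulrC; have := rho0; lra.
have rE : 2 * rho <= E.
  have : 0 <= K * rho by rewrite mulr_ge0 ?(ltW rho0) // (le_trans ler01 K1).
  by move: rK; rewrite mulrDr; lra.
have rE1 : rho <= E by move: rE; have := rho0; lra.
have [c Lc xc] := hx A (leqnn A); have [c0 Lc0 xc0] := hx 0%N (leq0n A).
rewrite mul0r (flow0 sphi) in xc0.
have [B [x2 [s2 [e2 H2 p2 l2]]]] := chL _ _ rho (iL tau c Lc) Lc0 rho0.
have p1 : pseudo A (hat A) (fun k => phi (k%:R * tau) x) (fun=> tau) E.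
  apply: hat_pseudo; [exact: ltW|exact: tau_range|] => k kA.
  have [c1 Lc1 h1] := hx k kA; exists c1; first exact: LH.
  by apply: lt_le_trans h1 _; exact: le_trans rE1 Ed.
have l1 : d (phi tau (phi (A%:R * tau) x)) (x2 0%N) <= E.
  rewrite e2; apply: le_trans (HK tau _ _ tt) _; apply: le_trans KE.
  by rewrite ler_wpM2l ?(ltW xc) // (le_trans ler01 K1).
have pc := pseudo_cat p1 (pseudo_le rE1 p2) l1.
have [|y [T [T0 Hy Hp]]] := pseudo_shadow (brk := false) (ltW E0) Ed pc.
  move=> _; rewrite !glue2 glue1 // mul0r (flow0 sphi); apply: le_trans rE.
  apply: le_trans (mdist_triangle G c0 _ _) _; rewrite mulr_natl mulr2n.
  by apply: lerD l2 _; rewrite mdistC; exact: ltW.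
have [|T' T'0 hT'] := Hp; first by [].
have Ly : L y.
  have [_ h0] := Hy 0%N (leq0n _).
  rewrite T0 (flow0 sphi) !glue1 // mul0r (flow0 sphi) /hat min0n expr0 mulr1 in h0.
  apply: (Hr1 y T' c0) => //.
  apply: le_lt_trans (mdist_triangle G x _ _) _; rewrite [r1]splitr.
  exact: ltrD (le_lt_trans h0 Er) (lt_le_trans xc0 rr).
move=> k kA; have [_ h] := Hy k (leq_trans kA (leq_trans (leqnSn A) (leq_addl _ _))).
rewrite (glue1 _ _ kA) (glue1 _ _ kA) in h.
by exists (phi (T k) y); [exact: iL|rewrite mdistC].
Qed.

(** Here [eta] does not depend on the length of the segment of [x]. Follow [y0] until it is very
    close to [L], go by a chain to a point of [L] near [x], then follow [x]. The pseudo-orbit is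
    left open, since its ends need not be near each other. *)
Lemma chain_class_connecting L : chain_class L -> exists2 rho : R, 0 < rho & forall y0 (r : R),
  (forall k : nat, near rho L (phi (k%:R * tau) y0)) -> 0 < r ->
  exists2 eta : R, 0 < eta & forall x K, near eta L x ->
    (forall k, (k <= K)%N -> near del L (phi (k%:R * tau) x)) ->
    exists y t, [/\ 0 <= t, d y y0 < r & d (phi t y) (phi (K%:R * tau) x) < r].
Proof.
move=> gL; have [LH _ iL _ chL] := gL.
have [rho [C [rho0 C0 Hcl]]] := chain_class_closing gL.
have [K K1 HK] := @flow_lip R n M G phi sphi tau.
have K0 : 0 < K by apply: lt_le_trans ltr01 K1.
have tt : `|tau| <= tau by rewrite ger0_norm // (le_trans ler01 tau1).
exists (Num.min rho del); first by rewrite lt_min rho0 del_gt0.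
move=> y0 r hy r0.
have [E E0 [Ed Er]] := small_eps r0; have E20 : 0 < E / 2 by rewrite divr_gt0.
have KC0 : 0 <= K * C by rewrite mulr_ge0 // ltW.
have [J HJ] := exp_small KC0 E0.
have hy1 k : near rho L (phi (k%:R * tau) y0).
  by have [c Lc h] := hy k; exists c => //; apply: lt_le_trans h _; rewrite ge_min lexx.
have hy2 k : near del H (phi (k%:R * tau) y0).
  have [c Lc h] := hy k; exists c; first exact: LH.
  by apply: lt_le_trans h _; rewrite ge_min lexx orbT.
have JJ : (J <= 2 * J)%N by rewrite leq_pmull.
(* The closing estimate is best in the middle, so a segment of length [2 * J] gives precision
   [2^-1 ^+ J] at step [J]. *)
have [c Lc xc] := Hcl y0 (2 * J)%N (fun k _ => hy1 k) J JJ.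
rewrite /hat half_minn // in xc.
have jump : d (phi tau (phi (J%:R * tau) y0)) (phi tau c) <= E.
  apply: le_trans (HK tau _ _ tt) _; apply: le_trans (ltW (HJ J (leqnn J))).
  by rewrite -mulrA ler_pM2l.
exists (E / 2) => // x N [c' Lc' xc'] hx.
have [B [x2 [s2 [e2 H2 p2 l2]]]] := chL _ _ (E / 2) (iL tau c Lc) Lc' E20.
have EE : E / 2 <= E by lra.
have p1 : pseudo J (fun=> 1) (fun k => phi (k%:R * tau) y0) (fun=> tau) E.
  by apply: orbit_pseudo; [exact: ltW|exact: tau_range|].
have p3 : pseudo N (fun=> 1) (fun k => phi (k%:R * tau) x) (fun=> tau) E.
  apply: orbit_pseudo; [exact: ltW|exact: tau_range|] => k kN.
  by have [c1 Lc1 h1] := hx k kN; exists c1 => //; exact: LH.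
have l1 : d (phi tau (phi (J%:R * tau) y0)) (x2 0%N) <= E by rewrite e2.
have p12 := pseudo_cat p1 (pseudo_le EE p2) l1.
have l2' : d (phi (glue J (fun=> tau) s2 (B + J.+1)%N) (glue J (fun k => phi (k%:R * tau) y0) x2 (B + J.+1)%N))
   ((fun k => phi (k%:R * tau) x) 0%N) <= E.
  rewrite !glue2 /= mul0r (flow0 sphi).
  apply: le_trans (mdist_triangle G c' _ _) _; rewrite [E]splitr.
  by apply: lerD l2 _; rewrite mdistC; exact: ltW.
have pc := pseudo_cat p12 p3 l2'; rewrite !glue_const in pc.
have [|y [T [T0 Hy _]]] := pseudo_shadow (brk := true) (ltW E0) Ed pc; first by [].
have [_ h0] := Hy 0%N (leq0n _).
rewrite T0 (flow0 sphi) !glue1 // mul0r (flow0 sphi) mulr1 in h0.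
have [t0 h1] := Hy _ (leqnn _); rewrite glue2 mulr1 in h1.
exists y, (T (N + (B + J.+1).+1)%N); split=> //; first exact: le_lt_trans h0 Er.
exact: le_lt_trans h1 Er.
Qed.

End PseudoOrbits.

(** * Basins *)

Section Basins.
Variables (R : realType) (n : nat) (M : closed_manifold R n) (G : good_cover M)
  (phi : R -> M -> M).
Hypothesis sphi : smooth_flow phi.
Local Notation d := (@mdist R n M G).
Local Notation near := (@near R n M G).

Definition approach (L : set M) : Prop := exists rho C sigma : R,
  [/\ 0 < rho, 0 <= C, 0 < sigma & forall x, (forall k : nat, near rho L (phi (k%:R * sigma) x)) ->
    forall k : nat, exists2 c, L c & d (phi (k%:R * sigma) x) c <= C * 2^-1 ^+ k].

(** This is how attractors are recognized: Baire's theorem provides an open set of points whose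
    forward orbits stay near one basic set. *)
Definition open_attracts (L : set M) : Prop := exists2 rho : R, 0 < rho &
  forall O : set M, open O -> O !=set0 ->
  (forall y t, O y -> 0 <= t -> near rho L (phi t y)) -> L `<=` interior (Ws phi L).

Definition basin_fills (L : set M) : Prop := forall Z : set M, open Z -> invariant phi Z ->
  (Z `&` Ws phi L) !=set0 -> L `<=` closure Z.

Lemma near_open (r : R) L : open [set x | near r L x].
Proof.
rewrite openE => x [c Lc xc]; apply/(@mdist_nbhsP R n M G).
exists (r - d x c); first by rewrite subr_gt0.
move=> y xy; exists c => //; have := mdist_triangle G x y c; rewrite (mdistC G y x).
by move: xy; lra.
Qed.

Lemma near_le (r r' : R) L x : r <= r' -> near r L x -> near r' L x.
Proof. by move=> rr [c Lc h]; exists c => //; exact: lt_le_trans h rr. Qed.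

Lemma near_trans (r r' : R) L x y : d x y < r -> near r' L y -> near (r + r') L x.
Proof.
move=> xy [c Lc h]; exists c => //; have := mdist_triangle G y x c.
by move: xy h; lra.
Qed.

Lemma near_closure L x : closed L -> (forall r : R, 0 < r -> near r L x) -> L x.
Proof.
move=> cL h; apply: cL => U /(@mdist_nbhsP R n M G)[e e0 He].
by have [c Lc xc] := h e e0; exists c; split=> //; exact: He.
Qed.

(** Cluster point of the filter of late times at which the orbit is in [C]; it is an ordinary limit
    point of the orbit. *)
Lemma limit_in_closed (C : set M) x : closed C -> (forall T : R, exists2 t, T <= t & C (phi t x)) ->
  exists2 p, C p & omega_limit phi x p.
Proof.
move=> cC hC.
pose F : set (set M) := [set A | exists T : R, forall t, T <= t -> C (phi t x) -> A (phi t x)].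
have FF : ProperFilter F.
  apply: Build_ProperFilter.
    by move=> [T hT]; have [t tT Ct] := hC T; exact: hT tT Ct.
  split; first by exists 0.
    move=> P Q [T hT] [T' hT']; exists (Num.max T T') => t; rewrite ge_max => /andP[? ?] Ct.
    by split; [exact: hT|exact: hT'].
  by move=> P Q PQ [T hT]; exists T => t tT Ct; apply: PQ; exact: hT.
have cpC : compact C by apply: subclosed_compact cC (@mcompact R n M) _.
have [|p [Cp clp]] := cpC F FF; first by exists 0.
exists p => // A B [T [_ hT]] nB; apply: clp nB.
exists (T + 1) => t Tt _; apply: hT; rewrite /=; lra.
Qed.

Lemma omega_near x (L : set M) (r : R) : omega_limit phi x `<=` L -> 0 < r ->
  exists T : R, forall t, T <= t -> near r L (phi t x).
Proof.
move=> oL r0; apply: contrapT => h.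
have [||p nLp op] := @limit_in_closed (~` [set y | near r L y]) x.
- by apply: open_closedC; exact: near_open.
- move=> T; apply: contrapT => h'; apply: h; exists T => t Tt.
  by apply: contrapT => h2; apply: h'; exists t.
by apply: nLp; exists p; [exact: oL|rewrite mdistxx].
Qed.

Lemma Ws_near x L (r : R) : Ws phi L x -> 0 < r ->
  exists T : R, forall t, T <= t -> near r L (phi t x).
Proof. by move=> [_]; exact: omega_near. Qed.

Lemma near_Ws x L : closed L ->
  (forall r : R, 0 < r -> exists T : R, forall t, T <= t -> near r L (phi t x)) -> Ws phi L x.
Proof.
move=> cL h; split.
  have [||p _ op] := @limit_in_closed [set: M] x; [exact: closedT|by move=> T; exists T|].
  by exists p.
move=> p op; apply: near_closure cL _ => r r0.
have r20 : 0 < r / 2 by rewrite divr_gt0.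
have [T hT] := h _ r20.
have [||y [[c Lc yc] py]] := op [set y | near (r / 2) L y] [set y | d p y < r / 2].
- exists T; split; first exact: num_real.
  by move=> t /ltW; exact: hT.
- by apply/(@mdist_nbhsP R n M G); exists (r / 2).
by exists c => //; have := mdist_triangle G y p c; move: yc py => /=; lra.
Qed.

Lemma steps_Ws L (C sigma : R) x : closed L -> invariant phi L -> 0 <= C -> 0 < sigma ->
  (forall k : nat, exists2 c, L c & d (phi (k%:R * sigma) x) c <= C * 2^-1 ^+ k) -> Ws phi L x.
Proof.
move=> cL iL C0 s0 hx.
apply: near_Ws => // r r0; have [K K1 HK] := @flow_lip R n M G phi sphi sigma.
have K0 : 0 < K by apply: lt_le_trans ltr01 K1.
have KC0 : 0 <= K * C by rewrite mulr_ge0 // ltW.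
have [m Hm] := exp_small KC0 r0.
exists (m%:R * sigma) => t mt; have t0 : 0 <= t / sigma.
  by rewrite divr_ge0 ?(ltW s0) //; apply: le_trans mt; rewrite mulr_ge0 // ltW.
have /andP[h1 h2] := trunc_itv t0; set k := Num.trunc _ in h1 h2.
rewrite ler_pdivlMr // in h1; rewrite ltr_pdivrMr // -natr1 mulrDl mul1r in h2.
have mk : (m <= k)%N.
  rewrite -ltnS -(ltr_nat R) -natr1; apply: contraTT (le_lt_trans mt h2) => h.
  rewrite -leNgt -[X in _ + X]mul1r -mulrDl; rewrite -leNgt in h.
  by rewrite ler_wpM2r // ltW.
have [c Lc xc] := hx k; exists (phi (t - k%:R * sigma) c); first exact: iL.
have -> : phi t x = phi (t - k%:R * sigma) (phi (k%:R * sigma) x) by rewrite -(flowD sphi) subrK.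
apply: le_lt_trans (HK _ _ _ _) _; first by rewrite ger0_norm; lra.
by apply: le_lt_trans (Hm k mk); rewrite -mulrA ler_pM2l.
Qed.

Lemma approach_Ws L : closed L -> invariant phi L -> approach L ->
  exists rho sigma : R, [/\ 0 < rho, 0 < sigma &
  forall x, (forall k : nat, near rho L (phi (k%:R * sigma) x)) -> Ws phi L x].
Proof.
move=> cL iL [rho [C [sigma [rho0 C0 s0 H]]]]; exists rho, sigma; split=> // x /H.
exact: steps_Ws.
Qed.

Lemma Ws_flow L t x : closed L -> Ws phi L x -> Ws phi L (phi t x).
Proof.
move=> cL Wx; apply: near_Ws => // r r0; have [T hT] := Ws_near Wx r0.
by exists (T - t) => s Ts; rewrite -(flowD sphi); apply: hT; lra.
Qed.

Lemma Ws_open L : closed L -> L `<=` interior (Ws phi L) -> open (Ws phi L).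
Proof.
move=> cL Lint; rewrite openE => x Wx; have [[p op] oL] := Wx.
have [||_ [[t _ <-] h]] := op [set phi t x | t in [set: R]] (interior (Ws phi L)).
- by exists 0; split; [exact: num_real|move=> t _; exists t].
- by apply: open_nbhs_nbhs; split; [exact: open_interior|exact/Lint/oL].
have [r r0] := flow_cont sphi h.
apply: filterS => y Wy; have := @Ws_flow L (- t) _ cL (Wy t _).
rewrite subrr normr0 => /(_ r0).
by rewrite (flowK sphi).
Qed.

(** Each ball is contained in the ball of half the radius around the previous center, so a cluster
    point of the centers lies strictly inside all balls. Density of [V m] is only asked inside the
    ball around [x0]. *)
Lemma baire (L : set M) (V : nat -> set M) x0 (r0 : R) : closed L -> L x0 -> 0 < r0 ->
  (forall m x (r : R), L x -> 0 < r -> (forall z, d x z < r -> d x0 z < r0) -> exists x' (r' : R),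
     [/\ L x', 0 < r' & forall z, d x' z < r' -> d x z < r /\ V m z]) ->
  exists p, [/\ L p, d x0 p < r0 & forall m, V m p].
Proof.
move=> cL Lx0 r00 Hs.
have /choice[f Hf] : forall a : nat * (M * R), exists b : M * R, L a.2.1 -> 0 < a.2.2 ->
   (forall z, d a.2.1 z < a.2.2 -> d x0 z < r0) ->
   [/\ L b.1, 0 < b.2 & forall z, d b.1 z < b.2 -> d a.2.1 z < a.2.2 / 2 /\ V a.1 z].
  move=> [m [x r]] /=; have [[Lx rp hz]|h] :=
    pselect [/\ L x, 0 < r & forall z, d x z < r -> d x0 z < r0]; last first.
    by exists (x, r) => ? ? ?; case: h.
  have [||x' [r' h]] := Hs m x (r / 2) Lx; first by rewrite divr_gt0.
    by move=> z xz; apply: hz; lra.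
  by exists (x', r').
pose fix b k := if k is k'.+1 then f (k', b k') else (x0, r0).
have Hb' k : [/\ L (b k).1, 0 < (b k).2 & forall z, d (b k).1 z < (b k).2 -> d x0 z < r0].
  elim: k => [|k [h1 h2 h3]] //=; have [g1 g2 g3] := Hf (k, b k) h1 h2 h3.
  split=> // z /g3[/= h _]; apply: h3; lra.
have Hb k : L (b k).1 /\ 0 < (b k).2 by have [] := Hb' k.
have Hstep k z : d (b k.+1).1 z < (b k.+1).2 -> d (b k).1 z < (b k).2 / 2 /\ V k z.
  by have [h1 h2 h3] := Hb' k; have [_ _ h] := Hf (k, b k) h1 h2 h3; exact: h.
have Hnest k j z : d (b (k.+1 + j)%N).1 z < (b (k.+1 + j)%N).2 ->
    d (b k).1 z < (b k).2 / 2 /\ V k z.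
  elim: j z => [|j IH] z; first by rewrite addn0; exact: Hstep.
  rewrite addnS => /Hstep[h _]; apply: IH; apply: lt_le_trans h _.
  by have [_ h2] := Hb (k.+1 + j)%N; lra.
have cptL : compact L by apply: subclosed_compact cL (@mcompact R n M) _.
have [|p [Lp clp]] := cptL ((fun k => (b k).1) @ \oo) _.
  by exists 0%N => // k _; have [] := Hb k.
have near_p k : d (b k).1 p < (b k).2.
  have [_ bk0] := Hb k; have bk : 0 < (b k).2 / 2 by rewrite divr_gt0.
  have [||y [[j kj <-] py]] := clp [set (b j).1 | j in [set j | (k.+1 <= j)%N]] [set y | d p y < (b k).2 / 2].
  - by exists k.+1 => // j kj; exists j.
  - by apply/(@mdist_nbhsP R n M G); exists ((b k).2 / 2).
  have h : d (b (k.+1 + (j - k.+1))%N).1 (b j).1 < (b (k.+1 + (j - k.+1))%N).2.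
    by rewrite subnKC // mdistxx; have [] := Hb j.
  have [h1 _] := Hnest _ _ _ h; have := mdist_triangle G (b j).1 (b k).1 p.
  by rewrite (mdistC G (b j).1 p); move: h1 py => /=; lra.
exists p; split=> //; first exact: (near_p 0%N).
by move=> m; have [] := Hstep m p (near_p m.+1).
Qed.

End Basins.

Section ChainClasses.
Variables (R : realType) (n : nat) (M : closed_manifold R n) (G : good_cover M)
  (phi : R -> M -> M) (H : set M) (tau delta Cs : R).
Hypotheses (sphi : smooth_flow phi) (tau1 : 1 <= tau) (delta0 : 0 < delta) (Cs1 : 1 <= Cs).
Hypothesis Hsh : shadowing G phi H tau delta Cs.
Hypotheses (invH : invariant phi H)
  (per_dense : forall x (r : R), H x -> 0 < r ->
     exists p (T : R), [/\ H p, 0 < T, phi T p = p & mdist G x p < r])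
  (per_isol : exists2 r : R, 0 < r & forall z (T : R) c, 0 < T -> phi T z = z ->
     H c -> mdist G z c < r -> H z).
Variable L : set M.
Hypothesis gL : chain_class G phi H tau delta Cs L.
Local Notation d := (@mdist R n M G).
Local Notation near := (@near R n M G).
Local Notation del := (del delta Cs).

Lemma chain_class_closed : closed L. Proof. by have [] := gL. Qed.

Lemma chain_class_inv : invariant phi L. Proof. by have [] := gL. Qed.

Lemma chain_class_approach : approach G phi L.
Proof.
have [rho [C [rho0 C0 Hc]]] := chain_class_closing sphi tau1 delta0 Cs1 Hsh per_isol gL.
exists rho, C, tau; split=> // [|x hx k]; first exact: lt_le_trans ltr01 tau1.
(* Time [k * tau] is the middle of a segment of [2 * k] steps, where the weight is [2^-1 ^+ k]. *)
have kk : (k <= 2 * k)%N by rewrite leq_pmull.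
have [c Lc h] := Hc x (2 * k)%N (fun j _ => hx j) k kk.
by exists c => //; rewrite /hat half_minn in h.
Qed.

(** With a segment of length 0 at [q], the connecting orbit starts near a point of the orbit of [y],
    hence in [Z], and arrives near [q]. *)
Lemma chain_class_basin_fills : basin_fills phi L.
Proof.
have [rho rho0 Hc] := chain_class_connecting sphi tau1 delta0 Cs1 Hsh per_isol gL.
move=> Z oZ iZ [y [Zy Wy]] q Lq U /(@mdist_nbhsP R n M G)[r r0 Hr].
have [T hT] := Ws_near G Wy rho0; pose y0 := phi (Num.max T 0) y.
have /(@mdist_nbhsP R n M G)[r' r'0 Hr'] : nbhs y0 Z.
  by apply: open_nbhs_nbhs; split=> //; exact: iZ.
have rr : 0 < Num.min r r' by rewrite lt_min r0.
have [|eta eta0 He] := Hc y0 _ _ rr.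
  move=> k; rewrite /y0 -(flowD sphi); apply: hT.
  have : 0 <= k%:R * tau by rewrite mulr_ge0 // (le_trans ler01).
  have : T <= Num.max T 0 by rewrite le_max lexx.
  lra.
have [||z [t [t0 zy zq]]] := He q 0%N; first exact: near_in.
  by case=> // _; apply: near_in; [exact: del_gt0|exact: chain_class_inv].
rewrite mul0r (flow0 sphi) in zq; exists (phi t z); split.
  by apply: iZ; apply: Hr'; rewrite mdistC; apply: lt_le_trans zy _; rewrite ge_min lexx orbT.
by apply: Hr; rewrite mdistC; apply: lt_le_trans zq _; rewrite ge_min lexx.
Qed.

(** Every point near [L] can be imitated by an orbit that starts in [O]. Orbits from [O] stay near
    [L], so orbits starting near [L] do as well, and those approach [L]. *)
Lemma chain_class_open_attracts : open_attracts G phi L.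
Proof.
have [rho2 [C [rho20 C0 Hcl]]] := chain_class_closing sphi tau1 delta0 Cs1 Hsh per_isol gL.
have [rho1 rho10 Hc] := chain_class_connecting sphi tau1 delta0 Cs1 Hsh per_isol gL.
have [K K1 HK] := @flow_lip R n M G phi sphi tau.
have K0 : 0 < K by apply: lt_le_trans ltr01 K1.
have d0 := del_gt0 delta0 Cs1.
pose e := Num.min (Num.min rho1 (rho2 / 2)) (del / (2 * K)).
have e0 : 0 < e by rewrite !lt_min rho10 !divr_gt0 // mulr_gt0.
have eK : K * (2 * e) <= del.
  have : e <= del / (2 * K) by rewrite /e ge_min lexx orbT.
  by rewrite ler_pdivlMr ?mulr_gt0 //; lra.
have e2 : 2 * e <= rho2.
  have : e <= rho2 / 2 by rewrite /e !ge_min lexx orbT.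
  lra.
have e1 : e <= rho1 by rewrite /e !ge_min lexx.
clearbody e.
have ed : 2 * e <= del by apply: le_trans eK; rewrite ler_peMl // mulr_ge0 // ltW.
exists e => // O oO [y0 Oy0] hO.
have /(@mdist_nbhsP R n M G)[r' r'0 Hr'] : nbhs y0 O by apply: open_nbhs_nbhs.
have rr : 0 < Num.min e r' by rewrite lt_min e0.
have tt k : 0 <= k%:R * tau by rewrite mulr_ge0 // (le_trans ler01).
have [|eta eta0 He] := Hc y0 _ _ rr.
  by move=> k; apply: (near_le e1); exact: hO.
pose eta' := Num.min eta (2 * e).
have eta'0 : 0 < eta' by rewrite lt_min eta0 mulr_gt0.
(* At time [k.+1] the connecting orbit only needs the weak bound [del], which one step of the flow
   derives from the bound [2 * e] at time [k]. That orbit starts in [O], is [e]-near [L] and ends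
   [e]-close to the orbit of [x], which restores the bound [2 * e]. *)
have claim x : near eta' L x -> forall k, near (2 * e) L (phi (k%:R * tau) x).
  move=> hx; elim/ltn_ind=> k IH; case: k IH => [_|k IH].
    by rewrite mul0r (flow0 sphi); apply: near_le hx; rewrite ge_min lexx orbT.
  have [||z [t [t0 zy zq]]] := He x k.+1.
  - by apply: near_le hx; rewrite ge_min lexx.
  - move=> j; rewrite leq_eqVlt => /orP[/eqP->|jk]; last exact: near_le ed (IH j jk).
    have [c Lc h] := IH k (ltnSn k); exists (phi tau c); first exact: chain_class_inv.
    rewrite succ_time (flowD sphi); apply: le_lt_trans (HK tau _ _ _) _.
      by rewrite ger0_norm // (le_trans ler01).
    by apply: lt_le_trans eK; rewrite ltr_pM2l.
  have Oz : O z by apply: Hr'; rewrite mdistC; apply: lt_le_trans zy _; rewrite ge_min lexx orbT.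
  have -> : 2 * e = e + e by rewrite mulrDl mul1r.
  apply: near_trans (hO z t Oz t0).
  by rewrite mdistC; apply: lt_le_trans zq _; rewrite ge_min lexx.
move=> q Lq; apply/(@mdist_nbhsP R n M G); exists eta' => // x qx.
have hx k : near rho2 L (phi (k%:R * tau) x).
  by apply: (near_le e2); apply: claim; exists q; rewrite ?(mdistC G x).
apply: (@steps_Ws R n M G phi sphi L C tau x chain_class_closed chain_class_inv C0 (lt_le_trans ltr01 tau1)) => k.
have kk : (k <= 2 * k)%N by rewrite leq_pmull.
have [c Lc h] := Hcl x (2 * k)%N (fun j _ => hx j) k kk.
by exists c => //; rewrite /hat half_minn in h.
Qed.

(** For each [m], the points whose forward orbit visits the balls of radius [m.+1%:R^-1] around a
    finite net are dense by [chain_class_mixing]; Baire's theorem yields one point for all [m]. *)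
Lemma chain_class_transitive : L !=set0 -> transitive_on phi L.
Proof.
move=> [x0 Lx0].
have r1 m : 0 < (m.+1%:R : R)^-1 by rewrite invr_gt0 ltr0n.
have near_flow t x c (r : R) : d (phi t x) c < r -> exists2 r' : R, 0 < r' &
    forall z, d x z < r' -> d (phi t z) c < r.
  move=> h; have [K K1 HK] := @flow_lip R n M G phi sphi `|t|.
  have K0 : 0 < K by apply: lt_le_trans ltr01 K1.
  exists ((r - d (phi t x) c) / K); first by rewrite divr_gt0 // subr_gt0.
  move=> z; rewrite ltr_pdivlMr // => xz.
  have := HK t x z (lexx _); have := mdist_triangle G (phi t x) (phi t z) c.
  by rewrite (mdistC G (phi t z) (phi t x)); lra.
have cptL : compact L by apply: subclosed_compact chain_class_closed (@mcompact R n M) _.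
have step (cs : seq M) : (forall c, c \in cs -> L c) -> forall m x (r : R), L x -> 0 < r ->
   exists x' (r' : R), [/\ L x', 0 < r' & forall z, d x' z < r' -> d x z < r /\
     forall c, c \in cs -> exists2 t, 0 <= t & d (phi t z) c < m.+1%:R^-1].
  elim: cs => [|c cs IH] hcs m x r Lx r0.
    by exists x, r; split=> // z xz; split.
  have Lcs c' : c' \in cs -> L c' by move=> h; apply: hcs; rewrite in_cons h orbT.
  have [x1 [s1 [Lx1 s10 h1]]] := IH Lcs m x r Lx r0.
  have Lc : L c by apply: hcs; rewrite in_cons eqxx.
  have rr : 0 < Num.min s1 m.+1%:R^-1 by rewrite lt_min s10 r1.
  have [y [t [Ly t0 yx yc]]] := chain_class_mixing sphi tau1 delta0 Cs1 Hsh per_isol gL Lx1 Lc rr.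
  have [|s2 s20 h2] := near_flow t y c m.+1%:R^-1.
    by apply: lt_le_trans yc _; rewrite ge_min lexx orbT.
  have yx1 : d y x1 < s1 by apply: lt_le_trans yx _; rewrite ge_min lexx.
  exists y, (Num.min s2 (s1 - d y x1)); split=> //; first by rewrite lt_min s20 subr_gt0.
  move=> z; rewrite lt_min => /andP[yz1 yz2].
  have [|h3 h4] := h1 z; first by have := mdist_triangle G y x1 z; rewrite (mdistC G x1 y); lra.
  split=> // c'; rewrite in_cons => /orP[/eqP->|/h4//].
  by exists t => //; exact: h2.
have /choice[net Hnet] : forall m : nat, exists cs : seq M, (forall c, c \in cs -> L c) /\
    forall x, L x -> exists2 c, c \in cs & d c x < m.+1%:R^-1.
  move=> m; have [|cs Hcs] := @compact_finite_cover M M L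
      (fun c => [set x | L c /\ d c x < m.+1%:R^-1]) cptL.
    move=> x Lx; exists x; apply/(@mdist_nbhsP R n M G).
    by exists m.+1%:R^-1 => // y xy; split.
  exists [seq c <- cs | `[< L c >]]; split=> [c|x Lx].
    by rewrite mem_filter => /andP[/asboolP].
  have [c cc [Lc h]] := Hcs x Lx; exists c => //.
  by rewrite mem_filter cc andbT; apply/asboolP.
have [|p [Lp _ Vp]] := @baire R n M G L (fun m => [set x | forall c, c \in net m ->
   exists2 t, 0 <= t & d (phi t x) c < m.+1%:R^-1]) x0 1 chain_class_closed Lx0 ltr01.
  by move=> m x r Lx r0 _; have [h _] := Hnet m; exact: step.
exists p => // c Lc U /(@mdist_nbhsP R n M G)[r r0 Hr].
have r20 : 0 < r / 2 by rewrite divr_gt0.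
have [m hm] : exists m : nat, m.+1%:R^-1 < r / 2.
  exists (Num.trunc (r / 2)^-1); rewrite invf_plt ?posrE ?ltr0n //.
  have q0 : 0 <= (r / 2)^-1 by rewrite invr_ge0 ltW.
  by have /andP[] := trunc_itv q0.
have [_ /(_ c Lc)[c' c'm cc']] := Hnet m; have [t t0 h] := Vp m c' c'm.
exists (phi t p); split; first by exists t.
apply: Hr; apply: le_lt_trans (mdist_triangle G c' c (phi t p)) _.
rewrite (mdistC G c' (phi t p)) (mdistC G c c') [ltRHS]splitr.
by apply: ltrD; [exact: lt_trans cc' hm|exact: lt_trans h hm].
Qed.

End ChainClasses.

(** * Hyperbolic fixed points *)

Section Lyapunov.
Import complex ComplexField.Normc.
Variable R : realType.
Local Notation C := R[i].
Local Notation Re := (@complex.Re R).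

Lemma Re_le_normc (x : C) : `|Re x| <= normc x.
Proof.
case: x => a b /=; rewrite -sqrtr_sqr ler_wsqrtr // lerDl sqr_ge0 //.
Qed.

Lemma normc_conj (x : C) : normc (conjc x) = normc x.
Proof. by case: x => a b /=; rewrite sqrrN. Qed.

Lemma normc_ge0 (x : C) : 0 <= normc x. Proof. by case: x => a b /=; exact: sqrtr_ge0. Qed.

Lemma Re_conj_mul (u t : C) : Re (u * t * conjc u) = normc u ^+ 2 * Re t.
Proof.
case: u t => a b [c d] /=; rewrite sqr_sqrtr ?addr_ge0 ?sqr_ge0 //; ring.
Qed.

Lemma ReD (x y : C) : Re (x + y) = Re x + Re y. Proof. by case: x y => [? ?] [? ?]. Qed.

Lemma Re_sum (I : finType) (F : I -> C) : Re (\sum_i F i) = \sum_i Re (F i).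
Proof. by rewrite (big_morph _ ReD (erefl : Re 0 = 0)). Qed.

(* Choose the weights [w j], with the sign of [Re (T j j)], growing so fast that
   the off-diagonal terms are dominated. *)
Lemma trig_form_pos n (T : 'M[C]_n) : is_trig_mx T -> (forall i, Re (T i i) != 0) ->
  exists w : 'I_n -> R, forall u : 'rV[C]_n, u != 0 ->
    0 < \sum_i \sum_j w j * Re (u 0 i * T i j * conjc (u 0 j)).
Proof.
move=> /is_trig_mxP Ttrig T0.
have [|m m0 Hm] := @fin_lower_pos R _ (fun i => `|Re (T i i)|); first by move=> i; rewrite normr_gt0.
have [B B1 HB] := @fin_upper R _ (fun ij : 'I_n * 'I_n => normc (T ij.1 ij.2)).
(* Altogether the off-diagonal terms will cost at most [a * n] times the sum of the [x i], which
   this choice keeps below [m] times that sum. *)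
pose a := m / (2 * n.+1%:R).
have a0 : 0 < a by rewrite divr_gt0 // mulr_gt0 // ltr0n.
(* As [K] exceeds [b ^+ 2], an entry with [j < i] satisfies [q j * b ^+ 2 <= q i], and the
   inequality between arithmetic and geometric mean bounds its term by [a / 2 * (x i + x j)]. *)
pose b := B / a; pose K := 1 + b ^+ 2; have K1 : 1 <= K by rewrite lerDl sqr_ge0.
have K0 : 0 < K by apply: lt_le_trans ltr01 K1.
pose q (j : 'I_n) := K ^+ j; have q0 j : 0 < q j by rewrite exprn_gt0.
exists (fun j => Num.sg (Re (T j j)) * q j) => u u0.
pose x i := q i * normc (u 0 i) ^+ 2.
have x0 i : 0 <= x i by rewrite mulr_ge0 ?(ltW (q0 i)) ?exprn_ge0 ?normc_ge0.
have F i j : (i == j)%:R * (m * x i) - a / 2 * (x i + x j) <=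
   Num.sg (Re (T j j)) * q j * Re (u 0 i * T i j * conjc (u 0 j)).
  have ax : 0 <= a / 2 * (x i + x j) by rewrite mulr_ge0 ?addr_ge0 // divr_ge0 // ltW.
  have [->|ij] := eqVneq i j.
    rewrite Re_conj_mul mul1r; apply: (@le_trans _ _ (m * x j)).
      by move: ax; have := x0 j; have := mulr_ge0 (ltW a0) (x0 j); lra.
    have -> : Num.sg (Re (T j j)) * q j * (normc (u 0 j) ^+ 2 * Re (T j j)) =
       (Num.sg (Re (T j j)) * Re (T j j)) * x j by rewrite /x; ring.
    by rewrite -normrEsg ler_wpM2r // Hm.
  rewrite mul0r sub0r; have [ij'|ij'|/val_inj e] := ltngtP i j; last by rewrite e eqxx in ij.
    have -> : u 0 i * T i j * conjc (u 0 j) = 0 by rewrite (Ttrig i j ij') (mulr0 (u 0 i)) mul0r.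
    by rewrite mulr0 oppr_le0.
  have h : `|Num.sg (Re (T j j)) * q j * Re (u 0 i * T i j * conjc (u 0 j))| <= a / 2 * (x i + x j).
    rewrite !normrM normr_sg T0 mul1r (gtr0_norm (q0 j)).
    apply: (@le_trans _ _ (q j * (normc (u 0 i) * B * normc (u 0 j)))).
      rewrite ler_wpM2l ?(ltW (q0 j)) //; apply: le_trans (Re_le_normc _) _.
      rewrite !normcM normc_conj ler_wpM2r ?normc_ge0 // ler_wpM2l ?normc_ge0 //.
      exact: (HB (i, j)).
    have Ba : B = a * b by rewrite /b mulrC divfK // gt_eqF.
    have qq : q j * b ^+ 2 <= q i.
      apply: (@le_trans _ _ (q j * K)); first by rewrite ler_wpM2l ?(ltW (q0 j)) // lerDr.
      by rewrite -exprSr ler_weXn2l.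
    rewrite Ba /x; move: (normc_ge0 (u 0 i)) (normc_ge0 (u 0 j)).
    move: (normc (u 0 i)) (normc (u 0 j)) => ni nj ni0 nj0.
    have h1 : q j * b ^+ 2 * ni ^+ 2 <= q i * ni ^+ 2 by rewrite ler_wpM2r // exprn_ge0.
    have h2 : 0 <= q j * (b * ni - nj) ^+ 2 by rewrite mulr_ge0 ?(ltW (q0 j)) ?sqr_ge0.
    have h3 : q j * (2 * (b * (ni * nj))) <= q i * ni ^+ 2 + q j * nj ^+ 2.
      apply: le_trans (lerD h1 (lexx _)); rewrite -subr_ge0.
      have -> : q j * b ^+ 2 * ni ^+ 2 + q j * nj ^+ 2 - q j * (2 * (b * (ni * nj))) =
        q j * (b * ni - nj) ^+ 2 by ring.
      done.
    have := ler_wpM2l (ltW a0) h3; lra.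
  by move: h; rewrite ler_norml => /andP[].
pose SX := \sum_i x i.
have SX0 : 0 < SX.
  have /existsP[i ui] : [exists i, u 0 i != 0].
    apply: contraNT u0; rewrite negb_exists => /forallP h.
    by apply/eqP/rowP => i; rewrite mxE; apply/eqP; have := h i; rewrite negbK.
  rewrite /SX (bigD1 i) //=; apply: ltr_pwDl; last by apply: sumr_ge0.
  rewrite mulr_gt0 // exprn_gt0 // lt_neqAle normc_ge0 andbT eq_sym.
  by apply: contraNneq ui => /eq0_normc ->.
apply: (@lt_le_trans _ _ (\sum_i \sum_j ((i == j)%:R * (m * x i) - a / 2 * (x i + x j)))); last first.
  by apply: ler_sum => i _; apply: ler_sum => j _; exact: F.
have -> : \sum_i \sum_j ((i == j)%:R * (m * x i) - a / 2 * (x i + x j)) =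
   (m - a * n%:R) * SX.
  have inner i : \sum_j ((i == j)%:R * (m * x i) - a / 2 * (x i + x j)) =
      m * x i - (a / 2 * n%:R * x i + a / 2 * SX).
    rewrite sumrB (bigD1 i) //= eqxx mul1r big1 ?addr0; last first.
      by move=> j ji; rewrite eq_sym (negPf ji) mul0r.
    rewrite -mulr_sumr big_split /= sumr_const card_ord -/SX -[x i *+ n]mulr_natl; congr (_ - _).
    by rewrite mulrDr mulrA.
  rewrite (eq_bigr _ (fun i _ => inner i)) sumrB big_split /= -!mulr_sumr -/SX.
  by rewrite sumr_const card_ord -[_ *+ n]mulr_natl; field.
apply: mulr_gt0 => //; rewrite subr_gt0 /a.
have n0 : 0 < n.+1%:R :> R by rewrite ltr0n.
rewrite mulrAC ltr_pdivrMr ?mulr_gt0 // ltr_pM2l //.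
have : n%:R < n.+1%:R :> R by rewrite ltr_nat.
lra.
Qed.

(* Schur triangularization reduces this to [trig_form_pos]. *)
Lemma lyapunov n (A : 'M[R]_n) :
  (forall z : C, eigenvalue (complexify A) z -> Re z != 0) ->
  exists S : 'M[R]_n, S^T = S /\
    forall v : 'rV[R]_n, v != 0 -> 0 < (v *m S *m (v *m A)^T) 0 0.
Proof.
case: n A => [|n] A eA.
  exists 0; split=> [|v /eqP[]]; first by rewrite trmx0.
  by apply/rowP => -[].
have [P uP tP] := @Schur C n.+1 (complexify A) (ltn0Sn n).
have iP : P \in unitmx by apply: unitarymx_unit.
move: tP; rewrite /similar_to conjumx // => trigT; set T := _ *m invmx P in trigT.
have AT : complexify A = invmx P *m T *m P by rewrite /T !mulmxA mulVmx // mul1mx mulmxKV.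
have T0 i : Re (T i i) != 0.
  apply: eA; have : eigenvalue T (T i i).
    rewrite eigenvalue_root_char char_poly_trig // /root horner_prod.
    by rewrite (bigD1 i) //= hornerXsubC subrr mul0r.
  move=> /eigenvalueP[y yT y0]; apply/eigenvalueP; exists (y *m P).
    by rewrite AT (mulmxA (y *m P)) (mulmxA (y *m P)) mulmxK // yT -scalemxAl.
  by apply: contraNneq y0 => yP; rewrite -(mulmxK iP y) yP mul0mx.
have [w Hw] := trig_form_pos trigT T0.
pose Q := invmx P.
(* On real vectors this is the Hermitian form with weights [w] on the squared moduli of the
   coordinates of [v *m Q]. *)
pose S : 'M[R]_n.+1 := \matrix_(a, b) \sum_j w j * Re (Q a j * conjc (Q b j)).
exists S; split.
  apply/matrixP => a b; rewrite !mxE; apply: eq_bigr => j _; congr (_ * _).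
  by case: (Q a j) (Q b j) => [? ?] [? ?] /=; ring.
move=> v v0; pose u : 'rV[C]_n.+1 := map_mx (real_complex R) v *m Q.
have u0 : u != 0.
  apply: contraNneq v0 => u0; have : u *m P = 0 by rewrite u0 mul0mx.
  rewrite /u /Q mulmxKV // => /matrixP h; apply/eqP/rowP => i.
  by have := h 0 i; rewrite !mxE => -[].
have form (x y : 'rV[R]_n.+1) : (x *m S *m y^T) 0 0 = \sum_j w j *
    Re ((map_mx (real_complex R) y *m Q) 0 j * conjc ((map_mx (real_complex R) x *m Q) 0 j)).
  rewrite mxE; under eq_bigr do rewrite !mxE mulr_suml.
  under [RHS]eq_bigr do rewrite !mxE rmorph_sum mulr_suml Re_sum mulr_sumr.
  rewrite [RHS]exchange_big /=; apply: eq_bigr => b _.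
  under eq_bigr do rewrite !mxE mulr_sumr mulr_suml.
  under [RHS]eq_bigr do rewrite mulr_sumr Re_sum mulr_sumr.
  rewrite exchange_big /=; apply: eq_bigr => j _; apply: eq_bigr => a _.
  rewrite !mxE; case: (Q a j) (Q b j) => [? ?] [? ?] /=; ring.
have := Hw u u0; suff -> : (v *m S *m (v *m A)^T) 0 0 =
  \sum_i \sum_j w j * Re (u 0 i * T i j * conjc (u 0 j)) by [].
rewrite form exchange_big /=; apply: eq_bigr => j _; rewrite -mulr_sumr -Re_sum -mulr_suml.
congr (_ * Re (_ * _)).
have -> : map_mx (real_complex R) (v *m A) *m Q = u *m T.
  by rewrite /u /Q map_mxM -/(complexify A) AT !mulmxA mulmxK.
by rewrite mxE.
Qed.

End Lyapunov.

Section QuadraticDerivative.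
Variables (R : realType) (n : nat).
Implicit Types (S A : 'M[R]_n) (v w : 'rV[R]_n).

Lemma bilin_sym S v w : S^T = S -> (v *m S *m w^T) 0 0 = (w *m S *m v^T) 0 0.
Proof.
move=> sS; have -> : (w *m S *m v^T) 0 0 = ((w *m S *m v^T)^T) 0 0 by rewrite [in RHS]mxE.
by rewrite !trmx_mul trmxK sS mulmxA.
Qed.

Lemma bilinBZ S v w x (h : R) :
  (v *m S *m (w - h *: x)^T) 0 0 = (v *m S *m w^T) 0 0 - h * (v *m S *m x^T) 0 0.
Proof.
have -> : (w - h *: x)^T = w^T - h *: x^T by apply/matrixP => i j; rewrite !mxE.
by rewrite mulmxBr -scalemxAr !mxE.
Qed.

Lemma qfD S v w : S^T = S -> qf S (v + w) = qf S v + 2 * (v *m S *m w^T) 0 0 + qf S w.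
Proof.
move=> sS; rewrite /qf linearD /= mulmxDl mulmxDr !mulmxDl !mxE.
have := bilin_sym w v sS; rewrite !mxE => ->; ring.
Qed.

Lemma qf_is_derive S (g : R^o -> 'rV[R]_n) (t : R^o) v : S^T = S -> has_vel g t v ->
  is_derive t 1 (fun u : R^o => qf S (g u) : R^o) (2 * (g t *m S *m v^T) 0 0).
Proof.
move=> sS gv; set D := 2 * _.
have est (e : R) : 0 < e -> exists2 r : R, 0 < r & forall h : R, `|h| < r ->
    `|qf S (g (t + h)) - qf S (g t) - h * D| <= e * `|h|.
  move=> e0; pose K := n%:R ^+ 2 * `|S|; have K0 : 0 <= K by rewrite mulr_ge0 ?exprn_ge0.
  pose a := 2 * K * `|g t| + 1; have a0 : 0 < a by rewrite ltr_wpDl // !mulr_ge0.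
  pose b := K * (`|v| + 1) ^+ 2 + 1.
  have b0 : 0 < b by rewrite ltr_wpDl // mulr_ge0 // exprn_ge0 // addr_ge0.
  pose eta := Num.min 1 (e / (2 * a)).
  have eta0 : 0 < eta by rewrite lt_min ltr01 divr_gt0 // mulr_gt0.
  have eta1 : eta <= 1 by rewrite /eta ge_min lexx.
  have etae : 2 * a * eta <= e.
    by rewrite mulrC -ler_pdivlMr ?mulr_gt0 // /eta ge_min lexx orbT.
  have [r r0 Hr] := gv eta eta0.
  exists (Num.min r (e / (2 * b))); first by rewrite lt_min r0 divr_gt0 // mulr_gt0.
  move=> h; rewrite lt_min ltr_pdivlMr ?mulr_gt0 // => /andP[hr hb].
  have h1 := Hr h hr; set De := g (t + h) - g t in h1.
  have -> : g (t + h) = g t + De by rewrite /De addrCA subrr addr0.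
  rewrite qfD // /D.
  have -> : qf S (g t) + 2 * (g t *m S *m De^T) 0 0 + qf S De - qf S (g t) -
     h * (2 * (g t *m S *m v^T) 0 0) = 2 * (g t *m S *m (De - h *: v)^T) 0 0 + qf S De.
    rewrite (bilinBZ S (g t) De v h); move: (qf S (g t)) (qf S De) => q0 q1.
    by move: ((_ *m De^T) 0 0) ((_ *m v^T) 0 0) => q2 q3; ring.
  have h2 := bilin_le S (g t) (De - h *: v); have h3 := qf_le S De.
  have h4 : `|De| <= (`|v| + 1) * `|h|.
    rewrite -[De](subrK (h *: v)); apply: le_trans (ler_normD _ _) _.
    rewrite normrZ mulrDl mul1r addrC mulrC lerD2l; apply: le_trans h1 _.
    by rewrite ler_piMl.
  have h5 : `|De| ^+ 2 <= ((`|v| + 1) * `|h|) ^+ 2.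
    by rewrite ler_sqr ?nnegrE ?mulr_ge0 ?addr_ge0.
  apply: le_trans (ler_normD _ _) _; rewrite normrM (@ger0_norm _ 2) //.
  have g1 : 2 * `|(g t *m S *m (De - h *: v)^T) 0 0| <= a * (eta * `|h|).
    apply: (@le_trans _ _ (2 * (K * (`|g t| * (eta * `|h|))))).
      rewrite ler_pM2l //; apply: le_trans h2 _; rewrite ler_wpM2l //.
      by rewrite ler_wpM2l.
    have -> : 2 * (K * (`|g t| * (eta * `|h|))) = 2 * K * `|g t| * (eta * `|h|) by ring.
    by rewrite ler_wpM2r ?mulr_ge0 ?(ltW eta0) // /a lerDl.
  have g2 : `|qf S De| <= b * (`|h| * `|h|).
    apply: le_trans h3 _; apply: (@le_trans _ _ (K * ((`|v| + 1) * `|h|) ^+ 2)).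
      by rewrite ler_wpM2l.
    have -> : K * ((`|v| + 1) * `|h|) ^+ 2 = K * (`|v| + 1) ^+ 2 * (`|h| * `|h|) by ring.
    by rewrite ler_wpM2r ?mulr_ge0 // /b lerDl.
  have g3 : b * (`|h| * `|h|) <= e / 2 * `|h|.
    rewrite mulrA ler_wpM2r //; lra.
  have g4 : a * (eta * `|h|) <= e / 2 * `|h|.
    rewrite mulrA ler_wpM2r //; lra.
  lra.
have lim_v : (fun h : R => h^-1 *: (((fun u : R^o => qf S (g u) : R^o) \o shift t) (h *: (1 : R^o)) - qf S (g t))) @ 0^' --> (D : R^o).
  apply/cvgrPdist_le => e e0; have [r r0 H] := est _ e0.
  near=> h; rewrite /= scaler_regular1.
  have h0 : h != 0 by near: h; exact: nbhs_dnbhs_neq.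
  have hr : `|h| < r by near: h; exact: dnbhs0_lt.
  have H' := H _ hr; rewrite (addrC t) in H'.
  rewrite distrC -[D](mulKf h0) -[_ *: _]/(_ * _) -mulrBr normrM normfV mulrC.
  by rewrite ler_pdivrMr ?normr_gt0.
split; first by apply/cvg_ex; exists D.
exact: cvg_lim.
Unshelve. all: by end_near. Qed.

End QuadraticDerivative.

Section FixedPoint.
Variables (R : realType) (n : nat) (M : closed_manifold R n) (G : good_cover M)
  (phi : R -> M -> M) (p : M).
Hypotheses (sphi : smooth_flow phi) (hp : hyperbolic_fixed_point phi p).
Local Notation d := (@mdist R n M G).
Local Notation near := (@near R n M G).
Local Notation c := (chart_at p).
Local Notation A := (linearization phi p).
Local Notation Xv := (vfield_in c phi).

(** In the chart, the vector field is the time derivative of the flow at time 0; it is therefore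
    smooth, and [c1_uniform] applies with the time frozen. *)
Lemma vfield_strict (eta : R) : 0 < eta -> exists2 r : R, 0 < r & forall z z' : 'rV[R]_n,
  `|z - c p| < r -> `|z' - c p| < r ->
  cimg c z /\ `|Xv z - Xv z' - (z - z') *m A| <= eta * `|z - z'|.
Proof.
have fp : phi 0 p = p by exact: (flow0 sphi).
have cp := chart_at_dom p; have ac := chart_at_atlas p.
have sF := smooth_on_derive (time_dir R n) (flowc_smooth sphi ac ac).
set F := 'D_ _ _ in sF; pose J := jac_rows (@space_dir R n) F (0, c p).
have XE z : cimg c z -> F (0, z) = Xv z.
  move=> cz; have dz := cinv_dom cz.
  have dz0 : cdom c (phi 0 (cinv c z)) by rewrite (flow0 sphi).
  have := flowc_time_derive sphi ac ac dz dz0; rewrite (cinvK cz) => E.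
  by rewrite /F E (flow0 sphi) /XM (cinvK cz).
have Kin : [set ((0 : R^o), c p)] `<=` flow_dom phi c c.
  by move=> _ ->; split => /=; [exact: cimg_dom|rewrite cmapK ?fp].
have cK : compact [set ((0 : R^o), c p)] by exact: compact_set1.
have unif (e : R) : 0 < e -> exists2 r : R, 0 < r & forall z z' : 'rV[R]_n,
    `|z - c p| < r -> `|z' - c p| < r ->
    cimg c z /\ `|Xv z - Xv z' - (z - z') *m J| <= e * `|z - z'|.
  move=> e0; have [r r0 H] := c1_uniform sF (@flow_dom_open R n M phi sphi c c) cK Kin e0.
  exists r => // z z' zr zr'.
  have [||o1 h] := H _ erefl 0 0 z z'; try by rewrite pair_norm_lt subrr normr0 r0.
  have [||o2 _] := H _ erefl 0 0 z' z; try by rewrite pair_norm_lt subrr normr0 r0.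
  have [/= c1 _] := o1; have [/= c2 _] := o2; split=> //.
  by move: h; rewrite (XE _ c1) (XE _ c2) (subrr (0 : R^o)) scale0r add0r normr0 add0r; exact.
have JA : A = J.
  apply: has_jac_J => e e0; have [r r0 H] := unif e e0; exists r => // z zr.
  have [|_ h] := H z (c p) zr; [by rewrite subrr normr0|exact: h].
by rewrite JA; exact: unif.
Qed.

Definition inU (r : R) x := cdom c x /\ `|c x - c p| < r.

Lemma inU_near (r : R) : 0 < r -> exists2 e : R, 0 < e & forall x, d x p < e -> inU r x.
Proof.
move=> r0; have cp := chart_at_dom p.
have /(@mdist_nbhsP R n M G)[e1 e10 H1] : nbhs p (cdom c).
  by apply: open_nbhs_nbhs; split=> //; exact: cdom_open.
have /(@mdist_nbhsP R n M G)[e2 e20 H2] : nbhs p (c @^-1` [set z | `|z - c p| < r]).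
  by apply: cmap_continuous => //; apply/nbhs_normP; exists r.
exists (Num.min e1 e2); first by rewrite lt_min e10.
by move=> x; rewrite mdistC lt_min => /andP[? ?]; split; [exact: H1|exact: H2].
Qed.

Lemma mdist_inU : exists r K : R, [/\ 0 < r, 1 <= K & forall x, inU r x ->
  d x p <= K * `|c x - c p|].
Proof.
have [i ci] := core_exists G p; have wi := core_wide ci.
have cp := chart_at_dom p; have cpi := wide_dom wi.
have oI : open (c @` (cdom c `&` cdom (gch i))).
  by apply: chart_sub_open; exact: cdom_open.
have [|r [C [r0 C0 H]]] := @smooth_loc_lip R n n (c @` (cdom c `&` cdom (gch i)))
   (gch i \o cinv c) (c p) (atlas_compat (chart_at_atlas p) (gch_atlas i)) oI.
  by exists p.
have [K K0 HK] := mdist_chart_upper G; have [s s0 Hs] := wide_small G.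
pose e := Num.min r (s / (C + 1)).
have e0 : 0 < e by rewrite lt_min r0 divr_gt0 //; lra.
exists e, (K * C + 1); split=> //; first by rewrite lerDr mulr_ge0 // ltW.
move=> x [dx]; rewrite lt_min => /andP[xr xs].
have [|[y [dy dyi] yx] h] := H (c x) (c p) xr; first by rewrite subrr normr0.
rewrite /= (cmapK dx) (cmapK cp) in h.
have yE : y = x by rewrite -(cmapK dy) yx cmapK.
rewrite yE in dyi; rewrite ltr_pdivlMr in xs; last by lra.
have wx : wide i x.
  apply: Hs ci dyi _; apply: le_trans h _; apply: le_trans (ltW xs).
  by rewrite mulrC ler_wpM2l //; lra.
apply: le_trans (HK _ _ _ wx wi) _; apply: (@le_trans _ _ (K * C * `|c x - c p|)).
  by rewrite -mulrA ler_pM2l.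
by rewrite ler_wpM2r //; lra.
Qed.

(** The form is evaluated on the difference of two orbits. Its time derivative is twice a bilinear
    expression that equals, up to the nonlinear error, the positive form of the Lyapunov equation;
    the mean value theorem then selects [xi]. *)
Lemma quadratic_growth : exists (S : 'M[R]_n) (r a : R), [/\ S^T = S, 0 < r, 0 < a,
  forall v : 'rV[R]_n, v != 0 -> 0 < (v *m S *m (v *m A)^T) 0 0 &
  forall x y (T : R), 0 < T ->
  (forall u, 0 <= u <= T -> inU r (phi u x) /\ inU r (phi u y)) ->
  exists2 xi, 0 <= xi <= T & T * (a * `|c (phi xi x) - c (phi xi y)| ^+ 2) <=
     qf S (c (phi T x) - c (phi T y)) - qf S (c x - c y)].
Proof.
have [_ heig] := hp; have [S [sS Spos]] := lyapunov heig.
have posm v : v != 0 -> 0 < qf (S *m A^T) v.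
  by move=> /Spos; rewrite /qf trmx_mul !mulmxA.
have [m m0 Hm] := qf_lower posm.
pose K := n%:R ^+ 2 * `|S|; have K0 : 0 <= K by rewrite mulr_ge0 ?exprn_ge0.
(* The nonlinear error uses up at most half of the lower bound [m], so the derivative of the form is
   still at least [m] times the squared distance. *)
pose eta := m / (2 * (K + 1)).
have eta0 : 0 < eta by rewrite divr_gt0 // mulr_gt0 //; lra.
have Keta : K * eta <= m / 2.
  have Kn : K + 1 != 0 by rewrite gt_eqF //; lra.
  have : (K + 1) * eta = m / 2 by rewrite /eta; field.
  by rewrite mulrDl mul1r; lra.
have [r r0 Hr] := vfield_strict eta0.
exists S, r, m; split=> // x y T T0 hu.
pose De u := c (phi u x) - c (phi u y).
pose V u := Xv (c (phi u x)) - Xv (c (phi u y)).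
have dQ u : 0 <= u <= T -> is_derive (u : R^o) 1 (fun u : R^o => qf S (De u) : R^o)
    (2 * (De u *m S *m (V u)^T) 0 0).
  move=> /hu[[dx _] [dy _]]; apply: qf_is_derive => //.
  have h1 := XM_vel_at sphi (chart_at_atlas p) dx; have h2 := XM_vel_at sphi (chart_at_atlas p) dy.
  move=> e e0; have e20 : 0 < e / 2 by rewrite divr_gt0.
  have [r1 r10 H1] := h1 _ e20; have [r2 r20 H2] := h2 _ e20.
  exists (Num.min r1 r2); first by rewrite lt_min r10.
  move=> h; rewrite lt_min => /andP[/H1 g1 /H2 g2].
  have -> : De (u + h) - De u - h *: V u =
     (c (phi (u + h) x) - c (phi u x) - h *: XM phi c (phi u x)) -
     (c (phi (u + h) y) - c (phi u y) - h *: XM phi c (phi u y)).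
    rewrite /De /V /XM; move: (c _) (c _) (c _) (c _) (Xv _) (Xv _) => a1 a2 a3 a4 a5 a6.
    by apply/rowP => j; rewrite !mxE; ring.
  apply: le_trans (ler_normB _ _) _; apply: le_trans (lerD g1 g2) _.
  by rewrite -mulrDl -splitr.
have [|||xi xiT E] := @MVT R (fun u => qf S (De u)) (fun u => 2 * (De u *m S *m (V u)^T) 0 0) 0 T.
- exact: T0.
- by move=> u; rewrite in_itv /= => /andP[u0 uT]; apply: dQ; rewrite !ltW.
- apply: derivable_within_continuous => u; rewrite in_itv /= => uT.
  exact: (@ex_derive _ _ _ _ _ _ _ (dQ u uT)).
move: xiT; rewrite in_itv /= => /andP[x1 x2].
have xiT : 0 <= xi <= T by rewrite !ltW.
exists xi => //; move: E; rewrite subr0 {1 2}/De !(flow0 sphi) => ->.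
rewrite mulrC; apply: ler_wpM2r; first exact: ltW.
have [[dx xr] [dy yr]] := hu xi xiT.
have [_ h] := Hr _ _ xr yr; rewrite -/(V xi) -/(De xi) in h *.
move: (V xi) (De xi) h => w v h.
have -> : w = v *m A + (w - v *m A) by rewrite addrCA subrr addr0.
have h1 := bilin_le S v (w - v *m A); rewrite -/K in h1.
have h2 : `|(v *m S *m (w - v *m A)^T) 0 0| <= m / 2 * `|v| ^+ 2.
  apply: le_trans h1 _; apply: (@le_trans _ _ (K * (`|v| * (eta * `|v|)))).
    by rewrite ler_wpM2l // ler_wpM2l.
  have -> : K * (`|v| * (eta * `|v|)) = K * eta * `|v| ^+ 2 by ring.
  by rewrite ler_wpM2r // exprn_ge0.
have h3 := Hm v.
have E2 : qf (S *m A^T) v = (v *m S *m (v *m A)^T) 0 0 by rewrite /qf trmx_mul !mulmxA.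
rewrite linearD /= mulmxDr mxE -E2.
by move: h2; rewrite ler_norml => /andP[h2 _]; lra.
Qed.

Lemma fixed_point_flow (t : R) : phi t p = p. Proof. by have [] := hp. Qed.

Lemma quadratic_step : exists (S : 'M[R]_n) (r a T : R), [/\ S^T = S, 0 < r, 0 < a, 0 < T &
  (forall v : 'rV[R]_n, v != 0 -> 0 < (v *m S *m (v *m A)^T) 0 0) /\
  forall x y, (forall u, 0 <= u <= T -> inU r (phi u x) /\ inU r (phi u y)) ->
  let q0 := qf S (c x - c y) in let q1 := qf S (c (phi T x) - c (phi T y)) in
  [/\ q0 <= q1, 0 <= q0 -> 4 * q0 <= q1, q1 <= 0 -> 4 * (- q1) <= - q0 &
   exists2 xi, 0 <= xi <= T & T * (a * `|c (phi xi x) - c (phi xi y)| ^+ 2) <= q1 - q0]].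
Proof.
have [S [r [a [sS r0 a0 Sp H]]]] := quadratic_growth.
pose K := n%:R ^+ 2 * `|S| + 1; have K0 : 0 < K by rewrite ltr_wpDl // mulr_ge0 ?exprn_ge0.
have HK v : `|qf S v| <= K * `|v| ^+ 2.
  apply: le_trans (qf_le S v) _; rewrite ler_wpM2r ?exprn_ge0 // /K; lra.
pose T := 4 * K / a; have T0 : 0 < T by rewrite divr_gt0 // mulr_gt0.
have Ta : T * a = 4 * K by rewrite /T divfK // gt_eqF.
clearbody K T.
exists S, r, a, T; split=> //; split=> // x y hu q0 q1.
have mono (s t : R) : 0 <= s -> s <= t -> t <= T ->
    qf S (c (phi s x) - c (phi s y)) <= qf S (c (phi t x) - c (phi t y)).
  move=> s0; rewrite le_eqVlt => /orP[/eqP->//|st tT].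
  have st0 : 0 < t - s by rewrite subr_gt0.
  have [|xi _ h] := H (phi s x) (phi s y) (t - s) st0.
    by move=> u /andP[u0 us]; rewrite -!(flowD sphi); apply: hu; apply/andP; split; lra.
  rewrite -!(flowD sphi) !subrK in h; rewrite -subr_ge0; apply: le_trans h.
  by rewrite mulr_ge0 ?mulr_ge0 ?exprn_ge0 // ltW.
have [xi xiT h] := H x y T T0 hu; have /andP[x0 xT] := xiT.
have m1 := mono 0 xi (lexx _) x0 xT; have m2 := mono xi T x0 xT (lexx _).
rewrite !(flow0 sphi) -/q0 in m1; rewrite -/q0 -/q1 in m2 h.
have hx := HK (c (phi xi x) - c (phi xi y)).
rewrite mulrA Ta in h; move: hx m1 m2 h; set N := `|_ - _| ^+ 2; set q := qf _ _ => hx m1 m2 h.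
move: hx; rewrite ler_norml => /andP[h1 h2].
split; [lra|move=> g; lra|move=> g; lra|].
by exists xi => //; rewrite mulrA Ta.
Qed.

(** For two orbits staying near [p] the form is nonpositive, since a positive value would grow by 4
    at each step although it is bounded. Against [p] itself, negative values then shrink by 4 at
    each step, and the increments of the form control squared distances: this gives the rate 1/2. If
    an open set of orbits stays near [p], the form is negative definite and serves as a Lyapunov
    function. *)
Lemma fixed_approach_attracts : approach G phi [set p] /\ open_attracts G phi [set p].
Proof.
have [S [r [a [T [sS r0 a0 T0 [Sp Hs]]]]]] := quadratic_step.
have [r' [K1 [r'0 K11 HK1]]] := mdist_inU.
have [K2 K21 HK2] := @flow_lip R n M G phi sphi T.
have K10 : 0 < K1 by apply: lt_le_trans ltr01 K11.
have K20 : 0 < K2 by apply: lt_le_trans ltr01 K21.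
pose r2 := Num.min r r'; have r20 : 0 < r2 by rewrite lt_min r0.
have [rU rU0 HU] := inU_near r20.
pose K := n%:R ^+ 2 * `|S| + 1; have K0 : 0 < K by rewrite ltr_wpDl // mulr_ge0 ?exprn_ge0.
have HK v : `|qf S v| <= K * `|v| ^+ 2.
  apply: le_trans (qf_le S v) _; rewrite ler_wpM2r ?exprn_ge0 // /K; lra.
clearbody K.
pose rho := rU / K2; have rho0 : 0 < rho by rewrite divr_gt0.
have inr z : inU r2 z -> inU r z /\ inU r' z.
  by move=> [dz]; rewrite lt_min => /andP[? ?].
have stay x : d x p < rho -> forall u, 0 <= u <= T -> inU r2 (phi u x).
  move=> xp u /andP[u0 uT]; apply: HU; rewrite -{1}(fixed_point_flow u).
  have uT' : `|u| <= T by rewrite ger0_norm.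
  by apply: le_lt_trans (HK2 u x p uT') _; rewrite mulrC -ltr_pdivlMr.
have rhop : d p p < rho by rewrite mdistxx.
pose Q (k : nat) x y := qf S (c (phi (k%:R * T) x) - c (phi (k%:R * T) y)).
have Qstep k x y : d (phi (k%:R * T) x) p < rho -> d (phi (k%:R * T) y) p < rho ->
   [/\ Q k x y <= Q k.+1 x y, 0 <= Q k x y -> 4 * Q k x y <= Q k.+1 x y,
     Q k.+1 x y <= 0 -> 4 * (- Q k.+1 x y) <= - Q k x y &
   exists2 xi, 0 <= xi <= T & T * (a * `|c (phi xi (phi (k%:R * T) x)) - c (phi xi (phi (k%:R * T) y))| ^+ 2) <= Q k.+1 x y - Q k x y].
  move=> hx hy; rewrite /Q succ_time !(flowD sphi).
  apply: Hs => u uT; have [h1 _] := inr _ (stay _ hx u uT).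
  by have [h2 _] := inr _ (stay _ hy u uT).
have T0T : (0 : R) <= 0 <= T by rewrite lexx ltW.
have Qneg x y : (forall k : nat, d (phi (k%:R * T) x) p < rho) ->
    (forall k : nat, d (phi (k%:R * T) y) p < rho) -> forall k, Q k x y <= 0.
  move=> hx hy k; rewrite leNgt; apply/negP => Qk.
  have bd j : Q j x y <= K * (2 * r2) ^+ 2.
    apply: le_trans (ler_norm _) _; apply: le_trans (HK _) _.
    rewrite ler_pM2l // ler_sqr ?nnegrE ?mulr_ge0 ?(ltW r20) //.
    have [_ h1] := stay _ (hx j) 0 T0T; have [_ h2] := stay _ (hy j) 0 T0T.
    rewrite !(flow0 sphi) in h1 h2.
    have -> : c (phi (j%:R * T) x) - c (phi (j%:R * T) y) =
       c (phi (j%:R * T) x) - c p - (c (phi (j%:R * T) y) - c p) by rewrite opprB addrA subrK.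
    by apply: le_trans (ler_normB _ _) _; lra.
  have grow j : 0 < Q (k + j)%N x y /\ Q k x y <= 2^-1 ^+ j * Q (k + j)%N x y.
    elim: j => [|j [IH1 IH2]]; first by rewrite addn0 expr0 mul1r.
    have [_ h _ _] := Qstep _ _ _ (hx (k + j)%N) (hy (k + j)%N); have h' := h (ltW IH1).
    rewrite addnS; split; first by lra.
    apply: le_trans IH2 _; rewrite exprSr -mulrA ler_wpM2l ?exprn_ge0 ?invr_ge0 //.
    by rewrite mulrC ler_pdivlMr //; lra.
  have B0 : 0 <= K * (2 * r2) ^+ 2 by rewrite mulr_ge0 ?(ltW K0) // exprn_ge0 // mulr_ge0 ?(ltW r20).
  have [m Hm] := exp_small B0 Qk; have [_ h] := grow m.
  have := Hm m (leqnn m); rewrite ltNge => /negP; apply.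
  by apply: le_trans h _; rewrite mulrC ler_wpM2r ?exprn_ge0 ?invr_ge0.
have fixk (k : nat) : d (phi (k%:R * T) p) p < rho by rewrite fixed_point_flow.
have App : forall x, (forall k : nat, d (phi (k%:R * T) x) p < rho) -> forall k : nat,
    d (phi (k%:R * T) x) p ^+ 2 <= (K1 * K2) ^+ 2 * (K * r2 ^+ 2) / (T * a) * (2^-1 ^+ k) ^+ 2.
  move=> x hx k; have Qn := Qneg x p hx fixk.
  have Qd j : - Q j x p <= K * r2 ^+ 2 * (2^-1 ^+ j) ^+ 2.
    elim: j => [|j IH].
      rewrite expr0 expr1n mulr1; apply: (@le_trans _ _ `|Q 0%N x p|).
        by rewrite -normrN ler_norm.
      apply: le_trans (HK _) _; rewrite ler_pM2l // ler_sqr ?nnegrE ?(ltW r20) //.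
      have [_ h1] := stay _ (hx 0%N) 0 T0T.
      by rewrite (flow0 sphi) in h1; rewrite fixed_point_flow ltW.
    have [_ _ h _] := Qstep _ _ _ (hx j) (fixk j); have := h (Qn j.+1).
    rewrite (exprS _ j) exprMn; move: IH; set e := (2^-1 ^+ j) ^+ 2; set B := K * r2 ^+ 2.
    have -> : B * (2^-1 ^+ 2 * e) = B * e / 4 by field.
    lra.
  have [_ _ _ [xi xiT h]] := Qstep _ _ _ (hx k) (fixk k).
  have [_ ir'] := inr _ (stay _ (hx k) xi xiT).
  have h1 := HK1 _ ir'; rewrite !fixed_point_flow in h.
  have h2 : d (phi (k%:R * T) x) p <= K2 * d (phi xi (phi (k%:R * T) x)) p.
    have /andP[x0 xT] := xiT; have xT' : `|- xi| <= T by rewrite normrN ger0_norm.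
    by have := HK2 (- xi) (phi xi (phi (k%:R * T) x)) p xT'; rewrite (flowK sphi) fixed_point_flow.
  have h3 : d (phi (k%:R * T) x) p <= K1 * K2 * `|c (phi xi (phi (k%:R * T) x)) - c p|.
    apply: le_trans h2 _; rewrite [K1 * _]mulrC -mulrA ler_pM2l //.
  have h4 : d (phi (k%:R * T) x) p ^+ 2 <= (K1 * K2 * `|c (phi xi (phi (k%:R * T) x)) - c p|) ^+ 2.
    by rewrite ler_sqr ?nnegrE ?mdist_ge0 // !mulr_ge0 // ltW.
  apply: le_trans h4 _; rewrite exprMn.
  have Ta0 : 0 < T * a by rewrite mulr_gt0.
  have h5 : `|c (phi xi (phi (k%:R * T) x)) - c p| ^+ 2 <= K * r2 ^+ 2 * (2^-1 ^+ k) ^+ 2 / (T * a).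
    rewrite ler_pdivlMr // [_ * (T * a)]mulrC -[T * a * _]mulrA; apply: le_trans h _.
    by have := Qn k.+1; have := Qd k; lra.
  apply: le_trans (ler_wpM2l _ h5) _; first by rewrite exprn_ge0 // mulr_ge0 ?ltW.
  by rewrite le_eqVlt; apply/orP; left; apply/eqP; ring.
set D := (K1 * K2) ^+ 2 * (K * r2 ^+ 2) / (T * a) in App.
have D0 : 0 <= D.
  by rewrite divr_ge0 ?mulr_ge0 ?exprn_ge0 ?mulr_ge0 ?(ltW K0) ?(ltW r20) ?(ltW K10) ?(ltW K20) ?(ltW T0) ?(ltW a0).
(* [D + 1] replaces the square root of [D], as [D <= (D + 1) ^+ 2]. *)
have App' x : (forall k : nat, near rho [set p] (phi (k%:R * T) x)) ->
    forall k : nat, exists2 q, [set p] q & d (phi (k%:R * T) x) q <= (D + 1) * 2^-1 ^+ k.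
  move=> hx k; exists p => //.
  have e0 : 0 <= (2^-1 : R) ^+ k by rewrite exprn_ge0 // invr_ge0.
  rewrite -ler_sqr ?nnegrE ?mdist_ge0 ?mulr_ge0 ?addr_ge0 //.
  apply: le_trans (App x _ k) _; first by move=> j; have [_ ->] := hx j.
  rewrite exprMn ler_wpM2r ?exprn_ge0 //.
  have -> : (D + 1) ^+ 2 = D ^+ 2 + 2 * D + 1 by ring.
  by have := sqr_ge0 D; lra.
have cp1 : closed [set p] by apply: accessible_closed_set1; exact/hausdorff_accessible/mhausdorff.
have ip1 : invariant phi [set p] by move=> t x ->; exact: fixed_point_flow.
split.
  exists rho, (D + 1), T; split=> //; lra.
exists rho => // O oO [x0 Ox0] hO.
have nearP y : near rho [set p] y -> d y p < rho by move=> [_ ->].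
have hO' y : O y -> forall k : nat, d (phi (k%:R * T) y) p < rho.
  by move=> Oy k; apply/nearP/hO => //; rewrite mulr_ge0 // ltW.
(* Points of [O] near [x0] realize a small multiple of every vector as a difference from [x0]. *)
have Qall v : qf S v <= 0.
  have [dx0 _] : inU r2 x0 by have := stay _ (hO' x0 Ox0 0%N) 0 T0T; rewrite mul0r !(flow0 sphi).
  have /nbhs_normP[e e0 He] : nbhs (c x0) (c @` (cdom c `&` O)).
    by apply: open_nbhs_nbhs; split; [exact: chart_sub_open|exists x0].
  pose s := e / (`|v| + 1).
  have v1 : 0 < `|v| + 1 by rewrite ltr_wpDl.
  have s0 : 0 < s by rewrite divr_gt0.
  have [|y [dy Oy] yE] := He (c x0 + s *: v).
    rewrite /= addrAC subrr add0r normrZ gtr0_norm //.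
    by rewrite /s mulrAC ltr_pdivrMr // ltr_pM2l // ltrDl.
  have := Qneg y x0 (hO' y Oy) (hO' x0 Ox0) 0%N.
  rewrite /Q mul0r !(flow0 sphi) yE addrAC subrr add0r qfZ.
  by rewrite pmulr_rle0 // exprn_gt0.
(* If the form vanished at [v], it would become positive at [v + h *: w] for small [h], since
   [w = v *m A] makes the first-order term [2 * h * b] positive. *)
have Qdef v : v != 0 -> 0 < qf (- S) v.
  move=> v0; have -> : qf (- S) v = - qf S v by rewrite /qf mulmxN mulNmx mxE.
  rewrite oppr_gt0 lt_neqAle Qall andbT; apply/eqP => Qv.
  have b0 := Sp v v0; set w := v *m A in b0; set b := (_ *m _) 0 0 in b0.
  pose h := b / (`|qf S w| + 1); have w1 : 0 < `|qf S w| + 1 by rewrite ltr_wpDl.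
  have h0 : 0 < h by rewrite divr_gt0.
  have := Qall (v + h *: w); rewrite qfD // qfZ Qv add0r linearZ /= -scalemxAr mxE -/b.
  have hw : h * `|qf S w| <= b.
    have : h * (`|qf S w| + 1) = b by rewrite divfK // gt_eqF.
    by rewrite mulrDr mulr1; lra.
  have g1 : 0 < h * (b + (b - h * `|qf S w|)) by rewrite mulr_gt0 //; lra.
  have g2 : h ^+ 2 * (- `|qf S w|) <= h ^+ 2 * qf S w.
    by rewrite ler_wpM2l ?exprn_ge0 ?(ltW h0) // lerNl -normrN ler_norm.
  by move: g1 g2; rewrite expr2 mulrDr mulrBr; lra.
have [m m0 Hm] := qf_lower Qdef.
have Hm' v : m * `|v| ^+ 2 <= - qf S v.
  by apply: le_trans (Hm v) _; rewrite /qf mulmxN mulNmx mxE.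
pose e1 := rho / (2 * K1); have e10 : 0 < e1 by rewrite divr_gt0 // mulr_gt0.
(* For a start within [e1 * g] of [p], minus the form is at most [m * e1 ^+ 2]. It does not increase
   along the orbit, which therefore stays within [e1] in the chart and at distance less than [rho]
   from [p]. *)
pose g := Num.min 1 (m / K); have g0 : 0 < g by rewrite lt_min ltr01 divr_gt0.
have e00 : 0 < e1 * g by rewrite mulr_gt0.
have eg : K * (e1 * g) ^+ 2 <= m * e1 ^+ 2.
  have g1 : g <= 1 by rewrite /g ge_min lexx.
  have gm : K * g <= m by rewrite mulrC -ler_pdivlMr // /g ge_min lexx orbT.
  have -> : K * (e1 * g) ^+ 2 = K * g * g * e1 ^+ 2 by ring.
  rewrite ler_wpM2r ?exprn_ge0 ?(ltW e10) //; apply: le_trans gm.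
  by rewrite ler_piMr // mulr_ge0 // ltW.
have [eta eta0 Heta] := inU_near e00.
pose et := Num.min eta rho; have et0 : 0 < et by rewrite lt_min eta0.
move=> _ ->; apply/(@mdist_nbhsP R n M G); exists et => // x; rewrite mdistC lt_min => /andP[xe xr].
have hx : forall k : nat, d (phi (k%:R * T) x) p < rho /\ Q 0%N x p <= Q k x p.
  have [_ N0] := Heta x xe.
  elim=> [|k [IH1 IH2]]; first by rewrite mul0r (flow0 sphi).
  have [h1 _ _ _] := Qstep _ _ _ IH1 (fixk k); have h2 := le_trans IH2 h1.
  split=> //; have TT : 0 <= T <= T by rewrite lexx ltW.
  have [_ ir'] := inr _ (stay _ IH1 T TT); rewrite -(flowD sphi) -succ_time in ir'.
  apply: le_lt_trans (HK1 _ ir') _.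
  have h3 : m * `|c (phi (k.+1%:R * T) x) - c p| ^+ 2 <= m * e1 ^+ 2.
    apply: le_trans eg; apply: le_trans (Hm' _) _.
    have h4 : - Q k.+1 x p <= - Q 0%N x p by lra.
    rewrite /Q fixed_point_flow in h4; apply: le_trans h4 _.
    rewrite /Q mul0r fixed_point_flow (flow0 sphi).
    apply: (@le_trans _ _ `|qf S (c x - c p)|); first by rewrite -normrN ler_norm.
    apply: le_trans (HK _) _; rewrite ler_pM2l // ler_sqr ?nnegrE ?(ltW e00) //.
    exact: ltW.
  rewrite ler_pM2l // ler_sqr ?nnegrE ?(ltW e10) // in h3.
  apply: (@le_lt_trans _ _ (K1 * e1)); first by rewrite ler_pM2l.
  by rewrite /e1 mulrA ltr_pdivrMr ?mulr_gt0 // mulrC ltr_pM2l // ltr_pMl // ltr1n.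
apply: (@steps_Ws R n M G phi sphi [set p] (D + 1) T x cp1 ip1) => //; first lra.
by apply: App' => k; exists p => //; have [] := hx k.
Qed.

Lemma fixed_basin_fills : basin_fills phi [set p].
Proof.
move=> Z oZ iZ [y [Zy Wy]] _ -> U /(@mdist_nbhsP R n M G)[r r0 Hr].
have [T hT] := Ws_near G Wy r0; have [_ -> h] := hT T (lexx _).
by exists (phi T y); split; [exact: iZ|apply: Hr; rewrite mdistC].
Qed.

End FixedPoint.

(** * The set of agreement *)

Section IteratedDerivatives.
Variables (R : realType) (V W : normedModType R).
Implicit Types (A O : set V) (f g : V -> W).

Lemma iderive_eq0 O g vs x : open O -> (forall y, O y -> g y = 0) -> O x -> iderive vs g x = 0.
Proof.
move=> oO g0; elim: vs x => [|v vs IH] x Ox /=; first exact: g0.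
rewrite (@near_eq_derive _ _ _ _ (cst 0)) ?derive_cst //.
by apply: filterS (open_nbhs_nbhs (conj oO Ox)) => y /IH.
Qed.

Lemma smooth_onB A f g : open A -> smooth_on A f -> smooth_on A g ->
  smooth_on A (fun x => f x - g x).
Proof.
move=> oA sf sg.
have E vs x : A x -> iderive vs (fun x => f x - g x) x = iderive vs f x - iderive vs g x.
  elim: vs x => [//|v vs IH] x Ax /=.
  have [_ df] := sf vs x Ax; have [_ dg] := sg vs x Ax.
  rewrite (@near_eq_derive _ _ _ _ (iderive vs f - iderive vs g)); first exact: deriveB.
  by apply: filterS (open_nbhs_nbhs (conj oA Ax)) => y /IH.
move=> vs x Ax; have nA := open_nbhs_nbhs (conj oA Ax).
have [cf df] := sf vs x Ax; have [cg dg] := sg vs x Ax.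
have near : \forall y \near x, (iderive vs f - iderive vs g) y =
    iderive vs (fun x => f x - g x) y by apply: filterS nA => y /E ->.
split.
  rewrite /prop_for /continuous_at E //.
  apply: cvg_trans (cvgB cf cg); apply: near_eq_cvg.
  exact: near.
by move=> v; apply: near_eq_derivable near _; exact: derivableB.
Qed.

Lemma smooth_on_sub A O f : O `<=` A -> smooth_on A f -> smooth_on O f.
Proof. by move=> OA sf vs x /OA; exact: sf. Qed.

End IteratedDerivatives.

Section Flatness.
Variables (R : realType) (n : nat) (M : closed_manifold R n) (G : good_cover M)
  (f1 f2 : M -> M).
Hypotheses (sf1 : smooth_map f1) (sf2 : smooth_map f2).
Local Notation d := (@mdist R n M G).

Definition agree : set M := interior [set x | f1 x = f2 x].

Lemma eq_closed : closed [set x | f1 x = f2 x].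
Proof.
move=> x clx; apply: (@mhausdorff R n M) => A B nA nB.
have [c1 _] := sf1; have [c2 _] := sf2.
have [|y [/= yE [Ay By]]] := clx ((f1 @^-1` A) `&` (f2 @^-1` B)).
  by apply: filterI; [exact: c1|exact: c2].
by exists (f1 y); split=> //=; rewrite yE.
Qed.

Lemma agree_closure x : closure agree x -> f1 x = f2 x.
Proof. by move=> h; apply: eq_closed; apply: closure_subset h; exact: interior_subset. Qed.

(** Near a point [c0] of the closure, [f1] and [f2] map into a common chart, and their difference
    [g] there is flat at the points of [closure agree]; [flat_bound] and compactness conclude. *)
Lemma flat_agree k : exists r C : R, [/\ 0 < r, 0 <= C & forall y c, closure agree c ->
  d y c < r -> d (f1 y) (f2 y) <= C * d y c ^+ k].
Proof.
have [KG KG0 HKG] := mdist_chart_upper G; have [dw dw0 Hw] := core_near_wide G.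
have cK : compact (closure agree).
  by apply: subclosed_compact (@mcompact R n M) _ => //; exact: closed_closure.
pose P (r : R) c := closure agree c -> forall y, d y c < r -> d (f1 y) (f2 y) <= 1 / r * d y c ^+ k.
have [r r' y r'0 rr h Ky z yz|c0 Kc0|r r0 H] := @compact_uniform R M _ P cK; last first.
- exists r, (1 / r); split=> //; first by rewrite divr_ge0 // ltW.
  by move=> y c Kc; exact: H.
- have [cf1 s1] := sf1; have [cf2 s2] := sf2.
  have [i ci] := core_exists G c0; have [j cj] := core_exists G (f1 c0).
  have E0 := agree_closure Kc0; have wi := core_wide ci; have di := wide_dom wi.
  have dj := wide_dom (core_wide cj).
  set a := gch i in di *; set b := gch j in dj *.
  pose O1 := cdom a `&` f1 @^-1` cdom b; pose O2 := cdom a `&` f2 @^-1` cdom b.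
  have op (f : M -> M) : continuous f -> open (f @^-1` cdom b).
    by move=> cf; apply: open_comp => [x _|]; [exact: cf|exact: cdom_open].
  pose A : set 'rV[R]_n := a @` (cdom a `&` (f1 @^-1` cdom b `&` f2 @^-1` cdom b)).
  have oA : open A by apply: chart_sub_open; apply: openI; exact: op.
  pose g z := (b \o f1 \o cinv a) z - (b \o f2 \o cinv a) z.
  have sg : smooth_on A g.
    apply: smooth_onB => //.
      apply: smooth_on_sub (s1 a b (gch_atlas i) (gch_atlas j)).
      by move=> _ [x [dx [h1 h2]] <-]; exists x.
    apply: smooth_on_sub (s2 a b (gch_atlas i) (gch_atlas j)).
    by move=> _ [x [dx [h1 h2]] <-]; exists x.
  have Aa : A (a c0) by exists c0 => //; split=> //; split=> //=; rewrite -E0.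
  have /nbhs_normP[e e0 He] : nbhs (a c0) A by apply: open_nbhs_nbhs.
  pose rho := e / 2; have rho0 : 0 < rho by rewrite divr_gt0.
  have Bsub : cball (a c0) rho `<=` A.
    by move=> z; rewrite /cball /= => h; apply: He => /=; apply: le_lt_trans h _; rewrite /rho; lra.
  pose Sx : set 'rV[R]_n := [set z | `|z - a c0| <= rho / 2 /\ exists2 c, closure agree c & cdom a c /\ a c = z].
  (* All derivatives of [g] vanish on the open set [agree]. A nonzero derivative at a point of the
     closure would, by continuity, remain nonzero at nearby points of [agree]. *)
  have flat vs (z : 'rV[R]_n) : Sx z -> iderive vs g z = 0.
    move=> [zr [c Kc [dc cz]]].
    have Az : A z by apply: Bsub; rewrite /cball /=; apply: le_trans zr _; lra.
    have [cg _] := sg vs z Az.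
    apply: contrapT => /eqP nz; rewrite -normr_gt0 in nz.
    have /continuous_normP/(_ _ nz)[s s0 Hs] := cg.
    have nU : nbhs c [set y | cdom a y /\ (A `&` [set z' | `|z' - z| < s]) (a y)].
      apply: chart_preim_nbhs => //; rewrite cz; apply: filterI; first exact: open_nbhs_nbhs.
      by apply/nbhs_normP; exists s.
    have [y [Zy [dy [Ay ys]]]] := Kc _ nU.
    have oZ : open (a @` (cdom a `&` agree)) by apply: chart_sub_open; exact: open_interior.
    have : iderive vs g (a y) = 0.
      apply: (iderive_eq0 _ oZ); last by exists y.
      move=> _ [x [dx Zx] <-]; rewrite /g /= cmapK //.
      by have /= -> := interior_subset Zx; rewrite subrr.
    by move=> gy; have := Hs _ ys; rewrite gy sub0r normrN ltxx.
  have Bz (x y : 'rV[R]_n) : Sx x -> `|y - x| <= rho / 2 -> cball (a c0) rho y.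
    move=> [xr _] yx; rewrite /cball /=; rewrite -(subrKA x).
    by apply: le_trans (ler_normD _ _) _; lra.
  have cB : compact (cball (a c0) rho) by exact: cball_compact.
  have [C C0 HC] := @flat_bound R n n A _ Sx g (rho / 2) k sg cB Bsub Bz flat.
  have /(@mdist_nbhsP R n M G)[e1 e10 H1] : nbhs c0 (f1 @^-1` wide j).
    apply: cf1; apply/(@mdist_nbhsP R n M G); exists dw => // z; exact: Hw.
  have /(@mdist_nbhsP R n M G)[e2 e20 H2] : nbhs c0 (f2 @^-1` wide j).
    apply: cf2; rewrite -E0; apply/(@mdist_nbhsP R n M G); exists dw => // z; exact: Hw.
  pose q := Num.min (Num.min dw (rho / 2)) (Num.min e1 e2).
  have q0 : 0 < q by rewrite !lt_min dw0 e10 e20 divr_gt0.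
  have qP x : d c0 x < q -> [/\ wide i x, d c0 x < rho / 2, wide j (f1 x) & wide j (f2 x)].
    rewrite !lt_min => /andP[/andP[h1 h2] /andP[h3 h4]]; split=> //; [exact: Hw h1|exact: H1|exact: H2].
  have KC0 : 0 <= KG * C by rewrite mulr_ge0 // ltW.
  pose r := Num.min (q / 2) (1 / (KG * C + 1)).
  have r0 : 0 < r by rewrite lt_min !divr_gt0 //; lra.
  have rKC : KG * C <= 1 / r.
    have : r <= 1 / (KG * C + 1) by rewrite /r ge_min lexx orbT.
    rewrite ler_pdivlMr; last by lra.
    by rewrite ler_pdivlMr // mulrDr mulr1 mulrC; lra.
  have rq : r <= q / 2 by rewrite /r ge_min lexx.
  exists r => //; apply/(@mdist_nbhsP R n M G); exists (q / 2); first by rewrite divr_gt0.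
  move=> c c0c Kc y yc.
  have [|wc cr _ _] := qP c; first by lra.
  have [|wy _ w1 w2] := qP y.
    by have := mdist_triangle G c c0 y; rewrite (mdistC G c y); lra.
  have dc := wide_dom wc; have dy := wide_dom wy.
  have ach := wide_chart_dist wy wc.
  have Sc : Sx (a c).
    split; last by exists c.
    have := wide_chart_dist wc wi; rewrite (mdistC G c c0) => h; exact: le_trans h (ltW cr).
  have yc2 : `|a y - a c| <= rho / 2.
    apply: le_trans ach _; apply/ltW; apply: lt_le_trans yc _; apply: le_trans rq _.
    have : q <= rho / 2 by rewrite /q !ge_min lexx !orbT.
    lra.
  have := HC _ _ Sc yc2; rewrite /g /= (cmapK dy) => h.
  apply: le_trans (HKG _ _ _ w1 w2) _.
  apply: (@le_trans _ _ (KG * (C * d y c ^+ k))).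
    rewrite ler_pM2l //; apply: le_trans h _; rewrite ler_wpM2l //.
    by apply: lerXn2r => //; rewrite nnegrE ?mdist_ge0.
  by rewrite mulrA ler_wpM2r // exprn_ge0 // mdist_ge0.
- apply: le_trans (h Ky z (lt_le_trans yz rr)) _.
  rewrite ler_wpM2r ?exprn_ge0 ?mdist_ge0 // !div1r lef_pV2 // posrE //.
  exact: lt_le_trans r'0 rr.
Qed.

Variable phi : R -> M -> M.
Hypotheses (sphi : smooth_flow phi) (com1 : forall t x, f1 (phi t x) = phi t (f1 x))
  (com2 : forall t x, f2 (phi t x) = phi t (f2 x)).

Lemma agree_flow : invariant phi agree.
Proof.
move=> t x Zx; have h : nbhs (phi (- t) (phi t x)) agree.
  by rewrite (flowK sphi); apply: open_nbhs_nbhs; split=> //; exact: open_interior.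
have [r r0] := flow_cont sphi h; rewrite /agree /interior /=; apply: filterS => y Hy.
have : agree (phi (- t) y) by apply: Hy; rewrite subrr normr0.
move=> /interior_subset /= E; rewrite -[y](flowNK sphi t) com1 com2.
by rewrite E.
Qed.

(* Choose [k] with [Lam * 2^-k < 1], where [Lam] is a Lipschitz constant of the
   time [- sigma] map. *)
Lemma eq_of_approach (L : set M) (C sigma : R) x : 0 <= C -> L `<=` closure agree ->
  (forall k : nat, exists2 c, L c & d (phi (k%:R * sigma) x) c <= C * 2^-1 ^+ k) -> f1 x = f2 x.
Proof.
move=> C0 LK hx; have [Lam Lam1 HL] := @flow_lip R n M G phi sphi `|sigma|.
have L0 : 0 <= Lam by apply: le_trans ler01 Lam1.
have [k Hk] := exp_small L0 (ltr0Sn R 0 : 0 < 1).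
have Lk : Lam * 2^-1 ^+ k.+1 <= 2^-1.
  by rewrite exprS mulrCA ler_piMr ?invr_ge0 // ltW // Hk.
have [r [Ck [r0 Ck0 Hflat]]] := flat_agree k.+1.
have back (N : nat) : d (f1 x) (f2 x) <= Lam ^+ N * d (f1 (phi (N%:R * sigma) x)) (f2 (phi (N%:R * sigma) x)).
  elim: N => [|N IH]; first by rewrite mul0r (flow0 sphi) expr0 mul1r.
  apply: le_trans IH _; rewrite exprSr -mulrA ler_wpM2l ?exprn_ge0 //.
  rewrite succ_time (flowD sphi) !com1 !com2.
  have s1 : `|- sigma| <= `|sigma| by rewrite normrN.
  have := HL (- sigma) (phi sigma (f1 (phi (N%:R * sigma) x))) (phi sigma (f2 (phi (N%:R * sigma) x))) s1.
  by rewrite !(flowK sphi) -!com1 -!com2.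
have [N0 HN0] := exp_small C0 r0.
pose B := Ck * C ^+ k.+1; have B0 : 0 <= B by rewrite mulr_ge0 ?exprn_ge0.
have bound (N : nat) : (N0 <= N)%N -> d (f1 x) (f2 x) <= B * 2^-1 ^+ N.
  move=> NN; have [c Lc xc] := hx N; apply: le_trans (back N) _.
  have h1 := Hflat _ c (LK _ Lc) (le_lt_trans xc (HN0 N NN)).
  have h2 : d (phi (N%:R * sigma) x) c ^+ k.+1 <= (C * 2^-1 ^+ N) ^+ k.+1.
    by apply: lerXn2r => //; rewrite nnegrE ?mdist_ge0 // mulr_ge0 // exprn_ge0 // invr_ge0.
  apply: (@le_trans _ _ (Lam ^+ N * (Ck * (C * 2^-1 ^+ N) ^+ k.+1))).
    by rewrite ler_wpM2l ?exprn_ge0 // (le_trans h1) // ler_wpM2l.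
  have -> : Lam ^+ N * (Ck * (C * 2^-1 ^+ N) ^+ k.+1) = B * (Lam * 2^-1 ^+ k.+1) ^+ N.
    by rewrite /B !exprMn -!exprM (mulnC N); ring.
  rewrite ler_wpM2l //; apply: lerXn2r => //; rewrite nnegrE ?invr_ge0 //.
  by rewrite mulr_ge0 // exprn_ge0 // invr_ge0.
apply: (@mdist_eq0 R n M G); apply/eqP; rewrite eq_le mdist_ge0 andbT leNgt; apply/negP => dpos.
have [m Hm] := exp_small B0 dpos.
have h1 := bound (maxn N0 m) (leq_maxl _ _); have h2 := Hm (maxn N0 m) (leq_maxr _ _).
by have := le_lt_trans h1 h2; rewrite ltxx.
Qed.

End Flatness.

(** * Basic sets of an Axiom A flow *)

Section Structure.
Variables (R : realType) (n : nat) (M : closed_manifold R n) (G : good_cover M).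
Local Notation d := (@mdist R n M G).
Local Notation near := (@near R n M G).

Lemma closed1 (p : M) : closed [set p].
Proof. by apply: accessible_closed_set1; exact/hausdorff_accessible/mhausdorff. Qed.

Lemma closed_compactM (A : set M) : closed A -> compact A.
Proof. by move=> cA; apply: subclosed_compact cA (@mcompact R n M) _. Qed.

Lemma separated (A B : set M) : closed A -> closed B -> A `&` B = set0 ->
  exists2 e : R, 0 < e & forall a b, A a -> B b -> e <= d a b.
Proof.
move=> cA cB AB; have [r r' x r'0 rr h b Bb|x Ax|e e0 H] := @compact_uniform R M A
   (fun r x => forall b, B b -> r <= d x b) (closed_compactM cA).
- exact: le_trans rr (h b Bb).
- have nB : nbhs x (~` B).
    apply: open_nbhs_nbhs; split; first exact: closed_openC.
    by move=> Bx; have : (A `&` B) x by []; rewrite AB.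
  have [e e0 He] := (@mdist_nbhsP R n M G x _).1 nB.
  exists (e / 2); first by rewrite divr_gt0.
  apply/(@mdist_nbhsP R n M G); exists (e / 2); first by rewrite divr_gt0.
  move=> y xy b Bb; rewrite leNgt; apply/negP => yb; apply: (He b) => //.
  by have := mdist_triangle G y x b; lra.
by exists e => // a b Aa; exact: H.
Qed.

(** An orbit that is near [L] for all times can be started [m] steps earlier, so its present point
    is already within [C * 2^-1 ^+ m] of [L]. *)
Lemma approach_locally_maximal (phi : R -> M -> M) L : smooth_flow phi -> closed L ->
  invariant phi L -> approach G phi L -> locally_maximal phi L.
Proof.
move=> sphi cL iL [rho [C [sigma [rho0 C0 s0 H]]]].
exists [set x | near rho L x]; split; first exact: near_open.
  by move=> x Lx; exact: near_in.
apply/seteqP; split=> x /= hx; first by move=> t; apply: near_in => //; exact: iL.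
apply: (near_closure (G := G) cL) => r r0; have [m Hm] := exp_small C0 r0.
have [|c Lc h] := H (phi (- (m%:R * sigma)) x) _ m.
  by move=> k; rewrite -(flowD sphi); exact: hx.
rewrite (flowNK sphi) in h.
by exists c => //; apply: le_lt_trans h _; exact: Hm.
Qed.

Definition shadowable_periodic (psi : R -> M -> M) (H : set M) (tau delta Cs : R) : Prop :=
  [/\ 1 <= tau, 0 < delta, 1 <= Cs & shadowing G psi H tau delta Cs] /\
  [/\ invariant psi H,
    forall x (r : R), H x -> 0 < r -> exists p (T : R), [/\ H p, 0 < T, psi T p = p & d x p < r] &
    exists2 r : R, 0 < r & forall z (T : R) c, 0 < T -> psi T z = z -> H c -> d z c < r -> H z].

Variable phi : R -> M -> M.
Hypothesis sphi : smooth_flow phi.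

Lemma vfield_fixed p : fixed_point phi p -> vfield phi p = 0.
Proof.
move=> fp; have h := XM_vel sphi (chart_at_atlas p) (chart_at_dom p).
apply: has_vel_uniq h _ => e e0; exists 1 => // t _.
by rewrite !fp subrr scaler0 subr0 normr0 mulr_ge0 // ltW.
Qed.

Lemma vfield_reverse x : vfield (reverse phi) x = - vfield phi x.
Proof. by rewrite !vfield_XM; exact: XM_reverse sphi (chart_at_atlas x) (chart_at_dom x). Qed.

Lemma hyperbolic_fixed_reverse p : hyperbolic_fixed_point phi p ->
  hyperbolic_fixed_point (reverse phi) p.
Proof.
move=> hp; have [fp ep] := hp; split=> [t|z]; first exact: fp.
have -> : linearization (reverse phi) p = - linearization phi p.
  apply: has_jac_J => e e0; have [r r0 H] := vfield_strict p sphi e0.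
  exists r => // y yr; have cp0 : `|chart_at p p - chart_at p p| < r by rewrite subrr normr0.
  have [cy h] := H y _ yr cp0; have [cp _] := H _ _ cp0 cp0.
  have E w : cimg (chart_at p) w -> vfield_in (chart_at p) (reverse phi) w = - vfield_in (chart_at p) phi w.
    move=> cw; have := XM_reverse sphi (chart_at_atlas p) (cinv_dom cw).
    by rewrite /XM (cinvK cw).
  rewrite !E // mulmxN -normrN.
  move: h; move: (vfield_in _ _ _) (vfield_in _ _ _) (_ *m _) => a b x.
  suff -> : - (- b - - a - - x) = b - a - x by [].
  by apply/rowP => j; rewrite !mxE; ring.
move=> /eigenvalueP[v vz v0].
have : complex.Re (- z) != 0.
  apply: ep; apply/eigenvalueP; exists v => //.
  by move: vz; rewrite /complexify map_mxN mulmxN scaleNr => <-; rewrite opprK.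
by case: z {vz} => a b /=; rewrite oppr_eq0.
Qed.

(** [H] is the part carrying the splitting and [P] the finite set of fixed points; the vector field
    is nonzero on [H], so they are disjoint. Shadowing is recorded for both directions of time,
    because repellers will be handled as attractors of the reversed flow. *)
Lemma axiom_A_structure : axiom_A phi -> exists H P : set M,
 [/\ nonwandering phi = H `|` P, closed H, finite_set P & H `&` P = set0] /\
 [/\ forall p, P p -> hyperbolic_fixed_point phi p,
     forall L, L `<=` H -> closed L -> invariant phi L -> hyperbolic_set phi L,
     forall p, P p -> hyperbolic_set phi [set p],
     exists tau delta Cs, shadowable_periodic phi H tau delta Cs &
     exists tau delta Cs, shadowable_periodic (reverse phi) H tau delta Cs].
Proof.
move=> [[cN iN [P [H [fP hP cH NE [g [Es [Ec [Eu [C [lam [gm C1 lam01 Hdata]]]]]]]]]]] Nper].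
have regH x : H x -> vfield phi x != 0 by move=> /Hdata[_ _ []].
have HP0 : H `&` P = set0.
  apply/seteqP; split=> // x [Hx Px]; have := regH x Hx.
  by rewrite vfield_fixed ?eqxx //; have [] := hP x Px.
have iH : invariant phi H.
  move=> t x Hx; have : nonwandering phi (phi t x) by apply: iN; rewrite NE; left.
  rewrite NE => -[//|Pt]; have [fp _] := hP _ Pt.
  have xE : x = phi t x by rewrite -{1}(flowK sphi t x) fp.
  by have : (H `&` P) x; [split=> //; rewrite xE|rewrite HP0].
have cP : closed P.
  have acc : accessible_space M by exact/hausdorff_accessible/mhausdorff.
  by move/accessible_finite_set_closed : acc; exact.
have [e e0 He] := separated cH cP HP0.
(* A periodic point is nonwandering, hence in [H] or [P], and [P] is at distance at least [e] from
   [H]. *)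
have isol z (T : R) c : 0 < T -> phi T z = z -> H c -> d z c < e -> H z.
  move=> T0 zT Hc zc; have : nonwandering phi z.
    by rewrite Nper; apply: subset_closure; exists T.
  rewrite NE => -[//|Pz]; have := He c z Hc Pz.
  by rewrite (mdistC G c z) leNgt zc.
have dense x (r : R) : H x -> 0 < r -> exists p (T : R), [/\ H p, 0 < T, phi T p = p & d x p < r].
  move=> Hx r0; have : nonwandering phi x by rewrite NE; left.
  rewrite Nper => clx; have [|p [[T T0 pT] /=]] := clx [set y | d x y < Num.min r e].
    by apply/(@mdist_nbhsP R n M G); exists (Num.min r e); rewrite // lt_min r0.
  rewrite lt_min => /andP[xr xe]; exists p, T; split=> //.
  by apply: (isol p T x) => //; rewrite mdistC.
exists H, P; split=> //; split=> //.
- move=> L LH cL iL; split=> //; first exact: closed_compactM.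
  exists set0, L; split=> //; first by rewrite setU0.
  exists g, Es, Ec, Eu, C, lam; split=> // x Lx; apply: Hdata; exact: LH.
- move=> p Pp; have [fp _] := hP p Pp; split.
  + exact/closed_compactM/closed1.
  + by move=> t x ->; exact: fp.
  exists [set p], set0; split.
  + exact: finite_set1.
  + by move=> q ->; exact: hP.
  + exact: closed0.
  + by rewrite set0U.
  by exists g, Es, Ec, Eu, C, lam; split.
- have [sp] := splitting_exists G sphi cH iH gm C1 lam01 Hdata.
  have [tau [delta [Cs [h1 h2 h3 h4]]]] := flow_shadowing sphi cH iH regH sp.
  by exists tau, delta, Cs; split=> //; split=> //; exists e.
have [sp] := splitting_exists G sphi cH iH gm C1 lam01 Hdata.
have regH' x : H x -> vfield (reverse phi) x != 0.
  by move=> Hx; rewrite vfield_reverse oppr_eq0; exact: regH.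
have iH' : invariant (reverse phi) H by move=> t x; exact: iH.
have [tau [delta [Cs [h1 h2 h3 h4]]]] := flow_shadowing (smooth_flow_reverse sphi) cH iH' regH'
   (splitting_reverse sphi sp).
have rper z (T : R) : phi T z = z -> phi (- T) z = z by move=> zT; rewrite -{1}zT (flowK sphi).
exists tau, delta, Cs; split=> //; split=> //.
  by move=> x r Hx r0; have [p [T [Hp T0 pT xp]]] := dense x r Hx r0; exists p, T; split=> //; exact: rper.
exists e => // z T c T0 zT; apply: isol T0 _.
by rewrite -{1}zT /reverse (flowNK sphi).
Qed.

End Structure.

Section Decomposition.
Variables (R : realType) (n : nat) (M : closed_manifold R n) (G : good_cover M).
Local Notation d := (@mdist R n M G).
Local Notation near := (@near R n M G).

Definition well_behaved (psi : R -> M -> M) L : Prop :=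
  [/\ approach G psi L, open_attracts G psi L & basin_fills psi L].

Lemma chain_class_well_behaved psi H tau delta Cs L : smooth_flow psi -> shadowable_periodic G psi H tau delta Cs ->
  chain_class G psi H tau delta Cs L -> well_behaved psi L.
Proof.
move=> sp [[t1 d0 C1 sh] [iH pd pi]] gL; split.
- exact: chain_class_approach sp t1 d0 C1 sh pi _ gL.
- exact: chain_class_open_attracts sp t1 d0 C1 sh pi _ gL.
- exact: chain_class_basin_fills sp t1 d0 C1 sh pi _ gL.
Qed.

Lemma fixed_well_behaved psi p : smooth_flow psi -> hyperbolic_fixed_point psi p ->
  well_behaved psi [set p].
Proof.
move=> sp hp; have [h1 h2] := fixed_approach_attracts G sp hp.
by split=> //; exact: (fixed_basin_fills G).
Qed.

(** Classes are defined through saturated sets, closed under the flow and under jumps shorter than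
    [e0] within [H]: this makes the relation an equivalence at once. The set of points reachable
    from [b] by chains of every precision is saturated, whence chain transitivity. Each class
    contains all points of [H] within [e0] of its own, so compactness leaves finitely many. *)
Lemma chain_class_classes psi H tau delta Cs : smooth_flow psi -> shadowable_periodic G psi H tau delta Cs -> closed H ->
  exists Cl : seq (set M), [/\ forall L, L \in Cl -> chain_class G psi H tau delta Cs L /\ L !=set0,
    forall x, H x -> exists2 L, L \in Cl & L x &
    forall L L', L \in Cl -> L' \in Cl -> L `&` L' !=set0 -> L = L'].
Proof.
move=> sp [[t1 d0 C1 sh] [iH pd pi]] cH.
have [e0 e00 Hloc] := chain_local sp t1 d0 C1 sh iH pd pi.
pose sat S := [/\ S `<=` H, invariant psi S & forall a b, S a -> H b -> d a b < e0 -> S b].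
pose cls a := [set b | H b /\ forall S, sat S -> (S a <-> S b)].
have sat_near S b b' : sat S -> H b -> H b' -> d b b' < e0 -> (S b <-> S b').
  move=> [_ _ h] Hb Hb' bb; split=> ?; first exact: h bb.
  by apply: (h b') => //; rewrite mdistC.
have reach_sat b : H b -> sat [set c | H c /\ forall eps : R, 0 < eps -> chain G psi H tau delta Cs eps b c].
  move=> Hb; split=> [c []//|t c [Hc h]|c c' [Hc h] Hc' cc].
    split=> [|eps eps0]; first exact: iH.
    apply: (chain_trans t1 d0 C1 (h eps eps0)).
    have := chain_along sp t1 d0 C1 iH pd (- t) eps0 (iH t c Hc).
    by rewrite (flowK sp).
  split=> // eps eps0; apply: (chain_trans t1 d0 C1 (h eps eps0)); exact: Hloc.
have gcls a : H a -> chain_class G psi H tau delta Cs (cls a).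
  move=> Ha; split.
  - by move=> x [].
  - move=> x clx; have Hx : H x.
      by apply: cH => U /clx[y [[Hy _] Uy]]; exists y.
    have [|b [[Hb hb] xb]] := clx [set b | d x b < e0].
      by apply/(@mdist_nbhsP R n M G); exists e0.
    split=> // S sS; rewrite (hb S sS); apply: sat_near => //; by rewrite mdistC.
  - move=> t b [Hb hb]; split=> [|S sS]; first exact: iH.
    rewrite (hb S sS); have [_ iS _] := sS; split; first exact: iS.
    by move=> /(iS (- t)); rewrite (flowK sp).
  - exists e0 => // b b' [Hb hb] Hb' bb; split=> // S sS.
    by rewrite (hb S sS); exact: sat_near.
  move=> b b' eps [Hb hb] [Hb' hb'] eps0; have sS := reach_sat b Hb.
  have : [set c | H c /\ forall eps : R, 0 < eps -> chain G psi H tau delta Cs eps b c] b'.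
    rewrite -(hb' _ sS) (hb _ sS); split=> // eps' e'0; apply: Hloc => //; by rewrite mdistxx.
  by move=> [_]; exact.
have [|cs Hcs] := @compact_finite_cover M M H (fun a => [set b | H a /\ d a b < e0]) (closed_compactM cH).
  move=> x Hx; exists x; apply/(@mdist_nbhsP R n M G).
  by exists e0 => // y xy; split.
exists [seq cls a | a <- cs & `[< H a >]]; split.
- move=> L /mapP[a]; rewrite mem_filter => /andP[/asboolP Ha _] ->; split; first exact: gcls.
  by exists a; split.
- move=> x Hx; have [a ac [Ha ax]] := Hcs x Hx; exists (cls a); last first.
    by split=> // S sS; exact: sat_near.
  by apply/mapP; exists a => //; rewrite mem_filter ac andbT; apply/asboolP.
move=> L L' /mapP[a _ ->] /mapP[a' _ ->] [x [[Hx h] [_ h']]].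
by apply/seteqP; split=> y [Hy hy]; split=> // S sS; rewrite -hy // ?h // ?h'.
Qed.

Variable phi : R -> M -> M.
Hypotheses (sphi : smooth_flow phi) (Aphi : axiom_A phi).

Lemma spectral_decomposition_exists : exists (m : nat) (Ls : 'I_m -> set M),
  spectral_decomposition phi Ls.
Proof.
have [H [P [[NE cH fP HP0] [hP hypH hypP [tau [delta [Cs tl]]] _]]]] := axiom_A_structure G sphi Aphi.
have [Cl [gCl covCl disCl]] := chain_class_classes sphi tl cH.
have [tt [iH pd pi]] := tl; have [t1 d0 C1 sh] := tt.
have /finite_fsetP[Q PE] := fP.
(* Duplicates are removed because the parts, indexed by ordinals, must be pairwise disjoint. *)
pose LL := undup (Cl ++ [seq [set q] | q <- Q]).
have memLL L : (L \in LL) = (L \in Cl) || (L \in [seq [set q] | q <- Q]).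
  by rewrite mem_undup mem_cat.
have memP L : L \in [seq [set q] | q <- Q] -> exists2 p, P p & L = [set p].
  by move=> /mapP[q qQ ->]; exists q => //; rewrite PE.
have disj L L' : L \in LL -> L' \in LL -> L `&` L' !=set0 -> L = L'.
  have cross K K' : K \in Cl -> K' \in [seq [set q] | q <- Q] -> K `&` K' !=set0 -> False.
    move=> /gCl[[KH _ _ _ _] _] /memP[p Pp ->] [x [Kx xp]].
    by have : (H `&` P) x; [split; [exact: KH|rewrite (xp : x = p)]|rewrite HP0].
  rewrite !memLL => /orP[h|h] /orP[h'|h'] LL'.
  - exact: disCl.
  - by case: (cross L L').
  - by case: (cross L' L) => //; rewrite setIC.
  have [p _ E] := memP _ h; have [p' _ E'] := memP _ h'; move: LL'.
  by rewrite E E' => -[x [-> ->]].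
exists (size LL), (fun i => nth set0 LL i); split.
- apply/seteqP; split=> [x|x [i _ Lx]].
    have mk L : L \in LL -> L x -> (\bigcup_(i : 'I_(size LL)) nth set0 LL i) x.
      move=> LM Lx; have iL : (index L LL < size LL)%N by rewrite index_mem.
      by exists (Ordinal iL) => //=; rewrite nth_index.
    rewrite NE => -[Hx|Px].
      have [L LC Lx] := covCl x Hx; apply: (mk L) => //; by rewrite memLL LC.
    apply: (mk [set x]) => //; rewrite memLL; apply/orP; right; apply/mapP.
    by exists x => //; move: Px; rewrite PE.
  have := mem_nth set0 (ltn_ord i); rewrite memLL NE => /orP[h|h].
    by left; have [[KH _ _ _ _] _] := gCl _ h; exact: KH.
  by right; have [p Pp E] := memP _ h; move: Lx; rewrite E => ->.
- move=> i j _ _ ij; apply: val_inj; apply/eqP.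
  rewrite -(nth_uniq set0 (ltn_ord i) (ltn_ord j) (undup_uniq _)); apply/eqP.
  by apply: disj => //; exact: mem_nth.
move=> i; have := mem_nth set0 (ltn_ord i); rewrite memLL => /orP[h|h].
  have [gL L0] := gCl _ h; have [LH cL iL _ _] := gL.
  have [ap _ _] := chain_class_well_behaved sphi tl gL.
  split; [exact: (approach_locally_maximal (G := G))| |exact: hypH].
  exact: chain_class_transitive sphi t1 d0 C1 sh pi _ gL L0.
have [p Pp ->] := memP _ h; have [fp _] := hP p Pp.
have [ap _ _] := fixed_well_behaved sphi (hP p Pp).
split; [|exists p => // x ->|exact: hypP].
  apply: (approach_locally_maximal (G := G)) => //; first exact: closed1.
  by move=> t x ->; exact: fp.
by apply: subset_closure; exists 0 => //=; rewrite fp.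
Qed.

Lemma spectral_part m (Ls : 'I_m -> set M) i : spectral_decomposition phi Ls ->
  [/\ closed (Ls i), invariant phi (Ls i), Ls i !=set0 & basic_set phi (Ls i)].
Proof.
move=> sd; have [_ _ /(_ i)[_ [x Lx _] [cL iL _]]] := sd; split=> //.
- by apply: compact_closed cL; exact: mhausdorff.
- by exists x.
by exists m, Ls; split=> //; exists i.
Qed.

Lemma spectral_separated m (Ls : 'I_m -> set M) i : spectral_decomposition phi Ls ->
  exists2 e : R, 0 < e & forall a b, Ls i a -> nonwandering phi b -> d a b < e -> Ls i b.
Proof.
move=> sd; have [NE tI _] := sd.
pose K := \bigcup_(j in [set j | j != i]) Ls j.
have cK : closed K.
  apply: closed_bigcup; first exact: finite_finset.
  by move=> j _; have [] := spectral_part j sd.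
have [cL _ _ _] := spectral_part i sd.
have LK : Ls i `&` K = set0.
  apply/seteqP; split=> // x [Lx [j /= ji Kx]].
  by move: ji; rewrite (tI i j) ?eqxx //; exists x.
have [e e0 He] := separated G cL cK LK; exists e => // a b La Nb ab.
move: Nb; rewrite NE => -[j _ Lb]; have [<-//|ji] := eqVneq j i.
have Kb : K b by exists j.
by have := He a b La Kb; rewrite leNgt ab.
Qed.

(** The basic set may come from any decomposition, so its structure is derived anew: it is a fixed
    point or satisfies [connected_chain_class], in both directions of time. *)
Lemma basic_well_behaved L : basic_set phi L ->
  [/\ closed L, invariant phi L, well_behaved phi L & well_behaved (reverse phi) L].
Proof.
move=> [m [Ls [sd [i <-]]]].
have [cL iL _ _] := spectral_part i sd; have [e e0 He] := spectral_separated i sd.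
have [NE _ /(_ i)[_ [x Lx dx] _]] := sd.
have LN y : Ls i y -> nonwandering phi y by move=> Ly; rewrite NE; exists i.
have [H [P [[NE' cH fP HP0] [hP _ _ [tau [delta [Cs tl]]] [tau' [delta' [Cs' tl']]]]]]] :=
  axiom_A_structure G sphi Aphi.
have dense a (r : R) : Ls i a -> 0 < r -> exists t, d (phi t x) a < r.
  move=> La r0; have [|y [[t _ <-] h]] := dx a La [set y | d a y < r].
    by apply/(@mdist_nbhsP R n M G); exists r.
  by exists t; rewrite mdistC.
(* A fixed point [p] of [P] is isolated in the nonwandering set. If it belongs to [Ls i], the dense
   orbit passes through [p], hence is constant, and [Ls i] reduces to [p]. *)
have [[p Pp pE]|LH] : (exists2 p, P p & Ls i = [set p]) \/ Ls i `<=` H.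
    have [[p [Pp Lp]]|nP] := pselect (exists p, P p /\ Ls i p); last first.
      right=> y Ly; have := LN y Ly; rewrite NE' => -[//|Py].
      by exfalso; apply: nP; exists y.
    left; exists p => //; have [fp _] := hP p Pp.
    have cB : closed (H `|` (P `\ p)).
      apply: closedU => //; have acc : accessible_space M by exact/hausdorff_accessible/mhausdorff.
      by move/accessible_finite_set_closed : acc; apply; apply: sub_finite_set fP; exact: subDsetl.
    have pB : [set p] `&` (H `|` (P `\ p)) = set0.
      apply/seteqP; split=> // y [-> [Hp|[_ /(_ erefl)//]]].
      by have : (H `&` P) p; [|rewrite HP0].
    have [e1 e10 He1] := separated G (@closed1 R n M p) cB pB.
    have [t ht] := dense p e1 Lp e10.
    have tp : phi t x = p.
      apply: contrapT => ne; have : nonwandering phi (phi t x) by apply/LN/iL.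
      rewrite NE' => h; have Bt : (H `|` (P `\ p)) (phi t x).
        by case: h => h; [left|right].
      by have := He1 p _ erefl Bt; rewrite mdistC leNgt ht.
    have xp : x = p by rewrite -(flowK sphi t x) tp fp.
    apply/seteqP; split=> [y Ly|_ ->//]; apply: (near_closure (G := G) (@closed1 R n M p)) => r r0.
    by have [u] := dense y r Ly r0; rewrite xp fp => h; exists p => //; rewrite mdistC.
  rewrite pE; split.
  - exact: closed1.
  - by move=> t y ->; have [fp _] := hP p Pp; exact: fp.
  - exact: fixed_well_behaved sphi (hP p Pp).
  apply: fixed_well_behaved; first exact: smooth_flow_reverse.
  exact: (hyperbolic_fixed_reverse sphi (hP p Pp)).
have sep : exists2 e : R, 0 < e & forall a b, Ls i a -> H b -> d a b < e -> Ls i b.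
  by exists e => // a b La Hb; apply: He => //; rewrite NE'; left.
split=> //.
- apply: (chain_class_well_behaved sphi tl).
  have [[t1 d0 C1 sh] [iH pd pi]] := tl.
  exact: (@connected_chain_class R n M G phi H tau delta Cs sphi t1 d0 C1 sh iH pd pi (Ls i) x LH cL iL sep Lx dense).
apply: (chain_class_well_behaved (smooth_flow_reverse sphi) tl').
have [[t1 d0 C1 sh] [iH pd pi]] := tl'.
have iL' : invariant (reverse phi) (Ls i) by move=> t y; exact: iL.
have dense' a (r : R) : Ls i a -> 0 < r -> exists t, d (reverse phi t x) a < r.
  by move=> La r0; have [t h] := dense a r La r0; exists (- t); rewrite /reverse opprK.
exact: (@connected_chain_class R n M G _ H tau' delta' Cs' (smooth_flow_reverse sphi) t1 d0 C1 sh iH pd pi (Ls i) x LH cL iL' sep Lx dense').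
Qed.

Lemma omega_nonwandering x : omega_limit phi x `<=` nonwandering phi.
Proof.
move=> q oq O T oO Oq T0; have nO : nbhs q O by apply: open_nbhs_nbhs.
have tail (S : R) : exists2 t, S <= t & O (phi t x).
  have [|_ [[t /= St <-] Ot]] := oq [set phi t x | t in [set t : R | S <= t]] O _ nO.
    exists S; split; first exact: num_real.
    by move=> t /ltW St; exists t.
  by exists t.
have [t1 _ O1] := tail 0; have [t2 t12 O2] := tail (t1 + T + 1).
exists (t2 - t1); first lra.
exists (phi t2 x); split=> //; exists (phi t1 x) => //.
by rewrite -(flowD sphi) subrK.
Qed.

(** Eventually the orbit is within [e / 4] of the nonwandering set, and in time [u0] it moves by at
    most [e / 4]. This is too little to change parts, whose mutual distance is at least [e];
    induction over steps of length [u0] reaches every later time. *)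
Lemma eventually_one_part m (Ls : 'I_m -> set M) x (r : R) : spectral_decomposition phi Ls ->
  0 < r -> exists i (T : R), forall t, T <= t -> near r (Ls i) (phi t x).
Proof.
move=> sd r0; have [NE _ _] := sd.
have /choice[ef Hef] : forall i, exists e : R, 0 < e /\
    forall a b, Ls i a -> nonwandering phi b -> d a b < e -> Ls i b.
  by move=> i; have [e e0 He] := spectral_separated i sd; exists e.
have [|e e0 He] := @fin_lower_pos R _ ef; first by move=> i; have [] := Hef i.
have [K K1 HK] := flow_time_lip G sphi; have K0 : 0 < K by apply: lt_le_trans ltr01 K1.
pose s := Num.min r (e / 4); have s0 : 0 < s by rewrite lt_min r0 divr_gt0.
have s4 : s <= e / 4 by rewrite /s ge_min lexx orbT.
have [T HT] := omega_near G (@omega_nonwandering x) s0.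
pose u0 := e / (4 * K); have u00 : 0 < u0 by rewrite divr_gt0 // mulr_gt0.
have Ku : K * u0 = e / 4 by rewrite /u0; field; exact: lt0r_neq0.
have step i t u : T <= t -> near s (Ls i) (phi t x) -> 0 <= u -> u <= u0 ->
    near s (Ls i) (phi (t + u) x).
  move=> Tt [a La ta] u1 u2; have [|b Nb tb] := HT (t + u); first lra.
  exists b => //; have [_ h] := Hef i; apply: (h a b La Nb).
  have h1 := HK u (phi t x); rewrite -(flowD sphi) addrC ger0_norm // in h1.
  have h2 : K * u <= e / 4.
    apply: (@le_trans _ _ (K * u0)); first by rewrite ler_pM2l.
    by rewrite Ku.
  have h3 := mdist_triangle G (phi t x) a b; have h4 := mdist_triangle G (phi (t + u) x) (phi t x) b.
  have h5 := He i; rewrite (mdistC G a (phi t x)) in h3.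
  rewrite (mdistC G (phi (t + u) x) (phi t x)) in h1.
  lra.
have [b Nb Tb] := HT T (lexx _); move: Nb; rewrite NE => -[i _ Lb].
exists i, T => t Tt.
have all (k : nat) u : 0 <= u -> u <= u0 -> near s (Ls i) (phi (T + k%:R * u0 + u) x).
  have k0 (j : nat) : 0 <= j%:R * u0 by rewrite mulr_ge0 // ltW.
  elim: k u => [|k IH] u u1 u2.
    apply: step => //; first by have := k0 0%N; lra.
    by rewrite mul0r addr0; exists b.
  apply: step => //; first by have := k0 k.+1; lra.
  by rewrite succ_time addrCA addrC; apply: IH => //; exact: ltW.
have q0 : 0 <= (t - T) / u0 by rewrite divr_ge0 ?(ltW u00) // subr_ge0.
have /andP[h1 h2] := trunc_itv q0; set k := Num.trunc _ in h1 h2.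
rewrite ler_pdivlMr // in h1; rewrite ltr_pdivrMr // -natr1 mulrDl mul1r in h2.
have := all k (t - T - k%:R * u0).
have -> : T + k%:R * u0 + (t - T - k%:R * u0) = t by ring.
move=> h; apply: near_le (h _ _); [by rewrite /s ge_min lexx|lra|lra].
Qed.

(* Every orbit eventually stays near one basic set; by Baire's theorem one basic
   set works for all points of a nonempty open subset of [O]. *)
Lemma attractor_basins_dense m (Ls : 'I_m -> set M) (O : set M) : spectral_decomposition phi Ls ->
  open O -> O !=set0 -> exists i, attractor phi (Ls i) /\ (O `&` Ws phi (Ls i)) !=set0.
Proof.
move=> sd oO [x0 Ox0]; apply: contrapT => noatt.
(* If all forward orbits from an open set stay within this radius of [Ls i], then [Ls i] is an
   attractor and the open set lies in its basin. *)
have /choice[rf Hrf] : forall i, exists r : R, 0 < r /\ forall O', open O' -> O' !=set0 ->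
   (forall y t, O' y -> 0 <= t -> near r (Ls i) (phi t y)) ->
   attractor phi (Ls i) /\ O' `<=` Ws phi (Ls i).
  move=> i; have [cL iL L0 bL] := spectral_part i sd.
  have [_ _ [ap [r1 r10 H1] _] _] := basic_well_behaved bL.
  have [r2 [s [r20 s0 H2]]] := approach_Ws sphi cL iL ap.
  exists (Num.min r1 r2); split; first by rewrite lt_min r10.
  move=> O' oO' O'0 hO'; split.
    split=> //; apply: (H1 O' oO' O'0) => y t Oy t0; apply: near_le (hO' y t Oy t0).
    by rewrite ge_min lexx.
  move=> y Oy; apply: H2 => k; apply: near_le (hO' y _ Oy _); first by rewrite ge_min lexx orbT.
  by rewrite mulr_ge0 // ltW.
have [|r r0 Hr] := @fin_lower_pos R _ rf; first by move=> i; have [] := Hrf i.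
have r20 : 0 < r / 2 by rewrite divr_gt0.
have [e0 e00 He0] := (@mdist_nbhsP R n M G x0 O).1 (open_nbhs_nbhs (conj oO Ox0)).
(* The index encodes a part and an integer time. A point of all [V k] leaves the
   [r / 2]-neighborhood of every part at arbitrarily late times, against [eventually_one_part]. The
   step below first finds an exit from the larger neighborhood of radius [r], so that nearby points
   exit the smaller one. *)
pose V (k : nat) : set M := match unpickle k with
  | Some (i, N) => [set x | exists2 t : R, N%:R <= t & ~ near (r / 2) (Ls i) (phi t x)]
  | None => setT end.
have [k x e _ ep Hx|p [_ _ Vp]] := @baire R n M G setT V x0 e0 closedT Logic.I e00.
  rewrite /V; case: (unpickle k) => [[i N]|]; last by exists x, e; split.
  pose B := [set y | d x y < e]; pose N' : R := N%:R.
  have oB : open B.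
    rewrite openE => y xy; apply/(@mdist_nbhsP R n M G).
    exists (e - d x y); first by rewrite subr_gt0.
    by move=> z yz; rewrite /B /=; have := mdist_triangle G y x z; move: xy; rewrite /B /=; lra.
  have [z Bz [t Nt nz]] : exists2 z, B z & exists2 t : R, N%:R <= t & ~ near r (Ls i) (phi t z).
    apply: contrapT => no; apply: noatt; exists i.
    (* [O'] is the image of [B] at time [N']. If no point of [B] left the neighborhood after that
       time, [O'] would lie in the basin of an attractor, and so would the point [x] of [O]. *)
    have [_ Hi] := Hrf i; pose O' := [set y | B (phi (- N') y)].
    have xB : B x by rewrite /B /= mdistxx.
    have [|||aL OW] := Hi O'.
    - rewrite openE => y By; have [s s0] := flow_cont sphi (open_nbhs_nbhs (conj oB By)).
      by apply: filterS => w Hw; apply: Hw; rewrite subrr normr0.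
    - by exists (phi N' x); rewrite /O' /= (flowK sphi).
    - move=> y t By t0; apply: near_le (Hr i) _; apply: contrapT => ny; apply: no.
      exists (phi (- N') y) => //; exists (t + N'); first by rewrite lerDr.
      by rewrite -(flowD sphi) addrK.
    split=> //; exists x; split; first by apply: He0; exact: Hx.
    have [cL _ _ _] := spectral_part i sd.
    have := @Ws_flow R n M G phi sphi (Ls i) (- N') (phi N' x) cL; rewrite (flowK sphi); apply.
    by apply: OW; rewrite /O' /= (flowK sphi).
  have [K K1 HK] := @flow_lip R n M G phi sphi `|t|; have K0 : 0 < K by apply: lt_le_trans ltr01 K1.
  exists z, (Num.min (e - d x z) (r / (2 * K))); split=> //.
    by rewrite lt_min subr_gt0 Bz divr_gt0 // mulr_gt0.
  move=> w; rewrite lt_min => /andP[w1 w2]; split; first by have := mdist_triangle G z x w; lra.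
  exists t => // -[c Lc wc]; apply: nz; exists c => //.
  rewrite ltr_pdivlMr ?mulr_gt0 // in w2.
  by have := HK t z w (lexx _); have := mdist_triangle G (phi t w) (phi t z) c; lra.
have [i [T HT]] := eventually_one_part p sd r20.
have := Vp (pickle (i, (Num.trunc `|T|).+1)); rewrite /V pickleK => -[t Nt]; apply.
apply: HT; have T0 : 0 <= `|T| by [].
have /andP[_ h] := trunc_itv T0; have := ler_norm T; lra.
Qed.

End Decomposition.

(** * Agreement on basins and on the manifold *)

Section Agreement.
Variables (R : realType) (n : nat) (M : closed_manifold R n) (G : good_cover M).
Variables (f1 f2 : M -> M) (psi : R -> M -> M).
Hypotheses (sf1 : smooth_map f1) (sf2 : smooth_map f2) (spsi : smooth_flow psi)
  (com1 : forall t x, f1 (psi t x) = psi t (f1 x))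
  (com2 : forall t x, f2 (psi t x) = psi t (f2 x)).

(** Exponential approach gives equality at each point of the basin; as the basin is open, it then
    lies in the interior of the set of equality. *)
Lemma agree_basin L : closed L -> invariant psi L -> well_behaved G psi L ->
  L `<=` interior (Ws psi L) -> (agree f1 f2 `&` Ws psi L) !=set0 -> Ws psi L `<=` agree f1 f2.
Proof.
move=> cL iL [[rho [C [sigma [rho0 C0 s0 ap]]]] _ fills] Lint ne.
have LK := fills _ (@open_interior _ _) (agree_flow spsi com1 com2) ne.
have eqW x : Ws psi L x -> f1 x = f2 x.
  move=> Wx; have [T HT] := Ws_near G Wx rho0.
  pose T' := Num.max T 0; have TT : T <= T' by rewrite le_max lexx.
  have T'0 : 0 <= T' by rewrite le_max lexx orbT.
  suff : f1 (psi T' x) = f2 (psi T' x).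
    by move=> E; rewrite -[x](flowK spsi T') com1 com2 E.
  apply: (eq_of_approach (G := G) sf1 sf2 spsi com1 com2 C0 LK (sigma := sigma)).
  apply: ap => k; rewrite -(flowD spsi); apply: HT.
  by apply: le_trans TT _; rewrite lerDr mulr_ge0 // ltW.
have oW := Ws_open G spsi cL Lint.
by move=> x Wx; apply: filterS eqW _; apply: open_nbhs_nbhs; split.
Qed.

End Agreement.

Lemma Wu_reverse (R : realType) (n : nat) (M : closed_manifold R n) (phi : R -> M -> M) L :
  Wu phi L = Ws (reverse phi) L.
Proof.
suff E x : alpha_limit phi x = omega_limit (reverse phi) x.
  by apply/funext => x; rewrite /Wu /Ws /= E.
rewrite /alpha_limit /omega_limit; congr cluster; apply/funext => B.
apply/propext; split=> -[T [Tr HT]]; exists (- T); split; rewrite ?realN //.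
  by move=> t /= Tt; apply: HT; rewrite /= ltrNl.
by move=> t /= Tt; have := HT (- t); rewrite /reverse /= opprK; apply; rewrite ltrNr.
Qed.

Theorem theorem1p7 (R : realType) (n : nat) (M : closed_manifold R n)
    (U V : set (R -> M -> M))
    (U_open : open_in (A_infty M) U) (U_dense : dense_in (A_infty M) U)
    (U_points : forall phi, U phi -> nonresonant_unique phi)
    (VU : V `<=` U)
    (V_open : open_in (A_infty M) V) (V_dense : dense_in (A_infty M) V)
    (V_linking : forall phi, V phi -> basin_linking phi)
    (phi : R -> M -> M) (Vphi : V phi)
    (f1 f2 : M -> M)
    (f1_diffeo : smooth_diffeo f1) (f2_diffeo : smooth_diffeo f2)
    (f1_comm : forall t x, f1 (phi t x) = phi t (f1 x))
    (f2_comm : forall t x, f2 (phi t x) = phi t (f2 x))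
    (f12 : exists O : set M,
      [/\ open O, O !=set0 & forall x, O x -> f1 x = f2 x]) :
  forall x, f1 x = f2 x.
Proof.
have [sphi Aphi _ _] := V_open.1 _ Vphi.
have [sf1 _] := f1_diffeo; have [sf2 _] := f2_diffeo; have link := V_linking _ Vphi.
have [G] := good_cover_exists M.
have [m [Ls sd]] := spectral_decomposition_exists G sphi Aphi.
pose Zag := agree f1 f2.
have [Z1 [oZ1 [z0 Zz0] HZ1]] := f12.
have Z0 : Zag !=set0 by exists z0; apply: filterS HZ1 _; apply: open_nbhs_nbhs.
pose att i := attractor phi (Ls i).
pose hit i := (Zag `&` Ws phi (Ls i)) !=set0.
(* The closed sets [C1] and [C2] gather the attractors whose basins do or do not meet [Zag]. Density
   of the basins makes them cover [M], linking makes them disjoint, and connectedness leaves only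
   [C1]. *)
pose C1 := \bigcup_(i in [set i | att i /\ hit i]) closure (Ws phi (Ls i)).
pose C2 := \bigcup_(i in [set i | att i /\ ~ hit i]) closure (Ws phi (Ls i)).
have cC (D : set 'I_m) : closed (\bigcup_(i in D) closure (Ws phi (Ls i))).
  by apply: closed_bigcup; [exact: finite_finset|move=> i _; exact: closed_closure].
have cover x : C1 x \/ C2 x.
  apply: contrapT => h; have oN : open (~` (C1 `|` C2)).
    by apply: closed_openC; apply: closedU; exact: cC.
  have [|i [ai [y [nC Wy]]]] := attractor_basins_dense G sphi Aphi sd oN; first by exists x.
  apply: nC; have [hi|nhi] := pselect (hit i).
    by left; exists i => //; exact: subset_closure.
  by right; exists i => //; exact: subset_closure.
have basin i : att i -> hit i -> Ws phi (Ls i) `<=` Zag.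
  move=> [bL Lint] hi; have [cL iL wb _] := basic_well_behaved G sphi Aphi bL.
  exact: (agree_basin sf1 sf2 sphi f1_comm f2_comm cL iL wb Lint hi).
have disj : C1 `&` C2 = set0.
  apply/seteqP; split=> // x [[i [ai hi] xi] [j [aj nhj] xj]].
  have [|Lr [[bLr Lrint] [y [yi yr]] [w [wj wr]]]] := link _ _ ai aj; first by exists x.
  have [cL iL _ wb] := basic_well_behaved G sphi Aphi bLr.
  rewrite Wu_reverse in yr wr Lrint.
  have iL' : invariant (reverse phi) Lr by move=> t q; exact: iL.
  have sub : Ws (reverse phi) Lr `<=` Zag.
    have c1 t q : f1 (reverse phi t q) = reverse phi t (f1 q) by exact: f1_comm.
    have c2 t q : f2 (reverse phi t q) = reverse phi t (f2 q) by exact: f2_comm.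
    apply: (agree_basin sf1 sf2 (smooth_flow_reverse sphi) c1 c2 cL iL' wb Lrint).
    by exists y; split=> //; exact: (basin i).
  by apply: nhj; exists w; split=> //; exact: sub.
have C1T : C1 = setT.
  apply: (@mconnected R n M).
  - have [i [ai [y [Zy Wy]]]] := attractor_basins_dense G sphi Aphi sd (@open_interior _ _) Z0.
    exists y; exists i; last exact: subset_closure.
    by split=> //; exists y.
  - exists (~` C2); first exact: closed_openC (cC _).
    rewrite setTI; apply/seteqP; split=> x.
      by move=> h1 h2; have : (C1 `&` C2) x by []; rewrite disj.
    by case: (cover x).
  by exists C1; rewrite ?setTI //; exact: cC.
move=> x; have : C1 x by rewrite C1T.
move=> [i [ai hi] xi]; apply: (agree_closure sf1 sf2).
exact: closure_subset (basin i ai hi) _ xi.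
Qed.
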